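(* There is a randomized algorithm for the bounded knapsack problem that runs in $\widetilde{O}(n+w_{\max}^{5/2})$ time and outputs the optimal value correctly with high probability.
   Context: In the bounded knapsack problem, the input is a capacity $W\in\mathbb{Z}^+$ and $n$ items $(w_1,p_1,m_1),\dots,(w_n,p_n,m_n)$, where item $i$ has weight $w_i\in\mathbb{Z}^+$, profit $p_i\in\mathbb{Z}^+$ and multiplicity $m_i\in\mathbb{Z}^+$ (it may be selected up to $m_i$ times); the goal is to compute the maximum total profit of a selection with total weight at most $W$. Here $w_{\max}=\max_i w_i$. The notation $\widetilde{O}(\cdot)$ hides polylogarithmic factors, and ''with high probability'' means with probability at least $1-1/\mathrm{poly}$ of the input size. *)

(* Defs.v *)
From Stdlib Require Import Arith List.
Import ListNotations.

(* An item is (weight, profit, multiplicity). *)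
Definition item : Type := (nat * nat * nat)%type.
Definition iw (it : item) : nat := fst (fst it).
Definition ip (it : item) : nat := snd (fst it).
Definition im (it : item) : nat := snd it.

Definition valid_instance (W : nat) (items : list item) : Prop :=
  0 < W /\ items <> [] /\
  Forall (fun it => 0 < iw it /\ 0 < ip it /\ 0 < im it) items.

Definition sel_weight (items : list item) (x : list nat) : nat :=
  fold_right Nat.add 0 (map (fun '(it, xi) => xi * iw it) (combine items x)).
Definition sel_profit (items : list item) (x : list nat) : nat :=
  fold_right Nat.add 0 (map (fun '(it, xi) => xi * ip it) (combine items x)).

Definition feasible (W : nat) (items : list item) (x : list nat) : Prop :=
  Forall2 (fun it xi => xi <= im it) items x /\ sel_weight items x <= W.

Definition is_opt (W : nat) (items : list item) (v : nat) : Prop :=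
  (exists x, feasible W items x /\ sel_profit items x = v) /\
  (forall x, feasible W items x -> sel_profit items x <= v).

Definition wmax (items : list item) : nat := fold_right Nat.max 0 (map iw items).

Definition maxval (W : nat) (items : list item) : nat :=
  fold_right Nat.max (Nat.max (length items) W)
    (map (fun it => Nat.max (iw it) (Nat.max (ip it) (im it))) items).

Definition bitlen (v : nat) : nat := Nat.log2 v + 1.

Definition input_size (W : nat) (items : list item) : nat :=
  length items + bitlen W +
  fold_right Nat.add 0
    (map (fun it => bitlen (iw it) + bitlen (ip it) + bitlen (im it)) items).

(* Memory is an array of words (cells indexed by nat, initially 0 except
   for the input).  All arithmetic is on L-bit words (mod 2^L), unit cost
   per instruction.  Register operands d a b are fixed cell addresses
   written in the program; indirect addressing via Load/Store. *)
Inductive instr : Type :=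
| IConst (d k : nat)
| IAdd (d a b : nat)
| ISub (d a b : nat)
| IMul (d a b : nat)
| IDiv (d a b : nat)          (* M[d] := M[a] / M[b]  (0 if M[b] = 0) *)
| IMod (d a b : nat)
| IAnd (d a b : nat)
| IOr  (d a b : nat)
| IXor (d a b : nat)
| ILt  (d a b : nat)
| ILoad (d a : nat)
| IStore (a s : nat)
| IJz (c t : nat)
| IRand (d : nat)
| IHalt.

Definition program := list instr.

Definition upd (M : nat -> nat) (d v : nat) : nat -> nat :=
  fun x => if Nat.eqb x d then v else M x.

(* Run program P with word size L on random bit string bits, for at most
   fuel steps (every executed instruction, including IHalt, costs 1),
   from program counter pc, memory M, with r random bits consumed.
   Returns the final memory if the machine halts within fuel steps.
   Falling off the program counts as halting. *)
Fixpoint run (L : nat) (P : program) (bits : list bool) (fuel pc : nat)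
    (M : nat -> nat) (r : nat) {struct fuel} : option (nat -> nat) :=
  match fuel with
  | 0 => None
  | S f =>
    let m := 2 ^ L in
    let next M' := run L P bits f (S pc) M' r in
    match nth pc P IHalt with
    | IHalt => Some M
    | IConst d k => next (upd M d (k mod m))
    | IAdd d a b => next (upd M d ((M a + M b) mod m))
    | ISub d a b => next (upd M d ((M a + m - M b mod m) mod m))
    | IMul d a b => next (upd M d ((M a * M b) mod m))
    | IDiv d a b => next (upd M d ((M a / M b) mod m))
    | IMod d a b => next (upd M d ((M a mod M b) mod m))
    | IAnd d a b => next (upd M d ((Nat.land (M a) (M b)) mod m))
    | IOr d a b => next (upd M d ((Nat.lor (M a) (M b)) mod m))
    | IXor d a b => next (upd M d ((Nat.lxor (M a) (M b)) mod m))
    | ILt d a b => next (upd M d (if Nat.ltb (M a) (M b) then 1 else 0))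
    | ILoad d a => next (upd M d (M (M a)))
    | IStore a s => next (upd M (M a) (M s))
    | IJz c t =>
        if Nat.eqb (M c) 0 then run L P bits f t M r
        else run L P bits f (S pc) M r
    | IRand d =>
        run L P bits f (S pc) (upd M d (if nth r bits false then 1 else 0)) (S r)
    end
  end.

Definition init_mem (W : nat) (items : list item) : nat -> nat :=
  fun x =>
    match x with
    | 0 => length items
    | 1 => W
    | S (S y) =>
        let i := y / 3 in
        match nth_error items i with
        | None => 0
        | Some it =>
            match y mod 3 with
            | 0 => iw it
            | 1 => ip it
            | _ => im it
            end
        end
    end.

Fixpoint all_bits (t : nat) : list (list bool) :=
  match t with
  | 0 => [[]]
  | S t' => map (cons false) (all_bits t') ++ map (cons true) (all_bits t')
  end.

Definition output (L : nat) (P : program) (T : nat) (bits : list bool)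
    (W : nat) (items : list item) : option nat :=
  match run L P bits T 0 (init_mem W items) 0 with
  | Some M => Some (M 0)
  | None => None
  end.

(* number of random strings of length T on which the output equals v
   (a run of at most T steps reads at most T random bits, so the
   probability of outputting v is this count divided by 2^T) *)
Definition count_out (L : nat) (P : program) (T : nat)
    (W : nat) (items : list item) (v : nat) : nat :=
  length (filter (fun bs => match output L P T bs W items with
                            | Some o => Nat.eqb o v
                            | None => false end) (all_bits T)).

(* Main.v *)
(* Sort the copies by efficiency and let l1 be the greedy prefix.  A suitable
   optimum removes at most 2w copies from l1 and adds at most 2w later copies,
   the two total weights differing by at most w (w = wmax): otherwise a removed
   and an added set of equal weight could be exchanged back.

   If n^4 <= w, these copies are replaced by O(n log w) binary bundles and a
   signed 0/1 knapsack over weights in [-2w^2, 2w^2] takes O(n w^2 log w) =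
   O(w^(5/2)) time.  If n^4 > w, logarithms of w are polylogarithmic in the
   input size and a scan keeps only O(w log^2 w) copies: as soon as more than
   16w/h weight classes of comparable weight have h copies before the h-th copy
   of v, the optimum uses at most 2h copies of v, since by the
   Kemperman-Scherk theorem in Z/v few unused copies of these classes sum to a
   multiple of v.  The candidates are then processed in random order.  By a
   Chernoff bound all prefix sums of the signed weights of the optimum stay
   within w^(3/2) polylog with high probability, so a table of that size
   suffices.

   The program is written in a small structured language, compiled to word-RAM
   code behind a prologue that moves the input away from the low cells. *)
Require Import Defs.
From Stdlib Require Import Arith List.
From Stdlib Require Import Lia Bool Permutation Sorted Classical ZArith Reals Lra.
Import ListNotations.
Open Scope nat_scope.

(** * A structured language and its compilation *)

(** Only factors polylogarithmic in the input size N are free, and log w need not be one: N counts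
    bits, so log w can be as large as N itself. This forces the split at n^4 = w. For w < n^4 one
    has log w = O(log N); for n^4 <= w one has n (log w + 2) <= 8 sqrt w, so the logarithm caused by
    the bundles disappears in the exponent 5/2. For the same reason the Chernoff parameter is built
    from log n plus log log of the largest number, which already dominates log N.

    The random order comes from independent keys below a power of two G with w <= G <= 2w, ties
    being broken by the index. The candidates are not sorted: visiting all of them once per key
    value costs about w^2 steps. Inside a tie group the order is fixed, which shifts the mean of a
    prefix sum by at most 4w^2/G <= 4w; hence keys of about log w bits are long enough.

    The machine has no registers besides its memory, and every low cell holds input. The prologue
    therefore frees cells by arithmetic alone: the first cells become the digits of one number, in
    the base given by their sum. *)

Record st := St { rg : nat -> nat; ar : nat -> nat -> nat; rp : nat }.

Inductive bop := OAdd | OSub | OMul | ODiv | OLt.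
Inductive expr :=
| EV (x : nat) | EC (k : nat) | EA (a : nat) (e : expr) | EB (o : bop) (e1 e2 : expr).

Definition bopv (o : bop) (a b : nat) : nat :=
  match o with
  | OAdd => a + b | OSub => a - b | OMul => a * b | ODiv => a / b
  | OLt => if a <? b then 1 else 0
  end.

Fixpoint ev (s : st) (e : expr) : nat :=
  match e with
  | EV x => rg s x
  | EC k => k
  | EA a e => ar s a (ev s e)
  | EB o e1 e2 => bopv o (ev s e1) (ev s e2)
  end.

Definition okop (m : nat) (o : bop) (a b : nat) : Prop :=
  match o with
  | OAdd => a + b < m | OSub => b <= a | OMul => a * b < m | _ => True
  end.

(* No operation of e overflows or underflows, so that the machine computes the exact value. *)
Fixpoint ok (m : nat) (s : st) (e : expr) : Prop :=
  match e with
  | EV x => True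
  | EC k => k < m
  | EA a e => ok m s e /\ 64 + 16 * ev s e + a < m
  | EB o e1 e2 => ok m s e1 /\ ok m s e2 /\ okop m o (ev s e1) (ev s e2)
  end.

Inductive cmd :=
| CSkip
| CAsg (x : nat) (e : expr)
| CSto (a : nat) (e1 e2 : expr)
| CSeq (c1 c2 : cmd)
| CIf (e : expr) (c1 c2 : cmd)
| CWh (e : expr) (c : cmd)
| CRnd (x : nat).

Definition setr (s : st) (x v : nat) : st := St (upd (rg s) x v) (ar s) (rp s).
(** Kept apart from [upd], so that [wsim] computes updates of numbered variables by reduction while
    array updates at symbolic indices stay folded. *)
Definition updi (f : nat -> nat) (i v : nat) : nat -> nat :=
  fun j => if Nat.eq_dec j i then v else f j.
Definition seta (s : st) (a i v : nat) : st :=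
  St (rg s) (fun b => if Nat.eqb b a then updi (ar s a) i v else ar s b) (rp s).

Fixpoint esz (e : expr) : nat :=
  match e with
  | EV _ | EC _ => 1
  | EA _ e => esz e + 5
  | EB _ e1 e2 => esz e1 + esz e2 + 1
  end.

(** The last argument is the exact number of machine instructions of the compiled code. A taken
    branch pays two more than a failed test for the jump over the other branch, and a loop iteration
    pays the same for the jump back. *)
Inductive exec (m : nat) (bits : list bool) : cmd -> st -> st -> nat -> Prop :=
| ex_skip s : exec m bits CSkip s s 0
| ex_asg x e s : ok m s e -> exec m bits (CAsg x e) s (setr s x (ev s e)) (esz e + 1)
| ex_sto a e1 e2 s : ok m s e1 -> ok m s e2 -> 64 + 16 * ev s e1 + a < m ->
    exec m bits (CSto a e1 e2) s (seta s a (ev s e1) (ev s e2)) (esz e1 + esz e2 + 5)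
| ex_seq c1 c2 s s1 s2 t1 t2 : exec m bits c1 s s1 t1 -> exec m bits c2 s1 s2 t2 ->
    exec m bits (CSeq c1 c2) s s2 (t1 + t2)
| ex_ift e c1 c2 s s1 t : ok m s e -> ev s e <> 0 -> exec m bits c1 s s1 t ->
    exec m bits (CIf e c1 c2) s s1 (esz e + 3 + t)
| ex_iff e c1 c2 s s1 t : ok m s e -> ev s e = 0 -> exec m bits c2 s s1 t ->
    exec m bits (CIf e c1 c2) s s1 (esz e + 1 + t)
| ex_whf e c s : ok m s e -> ev s e = 0 -> exec m bits (CWh e c) s s (esz e + 1)
| ex_wht e c s s1 s2 t1 t2 : ok m s e -> ev s e <> 0 -> exec m bits c s s1 t1 ->
    exec m bits (CWh e c) s1 s2 t2 ->
    exec m bits (CWh e c) s s2 (esz e + 3 + t1 + t2)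
| ex_rnd x s : exec m bits (CRnd x) s
    (St (upd (rg s) x (if nth (rp s) bits false then 1 else 0)) (ar s) (S (rp s))) 1.

Definition opi (o : bop) (d a b : nat) : instr :=
  match o with
  | OAdd => IAdd d a b | OSub => ISub d a b | OMul => IMul d a b | ODiv => IDiv d a b | OLt => ILt d a b
  end.

(* Variables live in cells 0..39, scratch space in cells 40..63, and entry i of
   array a (a < 16) in cell 64 + 16 * i + a. *)
Fixpoint cexp (d : nat) (e : expr) : list instr :=
  match e with
  | EV x => [IOr d x x]
  | EC k => [IConst d k]
  | EA a e => cexp d e ++ [IConst (S d) 16; IMul d d (S d); IConst (S d) (64 + a);
                           IAdd d d (S d); ILoad d d]
  | EB o e1 e2 => cexp d e1 ++ cexp (S d) e2 ++ [opi o d d (S d)]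
  end.

Fixpoint csize (c : cmd) : nat :=
  match c with
  | CSkip => 0
  | CAsg _ e => esz e + 1
  | CSto _ e1 e2 => esz e1 + esz e2 + 5
  | CSeq c1 c2 => csize c1 + csize c2
  | CIf e c1 c2 => esz e + 3 + csize c1 + csize c2
  | CWh e c => esz e + 3 + csize c
  | CRnd _ => 1
  end.

Fixpoint ccmd (pc : nat) (c : cmd) : list instr :=
  match c with
  | CSkip => []
  | CAsg x e => cexp 40 e ++ [IOr x 40 40]
  | CSto a e1 e2 =>
      cexp 40 e1 ++ [IConst 41 16; IMul 40 40 41; IConst 41 (64 + a); IAdd 40 40 41]
      ++ cexp 41 e2 ++ [IStore 40 41]
  | CSeq c1 c2 => ccmd pc c1 ++ ccmd (pc + csize c1) c2
  | CIf e c1 c2 =>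
      cexp 40 e ++ [IJz 40 (pc + esz e + 3 + csize c1)]
      ++ ccmd (pc + esz e + 1) c1
      ++ [IConst 40 0; IJz 40 (pc + esz e + 3 + csize c1 + csize c2)]
      ++ ccmd (pc + esz e + 3 + csize c1) c2
  | CWh e c =>
      cexp 40 e ++ [IJz 40 (pc + esz e + 3 + csize c)]
      ++ ccmd (pc + esz e + 1) c ++ [IConst 40 0; IJz 40 pc]
  | CRnd x => [IRand x]
  end.

(** Scratch cells form a stack with top [d]; the bounds on [d] keep every cell written below 64,
    where the arrays begin. *)
Fixpoint wfe (d : nat) (e : expr) : bool :=
  match e with
  | EV x => (x <? 40) && (d <? 63)
  | EC _ => d <? 63
  | EA a e => (a <? 16) && wfe d e && (d <? 62)
  | EB _ e1 e2 => wfe d e1 && wfe (S d) e2 && (d <? 62)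
  end.

Fixpoint wfc (c : cmd) : bool :=
  match c with
  | CSkip => true
  | CAsg x e => (x <? 40) && wfe 40 e
  | CSto a e1 e2 => (a <? 16) && wfe 40 e1 && wfe 41 e2
  | CSeq c1 c2 => wfc c1 && wfc c2
  | CIf e c1 c2 => wfe 40 e && wfc c1 && wfc c2
  | CWh e c => wfe 40 e && wfc c
  | CRnd x => x <? 40
  end.

Lemma cexp_length d e : length (cexp d e) = esz e.
Proof.
  revert d; induction e; intros d; simpl; auto.
  - rewrite length_app, IHe. reflexivity.
  - rewrite !length_app, IHe1, IHe2. simpl. lia.
Qed.

Lemma ccmd_length pc c : length (ccmd pc c) = csize c.
Proof.
  revert pc; induction c; intros pc; simpl;
    rewrite ?length_app; simpl; rewrite ?length_app, ?cexp_length, ?IHc1, ?IHc2, ?IHc;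
    simpl; rewrite ?length_app, ?cexp_length, ?IHc1, ?IHc2, ?IHc; simpl;
    rewrite ?length_app, ?cexp_length, ?IHc1, ?IHc2, ?IHc; simpl; lia.
Qed.

Definition code_at (P : program) (pc : nat) (l : list instr) : Prop :=
  forall i, i < length l -> nth (pc + i) P IHalt = nth i l IHalt.

Lemma code_app P pc l1 l2 :
  code_at P pc (l1 ++ l2) <-> code_at P pc l1 /\ code_at P (pc + length l1) l2.
Proof.
  unfold code_at; split.
  - intros H; split; intros i Hi.
    + rewrite H by (rewrite length_app; lia). now rewrite app_nth1.
    + rewrite <- Nat.add_assoc, H by (rewrite length_app; lia).
      rewrite app_nth2 by lia. f_equal; cbn [csize]; lia.
  - intros [H1 H2] i Hi. rewrite length_app in Hi.
    destruct (Nat.lt_ge_cases i (length l1)) as [h|h].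
    + rewrite app_nth1 by auto. auto.
    + rewrite app_nth2 by auto. rewrite <- H2 by lia. f_equal; cbn [csize]; lia.
Qed.

Lemma code_cons P pc i l :
  code_at P pc (i :: l) <-> nth pc P IHalt = i /\ code_at P (S pc) l.
Proof.
  change (i :: l) with ([i] ++ l). rewrite code_app. simpl.
  replace (pc + 1) with (S pc) by lia. split; intros [H1 H2]; split; auto.
  - specialize (H1 0). simpl in H1. rewrite Nat.add_0_r in H1. auto.
  - intros j Hj. simpl in Hj. assert (j = 0) by lia. subst. simpl. now rewrite Nat.add_0_r.
Qed.

Lemma upd_same M x v : upd M x v x = v.
Proof. unfold upd. now rewrite Nat.eqb_refl. Qed.
Lemma upd_diff M x v y : y <> x -> upd M x v y = M y.
Proof. intros H. unfold upd. apply Nat.eqb_neq in H. now rewrite H. Qed.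

Section Machine.
Context (L : nat) (P : program) (bits : list bool).
Notation m := (2 ^ L).

(** Quantified over the remaining fuel, so that runs compose by adding their step counts. *)
Definition step_to (k pc : nat) (M : nat -> nat) (r pc' : nat) (M' : nat -> nat) (r' : nat) : Prop :=
  forall f, run L P bits (k + f) pc M r = run L P bits f pc' M' r'.

Lemma step_trans k1 k2 k pc M r pc1 M1 r1 pc2 M2 r2 :
  k = k1 + k2 ->
  step_to k1 pc M r pc1 M1 r1 -> step_to k2 pc1 M1 r1 pc2 M2 r2 -> step_to k pc M r pc2 M2 r2.
Proof. intros -> H1 H2 f. rewrite <- Nat.add_assoc, H1. apply H2. Qed.

Definition rel (M : nat -> nat) (s : st) : Prop :=
  (forall x, x < 40 -> M x = rg s x) /\
  (forall a i, a < 16 -> M (64 + 16 * i + a) = ar s a i) /\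
  (forall x, M x < m).

Lemma rel_scratch M s d v : 40 <= d < 64 -> v < m -> rel M s -> rel (upd M d v) s.
Proof.
  intros Hd Hv (H1 & H2 & H3). split; [|split].
  - intros x Hx. rewrite upd_diff by lia. auto.
  - intros a i Ha. rewrite upd_diff by lia. auto.
  - intros x. unfold upd. destruct (x =? d); auto.
Qed.

Lemma rel_var M s x v : x < 40 -> v < m -> rel M s -> rel (upd M x v) (setr s x v).
Proof.
  intros Hd Hv (H1 & H2 & H3). split; [|split]; cbn [rg ar rp setr seta].
  - intros y Hy. unfold upd. destruct (y =? x); auto.
  - intros a i Ha. rewrite upd_diff by lia. auto.
  - intros y. unfold upd. destruct (y =? x); auto.
Qed.

Lemma rel_arr M s a i v : a < 16 -> v < m -> rel M s ->
  rel (upd M (64 + 16 * i + a) v) (seta s a i v).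
Proof.
  intros Ha Hv (H1 & H2 & H3). split; [|split]; cbn [rg ar rp setr seta].
  - intros y Hy. rewrite upd_diff by lia. auto.
  - intros b j Hb. change (M (64 + 16 * j + b)) with (M (64 + 16 * j + b)).
    destruct (Nat.eqb_spec b a) as [->|Hne].
    + unfold updi. destruct (Nat.eq_dec j i) as [->|Hji].
      * apply upd_same.
      * rewrite <- H2 by auto. apply upd_diff. lia.
    + rewrite <- H2 by auto. apply upd_diff. lia.
  - intros y. unfold upd. destruct (y =? _); auto.
Qed.

Context (Hm : 1 < m).

(** The body of [run] for a known instruction: a step can be rewritten without unfolding the
    fixpoint. *)
Definition stp (i : instr) (f pc : nat) (M : nat -> nat) (r : nat) : option (nat -> nat) :=
  let next M' := run L P bits f (S pc) M' r in
  match i with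
  | IHalt => Some M
  | IConst d k => next (upd M d (k mod m))
  | IAdd d a b => next (upd M d ((M a + M b) mod m))
  | ISub d a b => next (upd M d ((M a + m - M b mod m) mod m))
  | IMul d a b => next (upd M d ((M a * M b) mod m))
  | IDiv d a b => next (upd M d ((M a / M b) mod m))
  | IMod d a b => next (upd M d ((M a mod M b) mod m))
  | IAnd d a b => next (upd M d ((Nat.land (M a) (M b)) mod m))
  | IOr d a b => next (upd M d ((Nat.lor (M a) (M b)) mod m))
  | IXor d a b => next (upd M d ((Nat.lxor (M a) (M b)) mod m))
  | ILt d a b => next (upd M d (if Nat.ltb (M a) (M b) then 1 else 0))
  | ILoad d a => next (upd M d (M (M a)))
  | IStore a s => next (upd M (M a) (M s))
  | IJz c t =>
      if Nat.eqb (M c) 0 then run L P bits f t M r else run L P bits f (S pc) M r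
  | IRand d => run L P bits f (S pc) (upd M d (if nth r bits false then 1 else 0)) (S r)
  end.

Lemma run_S i f pc M r : nth pc P IHalt = i -> run L P bits (S f) pc M r = stp i f pc M r.
Proof. intros H. cbn [run]. rewrite H. reflexivity. Qed.

(** Cells below [d] survive, so the left operand is still in cell [d] after the right one has been
    evaluated in [S d]. *)
Lemma cexp_ok s e : forall d M pc r,
  wfe d e = true -> 40 <= d -> rel M s -> ok m s e -> code_at P pc (cexp d e) ->
  exists M', rel M' s /\ M' d = ev s e /\ (forall j, j < d -> M' j = M j) /\
    step_to (esz e) pc M r (pc + esz e) M' r.
Proof.
  induction e as [x|k|a e IH|o e1 IH1 e2 IH2]; intros d M pc r Hwf Hd HR Hok HC; cbn [cexp wfe ok ev esz] in *.
  - apply andb_prop in Hwf as [Hx Hd']. apply Nat.ltb_lt in Hx, Hd'.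
    apply code_cons in HC as [HC _].
    destruct HR as (H1 & H2 & H3).
    assert (Hv : Nat.lor (M x) (M x) mod m = rg s x).
    { rewrite Nat.lor_diag, Nat.mod_small; auto. }
    exists (upd M d (Nat.lor (M x) (M x) mod m)). split; [|split; [|split]].
    + apply rel_scratch; [lia| |repeat split; auto]. rewrite Hv, <- H1; auto.
    + now rewrite upd_same.
    + intros j Hj. apply upd_diff. lia.
    + rewrite Nat.add_1_r. intros f. cbn [Nat.add]. rewrite (run_S _ _ _ _ _ HC); cbn [stp]. reflexivity.
  - apply Nat.ltb_lt in Hwf. apply code_cons in HC as [HC _].
    exists (upd M d (k mod m)). rewrite (Nat.mod_small k) by auto. split; [|split; [|split]].
    + apply rel_scratch; auto; lia.
    + apply upd_same.
    + intros j Hj. apply upd_diff. lia.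
    + rewrite Nat.add_1_r. intros f. cbn [Nat.add]. rewrite (run_S _ _ _ _ _ HC); cbn [stp]. rewrite Nat.mod_small by auto. reflexivity.
  - apply andb_prop in Hwf as [Hwf Hd']. apply andb_prop in Hwf as [Ha Hwf].
    apply Nat.ltb_lt in Ha, Hd'. destruct Hok as [Hok Hb].
    apply code_app in HC as [HC1 HC2]. rewrite cexp_length in HC2.
    apply code_cons in HC2 as [C1 HC2]. apply code_cons in HC2 as [C2 HC2].
    apply code_cons in HC2 as [C3 HC2]. apply code_cons in HC2 as [C4 HC2].
    apply code_cons in HC2 as [C5 _].
    destruct (IH d M pc r Hwf Hd HR Hok HC1) as (M1 & R1 & V1 & F1 & S1).
    set (v := ev s e) in *.
    assert (Hin : forall v', v' < m -> rel (upd (upd (upd (upd M1 (S d) 16) d (16 * v)) (S d) (64 + a)) d v') s).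
    { intros v' Hv'. repeat (apply rel_scratch; [lia|lia|]). auto. }
    exists (upd (upd (upd (upd (upd M1 (S d) 16) d (16 * v)) (S d) (64 + a)) d (64 + 16 * v + a)) d (ar s a v)).
    split; [|split; [|split]].
    + apply rel_scratch; [lia| |apply Hin; lia].
      destruct R1 as (_ & R1 & R3). rewrite <- R1 by auto. auto.
    + apply upd_same.
    + intros j Hj. rewrite !upd_diff by lia. auto.
    + eapply step_trans; [|exact S1|]; [reflexivity|].
      intros f. change (5 + f) with (S (S (S (S (S f))))).
      do 5 (erewrite run_S by eassumption; cbn [stp]).
      replace (S (S (S (S (S (pc + esz e)))))) with (pc + (esz e + 5)) by lia.
      rewrite (Nat.mod_small 16) by lia.
      rewrite (upd_diff M1 (S d) _ d) by lia. rewrite upd_same, V1.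
      rewrite (Nat.mod_small (v * 16)) by lia.
      replace (v * 16) with (16 * v) by lia.
      rewrite (Nat.mod_small (64 + a)) by lia.
      rewrite upd_same. rewrite (upd_diff _ (S d) _ d) by lia. rewrite upd_same.
      rewrite (Nat.mod_small (16 * v + (64 + a))) by lia.
      replace (16 * v + (64 + a)) with (64 + 16 * v + a) by lia.
      rewrite upd_same. f_equal.
      f_equal.
      specialize (Hin (64 + 16 * v + a) ltac:(lia)) as (_ & Hin2 & _).
      specialize (Hin2 a v Ha). exact Hin2.
  - apply andb_prop in Hwf as [Hwf Hd']. apply andb_prop in Hwf as [Hw1 Hw2].
    apply Nat.ltb_lt in Hd'. destruct Hok as (Ho1 & Ho2 & Ho).
    apply code_app in HC as [HC1 HC2]. apply code_app in HC2 as [HC2 HC3].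
    rewrite !cexp_length in *. apply code_cons in HC3 as [C _].
    destruct (IH1 d M pc r Hw1 Hd HR Ho1 HC1) as (M1 & R1 & V1 & F1 & S1).
    destruct (IH2 (S d) M1 (pc + esz e1) r Hw2 ltac:(lia) R1 Ho2 HC2) as (M2 & R2 & V2 & F2 & S2).
    assert (V1' : M2 d = ev s e1) by (rewrite F2 by lia; auto).
    assert (Hlt1 : ev s e1 < m) by (rewrite <- V1'; apply R2).
    assert (Hlt2 : ev s e2 < m) by (rewrite <- V2; apply R2).
    exists (upd M2 d (bopv o (ev s e1) (ev s e2))).
    assert (Hres : bopv o (ev s e1) (ev s e2) < m).
    { destruct o; cbn [bopv okop opi] in *; try lia.
      - destruct (Nat.eq_dec (ev s e2) 0) as [->|]; [cbn; lia|].
        eapply Nat.le_lt_trans; [apply Nat.Div0.div_le_upper_bound with (q := ev s e1)|]; nia.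
      - destruct (_ <? _); lia. }
    split; [|split; [|split]].
    + apply rel_scratch; auto; lia.
    + apply upd_same.
    + intros j Hj. rewrite upd_diff by lia. rewrite F2 by lia. auto.
    + eapply (step_trans (esz e1) (esz e2 + 1)); [lia|exact S1|].
      eapply (step_trans (esz e2) 1); [lia|exact S2|].
      intros f. cbn [Nat.add]. rewrite (run_S _ _ _ _ _ C); cbn [stp].
      destruct o; cbn [bopv okop opi stp] in *; rewrite ?V1', ?V2;
        replace (S (pc + esz e1 + esz e2)) with (pc + (esz e1 + esz e2 + 1)) by lia.
      * rewrite Nat.mod_small by auto. reflexivity.
      * rewrite (Nat.mod_small (ev s e2)) by auto.
        (* There is no underflow, so the summand m vanishes in the reduction modulo m. *)
        replace (ev s e1 + m - ev s e2) with (ev s e1 - ev s e2 + 1 * m) by lia.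
        rewrite Nat.Div0.mod_add, Nat.mod_small by lia. reflexivity.
      * rewrite Nat.mod_small by auto. reflexivity.
      * rewrite Nat.mod_small by auto. reflexivity.
      * reflexivity.
Qed.

(** The instruction set has no unconditional jump; clearing cell 40 and testing it replaces one. *)
Lemma jump_ok pc t M s r :
  rel M s -> code_at P pc [IConst 40 0; IJz 40 t] ->
  exists M', rel M' s /\ step_to 2 pc M r t M' r.
Proof.
  intros HR HC. apply code_cons in HC as [C1 HC]. apply code_cons in HC as [C2 _].
  exists (upd M 40 0). split; [apply rel_scratch; auto; lia|].
  intros f. cbn [Nat.add]. do 2 (erewrite run_S by eassumption; cbn [stp]). rewrite Nat.Div0.mod_0_l, upd_same. reflexivity.
Qed.

Lemma jz_ok pc t M r v : M 40 = v -> nth pc P IHalt = IJz 40 t ->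
  step_to 1 pc M r (if v =? 0 then t else S pc) M r.
Proof. intros <- C f. cbn [Nat.add]. rewrite (run_S _ _ _ _ _ C); cbn [stp]. destruct (M 40 =? 0); reflexivity. Qed.

(** Induction on the execution instead of the command: the rest of a loop is again an execution of
    the same loop, so no separate measure is needed. *)
Theorem compile_ok c s s' t : exec m bits c s s' t -> forall pc M,
  wfc c = true -> rel M s -> code_at P pc (ccmd pc c) ->
  exists M', rel M' s' /\ step_to t pc M (rp s) (pc + csize c) M' (rp s').
Proof.
  induction 1 as [s|x e s Hok|a e1 e2 s Ho1 Ho2 Hb|c1 c2 s s1 s2 t1 t2 H1 IH1 H2 IH2
    |e c1 c2 s s1 t Hok Hv H1 IH1|e c1 c2 s s1 t Hok Hv H1 IH1|e c s Hok Hv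
    |e c s s1 s2 t1 t2 Hok Hv H1 IH1 H2 IH2|x s]; intros pc M Hwf HR HC; cbn [wfc] in Hwf.
  - exists M. split; auto. intros f. simpl. f_equal; cbn [csize]; lia.
  - apply andb_prop in Hwf as [Hx Hwf]. apply Nat.ltb_lt in Hx.
    cbn [ccmd] in HC. apply code_app in HC as [HC1 HC2]. rewrite cexp_length in HC2.
    apply code_cons in HC2 as [C _].
    destruct (cexp_ok s e 40 M pc (rp s) Hwf ltac:(lia) HR Hok HC1) as (M1 & R1 & V1 & F1 & S1).
    assert (Hlt : ev s e < m) by (rewrite <- V1; apply R1).
    exists (upd M1 x (ev s e)). split; [apply rel_var; auto|].
    eapply (step_trans (esz e) 1); [reflexivity|exact S1|].
    intros f. cbn [Nat.add]. rewrite (run_S _ _ _ _ _ C); cbn [stp]. rewrite V1, Nat.lor_diag, Nat.mod_small by auto. f_equal; cbn [csize]; lia.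
  - apply andb_prop in Hwf as [Hwf Hw2]. apply andb_prop in Hwf as [Ha Hw1].
    apply Nat.ltb_lt in Ha. cbn [ccmd] in HC.
    apply code_app in HC as [HC1 HC2]. apply code_app in HC2 as [HC2 HC3].
    apply code_app in HC3 as [HC3 HC4]. rewrite !cexp_length in *.
    apply code_cons in HC2 as [C1 HC2]. apply code_cons in HC2 as [C2 HC2].
    apply code_cons in HC2 as [C3 HC2]. apply code_cons in HC2 as [C4 _].
    apply code_cons in HC4 as [C5 _].
    destruct (cexp_ok s e1 40 M pc (rp s) Hw1 ltac:(lia) HR Ho1 HC1) as (M1 & R1 & V1 & F1 & S1).
    set (v := ev s e1) in *. set (ad := 64 + 16 * v + a) in *.
    set (M2 := upd (upd (upd (upd M1 41 16) 40 (16 * v)) 41 (64 + a)) 40 ad).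
    assert (R2 : rel M2 s). { unfold M2. repeat (apply rel_scratch; [lia|lia|]). auto. }
    assert (S2 : step_to 4 (pc + esz e1) M1 (rp s) (pc + esz e1 + 4) M2 (rp s)).
    { intros f. change (4 + f) with (S (S (S (S f)))).
      do 4 (erewrite run_S by eassumption; cbn [stp]).
      replace (S (S (S (S (pc + esz e1))))) with (pc + esz e1 + 4) by lia.
      rewrite (Nat.mod_small 16) by lia.
      rewrite (upd_diff M1 41 _ 40) by lia. rewrite upd_same, V1.
      rewrite (Nat.mod_small (v * 16)) by lia.
      replace (v * 16) with (16 * v) by lia.
      rewrite (Nat.mod_small (64 + a)) by lia.
      rewrite upd_same. rewrite (upd_diff _ 41 _ 40) by lia. rewrite upd_same.
      rewrite (Nat.mod_small (16 * v + (64 + a))) by lia.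
      replace (16 * v + (64 + a)) with ad by (unfold ad; lia). reflexivity. }
    change (length [IConst 41 16; IMul 40 40 41; IConst 41 (64 + a); IAdd 40 40 41]) with 4 in *.
    destruct (cexp_ok s e2 41 M2 _ (rp s) Hw2 ltac:(lia) R2 Ho2 HC3) as (M3 & R3 & V3 & F3 & S3).
    assert (V4 : M3 40 = ad) by (rewrite F3 by lia; apply upd_same).
    assert (Hlt : ev s e2 < m) by (rewrite <- V3; apply R3).
    exists (upd M3 ad (ev s e2)). split; [apply rel_arr; auto|].
    eapply (step_trans (esz e1)); [|exact S1|].
    2:{ eapply (step_trans 4); [|exact S2|]. 2:{ eapply (step_trans (esz e2) 1); [reflexivity|exact S3|].
        intros f. cbn [Nat.add]. rewrite (run_S _ _ _ _ _ C5); cbn [stp]. rewrite V4, V3. f_equal; cbn [csize]; lia. } reflexivity. }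
    lia.
  - apply andb_prop in Hwf as [Hw1 Hw2]. cbn [ccmd] in HC.
    apply code_app in HC as [HC1 HC2]. rewrite ccmd_length in HC2.
    destruct (IH1 pc M Hw1 HR HC1) as (M1 & R1 & S1).
    destruct (IH2 _ M1 Hw2 R1 HC2) as (M2 & R2 & S2).
    exists M2. split; auto. eapply step_trans; [reflexivity|exact S1|].
    simpl. rewrite Nat.add_assoc. exact S2.
  - apply andb_prop in Hwf as [Hwf Hw2]. apply andb_prop in Hwf as [Hwe Hw1].
    cbn [ccmd] in HC. apply code_app in HC as [HC1 HC2]. rewrite cexp_length in HC2.
    apply code_cons in HC2 as [C1 HC2]. apply code_app in HC2 as [HC2 HC3].
    apply code_app in HC3 as [HC3 HC4]. rewrite ccmd_length in *.
    replace (S (pc + esz e)) with (pc + esz e + 1) in * by lia.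
    destruct (cexp_ok s e 40 M pc (rp s) Hwe ltac:(lia) HR Hok HC1) as (M1 & R1 & V1 & F1 & S1).
    destruct (IH1 _ M1 Hw1 R1 HC2) as (M2 & R2 & S2).
    destruct (jump_ok _ _ M2 s1 (rp s1) R2 HC3) as (M3 & R3 & S3).
    exists M3. split; auto.
    eapply (step_trans (esz e) (3 + t)); [lia|exact S1|].
    pose proof (jz_ok _ _ _ (rp s) _ V1 C1) as SJ.
    apply Nat.eqb_neq in Hv. rewrite Hv in SJ.
    eapply (step_trans 1 (t + 2)); [lia|exact SJ|].
    replace (S (pc + esz e)) with (pc + esz e + 1) by lia.
    eapply (step_trans t 2); [lia|exact S2|].
    cbn [csize]. rewrite !Nat.add_assoc. exact S3.
  - apply andb_prop in Hwf as [Hwf Hw2]. apply andb_prop in Hwf as [Hwe Hw1].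
    cbn [ccmd] in HC. apply code_app in HC as [HC1 HC2]. rewrite cexp_length in HC2.
    apply code_cons in HC2 as [C1 HC2]. apply code_app in HC2 as [HC2 HC3].
    apply code_app in HC3 as [HC3 HC4]. rewrite ccmd_length in *.
    destruct (cexp_ok s e 40 M pc (rp s) Hwe ltac:(lia) HR Hok HC1) as (M1 & R1 & V1 & F1 & S1).
    replace (S (pc + esz e) + csize c1 + length [IConst 40 0; IJz 40 (pc + esz e + 3 + csize c1 + csize c2)])
      with (pc + esz e + 3 + csize c1) in HC4 by (cbn [length]; lia).
    destruct (IH1 _ M1 Hw2 R1 HC4) as (M2 & R2 & S2).
    exists M2. split; auto.
    eapply (step_trans (esz e) (1 + t)); [lia|exact S1|].
    pose proof (jz_ok _ _ _ (rp s) _ V1 C1) as SJ. rewrite Hv in SJ. cbn [Nat.eqb] in SJ.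
    eapply (step_trans 1 t); [lia|exact SJ|].
    cbn [csize]. rewrite !Nat.add_assoc. exact S2.
  - apply andb_prop in Hwf as [Hwe Hw].
    cbn [ccmd] in HC. apply code_app in HC as [HC1 HC2]. rewrite cexp_length in HC2.
    apply code_cons in HC2 as [C1 HC2].
    destruct (cexp_ok s e 40 M pc (rp s) Hwe ltac:(lia) HR Hok HC1) as (M1 & R1 & V1 & F1 & S1).
    exists M1. split; auto.
    pose proof (jz_ok _ _ _ (rp s) _ V1 C1) as SJ. rewrite Hv in SJ. cbn [Nat.eqb] in SJ.
    eapply (step_trans (esz e) 1); [lia|exact S1|].
    cbn [csize]. rewrite !Nat.add_assoc. exact SJ.
  - pose proof Hwf as Hwf0. apply andb_prop in Hwf as [Hwe Hw]. pose proof HC as HC0.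
    cbn [ccmd] in HC. apply code_app in HC as [HC1 HC2]. rewrite cexp_length in HC2.
    apply code_cons in HC2 as [C1 HC2]. apply code_app in HC2 as [HC2 HC3].
    rewrite ccmd_length in *.
    replace (S (pc + esz e)) with (pc + esz e + 1) in * by lia.
    destruct (cexp_ok s e 40 M pc (rp s) Hwe ltac:(lia) HR Hok HC1) as (M1 & R1 & V1 & F1 & S1).
    destruct (IH1 _ M1 Hw R1 HC2) as (M2 & R2 & S2).
    destruct (jump_ok _ _ M2 s1 (rp s1) R2 HC3) as (M3 & R3 & S3).
    destruct (IH2 pc M3 Hwf0 R3 HC0) as (M4 & R4 & S4).
    exists M4. split; auto.
    eapply (step_trans (esz e) (3 + t1 + t2)); [lia|exact S1|].
    pose proof (jz_ok _ _ _ (rp s) _ V1 C1) as SJ.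
    apply Nat.eqb_neq in Hv. rewrite Hv in SJ.
    eapply (step_trans 1 (t1 + 2 + t2)); [lia|exact SJ|].
    replace (S (pc + esz e)) with (pc + esz e + 1) by lia.
    eapply (step_trans t1 (2 + t2)); [lia|exact S2|].
    eapply (step_trans 2 t2); [lia|exact S3|]. exact S4.
  - apply Nat.ltb_lt in Hwf. cbn [ccmd] in HC. apply code_cons in HC as [C _].
    exists (upd M x (if nth (rp s) bits false then 1 else 0)). split.
    + assert (Hlt : (if nth (rp s) bits false then 1 else 0) < m) by (destruct (nth (rp s) bits false); lia).
      exact (rel_var M s x _ Hwf Hlt HR).
    + intros f. cbn [Nat.add]. rewrite (run_S _ _ _ _ _ C); cbn [stp]. cbn [csize rp]. f_equal; lia.
Qed.
End Machine.

(** * Program triples with time bounds *)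

Section Triple.
Context (m : nat) (bits : list bool).

(** One terminating execution is enough: by [compile_ok] the deterministic machine follows it. *)
Definition tri (t : nat) (c : cmd) (s : st) (Q : st -> Prop) : Prop :=
  exists s' t', exec m bits c s s' t' /\ t' <= t /\ Q s'.

(** Comparisons are read as inequalities, which [lia] can use directly. *)
Definition truth (s : st) (e : expr) : Prop :=
  match e with EB OLt a b => ev s a < ev s b | _ => ev s e <> 0 end.
Definition falsity (s : st) (e : expr) : Prop :=
  match e with EB OLt a b => ev s b <= ev s a | _ => ev s e = 0 end.

Lemma truth_ev s e : truth s e <-> ev s e <> 0.
Proof.
  destruct e; simpl; try tauto. destruct o; simpl; try tauto.
  destruct (Nat.ltb_spec (ev s e1) (ev s e2)); lia.
Qed.
Lemma falsity_ev s e : falsity s e <-> ev s e = 0.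
Proof.
  destruct e; simpl; try tauto. destruct o; simpl; try tauto.
  destruct (Nat.ltb_spec (ev s e1) (ev s e2)); lia.
Qed.

(** Weakest precondition of loop-free code; loops get [False] here and are treated by the rules with
    invariants. *)
Fixpoint wps (c : cmd) (Q : st -> Prop) (s : st) : Prop :=
  match c with
  | CSkip => Q s
  | CAsg x e => ok m s e /\ Q (setr s x (ev s e))
  | CSto a e1 e2 => ok m s e1 /\ ok m s e2 /\ 64 + 16 * ev s e1 + a < m /\
      Q (seta s a (ev s e1) (ev s e2))
  | CSeq c1 c2 => wps c1 (wps c2 Q) s
  | CIf e c1 c2 => ok m s e /\ (truth s e -> wps c1 Q s) /\ (falsity s e -> wps c2 Q s)
  | CWh _ _ => False
  | CRnd x => Q (St (upd (rg s) x (if nth (rp s) bits false then 1 else 0)) (ar s) (S (rp s)))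
  end.

Lemma tri_mono t t' c s (Q Q' : st -> Prop) :
  t <= t' -> (forall s', Q s' -> Q' s') -> tri t c s Q -> tri t' c s Q'.
Proof. intros Ht HQ (s' & t0 & H1 & H2 & H3). exists s', t0. repeat split; auto; lia. Qed.

Lemma tri_seq t1 t2 c1 c2 s Q :
  tri t1 c1 s (fun s1 => tri t2 c2 s1 Q) -> tri (t1 + t2) (CSeq c1 c2) s Q.
Proof.
  intros (s1 & a & H1 & H2 & s2 & b & H3 & H4 & H5).
  exists s2, (a + b). split; [econstructor; eauto|split; auto; lia].
Qed.

Lemma tri_if t e c1 c2 s Q :
  ok m s e -> (truth s e -> tri t c1 s Q) -> (falsity s e -> tri t c2 s Q) ->
  tri (esz e + 3 + t) (CIf e c1 c2) s Q.
Proof.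
  intros Hok H1 H2. destruct (Nat.eq_dec (ev s e) 0) as [h|h].
  - destruct H2 as (s' & a & A & B & C); [now apply falsity_ev|].
    exists s', (esz e + 1 + a). split; [now apply ex_iff|split; auto; lia].
  - destruct H1 as (s' & a & A & B & C); [now apply truth_ev|].
    exists s', (esz e + 3 + a). split; [now apply ex_ift|split; auto; lia].
Qed.

(** Without loops each instruction runs at most once, so the length of the code bounds its time. *)
Lemma wps_tri c : forall Q s, wps c Q s -> tri (csize c) c s Q.
Proof.
  induction c; intros Q s H; cbn [wps csize] in *.
  - exists s, 0. repeat split; auto. constructor.
  - destruct H. eexists _, _. split; [constructor; auto|split; auto].
  - destruct H as (? & ? & ? & ?). eexists _, _. split; [constructor; auto|split; auto].
  - apply tri_seq. eapply tri_mono; [apply le_n| |apply IHc1, H]. intros s1 H1. apply IHc2, H1.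
  - destruct H as (Ho & H1 & H2). rewrite <- Nat.add_assoc. apply tri_if; auto; intros h.
    + eapply tri_mono; [| |apply IHc1; auto]; auto; lia.
    + eapply tri_mono; [| |apply IHc2; auto]; auto; lia.
  - destruct H.
  - eexists _, _. split; [constructor; auto|split; auto].
Qed.

Lemma tri_while (I : nat -> st -> Prop) e c :
  (forall k s, I k s -> ok m s e /\
     (truth s e -> exists t, tri t c s (fun s' => exists k', I k' s' /\ t + esz e + 3 + k' <= k))) ->
  forall k s, I k s ->
  tri (k + esz e + 1) (CWh e c) s (fun s' => exists k', k' <= k /\ I k' s' /\ falsity s' e).
Proof.
  intros H k. induction k as [k IH] using lt_wf_ind. intros s HI.
  destruct (H k s HI) as [Ho Hb].
  destruct (Nat.eq_dec (ev s e) 0) as [h|h].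
  - exists s, (esz e + 1). split; [now apply ex_whf|split; [lia|]].
    exists k. repeat split; auto. now apply falsity_ev.
  - destruct Hb as (t & s1 & t1 & E1 & L1 & k1 & I1 & K1); [now apply truth_ev|].
    destruct (IH k1 ltac:(lia) s1 I1) as (s2 & t2 & E2 & L2 & k2 & K2 & I2 & F2).
    exists s2, (esz e + 3 + t1 + t2). split; [eapply ex_wht; eauto|split; [lia|]].
    exists k2. repeat split; auto. lia.
Qed.

Fixpoint modv (c : cmd) (x : nat) : bool :=
  match c with
  | CAsg y _ | CRnd y => Nat.eqb x y
  | CSeq c1 c2 | CIf _ c1 c2 => modv c1 x || modv c2 x
  | CWh _ c => modv c x
  | _ => false
  end.
Fixpoint moda (c : cmd) (a : nat) : bool :=
  match c with
  | CSto b _ _ => Nat.eqb a b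
  | CSeq c1 c2 | CIf _ c1 c2 => moda c1 a || moda c2 a
  | CWh _ c => moda c a
  | _ => false
  end.
Fixpoint modp (c : cmd) : bool :=
  match c with
  | CRnd _ => true
  | CSeq c1 c2 | CIf _ c1 c2 => modp c1 || modp c2
  | CWh _ c => modp c
  | _ => false
  end.

(** The three tests are computed from the syntax, so for a concrete variable or array the side
    condition is proved by [eq_refl]. *)
Definition fr (c : cmd) (s s' : st) : Prop :=
  (forall x, modv c x = false -> rg s' x = rg s x) /\
  (forall a, moda c a = false -> ar s' a = ar s a) /\
  (modp c = false -> rp s' = rp s).

Lemma fr_refl c s : fr c s s.
Proof. repeat split; auto. Qed.
Lemma fr_trans c s1 s2 s3 : fr c s1 s2 -> fr c s2 s3 -> fr c s1 s3.
Proof.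
  intros (A & B & C) (A' & B' & C'). repeat split; intros.
  - rewrite A'; auto. - rewrite B'; auto. - rewrite C'; auto.
Qed.
Lemma fr_sub c c' s s' :
  (forall x, modv c' x = false -> modv c x = false) ->
  (forall x, moda c' x = false -> moda c x = false) ->
  (modp c' = false -> modp c = false) -> fr c s s' -> fr c' s s'.
Proof. intros X Y Z (A & B & C). repeat split; auto. Qed.

Lemma ex_fr c s s' t : exec m bits c s s' t -> fr c s s'.
Proof.
  induction 1.
  - apply fr_refl.
  - repeat split; simpl; auto. intros y Hy. unfold upd. now rewrite Hy.
  - repeat split; simpl; auto. intros y Hy. now rewrite Hy.
  - eapply fr_trans; (eapply fr_sub; [| | |eassumption]); simpl; intros; auto; apply orb_false_iff in H1; tauto.
  - eapply fr_sub; [| | |eassumption]; simpl; intros; auto; apply orb_false_iff in H2; tauto.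
  - eapply fr_sub; [| | |eassumption]; simpl; intros; auto; apply orb_false_iff in H2; tauto.
  - apply fr_refl.
  - eapply fr_trans; [eapply fr_sub; [| | |apply IHexec1]; auto|apply IHexec2].
  - repeat split; simpl; auto; try discriminate. intros y Hy. unfold upd. now rewrite Hy.
Qed.

Lemma tri_fr t c s Q : tri t c s Q -> tri t c s (fun s' => Q s' /\ fr c s s').
Proof.
  intros (s' & t' & A & B & C). exists s', t'. repeat split; auto; apply (ex_fr _ _ _ _ A); auto.
Qed.

(* The invariant need not mention what c leaves untouched. *)
Lemma tri_for (I : nat -> st -> Prop) N C e c s0 :
  (forall k s, k < N -> I k s -> fr c s0 s -> ok m s e /\ truth s e /\ tri C c s (I (S k))) ->
  (forall s, I N s -> fr c s0 s -> ok m s e /\ falsity s e) ->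
  I 0 s0 ->
  tri (N * (C + esz e + 3) + esz e + 1) (CWh e c) s0 (fun s' => I N s' /\ fr c s0 s').
Proof.
  intros Hb He H0.
  (* The budget of the general rule is the cost of the iterations still to come. *)
  pose (J := fun k s => exists j, j <= N /\ I j s /\ fr c s0 s /\ k = (N - j) * (C + esz e + 3)).
  eapply tri_mono; [apply le_n| |apply (tri_while J)].
  - intros s' (k' & _ & (j & Hj & HI & HF & _) & Hf).
    destruct (Nat.eq_dec j N) as [->|]; auto.
    destruct (Hb j s' ltac:(lia) HI HF) as (_ & Ht & _).
    apply truth_ev in Ht. apply falsity_ev in Hf. contradiction.
  - intros k s (j & Hj & HI & HF & ->).
    destruct (Nat.eq_dec j N) as [->|].
    + destruct (He s HI HF) as [Ho Hf]. split; auto. intros Ht.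
      apply truth_ev in Ht. apply falsity_ev in Hf. contradiction.
    + destruct (Hb j s ltac:(lia) HI HF) as (Ho & _ & Ht). split; auto. intros _.
      exists C. eapply tri_mono; [apply le_n| |apply tri_fr, Ht].
      intros s' [HI' HF']. exists ((N - S j) * (C + esz e + 3)). split.
      * exists (S j). repeat split; auto; try lia; apply (fr_trans _ _ _ _ HF HF'); auto.
      * replace (N - j) with (S (N - S j)) by lia. simpl. lia.
  - exists 0. split; [lia|split; [auto|split; [apply fr_refl|now rewrite Nat.sub_0_r]]].
Qed.

Lemma tri_le t t' c s Q : tri t c s Q -> t <= t' -> tri t' c s Q.
Proof. intros H Ht. eapply tri_mono; eauto. Qed.

Lemma tri_then t1 t2 c1 c2 s R Q :
  tri t1 c1 s R -> (forall s1, R s1 -> fr c1 s s1 -> tri t2 c2 s1 Q) -> tri (t1 + t2) (CSeq c1 c2) s Q.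
Proof.
  intros H1 H2. apply tri_seq. eapply tri_mono; [apply le_n| |apply tri_fr, H1].
  intros s1 [A B]. auto.
Qed.

Lemma tri_wps t c s Q : wps c Q s -> csize c <= t -> tri t c s Q.
Proof. intros H Ht. eapply tri_le; [apply wps_tri, H|auto]. Qed.

Lemma tri_for_then (I : nat -> st -> Prop) N C e c s0 Q :
  I 0 s0 ->
  (forall k s, k < N -> I k s -> fr c s0 s -> ok m s e /\ truth s e /\ tri C c s (I (S k))) ->
  (forall s, I N s -> fr c s0 s -> ok m s e /\ falsity s e /\ Q s) ->
  tri (N * (C + esz e + 3) + esz e + 1) (CWh e c) s0 Q.
Proof.
  intros H0 Hb He. eapply tri_mono; [apply le_n| |apply (tri_for I N C)]; auto.
  - intros s' [A B]. now apply He.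
  - intros s A B. destruct (He s A B) as (X & Y & _). auto.
Qed.

(* Variant whose postcondition sees the exact cost, for amortised bounds. *)
Definition wpx (c : cmd) (s : st) (Q : st -> nat -> Prop) : Prop := exists s' t, exec m bits c s s' t /\ Q s' t.

Lemma wpx_seq c1 c2 s Q :
  wpx c1 s (fun s1 t1 => wpx c2 s1 (fun s2 t2 => Q s2 (t1 + t2))) -> wpx (CSeq c1 c2) s Q.
Proof. intros (s1 & t1 & H1 & s2 & t2 & H2 & H). exists s2, (t1 + t2). split; auto. econstructor; eauto. Qed.

Lemma wpx_tri t c s (R : st -> Prop) (Q : st -> nat -> Prop) :
  tri t c s R -> (forall s' t', t' <= t -> R s' -> fr c s s' -> Q s' t') -> wpx c s Q.
Proof. intros (s' & t' & H1 & H2 & H3) H. exists s', t'. split; auto. apply H; auto. eapply ex_fr; eauto. Qed.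

(** The potential left at the exit is returned, so an enclosing loop can go on spending it. *)
Lemma wpx_while (I : nat -> st -> Prop) e c s0 :
  (forall k s, I k s -> fr c s0 s -> ok m s e /\
     (truth s e -> wpx c s (fun s' t => exists k', I k' s' /\ t + esz e + 3 + k' <= k))) ->
  forall k s, I k s -> fr c s0 s ->
  wpx (CWh e c) s (fun s' t => exists k', I k' s' /\ falsity s' e /\ fr c s0 s' /\ t + k' <= k + esz e + 1).
Proof.
  intros H k. induction k as [k IH] using lt_wf_ind. intros s HI HF.
  destruct (H k s HI HF) as [Ho Hb].
  destruct (Nat.eq_dec (ev s e) 0) as [h|h].
  - exists s, (esz e + 1). split; [now apply ex_whf|].
    exists k. split; [auto|split; [now apply falsity_ev|split; [auto|lia]]].
  - destruct Hb as (s1 & t1 & E1 & k1 & I1 & K1); [now apply truth_ev|].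
    assert (HF1 : fr c s0 s1) by (eapply fr_trans; [exact HF|eapply ex_fr; eauto]).
    destruct (IH k1 ltac:(lia) s1 I1 HF1) as (s2 & t2 & E2 & k2 & I2 & F2 & HF2 & K2).
    exists s2, (esz e + 3 + t1 + t2). split; [eapply ex_wht; eauto|].
    exists k2. split; [auto|split; [auto|split; [auto|lia]]].
Qed.

Lemma tri_wpx t c s Q : wpx c s (fun s' t' => t' <= t /\ Q s') -> tri t c s Q.
Proof. intros (s' & t' & A & B & C). exists s', t'. auto. Qed.
End Triple.

(** * Exchange arguments *)

Definition sumw (l : list (nat * nat)) : nat := list_sum (map fst l).
Definition sump (l : list (nat * nat)) : nat := list_sum (map snd l).

(** Subset sums of weight and profit as a relation that does not name the subset; permuting or
    concatenating lists then needs no bookkeeping of indices. *)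
Inductive ach : list (nat * nat) -> nat -> nat -> Prop :=
| ach_nil : ach [] 0 0
| ach_skip c l a b : ach l a b -> ach (c :: l) a b
| ach_take c l a b : ach l a b -> ach (c :: l) (fst c + a) (snd c + b).

Lemma sumw_app l1 l2 : sumw (l1 ++ l2) = sumw l1 + sumw l2.
Proof. unfold sumw. now rewrite map_app, list_sum_app. Qed.
Lemma sump_app l1 l2 : sump (l1 ++ l2) = sump l1 + sump l2.
Proof. unfold sump. now rewrite map_app, list_sum_app. Qed.
Lemma sumw_cons c l : sumw (c :: l) = fst c + sumw l.
Proof. reflexivity. Qed.
Lemma sump_cons c l : sump (c :: l) = snd c + sump l.
Proof. reflexivity. Qed.

Lemma sumw_perm l l' : Permutation l l' -> sumw l = sumw l'.
Proof. induction 1; rewrite ?sumw_cons; lia. Qed.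

Lemma ach_inv c l a b : ach (c :: l) a b ->
  ach l a b \/ exists a' b', a = fst c + a' /\ b = snd c + b' /\ ach l a' b'.
Proof. inversion 1; subst; eauto 8. Qed.
Lemma ach_nil_inv a b : ach [] a b -> a = 0 /\ b = 0.
Proof. now inversion 1. Qed.

Lemma ach_perm l l' : Permutation l l' -> forall a b, ach l a b -> ach l' a b.
Proof.
  induction 1; intros a b H1; auto.
  - apply ach_inv in H1 as [H1|(a' & b' & -> & -> & H1)]; [apply ach_skip|apply ach_take]; auto.
  - apply ach_inv in H1 as [H1|(a' & b' & -> & -> & H1)];
      apply ach_inv in H1 as [H1|(a2 & b2 & -> & -> & H1)].
    + now apply ach_skip, ach_skip.
    + now apply ach_take, ach_skip.
    + now apply ach_skip, ach_take.
    + replace (fst y + (fst x + a2)) with (fst x + (fst y + a2)) by lia.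
      replace (snd y + (snd x + b2)) with (snd x + (snd y + b2)) by lia.
      now apply ach_take, ach_take.
Qed.

Lemma ach_0 l : ach l 0 0.
Proof. induction l; [apply ach_nil|now apply ach_skip]. Qed.

Lemma ach_all l : ach l (sumw l) (sump l).
Proof. induction l; [apply ach_nil|now apply ach_take]. Qed.

Lemma ach_app l1 l2 a1 b1 a2 b2 :
  ach l1 a1 b1 -> ach l2 a2 b2 -> ach (l1 ++ l2) (a1 + a2) (b1 + b2).
Proof.
  induction 1; intros H2; simpl; auto.
  - apply ach_skip; auto.
  - rewrite <- !Nat.add_assoc. apply ach_take; auto.
Qed.

Lemma ach_app_inv l1 l2 a b : ach (l1 ++ l2) a b ->
  exists a1 b1 a2 b2, ach l1 a1 b1 /\ ach l2 a2 b2 /\ a = a1 + a2 /\ b = b1 + b2.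
Proof.
  revert a b; induction l1 as [|c l1 IH]; simpl; intros a b H.
  - exists 0, 0, a, b. repeat split; auto. constructor.
  - apply ach_inv in H as [H3|(a' & b' & -> & -> & H3)].
    + destruct (IH _ _ H3) as (a1 & b1 & a2 & b2 & A & B & -> & ->).
      exists a1, b1, a2, b2. repeat split; auto. now apply ach_skip.
    + destruct (IH _ _ H3) as (a1 & b1 & a2 & b2 & A & B & -> & ->).
      exists (fst c + a1), (snd c + b1), a2, b2. repeat split; auto; try lia. now apply ach_take.
Qed.

Lemma ach_compl l a b : ach l a b ->
  exists a' b', ach l a' b' /\ a + a' = sumw l /\ b + b' = sump l.
Proof.
  induction 1.
  - exists 0, 0. repeat split. constructor.
  - destruct IHach as (a' & b' & A & B & C). exists (fst c + a'), (snd c + b').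
    rewrite sumw_cons, sump_cons. repeat split; try lia. now apply ach_take.
  - destruct IHach as (a' & b' & A & B & C). exists a', b'.
    rewrite sumw_cons, sump_cons. repeat split; try lia. now apply ach_skip.
Qed.

Lemma ach_le l a b : ach l a b -> a <= sumw l /\ b <= sump l.
Proof. intros H. destruct (ach_compl _ _ _ H) as (? & ? & ? & ? & ?). lia. Qed.

Lemma ach_repeat v p k a b :
  ach (repeat (v, p) k) a b <-> exists j, j <= k /\ a = j * v /\ b = j * p.
Proof.
  split.
  - revert a b; induction k; simpl; intros a b H.
    + apply ach_nil_inv in H as [-> ->]. exists 0; auto.
    + apply ach_inv in H as [H3|(a' & b' & -> & -> & H3)];
        destruct (IHk _ _ H3) as (j & ? & -> & ->); [exists j|exists (S j)]; simpl; auto with arith.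
  - intros (j & H & -> & ->). revert j H; induction k; simpl; intros j H.
    + replace j with 0 by lia. constructor.
    + destruct j; [apply ach_skip; apply ach_0|].
      apply (ach_take (v, p)). apply IHk. lia.
Qed.

Lemma ach_mid l1 l l2 : ach (l1 ++ l ++ l2) (sumw l) (sump l).
Proof.
  change (sumw l) with (0 + sumw l). change (sump l) with (0 + sump l).
  apply ach_app; [apply ach_0|]. rewrite <- (Nat.add_0_r (sumw l)), <- (Nat.add_0_r (sump l)).
  apply ach_app; [apply ach_all|apply ach_0].
Qed.

Lemma ach_incl_seg l i k : exists b, ach l (sumw (firstn k (skipn i l))) b.
Proof.
  eexists. pose proof (ach_mid (firstn i l) (firstn k (skipn i l)) (skipn k (skipn i l))) as H.
  rewrite !firstn_skipn in H. exact H.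
Qed.

(* Masked copies: the flag tells whether the copy is selected. *)
Definition bl := list (nat * nat * bool).
Definition base (l : bl) : list (nat * nat) := map fst l.
Definition se (l : bl) : list (nat * nat) := map fst (filter snd l).
Definition un (l : bl) : list (nat * nat) := map fst (filter (fun c => negb (snd c)) l).

Lemma se_app l1 l2 : se (l1 ++ l2) = se l1 ++ se l2.
Proof. unfold se. now rewrite filter_app, map_app. Qed.
Lemma un_app l1 l2 : un (l1 ++ l2) = un l1 ++ un l2.
Proof. unfold un. now rewrite filter_app, map_app. Qed.

Lemma sum_base l : sumw (base l) = sumw (se l) + sumw (un l) /\ sump (base l) = sump (se l) + sump (un l).
Proof.
  induction l as [|[c []] l IH]; unfold se, un, base in *; simpl; auto;
    rewrite ?sumw_cons, ?sump_cons; simpl in *; lia.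
Qed.

(** If copies are sorted by efficiency, exchanging a selected later set for an unselected earlier
    one of equal weight loses no profit, so an optimum without any such pair can be chosen. With
    positive weights, weight 0 means the empty set. *)
Definition propC (z : bl) : Prop :=
  forall l1 l2, z = l1 ++ l2 ->
  forall a b1 b2, ach (un l1) a b1 -> ach (se l2) a b2 -> a = 0.

(* Exchanging an unselected early set against a selected later set of the same
   weight strictly decreases this potential. *)
Fixpoint pot (l : bl) : nat :=
  match l with [] => 0 | c :: l' => sumw (se l) + pot l' end.

Lemma ach_mask E a b : ach E a b -> exists z, base z = E /\ sumw (se z) = a /\ sump (se z) = b.
Proof.
  induction 1.
  - exists []. auto.
  - destruct IHach as (z & A & B & C). exists ((c, false) :: z). unfold base, se in *; simpl.
    repeat split; auto; now f_equal.
  - destruct IHach as (z & A & B & C). exists ((c, true) :: z). unfold base, se in *; simpl.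
    rewrite sumw_cons, sump_cons. repeat split; auto; simpl; now f_equal.
Qed.

Lemma mask_ach z : ach (base z) (sumw (se z)) (sump (se z)).
Proof.
  induction z as [|[c []] z IH]; unfold base, se in *; simpl.
  - constructor.
  - rewrite sumw_cons, sump_cons. now apply ach_take.
  - now apply ach_skip.
Qed.

(** [pot] counts each selected weight as often as its position, starting from 1. Selecting weight a
    inside a block therefore adds at most a times the length of the block, whereas deselecting
    weight a behind the block saves at least a more than that ([flip_down], [pot_app]). *)
Lemma flip_up l : forall a b, ach (un l) a b ->
  exists l', base l' = base l /\ sumw (se l') = sumw (se l) + a /\ sump (se l') = sump (se l) + b /\
    pot l' <= pot l + a * length l.
Proof.
  induction l as [|[c []] l IH]; unfold un in *; simpl; intros a b H.
  - apply ach_nil_inv in H as [-> ->]. exists []. repeat split; auto.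
  - destruct (IH _ _ H) as (l' & A & B & C & D). exists ((c, true) :: l').
    cbn [pot length] in *; unfold se, base in *; simpl in *. rewrite ?sumw_cons, ?sump_cons in *. repeat split; try lia; try (now f_equal); nia.
  - apply ach_inv in H as [H3|(a' & b' & -> & -> & H3)].
    + destruct (IH _ _ H3) as (l' & A & B & C & D). exists ((c, false) :: l').
      cbn [pot length] in *; unfold se, base in *; simpl in *. rewrite ?sumw_cons, ?sump_cons in *. repeat split; try lia; try (now f_equal); nia.
    + destruct (IH _ _ H3) as (l' & A & B & C & D). exists ((c, true) :: l').
      cbn [pot length] in *; unfold se, base in *; simpl in *. rewrite ?sumw_cons, ?sump_cons in *. repeat split; try lia; try (now f_equal); nia.
Qed.

Lemma flip_down l : forall a b, ach (se l) a b ->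
  exists l', base l' = base l /\ sumw (se l') + a = sumw (se l) /\ sump (se l') + b = sump (se l) /\
    pot l' + a <= pot l.
Proof.
  induction l as [|[c []] l IH]; unfold se in *; simpl; intros a b H.
  - apply ach_nil_inv in H as [-> ->]. exists []. repeat split; auto.
  - apply ach_inv in H as [H3|(a' & b' & -> & -> & H3)].
    + destruct (IH _ _ H3) as (l' & A & B & C & D). exists ((c, true) :: l').
      cbn [pot length] in *; unfold se, base in *; simpl in *. rewrite ?sumw_cons, ?sump_cons in *. repeat split; try lia; try (now f_equal); nia.
    + destruct (IH _ _ H3) as (l' & A & B & C & D). exists ((c, false) :: l').
      cbn [pot length] in *; unfold se, base in *; simpl in *. rewrite ?sumw_cons, ?sump_cons in *. repeat split; try lia; try (now f_equal); nia.
  - destruct (IH _ _ H) as (l' & A & B & C & D). exists ((c, false) :: l').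
    cbn [pot length] in *; unfold se, base in *; simpl in *. repeat split; try lia; try (now f_equal); nia.
Qed.

Lemma pot_app l1 l2 : pot (l1 ++ l2) = pot l1 + pot l2 + length l1 * sumw (se l2).
Proof.
  induction l1 as [|c l1 IH]; simpl; auto.
  rewrite IH. change (c :: l1 ++ l2) with ((c :: l1) ++ l2). rewrite se_app, sumw_app. lia.
Qed.

(** The profit-to-weight ratio of [x] is at least that of [y], cross-multiplied to avoid
    fractions. *)
Definition eff (x y : nat * nat) : Prop := snd y * fst x <= snd x * fst y.

Lemma ach_eff_hi pv l a b : Forall (fun y => eff y pv) l -> ach l a b -> snd pv * a <= b * fst pv.
Proof.
  intros HF H. induction H; inversion HF; subst; auto; try lia.
  unfold eff in *. specialize (IHach H3). nia.
Qed.
Lemma ach_eff_lo pv l a b : Forall (fun y => eff pv y) l -> ach l a b -> b * fst pv <= snd pv * a.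
Proof.
  intros HF H. induction H; inversion HF; subst; auto; try lia.
  unfold eff in *. specialize (IHach H3). nia.
Qed.

Lemma Forall_un (Q : nat * nat -> Prop) l : Forall Q (base l) -> Forall Q (un l).
Proof.
  induction l as [|[c []] l IH]; unfold base, un in *; simpl; intros H; auto; inversion H; subst; auto.
Qed.
Lemma Forall_se (Q : nat * nat -> Prop) l : Forall Q (base l) -> Forall Q (se l).
Proof.
  induction l as [|[c []] l IH]; unfold base, se in *; simpl; intros H; auto; inversion H; subst; auto.
Qed.

Lemma SSorted_app {A} (R : A -> A -> Prop) l1 x l2 :
  StronglySorted R (l1 ++ x :: l2) -> Forall (fun y => R y x) l1 /\ Forall (R x) l2.
Proof.
  induction l1 as [|y l1 IH]; simpl; intros H; inversion H; subst.
  - auto.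
  - destruct (IH H2) as [X Y]. split; auto. constructor; auto.
    rewrite Forall_forall in H3. apply H3. apply in_app_iff; simpl; auto.
Qed.

(** Descent on [pot]. While [propC] fails, the exchange keeps the weight, loses no profit and lowers
    the potential; by optimality of v the result is again an optimum. *)
Theorem exists_canonical E W v : StronglySorted eff E -> Forall (fun c => 0 < fst c) E ->
  (exists a, a <= W /\ ach E a v) -> (forall a b, a <= W -> ach E a b -> b <= v) ->
  exists z, base z = E /\ sumw (se z) <= W /\ sump (se z) = v /\ propC z.
Proof.
  intros HS Hpos (a0 & Ha0 & H0) Hopt.
  destruct (ach_mask _ _ _ H0) as (z & Hz & Hw & Hp).
  assert (Hw' : sumw (se z) <= W) by lia. clear H0 Ha0 Hw a0.
  remember (pot z) as k eqn:Hk. revert z Hz Hp Hw' Hk.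
  induction k as [k IH] using lt_wf_ind. intros z Hz Hp Hw Hk.
  destruct (classic (propC z)) as [HC|HC]; [exists z; auto|].
  apply not_all_ex_not in HC as [l1 HC]. apply not_all_ex_not in HC as [l2 HC].
  apply imply_to_and in HC as [Hsplit HC].
  apply not_all_ex_not in HC as [a HC]. apply not_all_ex_not in HC as [b1 HC].
  apply not_all_ex_not in HC as [b2 HC].
  apply imply_to_and in HC as [A1 HC]. apply imply_to_and in HC as [A2 Ha].
  destruct (flip_up _ _ _ A1) as (l1' & B1 & B2 & B3 & B4).
  destruct (flip_down _ _ _ A2) as (l2' & C1 & C2 & C3 & C4).
  assert (Hlen : length l1' = length l1).
  { rewrite <- (length_map fst l1'), <- (length_map fst l1). f_equal. exact B1. }
  (* The head of [l2] separates the efficiencies: copies of [l1] are at least as efficient, copies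
     of [l2] at most, and the two exchanged sets weigh the same. *)
  assert (Hb : b2 <= b1).
  { destruct l2 as [|[pv f] l2]; [apply ach_nil_inv in A2; lia|].
    subst z. unfold base in Hz. rewrite map_app in Hz. simpl in Hz. subst E.
    destruct (SSorted_app _ _ _ _ HS) as [F1 F2].
    apply Forall_un in F1.
    assert (F2' : Forall (eff pv) (base ((pv, f) :: l2))).
    { constructor; auto. unfold eff. simpl. lia. }
    apply Forall_se in F2'.
    pose proof (ach_eff_hi pv _ _ _ F1 A1). pose proof (ach_eff_lo pv _ _ _ F2' A2).
    assert (0 < fst pv).
    { rewrite Forall_forall in Hpos. apply Hpos. apply in_app_iff; right; left; auto. }
    nia. }
  assert (Hbase : base (l1' ++ l2') = E).
  { unfold base in *. rewrite map_app, B1, C1, <- map_app. now subst. }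
  assert (HW' : sumw (se (l1' ++ l2')) <= W).
  { subst z. rewrite se_app, sumw_app in *. lia. }
  assert (Hge : v <= sump (se (l1' ++ l2'))).
  { subst z. rewrite se_app, sump_app in *. lia. }
  apply (IH (pot (l1' ++ l2'))) with (z := l1' ++ l2'); auto.
  - subst z k. rewrite !pot_app, Hlen. nia.
  - apply Nat.le_antisymm; auto. apply (Hopt _ _ HW'). rewrite <- Hbase. apply mask_ach.
Qed.

(** The distance from p down to the last prefix sum of [ys] that does not exceed it. *)
Fixpoint remq (ys : list (nat * nat)) (p : nat) : nat :=
  match ys with [] => p | y :: ys' => if p <? fst y then p else remq ys' (p - fst y) end.

Lemma remq_spec ys : forall p, exists j, p = sumw (firstn j ys) + remq ys p.
Proof.
  induction ys as [|y ys IH]; intros p; simpl.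
  - now exists 0.
  - destruct (Nat.ltb_spec p (fst y)); [now exists 0|].
    destruct (IH (p - fst y)) as (j & Hj). exists (S j). simpl. rewrite sumw_cons. lia.
Qed.
Lemma remq_lt w ys : Forall (fun c => fst c <= w) ys -> forall p, p < sumw ys -> remq ys p < w.
Proof.
  induction 1; intros p Hp.
  - unfold sumw in Hp. simpl in Hp. lia.
  - simpl. rewrite sumw_cons in Hp. destruct (Nat.ltb_spec p (fst x)); [lia|]. apply IHForall. lia.
Qed.

Lemma pigeon (f : nat -> nat) n k : k < n -> (forall i, i < n -> f i < k) ->
  exists i j, i < j /\ j < n /\ f i = f j.
Proof.
  intros Hk Hf. apply NNPP. intros HN.
  assert (HD : NoDup (map f (seq 0 n))).
  { apply NoDup_map_NoDup_ForallPairs; [|apply seq_NoDup].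
    intros i j Hi Hj Hij. apply in_seq in Hi, Hj.
    destruct (Nat.lt_trichotomy i j) as [h|[h|h]]; auto; exfalso; apply HN.
    - exists i, j. repeat split; auto; lia.
    - exists j, i. repeat split; auto; lia. }
  assert (HI : incl (map f (seq 0 n)) (seq 0 k)).
  { intros x Hx. apply in_map_iff in Hx as (i & <- & Hi). apply in_seq in Hi. apply in_seq.
    specialize (Hf i). lia. }
  pose proof (NoDup_incl_length HD HI) as Hlen. rewrite length_map, !length_seq in Hlen. lia.
Qed.

Lemma sumw_ge_length l : Forall (fun c => 0 < fst c) l -> length l <= sumw l.
Proof. induction 1; simpl; [lia|]. rewrite sumw_cons. lia. Qed.

Lemma sumw_firstn_mono l i j : i <= j ->
  sumw (firstn j l) = sumw (firstn i l) + sumw (firstn (j - i) (skipn i l)).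
Proof.
  intros H. rewrite <- sumw_app. f_equal.
  revert l j H; induction i as [|i IH]; intros l j H; simpl.
  - now rewrite Nat.sub_0_r.
  - destruct j as [|j]; [lia|]. destruct l as [|c l]; simpl.
    + now rewrite firstn_nil.
    + f_equal. apply IH. lia.
Qed.

(** Suppose the first w entries of [xs] weigh less than [ys]. Each of the w + 1 prefix sums of [xs]
    up to there lies less than w above a prefix sum of [ys], so two of them leave the same distance;
    between these, a segment of [xs] and a segment of [ys] have equal positive weight. *)
Lemma steinitz w xs ys :
  Forall (fun c => 0 < fst c <= w) xs -> Forall (fun c => 0 < fst c <= w) ys ->
  (forall a b b', ach xs a b -> ach ys a b' -> a = 0) ->
  sumw xs < sumw ys + w -> length xs <= 2 * w.
Proof.
  intros Hx Hy Hfree Hs.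
  assert (Hxp : Forall (fun c => 0 < fst c) xs) by (eapply Forall_impl; [|exact Hx]; simpl; lia).
  assert (Hyw : Forall (fun c => fst c <= w) ys) by (eapply Forall_impl; [|exact Hy]; simpl; lia).
  destruct (Nat.le_gt_cases (length xs) w) as [h|h]; [lia|].
  destruct (Nat.lt_ge_cases (sumw (firstn w xs)) (sumw ys)) as [h2|h2].
  - exfalso.
    destruct (pigeon (fun i => remq ys (sumw (firstn i xs))) (S w) w) as (i & j & Hij & Hj & Heq).
    + lia.
    + intros i Hi. apply remq_lt; auto.
      pose proof (sumw_firstn_mono xs i w ltac:(lia)). lia.
    + simpl in Heq.
      destruct (remq_spec ys (sumw (firstn i xs))) as (a & Ha).
      destruct (remq_spec ys (sumw (firstn j xs))) as (b & Hb).
      pose proof (sumw_firstn_mono xs i j ltac:(lia)) as Hd.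
      assert (Hpos : 0 < sumw (firstn (j - i) (skipn i xs))).
      { assert (HF : Forall (fun c => 0 < fst c) (firstn (j - i) (skipn i xs))).
        { apply Forall_forall. intros c Hc. rewrite Forall_forall in Hxp. apply Hxp.
          rewrite <- (firstn_skipn i xs). apply in_app_iff. right.
          rewrite <- (firstn_skipn (j - i)). apply in_app_iff. auto. }
        pose proof (sumw_ge_length _ HF) as Hl. rewrite length_firstn, length_skipn in Hl. lia. }
      destruct (Nat.le_gt_cases a b) as [hab|hab].
      * pose proof (sumw_firstn_mono ys a b hab) as He.
        destruct (ach_incl_seg xs i (j - i)) as (b1 & B1).
        destruct (ach_incl_seg ys a (b - a)) as (b2 & B2).
        replace (sumw (firstn (b - a) (skipn a ys))) with (sumw (firstn (j - i) (skipn i xs))) in B2 by lia.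
        pose proof (Hfree _ _ _ B1 B2). lia.
      * pose proof (sumw_firstn_mono ys b a ltac:(lia)) as He. lia.
  (* The first w entries already weigh as much as [ys]; the others weigh less than w together, so
     there are fewer than w of them. *)
  - assert (Hsplit : sumw xs = sumw (firstn w xs) + sumw (skipn w xs)).
    { rewrite <- sumw_app. now rewrite firstn_skipn. }
    assert (HF : Forall (fun c => 0 < fst c) (skipn w xs)).
    { apply Forall_forall. intros c Hc. rewrite Forall_forall in Hxp. apply Hxp.
      rewrite <- (firstn_skipn w xs). apply in_app_iff. auto. }
    pose proof (sumw_ge_length _ HF) as Hl. rewrite length_skipn in Hl. lia.
Qed.

(* l1 is the greedy prefix; the canonical optimum differs from it in at most
   2w copies on each side. *)
Theorem proximity w W z l1 l2 :
  Forall (fun c => 0 < fst c <= w /\ 0 < snd c) (base z) -> propC z -> z = l1 ++ l2 ->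
  sumw (se z) <= W -> (forall a b, a <= W -> ach (base z) a b -> b <= sump (se z)) ->
  sumw (base l1) <= W ->
  match l2 with [] => True | c :: _ => W < sumw (base l1) + fst (fst c) end ->
  length (un l1) <= 2 * w /\ length (se l2) <= 2 * w /\
  sumw (se l2) <= sumw (un l1) + w /\ sumw (un l1) <= sumw (se l2) + w.
Proof.
  intros HF HC Hz HW Hopt Hg1 Hg2.
  assert (Hsz : sumw (se z) = sumw (se l1) + sumw (se l2)) by (rewrite Hz, se_app, sumw_app; auto).
  pose proof (sum_base l1) as [Hb1 _]. pose proof (sum_base l2) as [Hb2 _].
  pose proof (sum_base z) as [Hbz _].
  assert (Hszu : sumw (un z) = sumw (un l1) + sumw (un l2)) by (rewrite Hz, un_app, sumw_app; auto).
  assert (HFs : Forall (fun c => 0 < fst c <= w) (base z)).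
  { eapply Forall_impl; [|exact HF]. simpl; tauto. }
  assert (HF1 : Forall (fun c => 0 < fst c <= w) (un l1)).
  { apply Forall_un. rewrite Hz in HFs. unfold base in HFs. rewrite map_app in HFs.
    now apply Forall_app in HFs as [? ?]. }
  assert (HF2 : Forall (fun c => 0 < fst c <= w) (se l2)).
  { apply Forall_se. rewrite Hz in HFs. unfold base in HFs. rewrite map_app in HFs.
    now apply Forall_app in HFs as [? ?]. }
  (* The copy behind [l1] does not fit, so W lies below the weight of [l1] plus w, whereas the
     selected copies fit into W. *)
  assert (Hup : sumw (se l2) < sumw (un l1) + w \/ se l2 = []).
  { destruct l2 as [|c l2]; [right; reflexivity|left].
    assert (fst (fst c) <= w).
    { rewrite Forall_forall in HFs. apply HFs. rewrite Hz. unfold base. rewrite map_app.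
      apply in_app_iff; right; left; auto. }
    lia. }
  (* If the removed copies outweighed the added ones by w or more, one of them could be put back,
     and its positive profit would contradict optimality. *)
  assert (Hlo : sumw (un l1) < sumw (se l2) + w \/ un l1 = []).
  { destruct (un l1) as [|y u0] eqn:Hu; [right; reflexivity|left].
    assert (Hin : In y (base z)).
    { rewrite Hz. unfold base. rewrite map_app. apply in_app_iff; left.
      assert (In y (un l1)) by (rewrite Hu; left; auto).
      unfold un in H. apply in_map_iff in H as (x & <- & Hx). apply filter_In in Hx as [Hx _].
      now apply in_map. }
    rewrite Forall_forall in HF. specialize (HF y Hin) as [Hy1 Hy2].
    apply Nat.nle_gt. intros Hle.
    assert (Hay : ach (un z) (fst y) (snd y)).
    { rewrite Hz, un_app, Hu. simpl. rewrite <- (Nat.add_0_r (fst y)), <- (Nat.add_0_r (snd y)).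
      apply ach_take, ach_0. }
    destruct (flip_up z _ _ Hay) as (z' & A & B & C & _).
    assert (Hw' : sumw (se z') <= W).
    { rewrite B, Hsz. lia. }
    pose proof (mask_ach z') as Hm. rewrite A in Hm. specialize (Hopt _ _ Hw' Hm). lia. }
  assert (Hfree : forall a b b', ach (se l2) a b -> ach (un l1) a b' -> a = 0).
  { intros a b b' H1 H2. exact (HC l1 l2 Hz a _ _ H2 H1). }
  assert (Hfree' : forall a b b', ach (un l1) a b -> ach (se l2) a b' -> a = 0).
  { intros a b b' H1 H2. exact (HC l1 l2 Hz a _ _ H1 H2). }
  repeat split.
  - destruct Hlo as [Hlo|Hlo]; [|rewrite Hlo; simpl; lia]. apply (steinitz w _ (se l2)); assumption.
  - destruct Hup as [Hup|Hup]; [|rewrite Hup; simpl; lia]. apply (steinitz w _ (un l1)); assumption.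
  - destruct Hup as [Hup|Hup]; [lia|rewrite Hup; unfold sumw; simpl; lia].
  - destruct Hlo as [Hlo|Hlo]; [lia|rewrite Hlo; unfold sumw; simpl; lia].
Qed.

(** * Capping the copies of a weight class *)

Fixpoint sm (f : nat -> nat) (n : nat) : nat :=
  match n with 0 => 0 | S k => sm f k + f k end.
Definition cnt (p : nat -> bool) (n : nat) : nat := sm (fun i => Nat.b2n (p i)) n.

Lemma sm_ext f g n : (forall i, i < n -> f i = g i) -> sm f n = sm g n.
Proof. induction n; simpl; intros H; auto. rewrite IHn, H; auto. Qed.
Lemma sm_le f g n : (forall i, i < n -> f i <= g i) -> sm f n <= sm g n.
Proof. induction n; simpl; intros H; auto. specialize (H n) as Hn. assert (sm f n <= sm g n) by auto. lia. Qed.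
Lemma sm_add f g n : sm (fun i => f i + g i) n = sm f n + sm g n.
Proof. induction n; simpl; lia. Qed.
Lemma sm_app f a b : sm f (a + b) = sm f a + sm (fun i => f (a + i)) b.
Proof. induction b; simpl; rewrite ?Nat.add_0_r, ?Nat.add_succ_r; simpl; lia. Qed.
Lemma sm_const c n : sm (fun _ => c) n = n * c.
Proof. induction n; simpl; lia. Qed.

Lemma sm_rot f v e : e < v -> sm (fun x => f ((x + e) mod v)) v = sm f v.
Proof.
  intros He. transitivity (sm (fun x => f ((x + e) mod v)) ((v - e) + e)); [f_equal; lia|].
  rewrite sm_app. replace (sm f v) with (sm f (e + (v - e))) by (f_equal; lia). rewrite sm_app.
  rewrite Nat.add_comm. f_equal; apply sm_ext; intros i Hi.
  - f_equal. replace (v - e + i + e) with (i + 1 * v) by lia.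
    rewrite Nat.Div0.mod_add. apply Nat.mod_small. lia.
  - f_equal. rewrite Nat.mod_small by lia. lia.
Qed.

Lemma cnt_filter p n : cnt p n = length (filter p (seq 0 n)).
Proof.
  unfold cnt. induction n; auto.
  rewrite seq_S, filter_app, length_app, <- IHn. simpl. destruct (p n); reflexivity.
Qed.
Lemma cnt_ge p n l : NoDup l -> (forall x, In x l -> x < n /\ p x = true) -> length l <= cnt p n.
Proof.
  intros HN H. rewrite cnt_filter. apply NoDup_incl_length; auto.
  intros x Hx. destruct (H x Hx). apply filter_In. rewrite in_seq. split; auto. lia.
Qed.
Lemma cnt_le p n : cnt p n <= n.
Proof. unfold cnt. induction n; simpl; auto. destruct (p n); simpl; lia. Qed.
Lemma cnt_mono p q n : (forall x, x < n -> p x = true -> q x = true) -> cnt p n <= cnt q n.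
Proof. intros H. apply sm_le. intros i Hi. specialize (H i Hi). destruct (p i), (q i); simpl; auto. discriminate H; auto. Qed.
Lemma cnt_mono_lt p q n y : (forall x, x < n -> p x = true -> q x = true) ->
  y < n -> p y = false -> q y = true -> cnt p n < cnt q n.
Proof.
  intros H Hy Hp Hq. induction n; [lia|]. unfold cnt in *; simpl.
  assert (Hle : cnt p n <= cnt q n) by (apply cnt_mono; auto). unfold cnt in Hle.
  destruct (Nat.eq_dec y n) as [->|].
  - rewrite Hp, Hq. simpl. lia.
  - specialize (IHn (fun x hx => H x (Nat.lt_lt_succ_r _ _ hx)) ltac:(lia)).
    specialize (H n ltac:(lia)). destruct (p n), (q n); simpl; try lia; discriminate H; auto.
Qed.

(* Kemperman-Scherk theorem in Z/v, by Dyson's e-transform. *)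
Theorem scherk v n : forall A B C : nat -> bool,
  0 < v -> cnt B v = n -> A 0 = true -> B 0 = true ->
  (forall a b, a < v -> b < v -> A a = true -> B b = true -> (a + b) mod v = 0 -> a = 0 /\ b = 0) ->
  (forall a b, a < v -> b < v -> A a = true -> B b = true -> C ((a + b) mod v) = true) ->
  cnt A v + cnt B v <= cnt C v + 1.
Proof.
  induction n as [n IH] using lt_wf_ind. intros A B C Hv Hn HA HB HZ HC.
  destruct (classic (exists e b, e < v /\ b < v /\ A e = true /\ B b = true /\ A ((e + b) mod v) = false))
    as [(e & b & He & Hb & HAe & HBb & HAeb)|HN].
  (* These are the union of A with e + B, and the part of B whose translate by e lies in A. The
     residue b leaves B, so the induction on the size of B advances, and translates of all that B
     loses are new in A. *)
  - pose (A' := fun x => A x || B ((x + (v - e)) mod v)).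
    pose (B' := fun y => B y && A ((y + e) mod v)).
    assert (Hlt : cnt B' v < cnt B v).
    { apply cnt_mono_lt with b; auto.
      - intros x _ Hx. unfold B' in Hx. now apply andb_prop in Hx.
      - unfold B'. rewrite (Nat.add_comm b e), HAeb. apply andb_false_r. }
    assert (Hsum : cnt A v + cnt B v <= cnt A' v + cnt B' v).
    { assert (H1 : cnt B v = cnt B' v + cnt (fun y => B y && negb (A ((y + e) mod v))) v).
      { unfold cnt. rewrite <- sm_add. apply sm_ext. intros i _. unfold B'.
        destruct (B i), (A ((i + e) mod v)); reflexivity. }
      assert (H2 : cnt A v + cnt (fun x => B ((x + (v - e)) mod v) && negb (A x)) v <= cnt A' v).
      { unfold cnt. rewrite <- sm_add. apply sm_le. intros i _. unfold A'.
        destruct (A i), (B ((i + (v - e)) mod v)); simpl; auto. }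
      assert (H3 : cnt (fun x => B ((x + (v - e)) mod v) && negb (A x)) v
                   = cnt (fun y => B y && negb (A ((y + e) mod v))) v).
      { unfold cnt. rewrite <- (sm_rot (fun x => Nat.b2n (B ((x + (v - e)) mod v) && negb (A x))) v e He).
        apply sm_ext. intros i Hi. do 2 f_equal. f_equal.
        rewrite Nat.Div0.add_mod_idemp_l. replace (i + e + (v - e)) with (i + 1 * v) by lia.
        rewrite Nat.Div0.mod_add. now apply Nat.mod_small. }
      lia. }
    assert (Hsh : forall a, a < v -> exists b', b' = (a + (v - e)) mod v /\ b' < v /\ (e + b') mod v = a).
    { intros a Ha. eexists. split; [reflexivity|]. split; [apply Nat.mod_upper_bound; lia|].
      rewrite Nat.Div0.add_mod_idemp_r. replace (e + (a + (v - e))) with (a + 1 * v) by lia.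
      rewrite Nat.Div0.mod_add. now apply Nat.mod_small. }
    specialize (IH (cnt B' v) ltac:(lia) A' B' C Hv eq_refl).
    assert (cnt A' v + cnt B' v <= cnt C v + 1); [|lia]. apply IH.
    + unfold A'. rewrite HA. reflexivity.
    + unfold B'. rewrite HB. simpl. rewrite Nat.mod_small; auto.
    + intros a c Ha Hc HA' HB' Hac. unfold A', B' in *.
      apply andb_prop in HB' as [HBc HAc]. apply orb_prop in HA' as [HAa|HBa]; auto.
      destruct (Hsh a Ha) as (b' & Eb & Hb' & Hab). rewrite <- Eb in HBa.
      (* Unique representation of 0 is inherited: with a = e + b', the sum a + c is also (c + e) +
         b', where c + e lies in A and b' in B. *)
      assert (Hx : (c + e) mod v = 0 /\ b' = 0).
      { apply HZ; auto.
        - apply Nat.mod_upper_bound; lia.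
        - rewrite Nat.Div0.add_mod_idemp_l. rewrite <- Hac, <- Hab, Nat.Div0.add_mod_idemp_l.
          f_equal; lia. }
      destruct Hx as [Hx ->]. destruct (HZ e c) as [-> ->]; auto.
      { rewrite Nat.add_comm; auto. }
      rewrite <- Hab. simpl. now rewrite Nat.Div0.mod_0_l.
    + intros a c Ha Hc HA' HB'. unfold A', B' in *.
      apply andb_prop in HB' as [HBc HAc]. apply orb_prop in HA' as [HAa|HBa]; auto.
      destruct (Hsh a Ha) as (b' & Eb & Hb' & Hab). rewrite <- Eb in HBa.
      replace ((a + c) mod v) with (((c + e) mod v + b') mod v).
      { apply HC; auto. apply Nat.mod_upper_bound; lia. }
      rewrite Nat.Div0.add_mod_idemp_l, <- Hab, Nat.Div0.add_mod_idemp_l. f_equal; lia.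
  - (* A is stable under translation by B, which then has to be {0}. *)
    assert (HB1 : cnt B v <= 1).
    { apply Nat.nlt_ge. intros Hlt.
      assert (exists b, 0 < b /\ b < v /\ B b = true) as (b & Hb0 & Hb & HBb).
      { apply NNPP. intros HN'. assert (cnt B v <= cnt (fun x => x =? 0) v).
        { apply cnt_mono. intros x Hx HBx. apply Nat.eqb_eq. apply NNPP. intros Hx0. apply HN'.
          exists x. repeat split; auto; lia. }
        assert (cnt (fun x => x =? 0) v = 1).
        { clear -Hv. destruct v; [lia|]. clear Hv. induction v; [reflexivity|]. unfold cnt in *. simpl in *. lia. }
        lia. }
      (* So A contains (v - 1) b, the negative of b, and its sum with b represents 0 a second
         time. *)
      assert (HA' : forall j, A ((j * b) mod v) = true).
      { induction j; [simpl; rewrite Nat.Div0.mod_0_l; auto|].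
        apply not_false_iff_true. intros Hf. apply HN. exists ((j * b) mod v), b.
        repeat split; auto; [apply Nat.mod_upper_bound; lia|].
        rewrite Nat.Div0.add_mod_idemp_l. rewrite <- Hf. do 2 f_equal. simpl. lia. }
      destruct (HZ ((v - 1) * b mod v) b); auto; try lia.
      - apply Nat.mod_upper_bound; lia.
      - rewrite Nat.Div0.add_mod_idemp_l. replace ((v - 1) * b + b) with (b * v) by nia.
        apply Nat.Div0.mod_mul. }
    assert (cnt A v <= cnt C v); [|lia].
    apply cnt_mono. intros x Hx HAx. rewrite <- (Nat.mod_small x v Hx), <- (Nat.add_0_r x). auto.
Qed.

(** * Short zero sums modulo v *)

Section ZeroSum.
Context (v : nat) (Us : list nat).

(** Residues of sums of at most j members of [Us], repetition allowed; boolean because [scherk]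
    counts boolean predicates. *)
Fixpoint rsum (j x : nat) : bool :=
  match j with
  | 0 => x =? 0
  | S j => rsum j x || existsb (fun u => rsum j ((x + (v - u mod v)) mod v)) Us
  end.

Lemma rsum_spec (Hv : 0 < v) j : forall x, x < v -> rsum j x = true ->
  exists r, incl r Us /\ length r <= j /\ list_sum r mod v = x.
Proof.
  induction j as [|j IH]; simpl; intros x Hx H.
  - apply Nat.eqb_eq in H. subst. exists []. repeat split; auto.
    + intros y [].
    + apply Nat.Div0.mod_0_l.
  - apply orb_prop in H as [H|H].
    + destruct (IH x Hx H) as (r & A & B & C). exists r. repeat split; auto.
    + apply existsb_exists in H as (u & Hu & H).
      apply IH in H as (r & A & B & C); [|apply Nat.mod_upper_bound; lia].
      exists (u :: r). simpl. repeat split; auto; try lia.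
      * intros y [<-|Hy]; auto.
      * rewrite <- Nat.Div0.add_mod_idemp_r, C, Nat.Div0.add_mod_idemp_r.
        rewrite <- Nat.Div0.add_mod_idemp_l.
        pose proof (Nat.mod_upper_bound u v ltac:(lia)).
        replace (u mod v + (x + (v - u mod v))) with (x + 1 * v) by lia.
        rewrite Nat.Div0.mod_add. now apply Nat.mod_small.
Qed.

(** As long as no short sum vanishes, 0 has only the trivial representation as a short sum plus an
    element of {0} together with [Us]. Then [scherk] makes the set of sums grow by the size of [Us]
    in every step, and after the stated number of steps it would have more than v elements. *)
Theorem short_zero_sum :
  0 < v -> 0 < length Us -> NoDup (map (fun u => u mod v) Us) -> (forall u, In u Us -> u mod v <> 0) ->
  exists r, r <> [] /\ incl r Us /\ length r <= (v - 1) / length Us + 1 /\ list_sum r mod v = 0.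
Proof.
  intros Hv HU HN H0. set (k := length Us) in *.
  apply NNPP. intros HF.
  set (B := fun x => (x =? 0) || existsb (fun u => u mod v =? x) Us).
  assert (HB : 1 + k <= cnt B v).
  { unfold k. rewrite <- (length_map (fun u => u mod v)).
    change (1 + length (map (fun u => u mod v) Us)) with (length (0 :: map (fun u => u mod v) Us)).
    apply cnt_ge.
    - constructor; auto. intros Hin. apply in_map_iff in Hin as (u & Hu & Hin). now apply (H0 u).
    - intros x [<-|Hin]; [split; [auto|reflexivity]|].
      apply in_map_iff in Hin as (u & <- & Hin). split; [apply Nat.mod_upper_bound; lia|].
      unfold B. apply orb_true_iff. right. apply existsb_exists. exists u. split; auto.
      apply Nat.eqb_refl. }
  assert (Hgrow : forall j, j <= (v - 1) / k + 1 -> 1 + j * k <= cnt (rsum j) v).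
  { induction j as [|j IH]; intros Hj.
    - change (1 + 0 * k) with (length [0]). apply cnt_ge; [repeat constructor; auto|].
      intros x [<-|[]]. split; auto.
    - specialize (IH ltac:(lia)).
      assert (cnt (rsum j) v + cnt B v <= cnt (rsum (S j)) v + 1); [|rewrite Nat.mul_succ_l; lia].
      apply scherk with (n := cnt B v); auto.
      + clear. induction j; simpl; auto. now rewrite IHj.
      + intros a b Ha Hb HA HB' Hab. unfold B in HB'. apply orb_prop in HB' as [HB'|HB'].
        * apply Nat.eqb_eq in HB'. subst b. rewrite Nat.add_0_r, Nat.mod_small in Hab; auto.
        * exfalso. apply existsb_exists in HB' as (u & Hu & HB'). apply Nat.eqb_eq in HB'.
          destruct (rsum_spec Hv j a Ha HA) as (r & R1 & R2 & R3).
          apply HF. exists (u :: r). repeat split; auto.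
          -- discriminate.
          -- intros y [<-|Hy]; auto.
          -- simpl. lia.
          -- simpl. rewrite Nat.Div0.add_mod, R3, HB', Nat.add_comm. exact Hab.
      + intros a b Ha Hb HA HB'. unfold B in HB'. simpl. apply orb_true_iff.
        apply orb_prop in HB' as [HB'|HB'].
        * left. apply Nat.eqb_eq in HB'. subst b. rewrite Nat.add_0_r, Nat.mod_small; auto.
        * right. apply existsb_exists in HB' as (u & Hu & HB'). apply Nat.eqb_eq in HB'.
          apply existsb_exists. exists u. split; auto. rewrite HB'.
          rewrite Nat.Div0.add_mod_idemp_l. replace (a + b + (v - b)) with (a + 1 * v) by lia.
          rewrite Nat.Div0.mod_add, Nat.mod_small; auto. }
  specialize (Hgrow _ (le_n _)). pose proof (cnt_le (rsum ((v - 1) / k + 1)) v).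
  pose proof (Nat.div_mod (v - 1) k ltac:(lia)). pose proof (Nat.mod_upper_bound (v - 1) k ltac:(lia)).
  nia.
Qed.
End ZeroSum.

Definition copies (v : nat) (l : list (nat * nat)) : nat :=
  length (filter (fun c => fst c =? v) l).

Lemma copies_app v l1 l2 : copies v (l1 ++ l2) = copies v l1 + copies v l2.
Proof. unfold copies. now rewrite filter_app, length_app. Qed.
Lemma copies_cons v c l : copies v (c :: l) = (if fst c =? v then 1 else 0) + copies v l.
Proof. unfold copies. simpl. destruct (fst c =? v); reflexivity. Qed.

Lemma copies_base v l : copies v (base l) = copies v (se l) + copies v (un l).
Proof.
  induction l as [|[c []] l IH]; unfold base, se, un in *; simpl; auto;
    rewrite ?copies_cons, IH; lia.
Qed.

Lemma copies_split v l : 0 < copies v l -> exists l1 p l2, l = l1 ++ (v, p) :: l2.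
Proof.
  induction l as [|[x p] l IH]; [unfold copies; simpl; lia|].
  rewrite copies_cons. simpl. destruct (Nat.eqb_spec x v) as [->|Hne].
  - intros _. exists [], p, l. reflexivity.
  - intros H. destruct (IH H) as (l1 & p' & l2 & ->). exists ((x, p) :: l1), p', l2. reflexivity.
Qed.

(** Copies of equal weight are interchangeable as long as the profit is left open, so comparing
    multiplicities is enough. *)
Lemma ach_counts r : forall l, (forall u, In u r -> count_occ Nat.eq_dec r u <= copies u l) ->
  exists b, ach l (list_sum r) b.
Proof.
  induction r as [|u r IH]; intros l H.
  - exists 0. apply ach_0.
  - pose proof (H u (or_introl eq_refl)) as Hu. simpl in Hu.
    destruct (Nat.eq_dec u u) as [_|]; [|contradiction].
    destruct (copies_split u l) as (l1 & p & l2 & ->); [lia|].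
    destruct (IH (l1 ++ l2)) as (b & Hb).
    + intros x Hx. specialize (H x (or_intror Hx)). simpl in H.
      rewrite copies_app, copies_cons in H. rewrite copies_app. simpl in H.
      destruct (Nat.eq_dec u x) as [->|Hne].
      * rewrite Nat.eqb_refl in H. lia.
      * apply Nat.eqb_neq in Hne. rewrite Hne in H. lia.
    + exists (p + b). apply ach_perm with ((u, p) :: l1 ++ l2); [apply Permutation_middle|].
      now apply (ach_take (u, p)).
Qed.

Lemma ach_mult v l q : q <= copies v l -> exists b, ach l (q * v) b.
Proof.
  intros H. destruct (ach_counts (repeat v q) l) as (b & Hb).
  - intros u Hu. apply repeat_spec in Hu. subst. now rewrite count_occ_repeat_eq.
  - exists b. replace (q * v) with (list_sum (repeat v q)); auto.
    clear. induction q; simpl; auto.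
Qed.

(** An earlier unselected copy of the same weight could be exchanged for the selected one. Every
    weight class is thus used from the front. *)
Lemma propC_prefix l1 c l2 : propC (l1 ++ (c, true) :: l2) -> 0 < fst c -> copies (fst c) (un l1) = 0.
Proof.
  intros HC Hc. apply Nat.le_0_r, Nat.nlt_ge. intros H.
  destruct (ach_mult (fst c) (un l1) 1) as (b & Hb); [lia|].
  assert (fst c = 0); [|lia]. rewrite Nat.mul_1_l in Hb.
  eapply (HC _ _ eq_refl); [exact Hb|].
  unfold se; simpl. rewrite <- (Nat.add_0_r (fst c)). apply ach_take, ach_0.
Qed.

Lemma sum_copies_le Us l : NoDup Us -> list_sum (map (fun u => copies u l) Us) <= length l.
Proof.
  intros HN. induction l as [|c l IH].
  - clear. induction Us; simpl; auto.
  - simpl. assert (Hle : list_sum (map (fun u => copies u (c :: l)) Us)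
      <= list_sum (map (fun u => copies u l) Us) + (if in_dec Nat.eq_dec (fst c) Us then 1 else 0)).
    { clear IH. induction Us as [|u Us IH]; simpl; [lia|]. inversion HN; subst.
      specialize (IH H2). rewrite copies_cons.
      destruct (in_dec Nat.eq_dec (fst c) Us) as [hi|hi]; destruct (Nat.eqb_spec (fst c) u) as [He|Hne];
        destruct (Nat.eq_dec u (fst c)); try congruence; lia. }
    destruct (in_dec _ _ _); lia.
Qed.

Lemma list_sum_lower (f : nat -> nat) h l : (forall u, In u l -> h <= f u) ->
  length l * h <= list_sum (map f l).
Proof.
  induction l; simpl; intros H; auto. pose proof (H a (or_introl eq_refl)).
  assert (length l * h <= list_sum (map f l)) by auto. lia.
Qed.

Lemma list_sum_upper B r : (forall u, In u r -> u < B) -> r <> [] -> list_sum r < length r * B.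
Proof.
  induction r as [|u r IH]; simpl; intros H Hr; [congruence|].
  pose proof (H u (or_introl eq_refl)). destruct r as [|u' r]; [simpl; lia|].
  specialize (IH (fun x hx => H x (or_intror hx)) ltac:(discriminate)). lia.
Qed.

Lemma log2_bounds u v : 0 < u -> 0 < v -> Nat.log2 u = Nat.log2 v -> u < 2 * v.
Proof.
  intros Hu Hv E. pose proof (Nat.log2_spec u Hu) as [A B]. pose proof (Nat.log2_spec v Hv) as [C D].
  rewrite E in *. simpl in *. lia.
Qed.

Lemma filter_split_length {A} (p : A -> bool) l :
  length l = length (filter p l) + length (filter (fun x => negb (p x)) l).
Proof. induction l as [|a l IH]; simpl; auto. destruct (p a); simpl; lia. Qed.

(* If more than 16w/h classes of comparable weight have h copies before the
   h-th copy of v is passed, then v is used at most 2h times: otherwise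
   few unused copies of these classes sum to a multiple of v. *)
Theorem class_cap w z l1 l2 v h Us :
  propC z -> z = l1 ++ l2 -> length (se z) <= 2 * w ->
  0 < v <= w -> 0 < h -> copies v (base l1) = h -> NoDup Us ->
  (forall u, In u Us -> 0 < u /\ Nat.log2 u = Nat.log2 v /\ h <= copies u (base l1)) ->
  16 * w < length Us * h ->
  copies v (se z) <= 2 * h.
Proof.
  intros HC Hz Hlen Hv Hh Hcv HN HU Hbad.
  apply Nat.nlt_ge. intros Hbig.
  assert (Hcz : forall u, copies u (se z) = copies u (se l1) + copies u (se l2)).
  { intros u. now rewrite Hz, se_app, copies_app. }
  assert (Hl2 : h + 1 <= copies v (se l2)).
  { pose proof (copies_base v l1). pose proof (Hcz v). lia. }
  assert (Hhw : 2 * h + 1 <= 2 * w).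
  { pose proof (sum_copies_le [v] (se z) ltac:(repeat constructor; auto)) as H. simpl in H. lia. }
  set (heavy := fun u => h <=? 2 * copies u (se z)).
  set (good := fun u => negb (heavy u) && negb (u =? v)).
  set (Vs := filter good Us).
  assert (Hheavy : length (filter heavy Us) * h <= 4 * w).
  { pose proof (sum_copies_le (filter heavy Us) (se z) (NoDup_filter _ HN)) as H1.
    pose proof (list_sum_lower (fun u => 2 * copies u (se z)) h (filter heavy Us)) as H2.
    assert (H3 : list_sum (map (fun u => 2 * copies u (se z)) (filter heavy Us))
                 = 2 * list_sum (map (fun u => copies u (se z)) (filter heavy Us))).
    { generalize (filter heavy Us). intros l. induction l; simpl in *; lia. }
    assert (length (filter heavy Us) * h <= list_sum (map (fun u => 2 * copies u (se z)) (filter heavy Us))).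
    { apply H2. intros u Hu. apply filter_In in Hu as [_ Hu]. now apply Nat.leb_le in Hu. }
    lia. }
  assert (HVlen : length Us <= length Vs + length (filter heavy Us) + 1).
  { rewrite (filter_split_length heavy Us).
    rewrite (filter_split_length (fun u => u =? v) (filter (fun x => negb (heavy x)) Us)).
    assert (length (filter (fun u => u =? v) (filter (fun x => negb (heavy x)) Us)) <= 1).
    { change 1 with (length [v]). apply NoDup_incl_length.
      - now apply NoDup_filter, NoDup_filter.
      - intros x Hx. apply filter_In in Hx as [_ Hx]. apply Nat.eqb_eq in Hx. subst; left; auto. }
    assert (filter (fun x => negb (x =? v)) (filter (fun x => negb (heavy x)) Us) = Vs).
    { unfold Vs, good. clear. induction Us as [|u l IH]; simpl; auto.
      destruct (negb (heavy u)); simpl; [destruct (negb (u =? v)); simpl; now rewrite IH|auto]. }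
    rewrite H0. lia. }
  assert (HVU : forall u, In u Vs -> In u Us /\ 2 * copies u (se z) < h /\ u <> v).
  { intros u Hu. apply filter_In in Hu as [Hin Hg]. unfold good, heavy in Hg.
    apply andb_prop in Hg as [G1 G2]. apply negb_true_iff in G1, G2.
    apply Nat.leb_gt in G1. apply Nat.eqb_neq in G2. auto. }
  (* Out of 16w, the heavy classes take at most 4w and the class of v itself takes h < w. *)
  assert (Hk : 11 * w < length Vs * h) by nia.
  assert (Hk0 : 0 < length Vs) by (destruct (length Vs); simpl in *; lia).
  (* Weights with the same binary logarithm differ by less than a factor 2. Hence reduction modulo v
     subtracts v at most once, never gives 0 for u other than v, and keeps these weights
     distinct. *)
  assert (Hmod : forall u, In u Vs -> u mod v = (if u <? v then u else u - v) /\ 0 < u mod v).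
  { intros u Hu. destruct (HVU u Hu) as (Hin & _ & Hne). destruct (HU u Hin) as (Hu0 & Hlog & _).
    pose proof (log2_bounds u v Hu0 ltac:(lia) Hlog).
    destruct (Nat.ltb_spec u v).
    - rewrite Nat.mod_small; auto.
    - replace u with (u - v + 1 * v) at 1 3 by lia. rewrite Nat.Div0.mod_add, Nat.mod_small; lia. }
  destruct (short_zero_sum v Vs) as (r & Hr0 & Hr1 & Hr2 & Hr3); auto; try lia.
  { apply NoDup_map_NoDup_ForallPairs; [|now apply NoDup_filter].
    intros a b Ha Hb Hab. rewrite (proj1 (Hmod a Ha)), (proj1 (Hmod b Hb)) in Hab.
    destruct (HVU a Ha) as (Ia & _ & Na). destruct (HU a Ia) as (Pa & La & _).
    destruct (HVU b Hb) as (Ib & _ & Nb). destruct (HU b Ib) as (Pb & Lb & _).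
    pose proof (log2_bounds a b Pa Pb ltac:(congruence)).
    pose proof (log2_bounds b a Pb Pa ltac:(congruence)).
    pose proof (log2_bounds a v Pa ltac:(lia) La). pose proof (log2_bounds b v Pb ltac:(lia) Lb).
    destruct (Nat.ltb_spec a v), (Nat.ltb_spec b v); lia. }
  { intros u Hu. pose proof (Hmod u Hu). lia. }
  set (x := (v - 1) / length Vs) in *.
  assert (Hx : 11 * x < h).
  { pose proof (Nat.Div0.mul_div_le (v - 1) (length Vs)). fold x in H. nia. }
  assert (HA : exists b, ach (un l1) (list_sum r) b).
  { apply ach_counts. intros u Hu.
    pose proof (count_occ_bound Nat.eq_dec u r).
    destruct (HVU u (Hr1 u Hu)) as (Hin & Hlight & _). destruct (HU u Hin) as (_ & _ & Hc).
    pose proof (copies_base u l1). pose proof (Hcz u). lia. }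
  destruct HA as (b1 & HA).
  apply Nat.Div0.div_exact in Hr3. set (q := list_sum r / v) in *.
  (* [r] has at most x + 1 members, all below 2v, so its sum is q v with q <= 2x + 1. As 11x < h,
     the h + 1 selected copies of v in [l2] suffice for the exchange. *)
  assert (Hsum : list_sum r < length r * (2 * v)).
  { apply list_sum_upper; auto. intros u Hu. destruct (HVU u (Hr1 u Hu)) as (Hin & _).
    destruct (HU u Hin) as (Hu0 & Hlog & _). apply log2_bounds; auto; lia. }
  assert (Hq : q < 2 * length r) by nia.
  destruct (ach_mult v (se l2) q) as (b2 & HB); [lia|].
  rewrite Hr3 in HA. rewrite (Nat.mul_comm v q) in HA.
  pose proof (HC _ _ Hz _ _ _ HA HB) as H0.
  destruct r as [|u r]; [congruence|].
  destruct (HVU u (Hr1 u (or_introl eq_refl))) as (Hin & _). destruct (HU u Hin) as (Hu0 & _).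
  simpl in Hr3. lia.
Qed.

Lemma sm_upd f f' n y : y < n -> (forall i, i <> y -> f' i = f i) -> sm f' n + f y = sm f n + f' y.
Proof.
  intros Hy H. induction n; [lia|]. simpl. destruct (Nat.eq_dec y n) as [->|].
  - rewrite (sm_ext f' f) by (intros; apply H; lia). lia.
  - rewrite (H n) by lia. specialize (IHn ltac:(lia)). lia.
Qed.

Lemma sm_exchange (f : nat -> nat -> nat) a b :
  sm (fun i => sm (fun j => f i j) b) a = sm (fun j => sm (fun i => f i j) a) b.
Proof.
  induction a; simpl.
  - rewrite sm_const. lia.
  - rewrite IHa, <- sm_add. reflexivity.
Qed.

Lemma sm_mono_n f a b : a <= b -> sm f a <= sm f b.
Proof. intros H. replace b with (a + (b - a)) by lia. rewrite sm_app. lia. Qed.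

Lemma sm_double f n : sm (fun i => f (i / 2)) (2 * n) = 2 * sm f n.
Proof.
  induction n; [reflexivity|]. replace (2 * S n) with (S (S (2 * n))) by lia.
  cbn [sm]. rewrite IHn.
  replace (2 * n / 2) with n by (rewrite Nat.mul_comm; symmetry; apply Nat.div_mul; lia).
  replace (S (2 * n) / 2) with n by (apply (Nat.div_unique _ _ _ 1); lia). lia.
Qed.

(** Dyadic blocks: the terms whose denominator lies between 2^k and 2^(k+1) - 1 contribute at most c
    together. *)
Lemma harmonic c n : 0 < n -> sm (fun i => c / S i) n <= c * (Nat.log2 n + 1).
Proof.
  intros Hn.
  assert (H : forall k, sm (fun i => c / S i) (2 ^ k - 1) <= c * k).
  { induction k as [|k IHk]; [simpl; lia|]. cbn [Nat.pow].
    assert (H2 : 1 <= 2 ^ k) by (clear; induction k; cbn [Nat.pow]; lia).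
    replace (2 * 2 ^ k - 1) with ((2 ^ k - 1) + 2 ^ k) by lia.
    rewrite sm_app.
    assert (sm (fun i => c / S (2 ^ k - 1 + i)) (2 ^ k) <= 2 ^ k * (c / 2 ^ k)).
    { rewrite <- sm_const. apply sm_le. intros i _. apply Nat.div_le_compat_l. lia. }
    pose proof (Nat.Div0.mul_div_le c (2 ^ k)). lia. }
  pose proof (Nat.log2_spec n Hn) as [_ Hl].
  etransitivity; [|apply (H (Nat.log2 n + 1))]. apply sm_mono_n.
  rewrite Nat.add_1_r. lia.
Qed.

(** * Scanning the copies with adaptive caps *)

Section Scan.
Context (w : nat) (z : bl).
Context (HC : propC z) (Hlen : length (se z) <= 2 * w)
  (Hwt : Forall (fun c => 0 < fst c <= w) (base z)).

Definition ing (g u : nat) : bool := (1 <=? u) && (Nat.log2 u =? g).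

(** A certificate for the cap 2h of v: the prefix [l1] read when the cap was set, and the classes
    [Us], satisfy the hypotheses of [class_cap]. *)
Definition capped (L : bl) (v c : nat) : Prop :=
  exists h l1 l2 Us, c = 2 * h /\ L = l1 ++ l2 /\ 0 < h /\ copies v (base l1) = h /\ NoDup Us /\
    (forall u, In u Us -> 0 < u /\ Nat.log2 u = Nat.log2 v /\ h <= copies u (base l1)) /\
    16 * w < length Us * h.

(** [L] is the part read, [em] the copies kept; [cn] and [cp] are the number kept and the cap of
    each weight, and [rch g h] counts the classes of group g with at least h kept copies. [si_sel]
    says that no selected copy was dropped, and [si_good] is what bounds the number of kept
    copies. *)
Record scanInv (L em : bl) (cn cp : nat -> nat) (rch : nat -> nat -> nat) : Prop := {
  si_sel : filter snd em = filter snd L;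
  si_sub : forall a b, ach (base em) a b -> ach (base L) a b;
  si_cn : forall v, 0 < v <= w -> cn v = Nat.min (copies v (base L)) (cp v);
  si_cp : forall v, 0 < v <= w -> cp v = 2 * w \/ capped L v (cp v);
  si_cp2 : forall v, 0 < v <= w -> cp v <= 2 * w;
  si_rch : forall g h, g <= Nat.log2 w -> 0 < h <= 2 * w ->
     rch g h = cnt (fun u => ing g u && (h <=? cn u)) (S w);
  si_good : forall g h, 0 < h ->
     cnt (fun u => ing g u && (h <=? cn u) && (2 * h <? cp u)) (S w) * h <= 16 * w;
  si_len : length em = sm (fun i => cn (S i)) w }.

Lemma scan_init cn cp rch :
  (forall v, v <= w -> cn v = 0) -> (forall v, v <= w -> cp v = 2 * w) ->
  (forall g h, g <= Nat.log2 w -> h <= 2 * w -> rch g h = 0) -> scanInv [] [] cn cp rch.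
Proof.
  intros H1 H2 H3. split; auto.
  - intros v Hv. rewrite H1 by lia. reflexivity.
  - intros v Hv. left. apply H2. lia.
  - intros v Hv. rewrite H2 by lia. lia.
  - intros g h Hg Hh. rewrite H3 by lia. symmetry. unfold cnt.
    rewrite (sm_ext _ (fun _ => 0)); [rewrite sm_const; lia|].
    intros i Hi. rewrite H1 by lia. destruct (ing g i), h; simpl; auto; lia.
  - intros g h Hh. unfold cnt. rewrite (sm_ext _ (fun _ => 0)); [rewrite sm_const; lia|].
    intros i Hi. rewrite H1 by lia. destruct (ing g i), h; simpl; auto; lia.
  - rewrite (sm_ext _ (fun _ => 0)); [simpl; rewrite sm_const; lia|]. intros i Hi. apply H1. lia.
Qed.

Lemma base_app l1 l2 : base (l1 ++ l2) = base l1 ++ base l2.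
Proof. apply map_app. Qed.

Lemma capped_mono L l v c : capped L v c -> capped (L ++ l) v c.
Proof.
  intros (h & l1 & l2 & Us & H1 & -> & H2). exists h, l1, (l2 ++ l), Us.
  split; auto. split; [symmetry; apply app_assoc|auto].
Qed.

Lemma ach_weaken l1 l2 a b : ach l1 a b -> ach (l1 ++ l2) a b.
Proof.
  intros H. rewrite <- (Nat.add_0_r a), <- (Nat.add_0_r b). apply ach_app; auto. apply ach_0.
Qed.

(** A skipped copy is unselected. Otherwise all earlier copies of its weight would be selected by
    [propC_prefix], hence more than the cap, against the bound 2w on all selected copies or against
    [class_cap]. *)
Lemma scan_skip L em cn cp rch c rest :
  z = L ++ c :: rest -> scanInv L em cn cp rch -> cp (fst (fst c)) <= cn (fst (fst c)) ->
  scanInv (L ++ [c]) em cn cp rch.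
Proof.
  intros Hz HI Hfull. destruct c as [[v p] f]. simpl in Hfull.
  assert (Hv : 0 < v <= w).
  { rewrite Forall_forall in Hwt. apply (Hwt (v, p)). rewrite Hz, base_app.
    apply in_app_iff; right; left; reflexivity. }
  assert (Hcop : cp v <= copies v (base L)).
  { rewrite (si_cn _ _ _ _ _ HI v Hv) in Hfull. lia. }
  assert (Hf : f = false).
  { destruct f; auto. exfalso.
    rewrite Hz in HC. pose proof (propC_prefix _ _ _ HC ltac:(simpl; lia)) as H0. simpl in H0.
    rewrite <- Hz in HC. pose proof (copies_base v L) as HB.
    assert (Hcz : cp v + 1 <= copies v (se z)).
    { rewrite Hz, se_app, copies_app. unfold se at 2. simpl. rewrite copies_cons. simpl.
      rewrite Nat.eqb_refl. lia. }
    destruct (si_cp _ _ _ _ _ HI v Hv) as [E|(h & l1 & l2 & Us & E & HL & H1 & H2 & H3 & H4 & H5)].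
    - pose proof (sum_copies_le [v] (se z) ltac:(repeat constructor; auto)) as H. simpl in H. lia.
    - assert (copies v (se z) <= 2 * h); [|lia].
      apply (class_cap w z l1 (l2 ++ (v, p, true) :: rest) v h Us); auto.
      rewrite Hz, HL, <- app_assoc. reflexivity. }
  subst f. destruct HI. split; auto.
  - rewrite filter_app. simpl. now rewrite app_nil_r.
  - intros a b H. rewrite base_app. apply ach_weaken. auto.
  - intros u Hu. rewrite (si_cn0 u Hu).
    assert (HcL : copies u (base (L ++ [(v, p, false)])) = copies u (base L) + (if v =? u then 1 else 0)).
    { rewrite base_app, copies_app. unfold base at 2; simpl. rewrite copies_cons.
      simpl. destruct (v =? u); unfold copies at 2; simpl; lia. }
    rewrite HcL. destruct (Nat.eqb_spec v u) as [->|]; lia.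
  - intros u Hu. destruct (si_cp0 u Hu); [auto|right; now apply capped_mono].
Qed.

Lemma scan_skip_many l : forall L em cn cp rch rest v,
  z = L ++ l ++ rest -> Forall (fun c => fst c = v) (base l) -> cp v <= cn v ->
  scanInv L em cn cp rch -> scanInv (L ++ l) em cn cp rch.
Proof.
  induction l as [|c l IH]; intros L em cn cp rch rest v Hz HF Hfull HI.
  - now rewrite app_nil_r.
  - inversion HF as [|? ? Hx HF']. subst v. change (c :: l) with ([c] ++ l). rewrite app_assoc.
    apply IH with (rest := rest) (v := fst (fst c)); auto.
    + rewrite <- app_assoc. exact Hz.
    + eapply scan_skip; eauto.
Qed.

Lemma cnt_ext p q n : (forall i, i < n -> p i = q i) -> cnt p n = cnt q n.
Proof. intros H. apply sm_ext. intros i Hi. now rewrite H. Qed.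

(** Raising the count of v to h changes only the entry (log2 v, h) of [rch]. If that entry exceeds
    16w/h, a cap of at most 2h excludes v from the count in [si_good], which therefore does not
    grow. *)
Lemma scan_emit L em cn cp rch c rest cn' cp' rch' :
  z = L ++ c :: rest -> scanInv L em cn cp rch ->
  let v := fst (fst c) in let g := Nat.log2 v in
  cn v < cp v ->
  let h := cn v + 1 in
  cn' v = h -> (forall u, u <> v -> cn' u = cn u) ->
  rch' g h = rch g h + 1 ->
  (forall g' h', g' <= Nat.log2 w -> 0 < h' <= 2 * w -> (g', h') <> (g, h) -> rch' g' h' = rch g' h') ->
  (forall u, u <> v -> cp' u = cp u) ->
  (16 * w < rch' g h * h -> 2 * h < cp v -> cp' v = 2 * h) ->
  (rch' g h * h <= 16 * w \/ cp v <= 2 * h -> cp' v = cp v) ->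
  scanInv (L ++ [c]) (em ++ [c]) cn' cp' rch'.
Proof.
  intros Hz HI v g Hlt h Hcv Hcu Hrg Hru Hpu Hp1 Hp2.
  assert (Hv : 0 < v <= w).
  { rewrite Forall_forall in Hwt. apply (Hwt (fst c)). rewrite Hz, base_app.
    apply in_app_iff; right; left; reflexivity. }
  destruct HI.
  assert (Hcop : cn v = copies v (base L)) by (pose proof (si_cn0 v Hv); lia).
  assert (HcL : forall u, copies u (base (L ++ [c])) = copies u (base L) + (if v =? u then 1 else 0)).
  { intros u. rewrite base_app, copies_app. unfold base at 2; simpl. rewrite copies_cons.
    fold v. destruct (v =? u); unfold copies at 2; simpl; lia. }
  assert (Hh2w : h <= 2 * w) by (pose proof (si_cp3 v Hv); unfold h; lia).
  assert (Hgw : g <= Nat.log2 w) by (apply Nat.log2_le_mono; lia).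
  assert (Hgu : ing g v = true).
  { unfold ing. apply andb_true_iff. split; [apply Nat.leb_le; lia|apply Nat.eqb_refl]. }
  assert (Hcp'le : cp' v <= cp v).
  { destruct (Nat.le_gt_cases (rch' g h * h) (16 * w)); [rewrite Hp2; auto|].
    destruct (Nat.le_gt_cases (cp v) (2 * h)); [rewrite Hp2; auto|]. rewrite Hp1 by auto. lia. }
  assert (Hrch' : forall g' h', g' <= Nat.log2 w -> 0 < h' <= 2 * w ->
    rch' g' h' = cnt (fun u => ing g' u && (h' <=? cn' u)) (S w)).
  { intros g' h' Hg' Hh'.
    assert (HU := sm_upd (fun u => Nat.b2n (ing g' u && (h' <=? cn u)))
      (fun u => Nat.b2n (ing g' u && (h' <=? cn' u))) (S w) v ltac:(lia)
      ltac:(intros i Hi; cbv beta; rewrite Hcu; auto)).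
    cbv beta in HU. rewrite Hcv in HU. remember (S w) as sw eqn:Esw. pose proof (si_rch0 g' h' Hg' Hh') as HR.
    unfold cnt in *. rewrite <- HR in HU.
    destruct (Nat.eq_dec g' g) as [->|Hne].
    - rewrite Hgu in HU. cbn [andb Nat.b2n] in HU. destruct (Nat.eq_dec h' h) as [->|Hneh].
      + rewrite Nat.leb_refl in HU. replace (h <=? cn v) with false in HU by (symmetry; apply Nat.leb_gt; unfold h; lia).
        cbn [andb Nat.b2n] in HU. rewrite Hrg. lia.
      + replace (h' <=? h) with (h' <=? cn v) in HU.
        2:{ destruct (Nat.leb_spec h' (cn v)), (Nat.leb_spec h' h); auto; unfold h in *; lia. }
        rewrite Hru; auto; [lia|congruence].
    - replace (ing g' v) with false in HU.
      2:{ symmetry. apply andb_false_iff. right. apply Nat.eqb_neq. fold g. lia. }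
      cbn [andb Nat.b2n] in HU. rewrite Hru; auto; [lia|congruence]. }
  split.
  - rewrite !filter_app. now rewrite si_sel0.
  - intros a b H. rewrite base_app in H |- *. apply ach_app_inv in H as (a1 & b1 & a2 & b2 & H1 & H2 & -> & ->).
    apply ach_app; auto.
  - intros u Hu. rewrite HcL. destruct (Nat.eqb_spec v u) as [<-|Hne].
    + rewrite Hcv. destruct (Nat.le_gt_cases (rch' g h * h) (16 * w)).
      * rewrite Hp2 by auto. unfold h. lia.
      * destruct (Nat.le_gt_cases (cp v) (2 * h)); [rewrite Hp2 by auto; unfold h; lia|].
        rewrite Hp1 by auto. unfold h; lia.
    + rewrite Hcu, Hpu by auto. rewrite si_cn0 by auto. lia.
  - intros u Hu. destruct (Nat.eq_dec u v) as [->|Hne].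
    + destruct (Nat.le_gt_cases (rch' g h * h) (16 * w)).
      * rewrite Hp2 by auto. destruct (si_cp0 v Hv); [auto|right; now apply capped_mono].
      * destruct (Nat.le_gt_cases (cp v) (2 * h)).
        -- rewrite Hp2 by auto. destruct (si_cp0 v Hv); [auto|right; now apply capped_mono].
        -- right. rewrite Hp1 by auto.
           (* The certificate of the new cap: the prefix just read, and the classes of the group
              that have reached h. *)
           exists h, (L ++ [c]), [], (filter (fun u => ing g u && (h <=? cn' u)) (seq 0 (S w))).
           split; [reflexivity|]. split; [now rewrite app_nil_r|]. split; [unfold h; lia|].
           split; [rewrite HcL, Nat.eqb_refl; unfold h; lia|].
           split; [apply NoDup_filter, seq_NoDup|]. split.
           ++ intros u Hin. apply filter_In in Hin as [Hin Hg']. apply in_seq in Hin.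
              apply andb_prop in Hg' as [G1 G2]. unfold ing in G1. apply andb_prop in G1 as [G0 G1].
              apply Nat.leb_le in G0, G2. apply Nat.eqb_eq in G1. split; [lia|]. split; [exact G1|].
              rewrite HcL. destruct (Nat.eqb_spec v u) as [<-|Hne].
              ** rewrite Hcv in G2. unfold h in *. lia.
              ** rewrite Hcu in G2 by auto. rewrite si_cn0 in G2 by lia. lia.
           ++ rewrite <- cnt_filter, <- Hrch' by (auto; unfold h; lia). auto.
    + rewrite Hpu by auto. destruct (si_cp0 u Hu); [auto|right; now apply capped_mono].
  - intros u Hu. destruct (Nat.eq_dec u v) as [->|Hne]; [|rewrite Hpu by auto; auto].
    pose proof (si_cp3 v Hv). lia.
  - exact Hrch'.
  - intros g' h' Hh'.
    destruct (Nat.eq_dec h' h) as [->|Hneh]; [destruct (Nat.eq_dec g' g) as [->|Hneg]|].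
    + destruct (Nat.le_gt_cases (rch' g h * h) (16 * w)) as [Hle|Hgt].
      * etransitivity; [|exact Hle]. apply Nat.mul_le_mono_r.
        rewrite Hrch' by (auto; lia). apply cnt_mono. intros x _ Hx. now apply andb_prop in Hx.
      * assert (Hcp : cp' v <= 2 * h).
        { destruct (Nat.le_gt_cases (cp v) (2 * h)); [lia|]. rewrite Hp1 by auto. lia. }
        etransitivity; [|apply (si_good0 g h Hh')]. apply Nat.mul_le_mono_r, cnt_mono.
        intros x _ Hx. apply andb_prop in Hx as [Hx1 Hx2]. apply andb_prop in Hx1 as [Hx0 Hx1].
        apply Nat.ltb_lt in Hx2. destruct (Nat.eq_dec x v) as [->|Hne]; [lia|].
        rewrite Hcu in Hx1 by auto. rewrite Hpu in Hx2 by auto.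
        rewrite Hx0, Hx1. simpl. now apply Nat.ltb_lt.
    + etransitivity; [|apply (si_good0 g' h Hh')]. apply Nat.mul_le_mono_r, cnt_mono.
      intros x _ Hx. apply andb_prop in Hx as [Hx1 Hx2]. apply andb_prop in Hx1 as [Hx0 Hx1].
      destruct (Nat.eq_dec x v) as [->|Hne].
      * unfold ing in Hx0. apply andb_prop in Hx0 as [_ Hx0]. apply Nat.eqb_eq in Hx0. fold g in Hx0. lia.
      * rewrite Hcu in Hx1 by auto. rewrite Hpu in Hx2 by auto. now rewrite Hx0, Hx1.
    + etransitivity; [|apply (si_good0 g' h' Hh')]. apply Nat.mul_le_mono_r, cnt_mono.
      intros x _ Hx. apply andb_prop in Hx as [Hx1 Hx2]. apply andb_prop in Hx1 as [Hx0 Hx1].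
      apply Nat.ltb_lt in Hx2. apply Nat.leb_le in Hx1. rewrite Hx0. simpl.
      apply andb_true_iff. rewrite Nat.leb_le, Nat.ltb_lt. destruct (Nat.eq_dec x v) as [->|Hne].
      * unfold h in *. lia.
      * rewrite Hcu in Hx1 by auto. rewrite Hpu in Hx2 by auto. auto.
  - rewrite length_app. simpl. rewrite si_len0.
    pose proof (sm_upd (fun i => cn (S i)) (fun i => cn' (S i)) w (v - 1) ltac:(lia)
      ltac:(intros i Hi; cbv beta; apply Hcu; lia)) as HU.
    cbv beta in HU. replace (S (v - 1)) with v in HU by lia. unfold h in *. lia.
Qed.

(** Counting by levels: a class with more than i + 2 kept copies has, for h = i/2 + 1, at least h
    kept copies and a cap above 2h. By [si_good] each of the log2 w + 1 groups contains at most
    16w/h of these, and the sum over i is harmonic. Levels 0 and 1 give the term 2w. *)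
Theorem scan_count L em cn cp rch : 0 < w -> scanInv L em cn cp rch ->
  length em <= 2 * w + 32 * w * (Nat.log2 w + 1) * (Nat.log2 w + 1).
Proof.
  intros Hw HI. destruct HI. rewrite si_len0. set (lg := Nat.log2 w).
  assert (Hcn2 : forall v, 0 < v <= w -> cn v <= 2 * w).
  { intros v Hv. rewrite si_cn0 by auto. pose proof (si_cp3 v Hv). lia. }
  assert (E1 : sm (fun i => cn (S i)) w = sm (fun r => cnt (fun i => r <? cn (S i)) w) (2 * w)).
  { unfold cnt. rewrite <- sm_exchange. apply sm_ext. intros i Hi.
    specialize (Hcn2 (S i) ltac:(lia)). clear -Hcn2. revert Hcn2. generalize (cn (S i)) as k, (2 * w) as n.
    intros k n Hk.
    replace n with (k + (n - k)) by lia. rewrite sm_app.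
    rewrite (sm_ext _ (fun _ => 1)), sm_const.
    2:{ intros j Hj. cbv beta. apply Nat.ltb_lt in Hj. now rewrite Hj. }
    rewrite (sm_ext _ (fun _ => 0)), sm_const; [lia|].
    intros j Hj. cbv beta. replace (k + j <? k) with false; auto. symmetry. apply Nat.ltb_ge. lia. }
  rewrite E1. replace (2 * w) with (2 + (2 * w - 2)) by lia. rewrite sm_app.
  assert (B1 : sm (fun r => cnt (fun i => r <? cn (S i)) w) 2 <= 2 * w).
  { simpl. pose proof (cnt_le (fun i => 0 <? cn (S i)) w). pose proof (cnt_le (fun i => 1 <? cn (S i)) w). lia. }
  assert (B2 : sm (fun i => cnt (fun j => 2 + i <? cn (S j)) w) (2 * w - 2)
     <= sm (fun i => (lg + 1) * (16 * w / S (i / 2))) (2 * w)).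
  { etransitivity; [|apply (sm_mono_n _ (2 * w - 2)); lia]. apply sm_le. intros i Hi.
    set (h := S (i / 2)).
    assert (Hh : 2 * h < 2 + i + 1).
    { unfold h. pose proof (Nat.Div0.mul_div_le i 2). lia. }
    assert (Hg : forall g, cnt (fun u => ing g u && (h <=? cn u) && (2 * h <? cp u)) (S w) <= 16 * w / h).
    { intros g. apply Nat.div_le_lower_bound; [unfold h; lia|]. specialize (si_good0 g h ltac:(unfold h; lia)). lia. }
    rewrite Nat.add_1_r.
    transitivity (sm (fun g => cnt (fun u => ing g u && (h <=? cn u) && (2 * h <? cp u)) (S w)) (S lg)).
    - unfold cnt. rewrite <- sm_exchange. rewrite <- (Nat.add_1_l w). rewrite sm_app.
      etransitivity; [|apply Nat.le_add_l]. apply sm_le. intros j Hj.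
      destruct (Nat.ltb_spec (2 + i) (cn (S j))) as [Hlt|]; [|simpl; lia].
      assert (HjL : Nat.log2 (S j) < S lg).
      { apply Nat.lt_succ_r, Nat.log2_le_mono. lia. }
      assert (Ht : (h <=? cn (1 + j)) && (2 * h <? cp (1 + j)) = true).
      { clear B1 E1. apply andb_true_iff. rewrite Nat.leb_le, Nat.ltb_lt. change (1 + j) with (S j).
        specialize (si_cn0 (S j) ltac:(lia)). lia. }
      change (Nat.b2n true) with 1.
      assert (HX := sm_upd (fun _ => 0) (fun g => if g =? Nat.log2 (S j) then 1 else 0) (S lg) (Nat.log2 (S j)) HjL
        ltac:(intros k Hk; cbv beta; apply Nat.eqb_neq in Hk; now rewrite Hk)).
      cbv beta in HX. rewrite Nat.eqb_refl, sm_const in HX.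
      transitivity (sm (fun g => if g =? Nat.log2 (S j) then 1 else 0) (S lg)); [lia|].
      apply sm_le. intros g _. rewrite <- andb_assoc. change (1 + j) with (S j) in *. rewrite Ht, andb_true_r.
      unfold ing. rewrite Nat.eqb_sym. destruct (Nat.log2 (S j) =? g); simpl; auto.
    - transitivity (sm (fun _ => 16 * w / h) (S lg)).
      + apply sm_le. intros g _. apply Hg.
      + rewrite sm_const. reflexivity. }
  assert (B3 : sm (fun i => (lg + 1) * (16 * w / S (i / 2))) (2 * w) <= (lg + 1) * (2 * (16 * w * (lg + 1)))).
  { rewrite (sm_double (fun k => (lg + 1) * (16 * w / S k))).
    assert (E : sm (fun k => (lg + 1) * (16 * w / S k)) w = (lg + 1) * sm (fun k => 16 * w / S k) w).
    { generalize w at 2 4 as n. induction n; simpl in *; lia. }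
    rewrite E. pose proof (harmonic (16 * w) w Hw) as H. fold lg in H. nia. }
  nia.
Qed.
End Scan.

(** * Prefix sums in a random order *)

Definition bitsat (bs : list bool) (p b : nat) : list bool :=
  map (fun j => nth (p + j) bs false) (seq 0 b).
Definition hv (u : list bool) : nat := fold_left (fun acc x => 2 * acc + Nat.b2n x) u 0.
Definition key (b : nat) (bs : list bool) (i : nat) : nat := hv (bitsat bs (i * b) b).

Lemma hv_app u x : hv (u ++ [x]) = 2 * hv u + Nat.b2n x.
Proof. unfold hv. now rewrite fold_left_app. Qed.

Lemma hv_cons x u : hv (x :: u) = Nat.b2n x * 2 ^ length u + hv u.
Proof.
  induction u as [|y u IH] using rev_ind.
  - unfold hv. simpl. lia.
  - rewrite app_comm_cons, !hv_app, IH, length_app, Nat.add_1_r. cbn [Nat.pow]. lia.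
Qed.

Lemma hv_lt u : hv u < 2 ^ length u.
Proof.
  induction u as [|y u IH] using rev_ind; [unfold hv; simpl; lia|].
  rewrite hv_app, length_app, Nat.add_1_r. cbn [Nat.pow]. destruct y; simpl Nat.b2n; lia.
Qed.

Lemma key_lt b bs i : key b bs i < 2 ^ b.
Proof.
  unfold key. pose proof (hv_lt (bitsat bs (i * b) b)) as H.
  unfold bitsat in *. now rewrite length_map, length_seq in H.
Qed.

Definition sZ (f : nat -> Z) (n : nat) : Z := fold_right Z.add 0%Z (map f (seq 0 n)).

Lemma sZ_0 f : sZ f 0 = 0%Z.
Proof. reflexivity. Qed.
Lemma sZ_S f n : sZ f (S n) = (sZ f n + f n)%Z.
Proof.
  unfold sZ. rewrite seq_S, map_app, fold_right_app. simpl. rewrite Z.add_0_r. clear.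
  generalize (map f (seq 0 n)). intros l. induction l; simpl; lia.
Qed.

(** Candidates are ordered by key and then by index; this says that candidate i with key k precedes
    the cut (x, j). Every prefix of the processing order is given by such a cut. *)
Definition before (x j i k : nat) : bool := (k <? x) || ((k =? x) && (i <? j)).

Definition psum (s : nat -> Z) (nc b x j : nat) (bs : list bool) : Z :=
  sZ (fun i => if before x j i (key b bs i) then s i else 0%Z) nc.

Open Scope R_scope.

Fixpoint rs (l : list (list bool)) (f : list bool -> R) : R :=
  match l with [] => 0 | u :: l => f u + rs l f end.
Fixpoint sR (f : nat -> R) (n : nat) : R :=
  match n with O => 0 | S n => sR f n + f n end.
Fixpoint pR (f : nat -> R) (n : nat) : R :=
  match n with O => 1 | S n => pR f n * f n end.

Lemma rs_ext l f g : (forall u, In u l -> f u = g u) -> rs l f = rs l g.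
Proof. induction l; simpl; intros H; auto. rewrite H by auto. f_equal. auto. Qed.
Lemma rs_app l1 l2 f : rs (l1 ++ l2) f = rs l1 f + rs l2 f.
Proof. induction l1; simpl; lra. Qed.
Lemma rs_map l (h : list bool -> list bool) f : rs (map h l) f = rs l (fun u => f (h u)).
Proof. induction l; simpl; auto. now rewrite IHl. Qed.
Lemma rs_scal l c f : rs l (fun u => c * f u) = c * rs l f.
Proof. induction l; simpl; [lra|]. rewrite IHl. lra. Qed.

Lemma sR_ext f g n : (forall i, (i < n)%nat -> f i = g i) -> sR f n = sR g n.
Proof. induction n; simpl; intros H; auto. rewrite H by auto. f_equal; auto. Qed.
Lemma sR_le f g n : (forall i, (i < n)%nat -> f i <= g i) -> sR f n <= sR g n.
Proof. induction n; simpl; intros H; [lra|]. apply Rplus_le_compat; auto. Qed.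
Lemma sR_add f g n : sR (fun i => f i + g i) n = sR f n + sR g n.
Proof. induction n; simpl; lra. Qed.
Lemma sR_scal c f n : sR (fun i => c * f i) n = c * sR f n.
Proof. induction n; simpl; [lra|]. rewrite IHn. lra. Qed.
Lemma sR_const c n : sR (fun _ => c) n = INR n * c.
Proof. induction n; [simpl; lra|]. rewrite S_INR. simpl sR. rewrite IHn. lra. Qed.
Lemma sR_app f a b : sR f (a + b) = sR f a + sR (fun i => f (a + i)%nat) b.
Proof. induction b; simpl; rewrite ?Nat.add_0_r, ?Nat.add_succ_r; simpl; lra. Qed.

Lemma pR_ext f g n : (forall i, (i < n)%nat -> f i = g i) -> pR f n = pR g n.
Proof. induction n; simpl; intros H; auto. rewrite H by auto. f_equal; auto. Qed.
Lemma pR_S_l f n : pR f (S n) = f O * pR (fun i => f (S i)) n.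
Proof. induction n; simpl in *; [lra|]. rewrite IHn. lra. Qed.
Lemma pR_le f g n : (forall i, (i < n)%nat -> 0 <= f i <= g i) -> 0 <= pR f n <= pR g n.
Proof.
  induction n; simpl; intros H; [lra|]. destruct IHn as [A B]; [auto|].
  destruct (H n ltac:(lia)) as [C D]. split; [now apply Rmult_le_pos|]. now apply Rmult_le_compat.
Qed.
Lemma pR_exp f n : pR (fun i => exp (f i)) n = exp (sR f n).
Proof. induction n; simpl; [now rewrite exp_0|]. now rewrite IHn, exp_plus. Qed.
Lemma pR_scal c f n : pR (fun i => c * f i) n = c ^ n * pR f n.
Proof. induction n; simpl; [lra|]. rewrite IHn. lra. Qed.

Lemma all_bits_length t u : In u (all_bits t) -> length u = t.
Proof.
  revert u; induction t; simpl; intros u H.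
  - destruct H as [<-|[]]; reflexivity.
  - apply in_app_iff in H as [H|H]; apply in_map_iff in H as (v & <- & H); simpl; f_equal; auto.
Qed.
Lemma all_bits_count t : length (all_bits t) = (2 ^ t)%nat.
Proof. induction t; simpl; auto. rewrite length_app, !length_map, IHt. lia. Qed.

Lemma rs_split a t f : rs (all_bits (a + t)) f = rs (all_bits a) (fun u => rs (all_bits t) (fun v => f (u ++ v))).
Proof.
  revert f; induction a; intros f; simpl; [rewrite Rplus_0_r; reflexivity|].
  rewrite !rs_app, !rs_map, !IHa. reflexivity.
Qed.

(** A key is uniform: reading b bits in binary is a bijection onto the numbers below 2^b. *)
Lemma rs_hv b (g : nat -> R) : rs (all_bits b) (fun u => g (hv u)) = sR g (2 ^ b).
Proof.
  revert g; induction b; intros g; simpl; [unfold hv; simpl; lra|].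
  rewrite rs_app, !rs_map, Nat.add_0_r, sR_app, <- (IHb g), <- (IHb (fun i => g (2 ^ b + i)%nat)). f_equal.
  all: apply rs_ext; intros u Hu; rewrite hv_cons, (all_bits_length _ _ Hu); f_equal; cbn [Nat.b2n]; lia.
Qed.

Lemma bitsat_0 u v : bitsat (u ++ v) 0 (length u) = u.
Proof.
  unfold bitsat. apply nth_ext with (d := false) (d' := false).
  - now rewrite length_map, length_seq.
  - intros n Hn. rewrite length_map, length_seq in Hn.
    rewrite nth_indep with (d' := nth (0 + 0) (u ++ v) false) by (now rewrite length_map, length_seq).
    rewrite (map_nth (fun j => nth (0 + j) (u ++ v) false)), seq_nth by auto. simpl.
    now apply app_nth1.
Qed.

Lemma key_0 u v : key (length u) (u ++ v) 0 = hv u.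
Proof. unfold key. simpl. now rewrite bitsat_0. Qed.
Lemma key_S b u v i : length u = b -> key b (u ++ v) (S i) = key b v i.
Proof.
  intros H. unfold key, bitsat. f_equal. apply map_ext. intros j.
  rewrite app_nth2 by (simpl; lia). f_equal. simpl. lia.
Qed.

(** Independence of the keys: they read disjoint blocks of b bits, so the sum over all strings
    factorises. The t bits that are not read give the factor 2^t. *)
Lemma rs_prod b n : forall (g : nat -> nat -> R) t,
  rs (all_bits (n * b + t)) (fun bs => pR (fun i => g i (key b bs i)) n)
  = 2 ^ t * pR (fun i => sR (g i) (2 ^ b)) n.
Proof.
  induction n; intros g t.
  - simpl pR. simpl Nat.add. rewrite (rs_ext _ _ (fun u => 1 * (fun _ => 1) u)) by (intros; lra).
    rewrite rs_scal. rewrite Rmult_1_l, Rmult_1_r. induction t; simpl; [lra|].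
    rewrite rs_app, !rs_map, IHt. lra.
  - replace (S n * b + t)%nat with (b + (n * b + t))%nat by lia. rewrite rs_split.
    rewrite (rs_ext _ _ (fun u => (2 ^ t * pR (fun i => sR (g (S i)) (2 ^ b)) n) * g O (hv u))).
    + rewrite rs_scal, (rs_hv b (g O)), pR_S_l. lra.
    + intros u Hu. apply all_bits_length in Hu.
      rewrite (rs_ext _ _ (fun v => g O (hv u) * pR (fun i => g (S i) (key b v i)) n)).
      * rewrite rs_scal, (IHn (fun i => g (S i))). lra.
      * intros v _. rewrite pR_S_l. f_equal; [subst b; now rewrite key_0|].
        apply pR_ext. intros i _. now rewrite key_S.
Qed.

Lemma Rabs_inv x a : Rabs x <= a -> - a <= x <= a.
Proof. pose proof (Rle_abs x). pose proof (Rle_abs (- x)). rewrite Rabs_Ropp in *. lra. Qed.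

(** From exp(-u) >= 1 - u one gets exp(u) <= 1/(1 - u), and (1 + u + 2u^2)(1 - u) = 1 + u^2 (1 - 2u)
    >= 1. *)
Lemma exp_le_quad u : Rabs u <= / 2 -> exp u <= 1 + u + 2 * (u * u).
Proof.
  intros H. apply Rabs_inv in H.
  assert (H1 : 1 - u <= exp (- u)).
  { destruct (Req_dec u 0) as [->|Hne]; [rewrite Ropp_0, exp_0; lra|].
    pose proof (exp_ineq1 (- u) ltac:(lra)). lra. }
  rewrite exp_Ropp in H1.
  pose proof (exp_pos u) as Hp.
  assert (H2 : exp u * (1 - u) <= 1).
  { apply Rmult_le_compat_l with (r := exp u) in H1; [|lra]. rewrite Rinv_r in H1; lra. }
  assert (H3 : 1 <= (1 + u + 2 * (u * u)) * (1 - u)).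
  { assert (0 <= u * u * (1 - 2 * u)) by (apply Rmult_le_pos; [apply Rle_0_sqr|lra]). nra. }
  apply Rmult_le_reg_r with (1 - u); lra.
Qed.

Definition b2R (x : bool) : R := if x then 1 else 0.

(** The linear term of [exp_le_quad] averages to 0 because q is the mean; the quadratic term is at
    most 2a^2 because the deviation from q is at most 1. *)
Lemma mgf_bound G (I : nat -> bool) a : (0 < G)%nat -> Rabs a <= / 2 ->
  let q := sR (fun k => b2R (I k)) G / INR G in
  sR (fun k => exp (a * (b2R (I k) - q))) G <= INR G * exp (2 * (a * a)).
Proof.
  intros HG Ha q. assert (HGR : 0 < INR G) by now apply lt_0_INR.
  assert (Hq : 0 <= q <= 1).
  { unfold q. assert (0 <= sR (fun k => b2R (I k)) G <= INR G).
    { split.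
      - replace 0 with (sR (fun _ => 0) G) by (rewrite sR_const; lra).
        apply sR_le. intros i _. unfold b2R. destruct (I i); lra.
      - replace (INR G) with (sR (fun _ => 1) G) by (rewrite sR_const; lra).
        apply sR_le. intros i _. unfold b2R. destruct (I i); lra. }
    split; [apply Rmult_le_pos; [lra|left; now apply Rinv_0_lt_compat]|].
    apply Rmult_le_reg_r with (INR G); auto. unfold Rdiv. rewrite Rmult_assoc, Rinv_l; lra. }
  assert (Hd : forall k, Rabs (b2R (I k) - q) <= 1).
  { intros k. unfold b2R. destruct (I k); apply Rabs_le; lra. }
  transitivity (sR (fun k => (1 + 2 * (a * a)) + a * (b2R (I k) - q)) G).
  - apply sR_le. intros k _. specialize (Hd k). set (y := b2R (I k) - q) in *.
    assert (Hy : y * y <= 1).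
    { rewrite <- (Rabs_pos_eq (y * y)) by apply Rle_0_sqr. rewrite Rabs_mult.
      pose proof (Rabs_pos y). nra. }
    assert (Hay : Rabs (a * y) <= / 2).
    { rewrite Rabs_mult. pose proof (Rabs_pos y). pose proof (Rabs_pos a). nra. }
    pose proof (exp_le_quad _ Hay). assert (0 <= a * a) by apply Rle_0_sqr. nra.
  - rewrite sR_add, sR_const, sR_scal.
    rewrite (sR_ext (fun i => b2R (I i) - q) (fun i => b2R (I i) + (- q))) by (intros; lra).
    rewrite sR_add, sR_const.
    assert (E : sR (fun i => b2R (I i)) G = INR G * q) by (unfold q; field; lra).
    rewrite E. replace (INR G * q + INR G * - q) with 0 by lra. rewrite Rmult_0_r, Rplus_0_r.
    apply Rmult_le_compat_l; [lra|].
    destruct (Req_dec (2 * (a * a)) 0) as [->|Hne]; [rewrite exp_0; lra|].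
    left. apply exp_ineq1; auto.
Qed.

(** * Chernoff bound for all prefix sums at once *)

Section Conc.
Context (w sq nc b t T : nat) (s : nat -> Z).
Notation G := (2 ^ b)%nat.
Context (Hw : (0 < w)%nat) (Hsq : (w <= sq * sq)%nat) (HG : (w <= 2 ^ b)%nat)
  (Hs : forall i, (i < nc)%nat -> (Z.abs (s i) <= Z.of_nat w)%Z)
  (Hnum : (length (filter (fun i => negb (s i =? 0)%Z) (seq 0 nc)) <= 4 * w)%nat)
  (Htot : (Z.abs (sZ s nc) <= Z.of_nat w)%Z)
  (HT : (nc * b <= T)%nat).

(** The parameter of the exponential moment: since |s_i| <= w, each exponent stays within 1/2, and
    lam^2 times the sum of squares, at most 4w^3, is at most w / sq^2 <= 1. *)
Notation lam := (/ (2 * INR w * INR sq)).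

Lemma sq_pos : (0 < sq)%nat.
Proof. destruct sq; lia. Qed.

Lemma sum_squares : sR (fun i => IZR (s i) * IZR (s i)) nc <= 4 * INR w * (INR w * INR w).
Proof.
  clear Htot HT. assert (HX : forall n, (n <= nc)%nat -> sR (fun i => IZR (s i) * IZR (s i)) n
    <= INR (length (filter (fun i => negb (s i =? 0)%Z) (seq 0 n))) * (INR w * INR w)).
  { induction n; intros Hn; [simpl; lra|]. rewrite seq_S, filter_app, length_app, plus_INR.
    simpl sR. specialize (IHn ltac:(lia)). specialize (Hs n ltac:(lia)). simpl filter.
    destruct (Z.eqb_spec (s n) 0) as [->|Hne].
    - simpl. lra.
    - simpl. assert (IZR (s n) * IZR (s n) <= INR w * INR w); [|lra].
      rewrite INR_IZR_INZ, <- !mult_IZR. apply IZR_le. nia. }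
  etransitivity; [apply HX; auto|]. apply le_INR in Hnum. rewrite mult_INR in Hnum. simpl in Hnum.
  apply Rmult_le_compat_r; [|lra]. apply Rle_0_sqr.
Qed.

Lemma num_before x j i : (x < G)%nat ->
  sR (fun k => b2R (before x j i k)) G = INR x + b2R (i <? j)%nat.
Proof.
  intros Hx. replace G with (x + (1 + (G - x - 1)))%nat by lia. rewrite !sR_app.
  rewrite (sR_ext (fun k => b2R (before x j i k)) (fun _ => 1) x).
  2:{ intros k Hk. unfold before. apply Nat.ltb_lt in Hk. now rewrite Hk. }
  rewrite sR_const. rewrite (sR_ext (fun k => b2R (before x j i (x + (1 + k)))) (fun _ => 0)).
  2:{ intros k Hk. unfold before. replace (x + (1 + k) <? x)%nat with false by (symmetry; apply Nat.ltb_ge; lia).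
      replace (x + (1 + k) =? x)%nat with false by (symmetry; apply Nat.eqb_neq; lia). reflexivity. }
  rewrite sR_const. simpl sR. rewrite Nat.add_0_r. unfold before at 1.
  rewrite Nat.ltb_irrefl, Nat.eqb_refl. simpl. lra.
Qed.

(** The probability that candidate i precedes the cut (x, j), by [num_before]. *)
Definition cen (x j i : nat) : R := (INR x + b2R (i <? j)%nat) / INR G.

Lemma G_pos : (0 < G)%nat.
Proof. lia. Qed.

(** Product of [mgf_bound] over the independent keys; by the choice of [lam] the exponents add up to
    at most 2. The sign [sg] selects one of the two tails. *)
Lemma exp_moment (sg : R) x j : sg * sg = 1 -> (x < G)%nat ->
  rs (all_bits T) (fun bs => exp (lam * (sg * sR (fun i => IZR (s i) * (b2R (before x j i (key b bs i)) - cen x j i)) nc)))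
  <= 2 ^ T * exp 2.
Proof.
  intros Hsg Hx. pose proof sq_pos as Hsp. pose proof G_pos as HGp.
  assert (HwR : 1 <= INR w) by (apply (le_INR 1); lia).
  assert (HsR : 1 <= INR sq) by (apply (le_INR 1); lia).
  assert (HGR : 0 < INR G) by (now apply lt_0_INR).
  assert (Hlam : 0 < lam) by (apply Rinv_0_lt_compat; nra).
  set (al := fun i => lam * sg * IZR (s i)).
  replace T with (nc * b + (T - nc * b))%nat at 1 by lia.
  rewrite (rs_ext _ _ (fun bs => pR (fun i => (fun i k => exp (al i * (b2R (before x j i k) - cen x j i))) i (key b bs i)) nc)).
  2:{ intros u _. cbv beta. rewrite pR_exp. f_equal. unfold al.
      rewrite <- Rmult_assoc, <- sR_scal. apply sR_ext. intros i _. lra. }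
  rewrite (rs_prod b nc (fun i k => exp (al i * (b2R (before x j i k) - cen x j i)))).
  assert (Hal : forall i, (i < nc)%nat -> Rabs (al i) <= / 2).
  { intros i Hi. unfold al. rewrite !Rabs_mult.
    assert (Rabs sg = 1).
    { destruct (Rcase_abs sg) as [h|h]; [rewrite Rabs_left|rewrite Rabs_right]; auto; nra. }
    rewrite H, (Rabs_pos_eq lam) by lra. rewrite <- abs_IZR.
    specialize (Hs i Hi). apply IZR_le in Hs. rewrite <- INR_IZR_INZ in Hs.
    rewrite Rmult_1_r. apply Rle_trans with (lam * INR w).
    - apply Rmult_le_compat_l; lra.
    - replace (lam * INR w) with (/ (2 * INR sq)) by (field; lra).
      apply Rinv_le_contravar; lra. }
  assert (HP : pR (fun i => sR (fun k => exp (al i * (b2R (before x j i k) - cen x j i))) G) nc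
    <= INR G ^ nc * exp (2 * sR (fun i => al i * al i) nc)).
  { rewrite <- sR_scal, <- pR_exp, <- pR_scal. apply pR_le. intros i Hi. split.
    - replace 0 with (sR (fun _ => 0) G) by (rewrite sR_const; lra).
      apply sR_le. intros k _. left. apply exp_pos.
    - unfold cen. rewrite <- (num_before x j i Hx). apply (mgf_bound G (before x j i)); auto. }
  apply Rle_trans with (2 ^ (T - nc * b) * (INR G ^ nc * exp (2 * sR (fun i => al i * al i) nc))).
  { apply Rmult_le_compat_l; [apply pow_le; lra|exact HP]. }
  rewrite <- Rmult_assoc.
  replace (INR G) with (2 ^ b) by (rewrite pow_INR; simpl; auto; f_equal; lra).
  rewrite <- pow_mult, <- pow_add. replace (T - nc * b + b * nc)%nat with T by lia.
  apply Rmult_le_compat_l; [apply pow_le; lra|].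
  assert (HS : 2 * sR (fun i => al i * al i) nc <= 2).
  { rewrite (sR_ext _ (fun i => (lam * lam) * (IZR (s i) * IZR (s i)))).
    2:{ intros i _. unfold al. transitivity ((sg * sg) * (lam * lam * (IZR (s i) * IZR (s i)))); [lra|]. rewrite Hsg; lra. }
    rewrite sR_scal. pose proof sum_squares as HQ.
    apply Rle_trans with (2 * (lam * lam * (4 * INR w * (INR w * INR w)))).
    { apply Rmult_le_compat_l; [lra|]. apply Rmult_le_compat_l; [nra|exact HQ]. }
    apply le_INR in Hsq. rewrite mult_INR in Hsq.
    replace (2 * (lam * lam * (4 * INR w * (INR w * INR w)))) with (2 * (INR w / (INR sq * INR sq))) by (field; lra).
    assert (INR w / (INR sq * INR sq) <= 1); [|lra].
    apply Rmult_le_reg_r with (INR sq * INR sq); [nra|]. unfold Rdiv.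
    rewrite Rmult_assoc, Rinv_l; nra. }
  destruct HS as [HS|HS]; [left; now apply exp_increasing|rewrite HS; lra].
Qed.

Lemma markov (l : list (list bool)) (p : list bool -> bool) (f : list bool -> R) :
  (forall u, In u l -> 0 <= f u) -> (forall u, In u l -> p u = true -> 1 <= f u) ->
  INR (length (filter p l)) <= rs l f.
Proof.
  induction l as [|u l IH]; intros H0 H1; [simpl; lra|].
  assert (INR (length (filter p l)) <= rs l f) by (apply IH; intros; [apply H0|apply H1]; simpl; auto).
  simpl. pose proof (H0 u (or_introl eq_refl)). specialize (H1 u (or_introl eq_refl)).
  destruct (p u); [|lra]. specialize (H1 eq_refl). simpl length. rewrite S_INR. lra.
Qed.

Lemma IZR_sZ f n : IZR (sZ f n) = sR (fun i => IZR (f i)) n.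
Proof. induction n; [reflexivity|]. rewrite sZ_S, plus_IZR, IHn. reflexivity. Qed.

Lemma abs_sZ_le n : (n <= nc)%nat -> (Z.abs (sZ s n) <= 4 * Z.of_nat w * Z.of_nat w)%Z.
Proof.
  clear Htot HT. intros Hn.
  assert (HX : forall n, (n <= nc)%nat -> (Z.abs (sZ s n)
    <= Z.of_nat (length (filter (fun i => negb (s i =? 0)%Z) (seq 0 n))) * Z.of_nat w)%Z).
  { clear n Hn. induction n; intros Hn; [simpl; lia|]. rewrite seq_S, filter_app, length_app, Nat2Z.inj_add.
    rewrite sZ_S. specialize (IHn ltac:(lia)). specialize (Hs n ltac:(lia)). simpl filter.
    destruct (Z.eqb_spec (s n) 0) as [->|Hne]; simpl length; lia. }
  specialize (HX n Hn).
  assert (length (filter (fun i => negb (s i =? 0)%Z) (seq 0 n)) <= 4 * w)%nat; [|nia].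
  etransitivity; [|exact Hnum]. replace nc with (n + (nc - n))%nat by lia.
  rewrite seq_app, filter_app, length_app. lia.
Qed.

(** The mean is x/G times the total sum plus 1/G times the sum over the indices below j. The first
    part is at most w because the optimum is nearly balanced, the second at most 4w^2/G <= 4w. *)
Lemma mean_bound x j : (x < G)%nat -> (j <= nc)%nat ->
  Rabs (sR (fun i => IZR (s i) * cen x j i) nc) <= 5 * INR w.
Proof.
  intros Hx Hj. assert (HGR : 0 < INR G) by (apply lt_0_INR, G_pos).
  assert (E : sR (fun i => IZR (s i) * cen x j i) nc
    = INR x / INR G * IZR (sZ s nc) + / INR G * IZR (sZ s j)).
  { rewrite !IZR_sZ. replace nc with (j + (nc - j))%nat by lia. rewrite !sR_app.
    rewrite (sR_ext (fun i => IZR (s i) * cen x j i) (fun i => ((INR x + 1) / INR G) * IZR (s i)) j).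
    2:{ intros i Hi. unfold cen. apply Nat.ltb_lt in Hi. rewrite Hi. unfold b2R. lra. }
    rewrite (sR_ext _ (fun i => (INR x / INR G) * IZR (s (j + i)%nat)) (nc - j)).
    2:{ intros i Hi. unfold cen. replace (j + i <? j)%nat with false by (symmetry; apply Nat.ltb_ge; lia).
        unfold b2R. rewrite Rplus_0_r. lra. }
    rewrite !sR_scal. lra. }
  rewrite E. eapply Rle_trans; [apply Rabs_triang|]. rewrite !Rabs_mult.
  assert (H1 : Rabs (INR x / INR G) <= 1).
  { rewrite Rabs_pos_eq.
    - apply Rmult_le_reg_r with (INR G); auto. unfold Rdiv. rewrite Rmult_assoc, Rinv_l by lra.
      rewrite Rmult_1_l, Rmult_1_r. left. now apply lt_INR.
    - apply Rmult_le_pos; [apply pos_INR|left; now apply Rinv_0_lt_compat]. }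
  assert (H2 : Rabs (IZR (sZ s nc)) <= INR w).
  { rewrite <- abs_IZR, INR_IZR_INZ. now apply IZR_le. }
  assert (H3 : Rabs (IZR (sZ s j)) <= 4 * INR w * INR w).
  { rewrite <- abs_IZR, INR_IZR_INZ, <- !mult_IZR. apply IZR_le. now apply abs_sZ_le. }
  assert (H4 : Rabs (/ INR G) * Rabs (IZR (sZ s j)) <= 4 * INR w).
  { rewrite Rabs_pos_eq by (left; now apply Rinv_0_lt_compat).
    apply Rmult_le_reg_l with (INR G); auto. rewrite <- Rmult_assoc, Rinv_r, Rmult_1_l by lra.
    assert (INR w <= INR G) by (now apply le_INR). pose proof (pos_INR w). nra. }
  pose proof (Rabs_pos (INR x / INR G)). pose proof (Rabs_pos (IZR (sZ s nc))). nra.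
Qed.

(* Deviation bound of the Chernoff argument plus the bound 5w on the means. *)
Definition Rng : nat := (2 * w * sq * t + 5 * w)%nat.

(** Markov's inequality for the exponential moment: a deviation of 2 w sq t from the mean,
    multiplied by [lam], is t. *)
Lemma tail_one (sg : Z) x j : (sg * sg = 1)%Z -> (x < G)%nat -> (j <= nc)%nat ->
  INR (length (filter (fun bs => (Z.of_nat Rng <? sg * psum s nc b x j bs)%Z) (all_bits T)))
  <= 2 ^ T * exp (2 - INR t).
Proof.
  intros Hsg Hx Hj. pose proof sq_pos as Hsp.
  assert (HwR : 1 <= INR w) by (apply (le_INR 1); lia).
  assert (HsR : 1 <= INR sq) by (apply (le_INR 1); lia).
  assert (Hlam : 0 < lam) by (apply Rinv_0_lt_compat; nra).
  set (Z0 := fun bs => sR (fun i => IZR (s i) * (b2R (before x j i (key b bs i)) - cen x j i)) nc).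
  assert (Hsg' : IZR sg * IZR sg = 1) by (rewrite <- mult_IZR, Hsg; reflexivity).
  apply Rle_trans with (rs (all_bits T) (fun bs => exp (- INR t) * exp (lam * (IZR sg * Z0 bs)))).
  - apply markov.
    + intros u _. apply Rmult_le_pos; left; apply exp_pos.
    + intros u _ Hu. apply Z.ltb_lt in Hu. rewrite <- exp_plus.
      rewrite <- exp_0. apply IZR_lt in Hu.
      assert (Hge : 0 <= - INR t + lam * (IZR sg * Z0 u)).
      { assert (EZ : Z0 u = IZR (psum s nc b x j u) - sR (fun i => IZR (s i) * cen x j i) nc).
        { unfold Z0, psum. rewrite IZR_sZ.
          rewrite (sR_ext _ (fun i => IZR (if before x j i (key b u i) then s i else 0%Z) + (- 1) * (IZR (s i) * cen x j i))).
          - rewrite sR_add, sR_scal. lra.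
          - intros i _. destruct (before x j i (key b u i)); unfold b2R; lra. }
        pose proof (mean_bound x j Hx Hj) as HM.
        rewrite mult_IZR, <- INR_IZR_INZ in Hu. unfold Rng in Hu.
        rewrite plus_INR, !mult_INR in Hu. simpl (INR 2) in Hu. simpl (INR 5) in Hu.
        set (mu := sR (fun i => IZR (s i) * cen x j i) nc) in *.
        assert (HM' : - (5 * INR w) <= IZR sg * mu <= 5 * INR w).
        { apply Rabs_inv. rewrite Rabs_mult.
          assert (Rabs (IZR sg) = 1).
          { destruct (Rcase_abs (IZR sg)) as [h|h]; [rewrite Rabs_left|rewrite Rabs_right]; auto; nra. }
          rewrite H. lra. }
        assert (HZ : 2 * INR w * INR sq * INR t <= IZR sg * Z0 u) by (rewrite EZ; lra).
        apply Rmult_le_compat_l with (r := lam) in HZ; [|lra].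
        replace (lam * (2 * INR w * INR sq * INR t)) with (INR t) in HZ by (field; lra). lra. }
      destruct Hge as [Hge|Hge]; [left; now apply exp_increasing|rewrite <- Hge; lra].
  - rewrite rs_scal. pose proof (exp_moment (IZR sg) x j Hsg' Hx) as HE. fold Z0 in HE.
    replace (2 - INR t) with (- INR t + 2) by lra. rewrite exp_plus.
    apply Rle_trans with (exp (- INR t) * (2 ^ T * exp 2)); [|lra].
    apply Rmult_le_compat_l; [left; apply exp_pos|exact HE].
Qed.

Definition bad (bs : list bool) : bool :=
  existsb (fun x => existsb (fun j => (Z.of_nat Rng <? Z.abs (psum s nc b x j bs))%Z) (seq 0 (S nc))) (seq 0 G).

Lemma union_bound {A} (p : A -> list bool -> bool) es l B :
  (forall e, In e es -> INR (length (filter (p e) l)) <= B) ->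
  INR (length (filter (fun u => existsb (fun e => p e u) es) l)) <= INR (length es) * B.
Proof.
  induction es as [|e es IH]; intros H; simpl existsb.
  - rewrite Rmult_0_l. clear. induction l; simpl; [lra|auto].
  - simpl length. rewrite S_INR.
    assert (H1 : INR (length (filter (fun u => existsb (fun e => p e u) es) l)) <= INR (length es) * B)
      by (apply IH; intros; apply H; simpl; auto).
    specialize (H e (or_introl eq_refl)).
    apply Rle_trans with (INR (length (filter (p e) l) + length (filter (fun u => existsb (fun e => p e u) es) l))).
    + apply le_INR. clear. induction l as [|u l IH]; simpl; auto.
      destruct (p e u), (existsb (fun e => p e u) es); simpl; lia.
    + rewrite plus_INR. lra.
Qed.

(** Union bound over G (nc + 1) cuts and two signs. As exp(2 - t) <= 9 / 2^t, the bad strings are at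
    most 18 G (nc + 1) 2^T / 2^t in number, which the constant 32 covers. *)
Theorem conc Q : (32 * G * (nc + 1) * Q <= 2 ^ t)%nat ->
  (length (filter bad (all_bits T)) * Q <= 2 ^ T)%nat.
Proof.
  intros HQ.
  set (B := 2 ^ T * exp (2 - INR t)).
  assert (H1 : INR (length (filter bad (all_bits T))) <= INR G * (INR (S nc) * (2 * B))).
  { unfold bad. replace (INR G) with (INR (length (seq 0 G))) by (now rewrite length_seq). apply union_bound. intros x Hx. apply in_seq in Hx.
    replace (INR (S nc)) with (INR (length (seq 0 (S nc)))) by (now rewrite length_seq). apply union_bound. intros j Hj. apply in_seq in Hj.
    rewrite (filter_ext_in _ (fun bs => existsb (fun sg => (Z.of_nat Rng <? sg * psum s nc b x j bs)%Z) [1%Z; (-1)%Z])).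
    - change 2 with (INR (length [1%Z; (-1)%Z])). apply union_bound.
      intros sg Hsg. apply tail_one; [destruct Hsg as [<-|[<-|[]]]; reflexivity|lia|lia].
    - intros u _. cbn [existsb]. rewrite orb_false_r.
      apply eq_true_iff_eq. rewrite orb_true_iff, !Z.ltb_lt. split; intros; lia. }
  assert (He : exp (2 - INR t) * 2 ^ t <= 9).
  { unfold Rminus. rewrite exp_plus, exp_Ropp. pose proof (exp_pos (INR t)) as Hp.
    assert (E2 : exp 2 <= 9).
    { replace 2 with (1 + 1) by lra. rewrite exp_plus. pose proof exp_le_3. pose proof (exp_pos 1). nra. }
    assert (Et : 2 ^ t <= exp (INR t)).
    { clear. induction t as [|k IH]; [simpl; rewrite exp_0; lra|].
      rewrite S_INR, exp_plus. simpl. pose proof (exp_ineq1 1 ltac:(lra)). pose proof (exp_pos (INR k)).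
      pose proof (pow_le 2 k). nra. }
    apply Rmult_le_reg_r with (exp (INR t)); auto.
    replace (exp 2 * / exp (INR t) * 2 ^ t * exp (INR t)) with (exp 2 * 2 ^ t) by (field; lra).
    pose proof (exp_pos 2). pose proof (pow_le 2 t ltac:(lra)). apply Rmult_le_compat; lra. }
  apply INR_le. rewrite mult_INR, pow_INR. simpl (INR 2).
  apply le_INR in HQ. rewrite !mult_INR, (pow_INR 2 t), plus_INR in HQ.
  replace (INR 32) with 32 in HQ by (simpl; lra). simpl (INR 2) in HQ. simpl (INR 1) in HQ. rewrite S_INR in H1.
  replace (1 + 1) with 2 in * by lra.
  assert (Hp2 : 0 < 2 ^ t) by (apply pow_lt; lra).
  assert (HpT : 0 < 2 ^ T) by (apply pow_lt; lra).
  pose proof (pos_INR Q). pose proof (pos_INR (2 ^ b)). pose proof (pos_INR nc).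
  set (X := INR (2 ^ b) * (INR nc + 1)) in *.
  assert (HX : 0 <= X) by (apply Rmult_le_pos; lra).
  apply Rmult_le_reg_r with (2 ^ t); auto.
  apply Rle_trans with (X * INR Q * (2 * 2 ^ T) * (exp (2 - INR t) * 2 ^ t)).
  - replace (X * INR Q * (2 * 2 ^ T) * (exp (2 - INR t) * 2 ^ t)) with (INR (2 ^ b) * ((INR nc + 1) * (2 * B)) * INR Q * 2 ^ t)
      by (unfold X, B; lra).
    apply Rmult_le_compat_r; [lra|]. apply Rmult_le_compat_r; [lra|]. exact H1.
  - apply Rle_trans with (X * INR Q * (2 * 2 ^ T) * 9).
    + apply Rmult_le_compat_l; [|exact He]. apply Rmult_le_pos; [|lra]. now apply Rmult_le_pos.
    + replace (32 * INR (2 ^ b) * (INR nc + 1) * INR Q) with (32 * (X * INR Q)) in HQ by (unfold X; lra).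
      assert (0 <= X * INR Q) by (now apply Rmult_le_pos).
      replace (X * INR Q * (2 * 2 ^ T) * 9) with (2 ^ T * (18 * (X * INR Q))) by lra.
      apply Rmult_le_compat_l; lra.
Qed.
End Conc.
Close Scope R_scope.

Lemma sZ_ext f g n : (forall i, i < n -> f i = g i) -> sZ f n = sZ g n.
Proof. induction n; intros H; auto. rewrite !sZ_S, H by auto. f_equal. auto. Qed.
Lemma sZ_upd f f' n y : y < n -> (forall i, i <> y -> f' i = f i) -> (sZ f' n + f y = sZ f n + f' y)%Z.
Proof.
  intros Hy H. induction n; [lia|]. rewrite !sZ_S. destruct (Nat.eq_dec y n) as [->|].
  - rewrite (sZ_ext f' f) by (intros; apply H; lia). lia.
  - rewrite (H n) by lia. specialize (IHn ltac:(lia)). lia.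
Qed.
Lemma sZ_app f a b : sZ f (a + b) = (sZ f a + sZ (fun i => f (a + i)%nat) b)%Z.
Proof.
  induction b; rewrite ?Nat.add_0_r, ?Nat.add_succ_r, ?sZ_S; [rewrite sZ_0; lia|]. rewrite IHb. lia.
Qed.

(** * The signed dynamic program *)

(* Table entries are profits plus 1, so that 0 means unreachable. *)
Definition upf (sz : nat) (F : nat -> nat) (sg v p i : nat) : nat :=
  if sg =? 0 then
    if (v <=? i) && (0 <? F (i - v)) && (F i <? F (i - v) + p) then F (i - v) + p else F i
  else
    if (i + v <? sz) && (p <? F (i + v)) && (F i <? F (i + v) - p) then F (i + v) - p else F i.

Section DP.
Context (nc R b1 : nat) (cs cw cp : nat -> nat) (D : nat -> bool).
Notation sz := (2 * R + 1).

Definition sgn (j x : nat) : Z := if cs j =? 0 then Z.of_nat x else (- Z.of_nat x)%Z.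
Definition dsum (Q : nat -> bool) : Z := sZ (fun j => if Q j then sgn j (cw j) else 0%Z) nc.
Definition qsum (Q : nat -> bool) : Z := sZ (fun j => if Q j then sgn j (cp j) else 0%Z) nc.

Definition dpsound (done : nat -> bool) (F : nat -> nat) : Prop :=
  forall i, i < sz -> 0 < F i -> exists Q, (forall j, Q j = true -> done j = true) /\
     Z.of_nat i = (Z.of_nat R + dsum Q)%Z /\ Z.of_nat (F i) = (Z.of_nat b1 + qsum Q)%Z.
Definition andf (P Q : nat -> bool) (j : nat) : bool := P j && Q j.
(** Required only along one target set D whose partial sums stay inside the table; other selections
    may be lost at its borders. *)
Definition dpcomp (done : nat -> bool) (F : nat -> nat) : Prop :=
  exists i, i < sz /\ Z.of_nat i = (Z.of_nat R + dsum (andf D done))%Z /\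
    (Z.of_nat b1 + qsum (andf D done) <= Z.of_nat (F i))%Z.

Context (Hpos : forall Q, (0 < Z.of_nat b1 + qsum Q)%Z).

Lemma set_sum (h : nat -> Z) (Q Q' : nat -> bool) j : j < nc -> Q j = false -> Q' j = true ->
  (forall i, i <> j -> Q' i = Q i) ->
  sZ (fun i => if Q' i then h i else 0%Z) nc = (sZ (fun i => if Q i then h i else 0%Z) nc + h j)%Z.
Proof.
  intros Hj H1 H2 H3.
  pose proof (sZ_upd (fun i => if Q i then h i else 0%Z) (fun i => if Q' i then h i else 0%Z) nc j Hj) as H.
  cbv beta in H. rewrite H1, H2 in H. rewrite <- H; [lia|]. intros i Hi. now rewrite H3.
Qed.

(** The set behind an entry of the old table cannot contain j, which is not yet done. Since all new
    entries are computed from the old table, each candidate is used at most once. *)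
Lemma dpsound_step done done' F F' j :
  j < nc -> done j = false -> done' j = true -> (forall i, i <> j -> done' i = done i) ->
  (forall i, i < sz -> F' i = upf sz F (cs j) (cw j) (cp j) i) ->
  dpsound done F -> dpsound done' F'.
Proof.
  intros Hj Hd Hd' Hdd HF HS i Hi Hpi.
  assert (Hold : 0 < F i -> F' i = F i -> exists Q, (forall j, Q j = true -> done' j = true) /\
     Z.of_nat i = (Z.of_nat R + dsum Q)%Z /\ Z.of_nat (F' i) = (Z.of_nat b1 + qsum Q)%Z).
  { intros H0 ->. destruct (HS i Hi H0) as (Q & A & B & C). exists Q. repeat split; auto.
    intros k Hk. destruct (Nat.eq_dec k j) as [->|]; auto. rewrite Hdd; auto. }
  assert (Hnew : forall i', i' < sz -> 0 < F i' ->
    Z.of_nat i = (Z.of_nat i' + sgn j (cw j))%Z -> Z.of_nat (F' i) = (Z.of_nat (F i') + sgn j (cp j))%Z ->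
    exists Q, (forall j, Q j = true -> done' j = true) /\
     Z.of_nat i = (Z.of_nat R + dsum Q)%Z /\ Z.of_nat (F' i) = (Z.of_nat b1 + qsum Q)%Z).
  { intros i' Hi' H0 E1 E2. destruct (HS i' Hi' H0) as (Q & A & B & C).
    set (Q' := fun k => if Nat.eq_dec k j then true else Q k).
    assert (Qj : Q j = false). { destruct (Q j) eqn:E; auto. apply A in E. congruence. }
    assert (Q'j : Q' j = true). { unfold Q'. destruct (Nat.eq_dec j j); congruence. }
    assert (Q'k : forall k, k <> j -> Q' k = Q k). { intros k Hk. unfold Q'. destruct (Nat.eq_dec k j); congruence. }
    exists Q'. repeat split.
    - intros k Hk. destruct (Nat.eq_dec k j) as [->|Hne]; auto. rewrite Q'k in Hk by auto. rewrite Hdd; auto.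
    - unfold dsum. rewrite (set_sum (fun j => sgn j (cw j)) Q Q' j) by auto. unfold dsum in B. lia.
    - unfold qsum. rewrite (set_sum (fun j => sgn j (cp j)) Q Q' j) by auto. unfold qsum in C. lia. }
  pose proof (HF i Hi) as E. unfold upf in E. unfold sgn in Hnew.
  destruct (cs j =? 0).
  - destruct ((cw j <=? i) && (0 <? F (i - cw j)) && (F i <? F (i - cw j) + cp j)) eqn:Hc.
    + apply andb_prop in Hc as [Hc H3]. apply andb_prop in Hc as [H1 H2].
      apply Nat.leb_le in H1. apply Nat.ltb_lt in H2, H3.
      apply (Hnew (i - cw j)); lia.
    + apply Hold; auto. lia.
  - destruct ((i + cw j <? sz) && (cp j <? F (i + cw j)) && (F i <? F (i + cw j) - cp j)) eqn:Hc.
    + apply andb_prop in Hc as [Hc H3]. apply andb_prop in Hc as [H1 H2].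
      apply Nat.ltb_lt in H1, H2, H3.
      apply (Hnew (i + cw j)); lia.
    + apply Hold; auto. lia.
Qed.

Lemma upf_ge F sg v p i : F i <= upf sz F sg v p i.
Proof.
  unfold upf. destruct (sg =? 0).
  - destruct (Nat.ltb_spec (F i) (F (i - v) + p)); [|rewrite andb_false_r; auto].
    rewrite andb_true_r. destruct (_ && _); lia.
  - destruct (Nat.ltb_spec (F i) (F (i + v) - p)); [|rewrite andb_false_r; auto].
    rewrite andb_true_r. destruct (_ && _); lia.
Qed.

(** The range hypothesis places the new partial sum inside the table, and [Hpos] keeps the values
    along D positive, so that the guards of [upf] let the step of the target set pass. *)
Lemma dpcomp_step done done' F F' j :
  j < nc -> done j = false -> done' j = true -> (forall i, i <> j -> done' i = done i) ->
  (forall i, i < sz -> F' i = upf sz F (cs j) (cw j) (cp j) i) ->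
  (Z.abs (dsum (andf D done')) <= Z.of_nat R)%Z ->
  dpcomp done F -> dpcomp done' F'.
Proof.
  intros Hj Hd Hd' Hdd HF HR (i & Hi & E1 & E2).
  destruct (D j) eqn:HD.
  - assert (A1 : andf D done j = false) by (unfold andf; now rewrite Hd, andb_false_r).
    assert (A2 : andf D done' j = true) by (unfold andf; now rewrite Hd', HD).
    assert (A3 : forall k, k <> j -> andf D done' k = andf D done k) by (intros; unfold andf; now rewrite Hdd).
    assert (S1 : dsum (andf D done') = (dsum (andf D done) + sgn j (cw j))%Z)
      by (apply (set_sum (fun j => sgn j (cw j))); auto).
    assert (S2 : qsum (andf D done') = (qsum (andf D done) + sgn j (cp j))%Z)
      by (apply (set_sum (fun j => sgn j (cp j))); auto).
    pose proof (Hpos (andf D done')) as HP. pose proof (Hpos (andf D done)) as HP0.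
    assert (Hex : exists i', i' < sz /\ Z.of_nat i' = (Z.of_nat R + dsum (andf D done'))%Z).
    { exists (Z.to_nat (Z.of_nat R + dsum (andf D done'))). lia. }
    destruct Hex as (i' & Hi' & E').
    exists i'. repeat split; auto. rewrite HF by auto. unfold upf, sgn in *.
    destruct (cs j =? 0).
    + assert (Hii : cw j <= i' /\ i' - cw j = i) by lia. destruct Hii as [Hle ->].
      assert (X1 : (cw j <=? i') = true) by now apply Nat.leb_le.
      assert (X2 : (0 <? F i) = true) by (apply Nat.ltb_lt; lia).
      rewrite X1, X2. simpl. destruct (Nat.ltb_spec (F i') (F i + cp j)); lia.
    + assert (Hii : i' + cw j = i) by lia. rewrite Hii.
      assert (X1 : (i <? sz) = true) by now apply Nat.ltb_lt.
      assert (X2 : (cp j <? F i) = true) by (apply Nat.ltb_lt; lia).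
      rewrite X1, X2. cbn [andb]. destruct (Nat.ltb_spec (F i') (F i - cp j)); lia.
  - assert (A : forall k, andf D done' k = andf D done k).
    { intros k. unfold andf. destruct (Nat.eq_dec k j) as [->|]; [now rewrite HD|]. now rewrite Hdd. }
    assert (S1 : dsum (andf D done') = dsum (andf D done)) by (apply sZ_ext; intros k _; now rewrite A).
    assert (S2 : qsum (andf D done') = qsum (andf D done)) by (apply sZ_ext; intros k _; now rewrite A).
    exists i. rewrite S1, S2. repeat split; auto. rewrite HF by auto.
    pose proof (upf_ge F (cs j) (cw j) (cp j) i). lia.
Qed.

Lemma sound_ext done done' F F' : (forall j, j < nc -> done j = done' j) ->
  (forall i, i < sz -> F i = F' i) -> dpsound done F -> dpsound done' F'.
Proof.
  intros H1 H2 HS i Hi Hp. rewrite <- H2 in Hp |- * by auto.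
  destruct (HS i Hi Hp) as (Q & A & B & C).
  exists (fun j => Q j && (j <? nc)). repeat split.
  - intros j Hj. apply andb_prop in Hj as [Hj Hl]. apply Nat.ltb_lt in Hl. rewrite <- H1; auto.
  - rewrite B. f_equal. apply sZ_ext. intros j Hj. apply Nat.ltb_lt in Hj. now rewrite Hj, andb_true_r.
  - rewrite C. f_equal. apply sZ_ext. intros j Hj. apply Nat.ltb_lt in Hj. now rewrite Hj, andb_true_r.
Qed.
Lemma comp_ext done done' F F' : (forall j, j < nc -> done j = done' j) ->
  (forall i, i < sz -> F i = F' i) -> dpcomp done F -> dpcomp done' F'.
Proof.
  intros H1 H2 (i & Hi & B & C). exists i. rewrite <- H2 by auto.
  assert (E1 : dsum (andf D done') = dsum (andf D done))
    by (apply sZ_ext; intros j Hj; unfold andf; now rewrite H1).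
  assert (E2 : qsum (andf D done') = qsum (andf D done))
    by (apply sZ_ext; intros j Hj; unfold andf; now rewrite H1).
  rewrite E1, E2. auto.
Qed.
End DP.

(** * Selections by index, and binary bundles *)

Definition masked (l : list (nat * nat)) (Q : nat -> bool) : bl :=
  map (fun i => (nth i l (0, 0), Q i)) (seq 0 (length l)).

Lemma map_nth_seq {A} (l : list A) d : map (fun i => nth i l d) (seq 0 (length l)) = l.
Proof.
  apply nth_ext with (d := nth (length l) l d) (d' := d).
  - now rewrite length_map, length_seq.
  - intros n Hn. rewrite length_map, length_seq in Hn.
    rewrite (map_nth (fun i => nth i l d)), seq_nth; auto.
Qed.

Lemma base_masked l Q : base (masked l Q) = l.
Proof.
  unfold base, masked. rewrite map_map. simpl. apply map_nth_seq.
Qed.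

Lemma masked_self (z : bl) : masked (base z) (fun i => snd (nth i z ((0, 0), false))) = z.
Proof.
  transitivity (map (fun i => nth i z ((0, 0), false)) (seq 0 (length z))); [|apply map_nth_seq].
  unfold masked, base. rewrite length_map.
  apply map_ext. intros i.
  change (nth i (map fst z) (0, 0)) with (nth i (map fst z) (fst ((0, 0), false))). rewrite map_nth.
  apply eq_sym, surjective_pairing.
Qed.

Lemma se_one (c : nat * nat) (q : bool) :
  sumw (se [(c, q)]) = (if q then fst c else 0) /\ sump (se [(c, q)]) = (if q then snd c else 0).
Proof. destruct q; unfold se, sumw, sump; simpl; lia. Qed.

Lemma masked_sums l (Q : nat -> bool) :
  sZ (fun i => if Q i then Z.of_nat (fst (nth i l (0, 0))) else 0%Z) (length l) = Z.of_nat (sumw (se (masked l Q))) /\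
  sZ (fun i => if Q i then Z.of_nat (snd (nth i l (0, 0))) else 0%Z) (length l) = Z.of_nat (sump (se (masked l Q))).
Proof.
  unfold masked. induction (length l) as [|n IH]; [split; reflexivity|].
  rewrite !sZ_S, seq_S, map_app, se_app, sumw_app, sump_app. destruct IH as [-> ->].
  simpl map. rewrite (proj1 (se_one _ _)), (proj2 (se_one _ _)). destruct (Q n); lia.
Qed.

Lemma masked_count l (Q : nat -> bool) : length (filter Q (seq 0 (length l))) = length (se (masked l Q)).
Proof.
  unfold masked, se. rewrite length_map. induction (length l) as [|n IH]; auto.
  rewrite seq_S, map_app, !filter_app, !length_app, IH. simpl. destruct (Q n); reflexivity.
Qed.

(** Bundles of b, 2b, 4b, ... copies and a last one for the remainder. [f] is fuel; for b > 0 the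
    number c of copies suffices, since no bundle is empty. *)
Fixpoint bund (f b c v p : nat) : list (nat * nat) :=
  match f with
  | 0 => []
  | S f => if c =? 0 then [] else
      let b' := Nat.min b c in (b' * v, b' * p) :: bund f (2 * b) (c - b') v p
  end.

Lemma bund_sound f : forall b c v p x y, ach (bund f b c v p) x y -> exists k, k <= c /\ x = k * v /\ y = k * p.
Proof.
  induction f; simpl; intros b c v p x y H.
  - apply ach_nil_inv in H as [-> ->]. exists 0. repeat split; lia.
  - destruct (c =? 0).
    + apply ach_nil_inv in H as [-> ->]. exists 0. repeat split; lia.
    + apply ach_inv in H as [H|(x' & y' & -> & -> & H)]; apply IHf in H as (k & Hk & -> & ->).
      * exists k. repeat split; lia.
      * exists (Nat.min b c + k). simpl. repeat split; lia.
Qed.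

(** Bundles from size b on reach every k <= c + b - 1 up to a deficit below b. The general b carries
    the induction, and b = 1 leaves no deficit. *)
Lemma bund_complete f : forall b c v p k, c <= f -> 0 < b -> k <= c + (b - 1) ->
  exists s, s <= k /\ k <= s + (b - 1) /\ ach (bund f b c v p) (s * v) (s * p).
Proof.
  induction f; cbn [bund]; intros b c v p k Hf Hb Hk.
  - exists 0. repeat split; try lia. constructor.
  - destruct (Nat.eqb_spec c 0) as [->|Hc].
    + exists 0. repeat split; try lia. constructor.
    + destruct (Nat.le_gt_cases c b) as [Hle|Hgt].
      * rewrite Nat.min_r by auto. destruct (Nat.le_gt_cases c k).
        -- exists c. repeat split; try lia.
           pose proof (ach_take (c * v, c * p) _ 0 0 (ach_0 (bund f (2 * b) (c - c) v p))) as X.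
           rewrite !Nat.add_0_r in X. exact X.
        -- exists 0. repeat split; try lia. apply ach_0.
      * rewrite Nat.min_l by lia. destruct (IHf (2 * b) (c - b) v p k) as (s & A & B & C); try lia.
        destruct (Nat.le_gt_cases (s + b) k).
        -- exists (b + s). repeat split; try lia. rewrite !Nat.mul_add_distr_r.
           now apply (ach_take (b * v, b * p)).
        -- exists s. repeat split; try lia. now apply ach_skip.
Qed.

Lemma bund_length f : forall b c v p k, 0 < b -> c <= b * (2 ^ k - 1) -> length (bund f b c v p) <= k.
Proof.
  induction f; cbn [bund length]; intros b c v p k Hb Hc; [lia|].
  destruct (Nat.eqb_spec c 0) as [->|Hc0]; [simpl; lia|].
  destruct k as [|k]; [simpl in Hc; lia|]. cbn [length]. apply le_n_S.
  assert (1 <= 2 ^ k) by (clear; induction k; cbn [Nat.pow]; lia).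
  destruct (Nat.le_gt_cases c b) as [Hle|Hgt].
  - rewrite Nat.min_r, Nat.sub_diag by auto. destruct f; simpl; lia.
  - rewrite Nat.min_l by lia. apply IHf; [lia|]. cbn [Nat.pow] in Hc. nia.
Qed.

Notation runT := (nat * nat * nat)%type.
Definition expand (rl : list runT) : list (nat * nat) :=
  flat_map (fun r => repeat (fst r) (snd r)) rl.
(** By [proximity] neither side uses more than 2w copies, so each count is cut there and a run costs
    at most log2 w + 2 bundles. *)
Definition bundles (w : nat) (rl : list runT) : list (nat * nat) :=
  flat_map (fun r => let c := Nat.min (snd r) (2 * w) in bund c 1 c (fst (fst r)) (snd (fst r))) rl.

Lemma bundles_sound w rl : forall a b, ach (bundles w rl) a b -> ach (expand rl) a b.
Proof.
  induction rl as [|[[v p] c] rl IH]; simpl; intros a b H; auto.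
  apply ach_app_inv in H as (a1 & b1 & a2 & b2 & H1 & H2 & -> & ->).
  apply ach_app; auto. apply bund_sound in H1 as (k & Hk & -> & ->).
  apply ach_repeat. exists k. repeat split; auto. lia.
Qed.

Lemma base_app_inv (z : bl) : forall l1 l2, base z = l1 ++ l2 ->
  exists z1 z2, z = z1 ++ z2 /\ base z1 = l1 /\ base z2 = l2.
Proof.
  induction z as [|c z IH]; intros l1 l2 H.
  - symmetry in H. apply app_eq_nil in H as [-> ->]. exists [], []. auto.
  - destruct l1 as [|x l1]; simpl in H.
    + exists [], (c :: z). auto.
    + injection H as Hx H. destruct (IH _ _ H) as (z1 & z2 & -> & <- & <-).
      exists (c :: z1), z2. simpl. rewrite Hx. auto.
Qed.

Lemma se_repeat z v p c : base z = repeat (v, p) c ->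
  sumw (se z) = length (se z) * v /\ sump (se z) = length (se z) * p /\ length (se z) <= c.
Proof.
  revert c; induction z as [|[x []] z IH]; intros c H.
  - unfold se; simpl. repeat split; lia.
  - destruct c; [discriminate|]. simpl in H. injection H as -> H. destruct (IH _ H) as (A & B & C).
    unfold se in *. simpl. rewrite sumw_cons, sump_cons, A, B. simpl. repeat split; lia.
  - destruct c; [discriminate|]. simpl in H. injection H as -> H. destruct (IH _ H) as (A & B & C).
    unfold se in *. simpl. repeat split; auto.
Qed.

Lemma bundles_complete w rl : forall z, base z = expand rl -> length (se z) <= 2 * w ->
  ach (bundles w rl) (sumw (se z)) (sump (se z)).
Proof.
  induction rl as [|[[v p] c] rl IH]; simpl; intros z Hz Hl.
  - destruct z; [constructor|discriminate].
  - destruct (base_app_inv _ _ _ Hz) as (z1 & z2 & -> & H1 & H2).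
    rewrite se_app, length_app in Hl. rewrite se_app, sumw_app, sump_app.
    apply ach_app; [|apply IH; auto; lia].
    destruct (se_repeat _ _ _ _ H1) as (A & B & C). simpl fst in *; simpl snd in *.
    destruct (bund_complete (Nat.min c (2 * w)) 1 (Nat.min c (2 * w)) v p (length (se z1))) as (s & S1 & S2 & S3); try lia.
    replace s with (length (se z1)) in S3 by lia. now rewrite A, B.
Qed.

Lemma bund_length_min w c v p : 0 < w ->
  length (bund (Nat.min c (2 * w)) 1 (Nat.min c (2 * w)) v p) <= Nat.log2 w + 2.
Proof.
  intros Hw. apply bund_length; [lia|].
  pose proof (Nat.log2_spec w Hw) as [_ H2]. replace (Nat.log2 w + 2) with (S (S (Nat.log2 w))) by lia.
  cbn [Nat.pow] in *. revert H2. generalize (2 ^ Nat.log2 w). intros X H2. lia.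
Qed.

Lemma bundles_length w rl : 0 < w -> length (bundles w rl) <= length rl * (Nat.log2 w + 2).
Proof.
  intros Hw. induction rl as [|[[v p] c] rl IH]; [simpl; auto|].
  change (bundles w ((v, p, c) :: rl))
    with (bund (Nat.min c (2 * w)) 1 (Nat.min c (2 * w)) v p ++ bundles w rl).
  rewrite length_app, length_cons. pose proof (bund_length_min w c v p Hw). lia.
Qed.

(** * Program segments *)

Notation "a +! b" := (EB OAdd a b) (at level 50, left associativity).
Notation "a -! b" := (EB OSub a b) (at level 50, left associativity).
Notation "a *! b" := (EB OMul a b) (at level 40, left associativity).
Notation "a /! b" := (EB ODiv a b) (at level 40, left associativity).
Notation "a <! b" := (EB OLt a b) (at level 70).
Notation "c ;; d" := (CSeq c d) (at level 90, right associativity).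
Notation "x ::= e" := (CAsg x e) (at level 80).
Definition incr (x : nat) : cmd := x ::= EV x +! EC 1.
Definition maxto (x : nat) (e : expr) : cmd := CIf (EV x <! e) (x ::= e) CSkip.

(** Symbolic execution of loop-free code: variable numbers are computed away, while values and array
    contents stay symbolic. *)
Ltac wsim := cbn [wps ev ok okop bopv truth falsity rg ar rp setr seta upd Nat.eqb incr maxto].
Ltac wsimh H := cbn [wps ev ok okop bopv truth falsity rg ar rp setr seta upd Nat.eqb incr maxto] in H.
Ltac frx F x := let E := fresh "E" in pose proof (proj1 F x eq_refl) as E; cbn [rg ar rp setr seta upd Nat.eqb] in E.
Ltac fra F a := let E := fresh "E" in pose proof (proj1 (proj2 F) a eq_refl) as E; cbn [rg ar rp setr seta upd Nat.eqb] in E.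

(* Variables: 0 n, 1 W, 3 wmax, 4 maxval, 5 log, 8 sqrt + 1, 15 remaining capacity,
   16 greedy profit + 1, 17/18 greedy break run and copies taken from it, 20 number
   of runs, 21-23 current run, 26 number of candidates, 27 side (0 = add, 1 = remove),
   30 table radius R, 31 table size 2R + 1, 38 power of two above wmax.
   Arrays: 0-2 items, 3/4 permutation, 5 copies kept per weight, 6 their cap, 7 number of
   classes of a group reaching a count, 8 group of a weight, 9-11 candidates (weight,
   profit, side), 12 random keys, 13/14 table (0 = unreachable, else profit + 1);
   while the runs are built and read, 15, 13, 14 hold their weights, profits and sizes. *)

Definition dit : item := ((0, 0), 0).
Definition inp (s : st) (W : nat) (items : list item) : Prop :=
  rg s 0 = length items /\ rg s 1 = W /\
  forall i, i < length items -> ar s 0 i = iw (nth i items dit) /\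
    ar s 1 i = ip (nth i items dit) /\ ar s 2 i = im (nth i items dit).

Lemma firstn_S_nth {A} (l : list A) d k : k < length l -> firstn (S k) l = firstn k l ++ [nth k l d].
Proof.
  revert k; induction l; intros k H; simpl in *; [lia|]. destruct k; simpl; auto.
  f_equal. apply IHl. lia.
Qed.
Lemma fold_max_snoc a l x : fold_right Nat.max a (l ++ [x]) = Nat.max x (fold_right Nat.max a l).
Proof. rewrite fold_right_app. simpl. induction l; simpl; lia. Qed.

(** * Parameters: maxima, logarithms, square root, key range *)

Section Prog.
Context (m : nat) (bits : list bool).
Notation tri := (tri m bits).
Notation wps := (wps m bits).

Definition stats_body : cmd :=
  6 ::= EA 0 (EV 2);; maxto 3 (EV 6);; maxto 4 (EV 6);;
  6 ::= EA 1 (EV 2);; maxto 4 (EV 6);;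
  6 ::= EA 2 (EV 2);; maxto 4 (EV 6);; incr 2.
Definition stats_init : cmd :=
  3 ::= EC 0;; 4 ::= EV 1;; maxto 4 (EV 0);; 2 ::= EC 0.
Definition stats : cmd := stats_init;; CWh (EV 2 <! EV 0) stats_body.

Lemma stats_spec W items s : inp s W items -> 64 + 16 * length items + 16 < m ->
  tri (length items * 100 + 100) stats s (fun s' =>
    rg s' 3 = wmax items /\ rg s' 4 = maxval W items).
Proof.
  intros (H0 & H1 & Hi) Hm. set (n := length items) in *.
  eapply tri_le; [eapply (tri_then _ _ 30) with
    (R := fun s' => rg s' 2 = 0 /\ rg s' 3 = 0 /\ rg s' 4 = Nat.max n W)|].
  - apply tri_wps; [|cbn; lia]. unfold stats_init. wsim. rewrite H0, H1. repeat split; intros; lia.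
  - intros s1 (A & B & C) F. frx F 0. fra F 0. fra F 1. fra F 2.
    apply (tri_for_then _ _
          (fun k s => rg s 2 = k /\ rg s 3 = wmax (firstn k items) /\
             rg s 4 = fold_right Nat.max (Nat.max n W)
               (map (fun it => Nat.max (iw it) (Nat.max (ip it) (im it))) (firstn k items))) n 80).
    + rewrite A, B, C. auto.
    + intros k s2 Hk (X & Y & Z) F2. frx F2 0. fra F2 0. fra F2 1. fra F2 2.
      destruct (Hi k Hk) as (I1 & I2 & I3).
      split; [wsim; lia|]. split; [wsim; lia|].
      apply tri_wps; [|cbn; lia].
      unfold stats_body, wmax in *. wsim. rewrite ?X.
      rewrite E4, E5, E6, E0, E1, E2, I1, I2, I3, Y, Z.
      rewrite (firstn_S_nth items dit k Hk), !map_app. cbn [map]. rewrite !fold_max_snoc.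
      repeat split; intros; try lia.
    + intros s2 (X & Y & Z) F2. frx F2 0. wsim. rewrite firstn_all2 in Y, Z by (unfold n; lia).
      repeat split; auto; lia.
  - cbn. lia.
Qed.

Lemma tri_init_for (I : nat -> st -> Prop) N C c1 e c s Q :
  wps c1 (I 0) s ->
  (forall k s', k < N -> I k s' -> fr (c1;; c) s s' ->
     ok m s' e /\ truth s' e /\ tri C c s' (I (S k))) ->
  (forall s', I N s' -> fr (c1;; c) s s' -> ok m s' e /\ falsity s' e /\ Q s') ->
  tri (csize c1 + (N * (C + esz e + 3) + esz e + 1)) (c1;; CWh e c) s Q.
Proof.
  intros H0 Hb He.
  assert (Hfr : forall s1 s2, fr c1 s s1 -> fr c s1 s2 -> fr (c1;; c) s s2).
  { intros s1 s2 F1 F2. eapply fr_trans; [eapply fr_sub; [| | |exact F1]|eapply fr_sub; [| | |exact F2]];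
      simpl; intros; apply orb_false_iff in H; tauto. }
  apply (tri_then _ _ _ _ _ _ _ (I 0)); [apply wps_tri, H0|].
  intros s1 H1 F1. apply (tri_for_then _ _ I); auto.
  - intros k s2 Hk HI F2. apply Hb; eauto.
  - intros s2 HI F2. apply He; eauto.
Qed.

Definition lg_body1 : cmd := 6 ::= EV 6 /! EC 2;; incr 5.
Definition lg_loop1 : cmd := (5 ::= EC 3;; 6 ::= EV 0);; CWh (EC 0 <! EV 6) lg_body1.
Lemma lg1_spec s : 0 < rg s 0 -> rg s 0 + 64 < m ->
  tri ((Nat.log2 (rg s 0) + 1) * 40 + 40) lg_loop1 s (fun s' => rg s' 5 = 4 + Nat.log2 (rg s 0)).
Proof.
  intros H0 Hm. set (n := rg s 0) in *.
  pose proof (Nat.log2_spec n H0) as [L1 L2].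
  assert (Hl : Nat.log2 n < n) by (apply Nat.log2_lt_lin; auto).
  eapply tri_le; [apply (tri_init_for (fun k s => rg s 5 = 3 + k /\ rg s 6 = n / 2 ^ k) (S (Nat.log2 n)) 20)|cbn; lia].
  - wsim. fold n. rewrite Nat.pow_0_r, Nat.div_1_r. repeat split; lia.
  - intros k s' Hk (A & B) F.
    assert (Hp : 0 < n / 2 ^ k).
    { apply Nat.div_str_pos. split; [pose proof (Nat.pow_nonzero 2 k); lia|].
      etransitivity; [|exact L1]. apply Nat.pow_le_mono_r; lia. }
    split; [wsim; lia|]. split; [wsim; lia|]. apply tri_wps; [|cbn; lia].
    unfold lg_body1. wsim. rewrite A, B. repeat split; try lia.
    rewrite Nat.Div0.div_div, Nat.mul_comm. f_equal.
  - intros s' (A & B) F. rewrite Nat.div_small in B by exact L2. wsim. repeat split; lia.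
Qed.

(** For x > 0, the least k with x < 2^(2^k), that is, how often 2 must be squared to exceed x.
    Repeated squaring takes about log log x steps; even log x steps, for the largest profit, would
    not be polylogarithmic in the input size. *)
Definition lglg (x : nat) : nat := if Nat.log2 x =? 0 then 0 else S (Nat.log2 (Nat.log2 x)).
Lemma lglg_lt x j : j < lglg x -> 2 ^ (2 ^ j) <= x.
Proof.
  unfold lglg. destruct (Nat.eqb_spec (Nat.log2 x) 0); [lia|]. intros Hj.
  pose proof (Nat.log2_spec (Nat.log2 x) ltac:(lia)) as [A _].
  assert (0 < x) by (apply Nat.neq_0_lt_0; intros ->; apply n; reflexivity).
  pose proof (Nat.log2_spec x ltac:(lia)) as [B _].
  etransitivity; [|exact B]. apply Nat.pow_le_mono_r; [lia|].
  etransitivity; [|exact A]. apply Nat.pow_le_mono_r; lia.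
Qed.
Lemma lglg_ge x : 0 < x -> x < 2 ^ (2 ^ lglg x).
Proof.
  intros Hx. pose proof (Nat.log2_spec x Hx) as [_ B].
  unfold lglg. destruct (Nat.eqb_spec (Nat.log2 x) 0) as [E|].
  - rewrite E in B. simpl in *. lia.
  - pose proof (Nat.log2_spec (Nat.log2 x) ltac:(lia)) as [_ A].
    eapply Nat.lt_le_trans; [exact B|]. apply Nat.pow_le_mono_r; lia.
Qed.

Definition lg_body2 : cmd := 7 ::= EV 7 *! EV 7;; incr 5.
Definition lg_loop2 : cmd := (7 ::= EC 2);; CWh (EV 7 <! EV 4 +! EC 1) lg_body2.
Lemma lg2_spec s : 0 < rg s 4 -> rg s 4 * rg s 4 + rg s 4 + rg s 5 + 64 < m ->
  tri (lglg (rg s 4) * 40 + 40) lg_loop2 s (fun s' => rg s' 5 = rg s 5 + lglg (rg s 4)).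
Proof.
  intros H0 Hm. set (x := rg s 4) in *.
  eapply tri_le; [apply (tri_init_for (fun k s' => rg s' 5 = rg s 5 + k /\ rg s' 7 = 2 ^ (2 ^ k)) (lglg x) 20)|cbn; lia].
  - wsim. fold x. repeat split; lia.
  - intros k s' Hk (A & B) F. frx F 4. fold x in E.
    pose proof (lglg_lt x k Hk).
    assert (k < x) by (pose proof (Nat.pow_gt_lin_r 2 k); pose proof (Nat.pow_gt_lin_r 2 (2 ^ k)); lia).
    split; [wsim; lia|]. split; [wsim; lia|]. apply tri_wps; [|cbn; lia].
    unfold lg_body2. wsim. rewrite A, B. repeat split; try nia.
    rewrite <- Nat.pow_add_r. f_equal. cbn [Nat.pow]. lia.
  - intros s' (A & B) F. frx F 4. fold x in E. pose proof (lglg_ge x H0). wsim. repeat split; lia.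
Qed.

Definition sq_loop : cmd := (8 ::= EC 0);; CWh (EV 8 *! EV 8 <! EV 3 +! EC 1) (incr 8).
Lemma sq_spec s : (rg s 3 + 1) * (rg s 3 + 1) + 64 < m ->
  tri (rg s 3 * 40 + 80) sq_loop s (fun s' => rg s' 8 = Nat.sqrt (rg s 3) + 1).
Proof.
  intros Hm. set (w := rg s 3) in *.
  pose proof (Nat.sqrt_spec w ltac:(lia)) as [A B]. pose proof (Nat.sqrt_le_lin w).
  eapply tri_le; [apply (tri_init_for (fun k s' => rg s' 8 = k) (S (Nat.sqrt w)) 20)|cbn; lia].
  - wsim. repeat split; lia.
  - intros k s' Hk X F. frx F 3. fold w in E.
    assert (k * k <= Nat.sqrt w * Nat.sqrt w) by (apply Nat.mul_le_mono; lia).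
    split; [wsim; rewrite X, E; nia|]. split; [wsim; rewrite X, E; lia|]. apply tri_wps; [|cbn; lia].
    wsim. rewrite X. repeat split; lia.
  - intros s' X F. frx F 3. fold w in E. wsim. rewrite X, E.
    assert (S (Nat.sqrt w) * S (Nat.sqrt w) <= (w + 1) * (w + 1)) by (apply Nat.mul_le_mono; lia).
    repeat split; lia.
Qed.

Definition G_loop : cmd := (38 ::= EC 1);; CWh (EV 38 <! EV 3) (38 ::= EV 38 +! EV 38).
Lemma G_spec s : 0 < rg s 3 -> 2 * rg s 3 + 64 < m ->
  tri (rg s 3 * 40 + 80) G_loop s (fun s' => rg s' 38 = 2 ^ Nat.log2_up (rg s 3)).
Proof.
  intros H0 Hm. set (w := rg s 3) in *.
  assert (Hl : Nat.log2_up w <= w) by (apply Nat.log2_up_le_lin; lia).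
  assert (HS : forall k, k < Nat.log2_up w -> 2 ^ k < w).
  { intros k Hk. destruct (Nat.eq_dec w 1) as [E|]; [rewrite E in Hk; change (Nat.log2_up 1) with 0 in Hk; lia|].
    pose proof (Nat.log2_up_spec w ltac:(lia)) as [A _]. eapply Nat.le_lt_trans; [|exact A].
    apply Nat.pow_le_mono_r; lia. }
  eapply tri_le; [apply (tri_init_for (fun k s' => rg s' 38 = 2 ^ k) (Nat.log2_up w) 20)|cbn; lia].
  - wsim. repeat split; lia.
  - intros k s' Hk X F. frx F 3. fold w in E. pose proof (HS k Hk).
    split; [wsim; auto|]. split; [wsim; rewrite X, E; lia|]. apply tri_wps; [|cbn; lia].
    wsim. rewrite X. cbn [Nat.pow]. repeat split; lia.
  - intros s' X F. frx F 3. fold w in E. wsim. rewrite X, E.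
    assert (w <= 2 ^ Nat.log2_up w).
    { destruct (Nat.eq_dec w 1) as [E1|]; [rewrite E1; simpl; lia|]. apply Nat.log2_up_spec; lia. }
    repeat split; lia.
Qed.
End Prog.

Definition seg (f : nat -> nat) (a b : nat) : list nat := map f (seq a (b - a)).
Lemma seg_snoc f a b : a <= b -> seg f a (S b) = seg f a b ++ [f b].
Proof.
  intros H. unfold seg. rewrite Nat.sub_succ_l, seq_S, map_app by auto. simpl. do 3 f_equal. lia.
Qed.
Lemma seg_nil f a : seg f a a = [].
Proof. unfold seg. now rewrite Nat.sub_diag. Qed.
Lemma seg_app f a b c : a <= b <= c -> seg f a c = seg f a b ++ seg f b c.
Proof.
  intros H. unfold seg. rewrite <- map_app. f_equal. replace (c - a) with ((b - a) + (c - b)) by lia.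
  rewrite seq_app. do 2 f_equal. lia.
Qed.
Lemma seg_ext f g a b : (forall x, a <= x < b -> f x = g x) -> seg f a b = seg g a b.
Proof. intros H. apply map_ext_in. intros x Hx. apply in_seq in Hx. apply H. lia. Qed.
Lemma updi_same f i v : updi f i v i = v.
Proof. unfold updi. destruct (Nat.eq_dec i i); congruence. Qed.
Lemma updi_diff f i v j : j <> i -> updi f i v j = f j.
Proof. intros H. unfold updi. destruct (Nat.eq_dec j i); congruence. Qed.

(** * Merge sort by efficiency *)

Section Sort.
Context (m : nat) (bits : list bool) (n : nat) (w p : nat -> nat).
Notation tri := (tri m bits).
Notation wps := (wps m bits).
Context (Hn : 0 < n) (Hm : 64 + 16 * n + 16 < m) (Hm2 : 4 * n + 64 < m)
  (Hwp : forall x y, x < n -> y < n -> p x * w y < m) (Hw : forall x, x < n -> 0 < w x).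

Definition bt (a b : nat) : Prop := p b * w a <= p a * w b.
Lemma bt_trans a b c : b < n -> bt a b -> bt b c -> bt a c.
Proof. intros Hb H1 H2. unfold bt in *. specialize (Hw b Hb). nia. Qed.

Definition takeI : cmd := CSto 4 (EV 14) (EA 3 (EV 2));; incr 2.
Definition takeJ : cmd := CSto 4 (EV 14) (EA 3 (EV 13));; incr 13.
Definition mbody : cmd :=
  CIf (EV 13 <! EV 12)
    (CIf (EV 2 <! EV 11)
      (CIf (EA 1 (EA 3 (EV 2)) *! EA 0 (EA 3 (EV 13)) <! EA 1 (EA 3 (EV 13)) *! EA 0 (EA 3 (EV 2)))
         takeJ takeI)
      takeJ)
    takeI;; incr 14.

Definition sorted (f : nat -> nat) (a b : nat) : Prop := forall x y, a <= x -> x < y -> y < b -> bt (f x) (f y).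

(** [A] is the source during the merge and [B0] the target before it. That every output entry is at
    least as efficient as all remaining ones of both halves is what allows the better head to be
    appended. *)
Definition minv (lo mid hi : nat) (A B0 : nat -> nat) (kk : nat) (s : st) : Prop :=
  exists i j, rg s 2 = i /\ rg s 13 = j /\ rg s 14 = lo + kk /\ lo <= i <= mid /\ mid <= j <= hi /\
    lo + kk + mid = i + j /\ sorted (ar s 4) lo (lo + kk) /\
    (forall x y, lo <= x < lo + kk -> i <= y < mid \/ j <= y < hi -> bt (ar s 4 x) (A y)) /\
    Permutation (seg (ar s 4) lo (lo + kk)) (seg A lo i ++ seg A mid j) /\
    (forall x, x < lo -> ar s 4 x = B0 x).

(** One lemma for all branches of [mbody]: c is the source index taken, from the left or from the
    right half. *)
Lemma minv_step lo mid hi A B0 kk s s' c :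
  hi <= n -> (forall x, x < n -> A x < n) -> sorted A lo mid -> sorted A mid hi ->
  minv lo mid hi A B0 kk s -> kk < hi - lo ->
  ar s' 4 = updi (ar s 4) (lo + kk) (A c) -> rg s' 14 = S (lo + kk) ->
  (c = rg s 2 /\ c < mid /\ rg s' 2 = S c /\ rg s' 13 = rg s 13 /\
     (rg s 13 < hi -> bt (A c) (A (rg s 13))) \/
   c = rg s 13 /\ c < hi /\ rg s' 2 = rg s 2 /\ rg s' 13 = S c /\
     (rg s 2 < mid -> bt (A c) (A (rg s 2)))) ->
  minv lo mid hi A B0 (S kk) s'.
Proof.
  intros Hhi HA S1 S2 (i & j & Ei & Ej & Ek & Hi & Hj & Hsum & HS & HX & HP & HL) Hkk E4 E14 Hc.
  rewrite Ei, Ej in Hc.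
  assert (Hc' : forall y, (c = i /\ c < mid /\ (S i <= y < mid \/ j <= y < hi) \/
     c = j /\ c < hi /\ (i <= y < mid \/ S j <= y < hi)) -> bt (A c) (A y)).
  { intros y Hy. destruct Hc as [(-> & Hcm & _ & _ & Hb)|(-> & Hch & _ & _ & Hb)].
    - assert (Hy' : S i <= y < mid \/ j <= y < hi) by lia. destruct Hy' as [Hy'|Hy'].
      + apply S1; lia.
      + specialize (Hb ltac:(lia)). destruct (Nat.eq_dec y j) as [->|]; auto.
        apply bt_trans with (A j); [apply HA; lia|auto|]. apply S2; lia.
    - assert (Hy' : i <= y < mid \/ S j <= y < hi) by lia. destruct Hy' as [Hy'|Hy'].
      + specialize (Hb ltac:(lia)). destruct (Nat.eq_dec y i) as [->|]; auto.
        apply bt_trans with (A i); [apply HA; lia|auto|]. apply S1; lia.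
      + apply S2; lia. }
  assert (Hcin : i <= c < mid \/ j <= c < hi) by lia.
  assert (HS' : sorted (ar s' 4) lo (lo + S kk)).
  { intros x y Hx Hxy Hy. rewrite E4. destruct (Nat.eq_dec y (lo + kk)) as [->|Hne].
    - rewrite updi_same, updi_diff by lia. apply HX; [lia|auto].
    - rewrite !updi_diff by lia. apply HS; lia. }
  assert (HL' : forall x, x < lo -> ar s' 4 x = B0 x).
  { intros x Hx. rewrite E4, updi_diff by lia. auto. }
  assert (Hseg : seg (ar s' 4) lo (lo + S kk) = seg (ar s 4) lo (lo + kk) ++ [A c]).
  { rewrite Nat.add_succ_r, seg_snoc by lia. f_equal.
    - apply seg_ext. intros x Hx. rewrite E4, updi_diff by lia. auto.
    - now rewrite E4, updi_same. }
  destruct Hc as [(-> & Hcm & A2 & A13 & Hb)|(-> & Hch & A2 & A13 & Hb)].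
  - exists (S i), j. repeat split; auto; try lia.
    + intros x y Hx Hy. rewrite E4. destruct (Nat.eq_dec x (lo + kk)) as [->|Hne].
      * rewrite updi_same. apply Hc'. left. lia.
      * rewrite updi_diff by auto. apply HX; lia.
    + rewrite Hseg, HP, seg_snoc by lia. rewrite <- !app_assoc. apply Permutation_app_head, Permutation_app_comm.
  - exists i, (S j). repeat split; auto; try lia.
    + intros x y Hx Hy. rewrite E4. destruct (Nat.eq_dec x (lo + kk)) as [->|Hne].
      * rewrite updi_same. apply Hc'. right. lia.
      * rewrite updi_diff by auto. apply HX; lia.
    + rewrite Hseg, HP, seg_snoc by lia. now rewrite app_assoc.
Qed.

Definition mloop : cmd := (2 ::= EV 10;; 13 ::= EV 11;; 14 ::= EV 10);; CWh (EV 14 <! EV 12) mbody.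

Lemma merge_spec s lo mid hi :
  (forall x, x < n -> ar s 0 x = w x) -> (forall x, x < n -> ar s 1 x = p x) ->
  (forall x, x < n -> ar s 3 x < n) ->
  rg s 10 = lo -> rg s 11 = mid -> rg s 12 = hi -> lo <= mid -> mid <= hi -> hi <= n ->
  sorted (ar s 3) lo mid -> sorted (ar s 3) mid hi ->
  tri ((hi - lo) * 300 + 100) mloop s (fun s' =>
    sorted (ar s' 4) lo hi /\ Permutation (seg (ar s' 4) lo hi) (seg (ar s 3) lo hi) /\
    (forall x, x < lo -> ar s' 4 x = ar s 4 x)).
Proof.
  intros H0 H1 H3 E10 E11 E12 Hlm Hmh Hhn S1 S2.
  eapply tri_le; [apply (tri_init_for _ _ (minv lo mid hi (ar s 3) (ar s 4)) (hi - lo) 250)|cbn; lia].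
  - wsim. repeat split. exists lo, mid. wsim. rewrite !Nat.add_0_r, !seg_nil.
    repeat split; auto; try lia. intros x y Hx; lia.
  - intros k s' Hk HI F. frx F 10. frx F 11. frx F 12. fra F 0. fra F 1. fra F 3.
    pose proof HI as (i & j & Ei & Ej & Ek & Hi & Hj & Hsum & _).
    split; [wsim; auto|]. split; [wsim; lia|].
    apply tri_wps; [|cbn; lia].
    assert (Ai : i < n -> ar s 3 i < n) by apply H3. assert (Aj : j < n -> ar s 3 j < n) by apply H3.
    assert (HI' : forall c s2, ar s2 4 = updi (ar s' 4) (lo + k) (ar s 3 c) -> rg s2 14 = S (lo + k) ->
      (c = i /\ c < mid /\ rg s2 2 = S c /\ rg s2 13 = j /\ (j < hi -> bt (ar s 3 c) (ar s 3 j)) \/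
       c = j /\ c < hi /\ rg s2 2 = i /\ rg s2 13 = S c /\ (i < mid -> bt (ar s 3 c) (ar s 3 i))) ->
      minv lo mid hi (ar s 3) (ar s 4) (S k) s2).
    { intros c s2 X1 X2 X3. eapply minv_step; eauto. rewrite Ei, Ej. exact X3. }
    unfold mbody, takeI, takeJ. wsim. rewrite E2, E3, E4, Ei, Ej, E0, E1, Ek, E11, E12.
    repeat split; intros; try lia.
    all: try (apply (HI' i); wsim; [reflexivity|lia|left; repeat split; auto; try lia]).
    all: try (apply (HI' j); wsim; [reflexivity|lia|right; repeat split; auto; try lia]).
    all: rewrite ?H0, ?H1 in * by (try apply Ai; try apply Aj; lia).
    all: try (apply Hwp; [apply Ai|apply Aj]; lia).
    all: try (apply Hwp; [apply Aj|apply Ai]; lia).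
    all: try (unfold bt; lia).
    all: try (specialize (Ai ltac:(lia)); lia).
    all: try (specialize (Aj ltac:(lia)); lia).
  - intros s' (i & j & Ei & Ej & Ek & Hi & Hj & Hsum & HS & HX & HP & HL) F.
    frx F 12. wsim. replace (lo + (hi - lo)) with hi in * by lia.
    assert (Xi : i = mid) by lia. assert (Xj : j = hi) by lia. rewrite Xi, Xj in HP.
    rewrite <- (seg_app (ar s 3) lo mid hi) in HP by lia. repeat split; auto; lia.
Qed.

(** Equal quotients by [wd] mean the same aligned block; each pass of the bottom-up merge doubles
    [wd]. *)
Definition blocks (f : nat -> nat) (wd e : nat) : Prop :=
  forall x y, x < y -> y < e -> x / wd = y / wd -> bt (f x) (f y).

Definition pbody : cmd :=
  (11 ::= EV 10 +! EV 9;; CIf (EV 0 <! EV 11) (11 ::= EV 0) CSkip;;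
   12 ::= EV 11 +! EV 9;; CIf (EV 0 <! EV 12) (12 ::= EV 0) CSkip);;
  mloop;; (10 ::= EV 12).
Definition ploop : cmd := (10 ::= EC 0);; CWh (EV 10 <! EV 0) pbody.

Definition pinv (wd : nat) (A : nat -> nat) (k : nat) (s : st) : Prop :=
  rg s 10 = Nat.min n (k * (2 * wd)) /\ blocks (ar s 4) (2 * wd) (rg s 10) /\ Permutation (seg (ar s 4) 0 (rg s 10)) (seg A 0 (rg s 10)).

Definition sorts (s : st) : Prop :=
  rg s 0 = n /\ (forall x, x < n -> ar s 0 x = w x) /\ (forall x, x < n -> ar s 1 x = p x) /\ (forall x, x < n -> ar s 3 x < n).

Lemma div_in k wd x : k * wd <= x < k * wd + wd -> x / wd = k.
Proof. intros H. symmetry. apply (Nat.div_unique _ _ _ (x - k * wd)); lia. Qed.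

Lemma pass_spec s wd : sorts s -> rg s 9 = wd -> 0 < wd -> wd < n -> blocks (ar s 3) wd n ->
  tri (n * 2000 + 500) ploop s (fun s' => blocks (ar s' 4) (2 * wd) n /\ Permutation (seg (ar s' 4) 0 n) (seg (ar s 3) 0 n)).
Proof.
  intros (Z0 & Z1 & Z2 & Z3) E9 Hwd Hwdn HB.
  (* The number of block pairs, n / (2 wd) rounded up. *)
  set (N := (n - 1) / (2 * wd) + 1).
  pose proof (Nat.Div0.mul_div_le (n - 1) (2 * wd)) as D1.
  pose proof (Nat.div_mod (n - 1) (2 * wd) ltac:(lia)) as D2.
  pose proof (Nat.mod_upper_bound (n - 1) (2 * wd) ltac:(lia)) as D3.
  assert (HN : N * (2 * wd) <= 3 * n) by (unfold N; nia).
  assert (HNn : N <= n) by (unfold N; nia).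
  assert (HN2 : n <= N * (2 * wd)) by (unfold N; nia).
  assert (HNk : forall k, k < N -> k * (2 * wd) < n) by (intros k Hk; unfold N in Hk; nia).
  eapply tri_le; [apply (tri_init_for _ _ (pinv wd (ar s 3)) N (2 * wd * 300 + 200))|cbn; nia].
  - wsim. split; [lia|]. unfold pinv. wsim. rewrite !seg_nil. split; [lia|split; [|auto]].
    intros x y _ H; lia.
  - intros k s' Hk (P1 & P2 & P3) F. frx F 0. frx F 9. fra F 0. fra F 1. fra F 3.
    specialize (HNk k Hk). rewrite Nat.min_r in P1 by lia. set (lo := k * (2 * wd)) in *.
    split; [wsim; auto|]. split; [wsim; lia|].
    eapply tri_le; [apply (tri_then _ _ 60 (2 * wd * 300 + 120) _ _ _ (fun s2 =>
       rg s2 11 = Nat.min (lo + wd) n /\ rg s2 12 = Nat.min (lo + 2 * wd) n))|lia].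
    + apply tri_wps; [|cbn; lia]. wsim. rewrite E, E0, Z0, E9, P1. repeat split; intros; lia.
    + intros s2 (M1 & M2) F2. frx F2 10. fra F2 0. fra F2 1. fra F2 3. fra F2 4.
      set (mid := Nat.min (lo + wd) n) in *. set (hi := Nat.min (lo + 2 * wd) n) in *.
      eapply tri_le; [apply (tri_then _ _ ((hi - lo) * 300 + 100) 10 _ _ _ _ _ (merge_spec s2 lo mid hi
         ltac:(rewrite E5, E1; auto) ltac:(rewrite E6, E2; auto) ltac:(rewrite E7, E3; auto)
         ltac:(lia) M1 M2 ltac:(lia) ltac:(lia) ltac:(lia)
         ltac:(rewrite E7, E3; intros x y X1 X2 X3; apply HB; [lia|lia|rewrite (div_in (2 * k) wd x), (div_in (2 * k) wd y); lia])
         ltac:(rewrite E7, E3; intros x y X1 X2 X3; apply HB; [lia|lia|rewrite (div_in (2 * k + 1) wd x), (div_in (2 * k + 1) wd y); lia])))|].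
      * intros s3 (S1 & S2 & S3) F3. frx F3 12. apply tri_wps; [|cbn; lia]. wsim. split; auto.
        unfold pinv. wsim. rewrite E10, M2. rewrite E7, E3 in S2. split; [rewrite Nat.mul_succ_l; fold lo; unfold hi; lia|]. split.
        -- intros x y X1 X2 X3. destruct (Nat.lt_ge_cases y lo) as [h|h].
           ++ rewrite !S3, E8 by lia. apply P2; lia.
           ++ destruct (Nat.lt_ge_cases x lo) as [h2|h2]; [|apply S1; lia].
              exfalso. rewrite (div_in k (2 * wd) y) in X3 by (fold lo; lia).
              assert (x / (2 * wd) < k); [|lia]. apply Nat.Div0.div_lt_upper_bound; lia.
        -- rewrite (seg_app (ar s3 4) 0 lo hi), (seg_app (ar s 3) 0 lo hi) by lia.
           apply Permutation_app; auto. rewrite P1 in P3. rewrite <- P3.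
           rewrite (seg_ext (ar s3 4) (ar s' 4)); [reflexivity|]. intros x Hx. rewrite S3, E8 by lia. reflexivity.
      * lia.
  - intros s' (P1 & P2 & P3) F. frx F 0. rewrite Nat.min_l in P1 by lia. rewrite P1 in *.
    wsim. repeat split; auto; lia.
Qed.

Definition cbody : cmd := CSto 3 (EV 10) (EA 4 (EV 10));; incr 10.
Definition cloop : cmd := (10 ::= EC 0);; CWh (EV 10 <! EV 0) cbody.
Lemma copy_spec s : rg s 0 = n ->
  tri (n * 60 + 60) cloop s (fun s' => forall x, x < n -> ar s' 3 x = ar s 4 x).
Proof.
  intros Z0.
  eapply tri_le; [apply (tri_init_for _ _ (fun k s' => rg s' 10 = k /\ forall x, x < k -> ar s' 3 x = ar s 4 x) n 40)|cbn; lia].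
  - wsim. repeat split; lia.
  - intros k s' Hk (A & B) F. frx F 0. fra F 4.
    split; [wsim; auto|]. split; [wsim; lia|]. apply tri_wps; [|cbn; lia].
    unfold cbody. wsim. rewrite A, E0. repeat split; try lia.
    intros x Hx. destruct (Nat.eq_dec x k) as [->|]; [now rewrite updi_same|]. rewrite updi_diff by auto. apply B; lia.
  - intros s' (A & B) F. frx F 0. wsim. repeat split; auto; lia.
Qed.

Definition ibody : cmd := CSto 3 (EV 10) (EV 10);; incr 10.
Definition iloop : cmd := (10 ::= EC 0);; CWh (EV 10 <! EV 0) ibody.
Lemma init_spec s : rg s 0 = n ->
  tri (n * 60 + 60) iloop s (fun s' => forall x, x < n -> ar s' 3 x = x).
Proof.
  intros Z0.
  eapply tri_le; [apply (tri_init_for _ _ (fun k s' => rg s' 10 = k /\ forall x, x < k -> ar s' 3 x = x) n 40)|cbn; lia].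
  - wsim. repeat split; lia.
  - intros k s' Hk (A & B) F. frx F 0.
    split; [wsim; auto|]. split; [wsim; lia|]. apply tri_wps; [|cbn; lia].
    unfold ibody. wsim. rewrite A. repeat split; try lia.
    intros x Hx. destruct (Nat.eq_dec x k) as [->|]; [now rewrite updi_same|]. rewrite updi_diff by auto. apply B; lia.
  - intros s' (A & B) F. frx F 0. wsim. repeat split; auto; lia.
Qed.

Definition wbody : cmd := ploop;; cloop;; (9 ::= EV 9 +! EV 9).
Definition sort_prog : cmd := iloop;; (9 ::= EC 1);; CWh (EV 9 <! EV 0) wbody.

Lemma seg_id_lt f : Permutation (seg f 0 n) (seq 0 n) -> forall x, x < n -> f x < n.
Proof.
  intros H x Hx. assert (Hin : In (f x) (seq 0 n)).
  { apply (Permutation_in _ H). apply in_map, in_seq. lia. }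
  apply in_seq in Hin. lia.
Qed.

Theorem sort_spec s : rg s 0 = n -> (forall x, x < n -> ar s 0 x = w x) -> (forall x, x < n -> ar s 1 x = p x) ->
  tri ((n + 1) * 4000 * (Nat.log2_up n + 1)) sort_prog s (fun s' =>
    sorted (ar s' 3) 0 n /\ Permutation (seg (ar s' 3) 0 n) (seq 0 n)).
Proof.
  intros Z0 Z1 Z2.
  eapply tri_le; [apply (tri_then _ _ _ ((Nat.log2_up n) * (n * 2100 + 900) + 50) _ _ _ _ _ (init_spec s Z0))|nia].
  intros s1 HA F1. frx F1 0. fra F1 0. fra F1 1.
  assert (HS : forall k, k < Nat.log2_up n -> 2 ^ k < n).
  { intros k Hk. destruct (Nat.eq_dec n 1) as [X|]; [exfalso; rewrite X in Hk; change (Nat.log2_up 1) with 0 in Hk; lia|].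
    pose proof (Nat.log2_up_spec n ltac:(lia)) as [A _]. eapply Nat.le_lt_trans; [|exact A].
    apply Nat.pow_le_mono_r; lia. }
  assert (HS2 : n <= 2 ^ Nat.log2_up n).
  { destruct (Nat.eq_dec n 1) as [X|]; [rewrite X; simpl; lia|]. apply Nat.log2_up_spec; lia. }
  unfold sort_prog.
  assert (Hinit : seg (ar s1 3) 0 n = seq 0 n).
  { unfold seg. rewrite Nat.sub_0_r. rewrite <- (map_id (seq 0 n)) at 2. apply map_ext_in.
    intros x Hx. apply in_seq in Hx. apply HA. lia. }
  eapply tri_le; [apply (tri_init_for _ _ (fun k s' => rg s' 9 = 2 ^ k /\ blocks (ar s' 3) (2 ^ k) n /\
      Permutation (seg (ar s' 3) 0 n) (seq 0 n)) (Nat.log2_up n) (n * 2070 + 800))|cbn; nia].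
  - wsim. repeat split; auto; try lia; [|now rewrite Hinit].
    intros x y X1 X2 X3. rewrite !Nat.pow_0_r, !Nat.div_1_r in X3. lia.
  - intros k s' Hk (P1 & P2 & P3) F. frx F 0. fra F 0. fra F 1. specialize (HS k Hk).
    split; [wsim; auto|]. split; [wsim; lia|].
    assert (Hpos : 0 < 2 ^ k) by (pose proof (Nat.pow_nonzero 2 k); lia).
    assert (Hsorts : sorts s').
    { split; [lia|]. split; [|split]; [rewrite E3, E0; auto|rewrite E4, E1; auto|].
      apply seg_id_lt; auto. }
    eapply tri_le; [apply (tri_then _ _ _ (n * 60 + 100) _ _ _ _ _ (pass_spec s' _ Hsorts P1 Hpos HS P2))|lia].
    intros s2 (Q1 & Q2) F2. frx F2 0. frx F2 9.
    eapply tri_le; [apply (tri_then _ _ _ 20 _ _ _ _ _ (copy_spec s2 ltac:(lia)))|lia].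
    intros s3 HC F3. frx F3 9.
    apply tri_wps; [|cbn; lia]. wsim. rewrite E7, E6, P1. cbn [Nat.pow].
    assert (Hseg : seg (ar s3 3) 0 n = seg (ar s2 4) 0 n) by (apply seg_ext; intros; apply HC; lia).
    repeat split; try lia.
    + intros x y X1 X2 X3. rewrite !HC by lia. apply Q1; auto.
    + rewrite Hseg, Q2. exact P3.
  - intros s' (P1 & P2 & P3) F. frx F 0. wsim. repeat split; try lia; auto.
    intros x y X1 X2 X3. apply P2; auto. rewrite !Nat.div_small; lia.
Qed.
End Sort.

(** * Runs of equal copies and the greedy prefix *)

Definition dr : runT := ((0, 0), 0).

Lemma expand_app r1 r2 : expand (r1 ++ r2) = expand r1 ++ expand r2.
Proof. apply flat_map_app. Qed.
Lemma sumw_repeat v p c : sumw (repeat (v, p) c) = c * v.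
Proof. unfold sumw. induction c; simpl in *; lia. Qed.
Lemma sump_repeat v p c : sump (repeat (v, p) c) = c * p.
Proof. unfold sump. induction c; simpl in *; lia. Qed.
Lemma expand_one v p c : expand [((v, p), c)] = repeat (v, p) c.
Proof. unfold expand. simpl. apply app_nil_r. Qed.
Lemma rev_expand r : rev (expand r) = expand (rev r).
Proof.
  induction r as [|[x c] r IH]; simpl; auto.
  rewrite rev_app_distr, IH, expand_app, rev_repeat. f_equal. unfold expand. simpl. now rewrite app_nil_r.
Qed.

(** The greedy prefix ends inside run [brk] after [xx] of its copies. [leftl] lists the prefix
    backwards from the break, the order in which removals look like additions (see [flip]). *)
Definition rightl (brk xx : nat) (rl : list runT) : list runT :=
  match skipn brk rl with [] => [] | (x, c) :: t => (x, c - xx) :: t end.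
Definition leftl (brk xx : nat) (rl : list runT) : list runT :=
  (match skipn brk rl with [] => [] | (x, c) :: _ => [(x, xx)] end) ++ rev (firstn brk rl).
Definition pref (brk xx : nat) (rl : list runT) : list (nat * nat) :=
  expand (firstn brk rl) ++ match skipn brk rl with [] => [] | (x, c) :: _ => repeat x xx end.

Lemma expand_leftl brk xx rl : expand (leftl brk xx rl) = rev (pref brk xx rl).
Proof.
  unfold leftl, pref. rewrite expand_app, rev_app_distr, rev_expand. f_equal.
  destruct (skipn brk rl) as [|[x c] t]; auto. rewrite rev_repeat. unfold expand. simpl. apply app_nil_r.
Qed.
Lemma expand_rightl brk xx rl :
  (match skipn brk rl with [] => True | (x, c) :: _ => xx <= c end) ->
  expand rl = pref brk xx rl ++ expand (rightl brk xx rl).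
Proof.
  intros H. unfold pref, rightl. rewrite <- app_assoc.
  rewrite <- (firstn_skipn brk rl) at 1. rewrite expand_app. f_equal.
  destruct (skipn brk rl) as [|[x c] t]; auto. unfold expand. simpl. rewrite app_assoc, <- repeat_app.
  do 2 f_equal. lia.
Qed.

Lemma skipn_nth {A} (l : list A) d k : k < length l -> skipn k l = nth k l d :: skipn (S k) l.
Proof.
  revert k; induction l; intros k H; simpl in *; [lia|]. destruct k; simpl; auto. apply IHl. lia.
Qed.

Section RunList.
Context (n : nat) (A w p c : nat -> nat).
Definition rl : list runT := map (fun a => ((w a, p a), c a)) (seg A 0 n).
Lemma rl_length : length rl = n.
Proof. unfold rl, seg. rewrite !length_map, length_seq. lia. Qed.
Lemma rl_nth k : k < n -> nth k rl dr = ((w (A k), p (A k)), c (A k)).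
Proof.
  intros H. unfold rl.
  rewrite nth_indep with (d' := (fun a => ((w a, p a), c a)) 0) by (fold rl; now rewrite rl_length).
  rewrite (map_nth (fun a => ((w a, p a), c a))). unfold seg. rewrite Nat.sub_0_r.
  rewrite nth_indep with (d' := A 0) by (now rewrite length_map, length_seq).
  rewrite (map_nth A), seq_nth by auto. reflexivity.
Qed.

Lemma sum_prefix j : j < n ->
  sumw (expand (firstn (S j) rl)) = sumw (expand (firstn j rl)) + c (A j) * w (A j) /\
  sump (expand (firstn (S j) rl)) = sump (expand (firstn j rl)) + c (A j) * p (A j).
Proof.
  intros Hj. rewrite (firstn_S_nth rl dr j) by (now rewrite rl_length).
  rewrite rl_nth, expand_app, expand_one, sumw_app, sump_app, sumw_repeat, sump_repeat by auto. auto.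
Qed.
Lemma sump_prefix_le j : sump (expand (firstn j rl)) <= sump (expand rl).
Proof. rewrite <- (firstn_skipn j rl) at 2. rewrite expand_app, sump_app. lia. Qed.

End RunList.

Section Greedy.
Context (m : nat) (bits : list bool) (n W : nat) (A w p c : nat -> nat).
Notation tri := (tri m bits).
Notation wps := (wps m bits).
Notation rl := (rl n A w p c).
Context (Hn : 0 < n) (Hm : 64 + 16 * n + 64 < m) (HA : forall x, x < n -> A x < n)
  (Hw : forall x, x < n -> 0 < w x) (Hcw : forall x, x < n -> c x * w x < m)
  (Hcp : forall x, x < n -> c x * p x < m) (HWm : W < m) (HPm : 1 + sump (expand rl) < m).

Definition gbody : cmd :=
  CIf (EV 17 <! EV 0)
    (6 ::= EA 2 (EA 3 (EV 17)) *! EA 0 (EA 3 (EV 17));;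
     CIf (EV 15 <! EV 6) (19 ::= EC 0)
       (15 ::= EV 15 -! EV 6;; 16 ::= EV 16 +! EA 2 (EA 3 (EV 17)) *! EA 1 (EA 3 (EV 17));; incr 17))
    (19 ::= EC 0).
Definition gfin : cmd :=
  CIf (EV 17 <! EV 0)
    (18 ::= EV 15 /! EA 0 (EA 3 (EV 17));;
     15 ::= EV 15 -! EV 18 *! EA 0 (EA 3 (EV 17));;
     16 ::= EV 16 +! EV 18 *! EA 1 (EA 3 (EV 17))) CSkip.
Definition greedy : cmd :=
  (15 ::= EV 1;; 16 ::= EC 1;; 17 ::= EC 0;; 18 ::= EC 0;; 19 ::= EC 1);;
  CWh (EC 0 <! EV 19) gbody;; gfin.

Definition arrs (s : st) : Prop :=
  rg s 0 = n /\ (forall x, x < n -> ar s 0 x = w x) /\ (forall x, x < n -> ar s 1 x = p x) /\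
  (forall x, x < n -> ar s 2 x = c x) /\ (forall x, x < n -> ar s 3 x = A x).

Definition ginv (k : nat) (s : st) : Prop :=
  exists j, rg s 17 = j /\ j <= n /\ arrs s /\ rg s 18 = 0 /\
    rg s 15 + sumw (expand (firstn j rl)) = W /\ rg s 16 = 1 + sump (expand (firstn j rl)) /\
    (rg s 19 = 1 /\ k = (n - j + 1) * 200 \/
     rg s 19 = 0 /\ k = 0 /\ (j < n -> rg s 15 < c (A j) * w (A j))).

(** The strict [xx < k] leaves a copy of the broken run on the right side, and this is the copy that
    no longer fits. *)
Definition gpost (s : st) : Prop :=
  exists brk xx, rg s 17 = brk /\ rg s 18 = xx /\ brk <= n /\
    (match skipn brk rl with [] => True | (x, k) :: _ => xx < k /\ W < sumw (pref brk xx rl) + fst x end) /\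
    rg s 15 + sumw (pref brk xx rl) = W /\ rg s 16 = 1 + sump (pref brk xx rl).

Lemma greedy_spec s : arrs s -> rg s 1 = W -> tri (n * 200 + 600) greedy s gpost.
Proof.
  intros HAr H1.
  eapply tri_le; [apply (tri_then _ _ 15 ((n - 0 + 1) * 200 + 4 + 150) _ _ _ (ginv ((n - 0 + 1) * 200)))|lia].
  - apply tri_wps; [|cbn; lia]. wsim. repeat split; try lia. exists 0. wsim. simpl firstn.
    change (expand []) with (@nil (nat * nat)). unfold sumw, sump. simpl list_sum.
    destruct HAr as (Z0 & Z1 & Z2 & Z3 & Z4). unfold arrs. wsim. repeat split; auto; try lia.
  - intros s1 HI _.
    assert (HB : forall k s, ginv k s -> ok m s (EC 0 <! EV 19) /\
      (truth s (EC 0 <! EV 19) -> exists t, tri t gbody s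
         (fun s' => exists k', ginv k' s' /\ t + esz (EC 0 <! EV 19) + 3 + k' <= k))).
    { clear s1 HI. intros k s1 (j & E17 & Hj & (Z0 & Z1 & Z2 & Z3 & Z4) & E18 & E15 & E16 & Hgo).
      split; [wsim; lia|]. wsim. intros Hlt.
      destruct Hgo as [[E19 Ek]|[E19 _]]; [|lia].
      exists 180. apply tri_wps; [|cbn; lia]. unfold gbody. wsim. rewrite E17, Z0.
      split; [auto|]. split.
      * intros Hjn. rewrite !Z4, !Z3, !Z1, !Z2 by (try apply HA; auto). pose proof (HA j Hjn).
        pose proof (Hcw _ H). pose proof (Hcp _ H). pose proof (sum_prefix n A w p c j Hjn) as [S1 S2].
        pose proof (sump_prefix_le n A w p c (S j)).
        repeat split; try lia.
        -- exists 0. split; [|cbn; nia].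
           exists j. wsim. repeat split; auto.
        -- exists ((n - S j + 1) * 200). split; [|cbn; nia].
           exists (S j). wsim. rewrite S1, S2. repeat split; auto; try lia.
      * intros Hjn. split; [lia|]. exists 0. split; [|cbn; nia].
        exists j. wsim. repeat split; auto. right. repeat split; auto. lia. }
    eapply tri_le; [apply (tri_then _ _ ((n - 0 + 1) * 200 + 3 + 1) 150 _ _ _ _ _
       (tri_while _ _ ginv (EC 0 <! EV 19) gbody HB _ _ HI))|lia].
    intros s2 (k & _ & (j & E17 & Hj & (Z0 & Z1 & Z2 & Z3 & Z4) & E18 & E15 & E16 & Hgo) & Hf) _.
      apply tri_wps; [|cbn; lia]. unfold gfin. wsim. rewrite E17, Z0.
      cbn [falsity ev] in Hf. destruct Hgo as [[E19 _]|(E19 & _ & Hst)]; [lia|].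
      split; [auto|]. split.
      * intros Hjn. specialize (Hst Hjn). rewrite !Z4, !Z1, !Z2 by (try apply HA; auto). pose proof (HA j Hjn) as HAj.
        specialize (Hw _ HAj). pose proof (Hcp _ HAj). pose proof (sum_prefix n A w p c j Hjn) as [S1 S2].
        pose proof (sump_prefix_le n A w p c (S j)).
        set (xx := rg s2 15 / w (A j)).
        assert (Hd1 : xx * w (A j) <= rg s2 15) by (rewrite Nat.mul_comm; apply Nat.Div0.mul_div_le).
        assert (Hd2 : rg s2 15 < xx * w (A j) + w (A j)).
        { pose proof (Nat.div_mod (rg s2 15) (w (A j)) ltac:(lia)).
          pose proof (Nat.mod_upper_bound (rg s2 15) (w (A j)) ltac:(lia)). fold xx in H1. lia. }
        (* The whole run exceeded the remaining capacity, so the quotient is smaller than its number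
           of copies. *)
        assert (Hxx : xx < c (A j)) by nia.
        assert (Hxp : xx * p (A j) <= c (A j) * p (A j)) by (apply Nat.mul_le_mono_r; lia).
        repeat split; try lia.
        exists j, xx. wsim. unfold pref. rewrite (skipn_nth rl dr j), rl_nth by (rewrite ?rl_length; auto).
        rewrite sumw_app, sump_app, sumw_repeat, sump_repeat. repeat split; auto; try lia. simpl fst; lia.
      * intros Hjn. exists j, 0. unfold pref. rewrite skipn_all2 by (rewrite rl_length; lia).
        rewrite app_nil_r. repeat split; auto.
Qed.
End Greedy.

Definition runsUpTo (s : st) (R : list runT) (k : nat) : Prop :=
  rg s 20 = k /\ forall i, i < k ->
    ar s 15 i = fst (fst (nth i R dr)) /\ ar s 13 i = snd (fst (nth i R dr)) /\ ar s 14 i = snd (nth i R dr).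

(** * Listing the runs on both sides of the break *)

Section Runs.
Context (m : nat) (bits : list bool) (n : nat) (A w p c : nat -> nat).
Notation tri := (tri m bits).
Notation rl := (rl n A w p c).
Notation arrs := (arrs n A w p c).
Context (Hn : 0 < n) (Hm : 64 + 16 * n + 64 < m) (HA : forall x, x < n -> A x < n).

Lemma rightl_length brk xx : brk <= n -> length (rightl brk xx rl) = n - brk.
Proof.
  intros H. unfold rightl. pose proof (length_skipn brk rl) as X. rewrite rl_length in X.
  rewrite <- X. destruct (skipn brk rl) as [|[x k] t]; reflexivity.
Qed.
Lemma rightl_nth brk xx i : brk + i < n ->
  nth i (rightl brk xx rl) dr = ((w (A (brk + i)), p (A (brk + i))), c (A (brk + i)) - (if i =? 0 then xx else 0)).
Proof.
  intros H. unfold rightl. rewrite (skipn_nth rl dr brk), rl_nth by (rewrite ?rl_length; lia).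
  destruct i as [|i].
  - simpl. now rewrite Nat.add_0_r.
  - cbn [nth Nat.eqb]. rewrite nth_skipn, Nat.sub_0_r.
    replace (S brk + i) with (brk + S i) by lia. rewrite rl_nth; auto.
Qed.

Definition it (a i : nat) : expr := EA a (EA 3 (EV i)).
Definition rbody : cmd :=
  CSto 15 (EV 20) (it 0 2);; CSto 13 (EV 20) (it 1 2);; CSto 14 (EV 20) (it 2 2 -! EV 6);;
  6 ::= EC 0;; incr 20;; incr 2.
Definition right_runs : cmd := (20 ::= EC 0;; 2 ::= EV 17;; 6 ::= EV 18);; CWh (EV 2 <! EV 0) rbody.

Lemma right_spec s brk xx : arrs s -> rg s 17 = brk -> rg s 18 = xx -> brk <= n ->
  (brk < n -> xx <= c (A brk)) ->
  tri (n * 200 + 100) right_runs s (fun s' =>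
    runsUpTo s' (rightl brk xx rl) (length (rightl brk xx rl))).
Proof.
  intros (Z0 & Z1 & Z2 & Z3 & Z4) E17 E18 Hb Hx. rewrite rightl_length by auto.
  eapply tri_le; [apply (tri_init_for _ _ (fun k s' => runsUpTo s' (rightl brk xx rl) k /\ rg s' 2 = brk + k /\
     rg s' 6 = if k =? 0 then xx else 0) (n - brk) 150)|cbn; nia].
  - unfold runsUpTo. wsim. repeat split; intros; try lia.
  - intros k s' Hk ((U0 & U) & E2 & E6) F. frx F 0. fra F 0. fra F 1. fra F 2. fra F 3.
    split; [wsim; auto|]. split; [wsim; lia|]. apply tri_wps; [|cbn; lia].
    pose proof (HA (brk + k) ltac:(lia)) as HAk.
    unfold rbody, it, runsUpTo. wsim. rewrite E2, E6, U0, E0, E1, E3, E4, Z4, Z1, Z2, Z3 by (auto; lia).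
    assert (Hxk : (if k =? 0 then xx else 0) <= c (A (brk + k))).
    { destruct (Nat.eqb_spec k 0) as [->|]; [|lia]. rewrite Nat.add_0_r. apply Hx. lia. }
    pose proof (rightl_nth brk xx k ltac:(lia)) as HR.
    repeat split; try lia.
    + destruct (Nat.eq_dec i k) as [->|]; [rewrite updi_same, HR; auto|rewrite updi_diff by auto; apply U; lia].
    + destruct (Nat.eq_dec i k) as [->|]; [rewrite updi_same, HR; auto|rewrite updi_diff by auto; apply U; lia].
    + destruct (Nat.eq_dec i k) as [->|]; [rewrite updi_same, HR; auto|rewrite updi_diff by auto; apply U; lia].
  - intros s' ((U0 & U) & E2 & E6) F. frx F 0. wsim. repeat split; auto; try lia; apply U; auto.
Qed.

(** 1 if some run is broken: the left list then opens with the [xx] copies of that run, possibly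
    none. *)
Definition off (brk : nat) : nat := if brk <? n then 1 else 0.
Lemma leftl_length brk xx : brk <= n -> length (leftl brk xx rl) = off brk + brk.
Proof.
  intros H. unfold leftl, off. rewrite length_app, length_rev, length_firstn, rl_length, Nat.min_l by auto.
  destruct (Nat.ltb_spec brk n) as [h|h].
  - rewrite (skipn_nth rl dr brk) by (rewrite rl_length; lia). destruct (nth brk rl dr). reflexivity.
  - rewrite skipn_all2 by (rewrite rl_length; lia). reflexivity.
Qed.
Lemma leftl_nth0 brk xx : brk < n -> nth 0 (leftl brk xx rl) dr = ((w (A brk), p (A brk)), xx).
Proof.
  intros H. unfold leftl. rewrite (skipn_nth rl dr brk), rl_nth by (rewrite ?rl_length; lia). reflexivity.
Qed.
Lemma leftl_nth brk xx i : brk <= n -> i < brk ->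
  nth (off brk + i) (leftl brk xx rl) dr = ((w (A (brk - 1 - i)), p (A (brk - 1 - i))), c (A (brk - 1 - i))).
Proof.
  intros Hb H. unfold leftl. rewrite app_nth2.
  2:{ unfold off. destruct (Nat.ltb_spec brk n) as [h|h].
    - rewrite (skipn_nth rl dr brk) by (rewrite rl_length; lia). destruct (nth brk rl dr). simpl. lia.
    - rewrite skipn_all2 by (rewrite rl_length; lia). simpl. lia. }
  rewrite <- (rl_nth n A w p c) by lia.
  rewrite rev_nth; rewrite length_firstn, rl_length, Nat.min_l by auto.
  - transitivity (nth (brk - S i) (firstn brk rl) dr).
    + f_equal. f_equal. unfold off. destruct (Nat.ltb_spec brk n) as [h|h].
      * rewrite (skipn_nth rl dr brk) by (rewrite rl_length; lia). destruct (nth brk rl dr). simpl. lia.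
      * rewrite skipn_all2 by (rewrite rl_length; lia). simpl. lia.
    + rewrite nth_firstn. replace (brk - S i <? brk) with true by (symmetry; apply Nat.ltb_lt; lia).
      f_equal. lia.
  - unfold off. destruct (Nat.ltb_spec brk n) as [h|h].
    + rewrite (skipn_nth rl dr brk) by (rewrite rl_length; lia). destruct (nth brk rl dr). simpl. lia.
    + rewrite skipn_all2 by (rewrite rl_length; lia). simpl. lia.
Qed.

Definition lbody : cmd :=
  2 ::= EV 2 -! EC 1;; CSto 15 (EV 20) (it 0 2);; CSto 13 (EV 20) (it 1 2);; CSto 14 (EV 20) (it 2 2);; incr 20.
Definition left_runs : cmd :=
  (20 ::= EC 0;; 2 ::= EV 17;;
   CIf (EV 2 <! EV 0)
     (CSto 15 (EC 0) (it 0 2);; CSto 13 (EC 0) (it 1 2);; CSto 14 (EC 0) (EV 18);; 20 ::= EC 1) CSkip);;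
  CWh (EC 0 <! EV 2) lbody.

Lemma left_spec s brk xx : arrs s -> rg s 17 = brk -> rg s 18 = xx -> brk <= n ->
  tri (n * 200 + 200) left_runs s (fun s' =>
    runsUpTo s' (leftl brk xx rl) (length (leftl brk xx rl))).
Proof.
  intros (Z0 & Z1 & Z2 & Z3 & Z4) E17 E18 Hb. rewrite leftl_length by auto.
  assert (Hoff : off brk <= 1) by (unfold off; destruct (_ <? _); lia).
  eapply tri_le; [apply (tri_init_for _ _ (fun k s' => runsUpTo s' (leftl brk xx rl) (off brk + k) /\ rg s' 2 = brk - k) brk 150)|cbn; nia].
  - unfold runsUpTo, it, off. wsim. rewrite E17, Z0. split; [lia|]. split; [auto|]. split; [auto|]. split.
    + intros h. pose proof (HA brk h). rewrite Z4, Z1, Z2 by auto.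
      repeat split; try lia; apply Nat.ltb_lt in h as h'; rewrite h' in *; auto; intros;
        assert (i = 0) by lia; subst i; rewrite updi_same, leftl_nth0 by auto; auto.
    + intros h. apply Nat.ltb_ge in h. rewrite h. repeat split; try lia.
  - intros k s' Hk ((U0 & U) & E2) F. frx F 0. fra F 0. fra F 1. fra F 2. fra F 3.
    split; [wsim; lia|]. split; [wsim; lia|]. apply tri_wps; [|cbn; lia].
    pose proof (HA (brk - k - 1) ltac:(lia)) as HAk.
    unfold lbody, it, runsUpTo. wsim. rewrite E2, U0, E0, E1, E3, E4, Z4, Z1, Z2, Z3 by (auto; lia).
    pose proof (leftl_nth brk xx k Hb Hk) as HR. replace (brk - 1 - k) with (brk - k - 1) in HR by lia.
    repeat split; try lia.
    + destruct (Nat.eq_dec i (off brk + k)) as [->|]; [rewrite updi_same, HR; auto|rewrite updi_diff by auto; apply U; lia].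
    + destruct (Nat.eq_dec i (off brk + k)) as [->|]; [rewrite updi_same, HR; auto|rewrite updi_diff by auto; apply U; lia].
    + destruct (Nat.eq_dec i (off brk + k)) as [->|]; [rewrite updi_same, HR; auto|rewrite updi_diff by auto; apply U; lia].
  - intros s' ((U0 & U) & E2) F. frx F 0. wsim. repeat split; auto; try lia; apply U; auto.
Qed.
End Runs.

Definition d0 : nat * nat := (0, 0).

(** * Emitting candidates by bundling or by scanning *)

Section Emit.
Context (m : nat) (bits : list bool) (wm nc0 sg : nat) (sb : st).
Notation tri := (tri m bits).
Notation wps := (wps m bits).
Notation wpx := (wpx m bits).

(* Candidates number nc0, nc0+1, ... (with sign sg) are the entries of cl; sb is the state
   before this side was processed. *)
Definition emitted (cl : list (nat * nat)) (s : st) : Prop :=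
  rg s 26 = nc0 + length cl /\
  (forall i, i < nc0 -> ar s 9 i = ar sb 9 i /\ ar s 10 i = ar sb 10 i /\ ar s 11 i = ar sb 11 i) /\
  (forall i, i < length cl -> ar s 9 (nc0 + i) = fst (nth i cl d0) /\
     ar s 10 (nc0 + i) = snd (nth i cl d0) /\ ar s 11 (nc0 + i) = sg).

Definition emit (ew ep : expr) : cmd :=
  CSto 9 (EV 26) ew;; CSto 10 (EV 26) ep;; CSto 11 (EV 26) (EV 27);; incr 26.

Lemma emitted_step cl s s' x y : emitted cl s ->
  rg s' 26 = rg s 26 + 1 -> ar s' 9 = updi (ar s 9) (rg s 26) x -> ar s' 10 = updi (ar s 10) (rg s 26) y ->
  ar s' 11 = updi (ar s 11) (rg s 26) sg -> emitted (cl ++ [(x, y)]) s'.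
Proof.
  intros (E1 & E2 & E3) H1 H2 H3 H4. unfold emitted. rewrite H1, H2, H3, H4, E1, length_app. simpl.
  split; [lia|]. split.
  - intros i Hi. rewrite !updi_diff by lia. auto.
  - intros i Hi. destruct (Nat.eq_dec i (length cl)) as [->|Hne].
    + rewrite !updi_same, app_nth2, Nat.sub_diag by lia. auto.
    + rewrite !updi_diff, app_nth1 by lia. apply E3. lia.
Qed.

Definition load_run : cmd := 21 ::= EA 15 (EV 2);; 22 ::= EA 13 (EV 2);; 23 ::= EA 14 (EV 2).

Definition bbody : cmd :=
  (CIf (EV 23 <! EV 24) (24 ::= EV 23) CSkip;;
   emit (EV 24 *! EV 21) (EV 24 *! EV 22);;
   23 ::= EV 23 -! EV 24;; 24 ::= EV 24 +! EV 24).
Definition bloop : cmd := (24 ::= EC 1);; CWh (EC 0 <! EV 23) bbody.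

Lemma bund_0 f b v p : bund f b 0 v p = [].
Proof. destruct f; reflexivity. Qed.

Lemma bloop_spec s v p c cl :
  rg s 21 = v -> rg s 22 = p -> rg s 23 = c -> rg s 27 = sg -> emitted cl s ->
  2 * c + 8 < m -> c * v < m -> c * p < m ->
  64 + 16 * (nc0 + length cl + length (bund c 1 c v p)) + 64 < m ->
  tri (length (bund c 1 c v p) * 150 + 50) bloop s (emitted (cl ++ bund c 1 c v p)).
Proof.
  intros E21 E22 E23 E27 HE Hm1 Hm2 Hm3 Hm4. set (BL := bund c 1 c v p) in *.
  (* [dn] is what has been emitted and [bund f b c' v p] what is still to come. A full bundle takes
     b from c' while b doubles, so c' + b does not change; the clause [c' + b <= c + 1] thus
     survives and keeps b from overflowing. *)
  eapply tri_le; [apply (tri_init_for _ _ (fun k s' => exists dn f b c',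
     rg s' 23 = c' /\ rg s' 24 = b /\ emitted (cl ++ dn) s' /\ dn ++ bund f b c' v p = BL /\ c' <= f /\ 0 < b /\
     (c' = 0 \/ c' + b <= c + 1) /\ length dn = k) (length BL) 120)|cbn; lia].
  - wsim. split; [lia|]. exists [], c, 1, c. wsim. rewrite app_nil_r.
    split; [auto|split; [auto|split; [exact HE|split; [reflexivity|split; [auto|split; [auto|split; [right; lia|auto]]]]]]].
  - intros k s' Hk (dn & f & b & c' & X1 & X2 & X3 & X4 & X5 & X6 & X7 & X8) F.
    frx F 21. frx F 22. frx F 27.
    assert (Hc' : c' <> 0).
    { intros ->. rewrite bund_0, app_nil_r in X4. rewrite X4 in X8. lia. }
    split; [wsim; lia|]. split; [wsim; lia|]. apply tri_wps; [|cbn; lia].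
    destruct f as [|f]; [lia|]. cbn [bund] in X4. replace (c' =? 0) with false in X4 by (symmetry; apply Nat.eqb_neq; auto).
    destruct X7 as [X7|X7]; [lia|].
    assert (Hlen : length (cl ++ dn) < length cl + length BL) by (rewrite length_app; lia).
    pose proof X3 as (N1 & _ & _).
    unfold bbody, emit. wsim. rewrite X1, X2, E, E0, E1, E21, E22, E27, N1.
    assert (Hb' : forall b', b' <= c -> b' * v <= c * v /\ b' * p <= c * p)
      by (intros b' h; split; apply Nat.mul_le_mono_r; auto).
    repeat split; try lia; intros.
    all: try (specialize (Hb' c' ltac:(lia)); lia). all: try (specialize (Hb' b ltac:(lia)); lia).
    + exists (dn ++ [(c' * v, c' * p)]), f, (c' + c'), 0. wsim. rewrite app_assoc.
      rewrite Nat.min_r, Nat.sub_diag, bund_0 in X4 by lia. rewrite bund_0, (app_nil_r (dn ++ _)).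
      split; [lia|split; [auto|split; [|split; [exact X4|split; [lia|split; [lia|split; [auto|rewrite length_app; simpl; lia]]]]]]].
      apply emitted_step with s'; wsim; rewrite ?N1; auto.
    + exists (dn ++ [(b * v, b * p)]), f, (b + b), (c' - b). wsim. rewrite app_assoc.
      rewrite Nat.min_l in X4 by lia. rewrite <- !app_assoc. replace (b + b) with (2 * b) by lia.
      split; [lia|split; [auto|split; [|split; [exact X4|split; [lia|split; [lia|split; [lia|rewrite length_app; simpl; lia]]]]]]].
      rewrite app_assoc. apply emitted_step with s'; wsim; rewrite ?N1; auto.
  - intros s' (dn & f & b & c' & X1 & X2 & X3 & X4 & X5 & X6 & X7 & X8) F.
    assert (Hc' : c' = 0).
    { destruct c'; auto. exfalso. destruct f; [lia|]. cbn [bund] in X4.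
      change (S c' =? 0) with false in X4. apply (f_equal (@length _)) in X4. rewrite length_app in X4.
      simpl in X4. lia. }
    subst c'. rewrite Hc', bund_0, app_nil_r in X4. subst dn. wsim. repeat split; try lia; apply X3; auto.
Qed.

Lemma emitted_init s : rg s 26 = nc0 -> ar s 9 = ar sb 9 -> ar s 10 = ar sb 10 -> ar s 11 = ar sb 11 -> emitted [] s.
Proof.
  intros H A B C. unfold emitted. rewrite H, A, B, C. split; [simpl; lia|]. split; [auto|].
  intros i Hi. simpl in Hi. lia.
Qed.
Lemma emitted_frame cl s s' : rg s' 26 = rg s 26 -> ar s' 9 = ar s 9 -> ar s' 10 = ar s 10 -> ar s' 11 = ar s 11 ->
  emitted cl s -> emitted cl s'.
Proof. intros A B C D. unfold emitted. now rewrite A, B, C, D. Qed.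

Definition runsOf (s : st) (R : list runT) : Prop :=
  rg s 20 = length R /\ forall i, i < length R ->
    ar s 15 i = fst (fst (nth i R dr)) /\ ar s 13 i = snd (fst (nth i R dr)) /\ ar s 14 i = snd (nth i R dr).

Definition bouter_body : cmd :=
  (load_run;; CIf (EV 3 +! EV 3 <! EV 23) (23 ::= EV 3 +! EV 3) CSkip);; bloop;; incr 2.
Definition bouter : cmd := (2 ::= EC 0);; CWh (EV 2 <! EV 20) bouter_body.

Lemma bundles_firstn_S R k : k < length R ->
  bundles wm (firstn (S k) R) = bundles wm (firstn k R) ++
    (let c := Nat.min (snd (nth k R dr)) (2 * wm) in
     bund c 1 c (fst (fst (nth k R dr))) (snd (fst (nth k R dr)))).
Proof.
  intros H. rewrite (firstn_S_nth R dr k H). unfold bundles. rewrite flat_map_app. f_equal.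
  simpl. apply app_nil_r.
Qed.

Lemma bouter_spec s R pm : 0 < wm -> runsOf s R -> rg s 3 = wm -> rg s 27 = sg -> emitted [] s ->
  (forall r, In r R -> fst (fst r) <= wm /\ snd (fst r) <= pm) ->
  4 * wm + 8 < m -> 2 * wm * wm < m -> 2 * wm * pm < m ->
  64 + 16 * (nc0 + length R * (Nat.log2 wm + 2)) + 16 * length R + 128 < m ->
  tri (length R * ((Nat.log2 wm + 2) * 150 + 300) + 100) bouter s (emitted (bundles wm R)).
Proof.
  intros Hw (R0 & RR) E3 E27 HE Hin Hm1 Hm2 Hm3 Hm4.
  eapply tri_le; [apply (tri_init_for _ _ (fun k s' => rg s' 2 = k /\ emitted (bundles wm (firstn k R)) s')
     (length R) ((Nat.log2 wm + 2) * 150 + 200))|cbn; nia].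
  - wsim. split; [lia|]. split; [auto|]. apply emitted_frame with s; auto.
  - intros k s' Hk (X1 & X2) F. frx F 3. frx F 20. frx F 27. fra F 13. fra F 14. fra F 15.
    split; [wsim; auto|]. split; [wsim; lia|].
    set (r := nth k R dr). set (c := Nat.min (snd r) (2 * wm)).
    destruct (RR k Hk) as (Q1 & Q2 & Q3).
    destruct (Hin r (nth_In _ _ Hk)) as [Hrv Hrp].
    assert (HBL : length (bund c 1 c (fst (fst r)) (snd (fst r))) <= Nat.log2 wm + 2).
    { apply bund_length_min; auto. }
    assert (HBk : length (bundles wm (firstn k R)) <= k * (Nat.log2 wm + 2)).
    { etransitivity; [apply bundles_length; auto|]. rewrite length_firstn, Nat.min_l by lia. lia. }
    assert (HBk2 : k * (Nat.log2 wm + 2) + (Nat.log2 wm + 2) <= length R * (Nat.log2 wm + 2)) by nia.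
    eapply tri_le; [apply (tri_then _ _ 80 ((Nat.log2 wm + 2) * 150 + 50 + 20) _ _ _
      (fun s2 => rg s2 21 = fst (fst r) /\ rg s2 22 = snd (fst r) /\ rg s2 23 = c))|lia].
    + apply tri_wps; [|cbn; lia]. unfold load_run. wsim. rewrite X1, E, E2, E4, E5, Q1, Q2, Q3, E3.
      fold r. repeat split; try lia; intros; unfold c; lia.
    + intros s2 (Y1 & Y2 & Y3) F2. frx F2 2. frx F2 26. frx F2 27. fra F2 9. fra F2 10. fra F2 11.
      assert (HE2 : emitted (bundles wm (firstn k R)) s2) by (apply emitted_frame with s'; auto).
      assert (Hcc : c <= 2 * wm) by (unfold c; lia).
      eapply tri_le; [apply (tri_then _ _ _ 20 _ _ _ _ _ (bloop_spec s2 _ _ _ _ Y1 Y2 Y3 ltac:(lia) HE2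
        ltac:(lia) ltac:(nia) ltac:(nia) ltac:(lia)))|lia].
      intros s3 HE3 F3. frx F3 2. apply tri_wps; [|cbn; lia]. wsim. split; [lia|]. split; [lia|].
      rewrite bundles_firstn_S by auto. apply emitted_frame with s3; auto.
  - intros s' (X1 & X2) F. frx F 20. rewrite firstn_all in X2. wsim. split; [auto|]. split; [lia|auto].
Qed.

Definition sbodyA : cmd :=
  24 ::= EA 5 (EV 21) +! EC 1;; CSto 5 (EV 21) (EV 24);;
  25 ::= EA 8 (EV 21) *! (EV 3 +! EV 3 +! EC 1) +! EV 24;;
  6 ::= EA 7 (EV 25) +! EC 1;; CSto 7 (EV 25) (EV 6).
Definition sbodyB : cmd :=
  CIf (EC 16 *! EV 3 <! EV 6 *! EV 24)
    (CIf (EV 24 +! EV 24 <! EA 6 (EV 21)) (CSto 6 (EV 21) (EV 24 +! EV 24)) CSkip) CSkip.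
Definition sbodyC : cmd := emit (EV 21) (EV 22);; 23 ::= EV 23 -! EC 1.
Definition sbody : cmd := sbodyA;; sbodyB;; sbodyC.
(** A conjunction as the product of two 0/1 tests. The loop ends as soon as the cap is reached, so
    the rest of a run, however long, is skipped at once. *)
Definition scond : expr := EC 0 <! (EC 0 <! EV 23) *! (EA 5 (EV 21) <! EA 6 (EV 21)).
Definition sloop : cmd := CWh scond sbody.
Definition souter_body : cmd := load_run;; sloop;; incr 2.
Definition souter : cmd := (2 ::= EC 0);; CWh (EV 2 <! EV 20) souter_body.

Context (z : bl) (HC : propC z) (Hlen : length (se z) <= 2 * wm) (Hw0 : 0 < wm)
  (Hwt : Forall (fun c => 0 < fst c <= wm) (base z)).
Definition LIM : nat := 2 * wm + 32 * wm * (Nat.log2 wm + 1) * (Nat.log2 wm + 1).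
Context (Hm1 : 64 + 16 * (nc0 + LIM + 1) + 128 < m)
  (Hm2 : 64 + 16 * ((Nat.log2 wm + 1) * (2 * wm + 1)) + 128 < m) (Hm3 : (wm + 1) * (4 * wm + 16) < m)
  (Hm4 : 64 + 16 * wm + 64 < m).

Definition rch (s : st) (g h : nat) : nat := ar s 7 (g * (2 * wm + 1) + h).
Definition SI (L em : bl) (s : st) : Prop :=
  scanInv wm L em (ar s 5) (ar s 6) (rch s) /\ emitted (base em) s /\
  (forall v, 0 < v <= wm -> ar s 8 v = Nat.log2 v) /\ rg s 3 = wm /\ rg s 27 = sg.

Lemma idx_inj g h g' h' : h <= 2 * wm -> h' <= 2 * wm ->
  g * (2 * wm + 1) + h = g' * (2 * wm + 1) + h' -> (g, h) = (g', h').
Proof.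
  clear. intros H H' E. assert (g = g') by nia. subst. f_equal. lia.
Qed.

(** Amortisation: each iteration keeps one copy and pays 300 for it, and by [scan_count] at most
    [LIM] copies are kept over all runs together. *)
Definition slinv (Z0 Z1 : bl) (v p : nat) (k : nat) (s : st) : Prop :=
  exists l1 l2 em, Z1 = l1 ++ l2 /\ SI (Z0 ++ l1) em s /\ rg s 21 = v /\ rg s 22 = p /\ rg s 23 = length l2 /\
    k + length em * 300 = LIM * 300.

Lemma SI_len L em s : SI L em s -> length em <= LIM.
Proof. intros (HI & _). exact (scan_count wm z Hlen L em _ _ _ Hw0 HI). Qed.

Definition sbody_post (v p : nat) (s s' : st) : Prop :=
  let h := ar s 5 v + 1 in let g := Nat.log2 v in
  rg s' 23 = rg s 23 - 1 /\ rg s' 26 = rg s 26 + 1 /\ ar s' 9 = updi (ar s 9) (rg s 26) v /\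
  ar s' 10 = updi (ar s 10) (rg s 26) p /\ ar s' 11 = updi (ar s 11) (rg s 26) sg /\
  ar s' 5 = updi (ar s 5) v h /\
  ar s' 7 = updi (ar s 7) (g * (2 * wm + 1) + h) (rch s g h + 1) /\
  (16 * wm < (rch s g h + 1) * h -> 2 * h < ar s 6 v -> ar s' 6 = updi (ar s 6) v (2 * h)) /\
  ((rch s g h + 1) * h <= 16 * wm \/ ar s 6 v <= 2 * h -> ar s' 6 = ar s 6).

Lemma sbody_spec L em s v p : SI L em s -> 0 < v <= wm -> rg s 21 = v -> rg s 22 = p -> 0 < rg s 23 ->
  ar s 5 v < ar s 6 v -> tri 200 sbody s (sbody_post v p s).
Proof.
  intros HSI Hv E21 E22 E23 Hlt. pose proof HSI as (HI & HE & H8 & H3 & H27).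
  assert (Hcp : ar s 6 v <= 2 * wm) by (apply (si_cp2 _ _ _ _ _ _ HI); auto).
  assert (Hg : Nat.log2 v <= Nat.log2 wm) by (apply Nat.log2_le_mono; lia).
  set (h := ar s 5 v + 1) in *. set (g := Nat.log2 v) in *.
  assert (Hh : h <= 2 * wm) by (unfold h; lia).
  assert (Hidx : g * (2 * wm + 1) + h < (Nat.log2 wm + 1) * (2 * wm + 1)) by nia.
  assert (Hr : rch s g h <= wm + 1).
  { rewrite (si_rch _ _ _ _ _ _ HI) by (auto; unfold h; lia).
    pose proof (cnt_le (fun u => ing g u && (h <=? ar s 5 u)) (S wm)). lia. }
  pose proof (SI_len L em s HSI) as Hle.
  pose proof HE as (N1 & _). unfold base in N1. rewrite length_map in N1.
  assert (Hprod : (rch s g h + 1) * h <= (wm + 2) * (2 * wm)) by (apply Nat.mul_le_mono; lia).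
  assert (Hprod2 : (wm + 2) * (2 * wm) < m) by nia.
  assert (HA : tri 80 sbodyA s (fun s1 => rg s1 24 = h /\ rg s1 6 = rch s g h + 1 /\
    ar s1 5 = updi (ar s 5) v h /\ ar s1 7 = updi (ar s 7) (g * (2 * wm + 1) + h) (rch s g h + 1))).
  { apply tri_wps; [|cbn; lia]. unfold sbodyA. wsim. rewrite E21, H3, H8 by auto. fold g h.
    replace (wm + wm + 1) with (2 * wm + 1) by lia. fold (rch s g h).
    repeat split; try lia. }
  eapply tri_le; [apply (tri_then _ _ _ 120 _ _ _ _ _ HA)|lia].
  clear HA. intros s1 (A1 & A2 & A3 & A4) F1. frx F1 3. frx F1 21. frx F1 22. frx F1 23. frx F1 26. frx F1 27.
  fra F1 6. fra F1 9. fra F1 10. fra F1 11.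
  assert (HB : tri 60 sbodyB s1 (fun s2 =>
    (16 * wm < (rch s g h + 1) * h -> 2 * h < ar s 6 v -> ar s2 6 = updi (ar s 6) v (2 * h)) /\
    ((rch s g h + 1) * h <= 16 * wm \/ ar s 6 v <= 2 * h -> ar s2 6 = ar s 6))).
  { apply tri_wps; [|cbn; lia]. unfold sbodyB. wsim. rewrite A1, A2, E, E0, E5, E21, H3.
    repeat split; intros; try lia. f_equal; lia. }
  eapply tri_le; [apply (tri_then _ _ _ 60 _ _ _ _ _ HB)|lia].
  clear HB. intros s2 (B1 & B2) F2. frx F2 21. frx F2 22. frx F2 23. frx F2 26. frx F2 27.
  fra F2 5. fra F2 7. fra F2 9. fra F2 10. fra F2 11.
  apply tri_wps; [|cbn; lia]. unfold sbodyC, emit, sbody_post. cbv zeta. fold h g. wsim.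
  rewrite E9, E10, E11, E12, E13, E14, E15, E16, E17, E18, E0, E1, E2, E3, E4, E6, E7, E8, E21, E22, H27, N1.
  repeat split; try lia; auto.
Qed.

Lemma scond_truth s : truth s scond <-> 0 < rg s 23 /\ ar s 5 (rg s 21) < ar s 6 (rg s 21).
Proof.
  unfold scond. wsim. destruct (Nat.ltb_spec 0 (rg s 23)), (Nat.ltb_spec (ar s 5 (rg s 21)) (ar s 6 (rg s 21))); lia.
Qed.

Lemma repeat_base_app (l1 l2 : bl) vp : base (l1 ++ l2) = repeat vp (length (l1 ++ l2)) ->
  Forall (fun c => c = vp) (base l2).
Proof.
  intros H. apply Forall_forall. intros x Hx. apply (repeat_spec (length (l1 ++ l2)) vp). rewrite <- H, base_app.
  apply in_app_iff. auto.
Qed.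

Lemma sloop_spec s Z0 Z1 Z2 em0 v p :
  z = Z0 ++ Z1 ++ Z2 -> base Z1 = repeat (v, p) (length Z1) -> v <= wm ->
  SI Z0 em0 s -> rg s 21 = v -> rg s 22 = p -> rg s 23 = length Z1 ->
  wpx sloop s (fun s' t => fr sloop s s' /\ exists em, SI (Z0 ++ Z1) em s' /\
      t + (LIM - length em) * 300 <= (LIM - length em0) * 300 + 60).
Proof.
  intros Hz HB Hvw HSI E21 E22 E23.
  set (I := fun k s => slinv Z0 Z1 v p k s).
  destruct (wpx_while m bits I scond sbody s) with (k := (LIM - length em0) * 300) (s := s) as (s' & t & Hex & Hpost).
  - intros k s1 (l1 & l2 & em & X1 & X2 & X3 & X4 & X5 & X6) F.
    split.
    { unfold scond. wsim. rewrite X3.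
      assert (Hb2n : forall a b, (if a <? b then 1 else 0) <= 1) by (intros a b; destruct (a <? b); lia).
      pose proof (Hb2n 0 (rg s1 23)). pose proof (Hb2n (ar s1 5 v) (ar s1 6 v)).
      repeat split; try lia. nia. }
    intros Ht. apply scond_truth in Ht as [T1 T2]. rewrite X3 in T2.
    destruct l2 as [|c l2]; [simpl in X5; lia|].
    assert (Hc : fst c = (v, p)).
    { rewrite X1 in HB. apply repeat_base_app in HB. inversion HB; auto. }
    assert (Hzs : z = (Z0 ++ l1) ++ c :: l2 ++ Z2).
    { rewrite Hz, X1, <- !app_assoc. reflexivity. }
    assert (Hv : 0 < v <= wm).
    { rewrite Forall_forall in Hwt. specialize (Hwt (fst c)). rewrite Hc in Hwt. apply Hwt.
      rewrite Hzs, base_app. apply in_app_iff. right. left. exact Hc. }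
    pose proof X2 as (HI & HE & H8 & H3 & H27).
    eapply wpx_tri; [apply (sbody_spec _ _ _ v p X2 Hv X3 X4 T1 T2)|].
    intros s2 t2 Ht2 (P23 & P26 & P9 & P10 & P11 & P5 & P7 & P6a & P6b) F2.
    frx F2 3. frx F2 21. frx F2 22. frx F2 27. fra F2 8.
    assert (Hcp : ar s1 6 v <= 2 * wm) by (apply (si_cp2 _ _ _ _ _ _ HI); auto).
    assert (HI2 : scanInv wm ((Z0 ++ l1) ++ [c]) (em ++ [c]) (ar s2 5) (ar s2 6) (rch s2)).
    { apply (scan_emit wm z Hlen Hwt (Z0 ++ l1) em (ar s1 5) (ar s1 6) (rch s1) c (l2 ++ Z2)); auto;
        rewrite ?Hc; cbn [fst]; auto.
      - rewrite P5. apply updi_same.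
      - intros u Hu. rewrite P5. now apply updi_diff.
      - unfold rch at 1. rewrite P7. now rewrite updi_same.
      - intros g' h' Hg Hh Hne. unfold rch. rewrite P7. apply updi_diff. intros Heq.
        apply Hne. apply idx_inj in Heq; auto; lia.
      - intros u Hu.
        destruct (Nat.le_gt_cases ((rch s1 (Nat.log2 v) (ar s1 5 v + 1) + 1) * (ar s1 5 v + 1)) (16 * wm)); [now rewrite P6b by auto|].
        destruct (Nat.le_gt_cases (ar s1 6 v) (2 * (ar s1 5 v + 1))); [now rewrite P6b by auto|].
        rewrite P6a by auto. now apply updi_diff.
      - unfold rch at 1. rewrite P7, updi_same. intros Q1 Q2. rewrite P6a by auto. apply updi_same.
      - unfold rch at 1. rewrite P7, updi_same. intros Q1. now rewrite P6b by auto. }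
    assert (X2' : SI (Z0 ++ l1 ++ [c]) (em ++ [c]) s2).
    { rewrite app_assoc. split; [exact HI2|]. split.
      - rewrite base_app. replace (base [c]) with [(v, p)] by (unfold base; simpl; now rewrite Hc).
        apply emitted_step with s1; auto.
      - rewrite E3, E, E2. auto. }
    pose proof (SI_len _ _ _ X2') as HL. rewrite length_app in HL. simpl in HL.
    assert (Hes : esz scond + 3 <= 100) by (cbn; lia).
    exists (k - 300). split.
    + exists (l1 ++ [c]), l2, (em ++ [c]). rewrite <- app_assoc. split; [exact X1|]. split; [exact X2'|].
      rewrite E0, E1, P23, X5, length_app. simpl. repeat split; auto; lia.
    + lia.
  - exists [], Z1, em0. rewrite app_nil_r. pose proof (SI_len _ _ _ HSI). split; [auto|split; [exact HSI|repeat split; auto; lia]].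
  - apply fr_refl.
  - exists s', t. split; [exact Hex|]. destruct Hpost as (k' & (l1 & l2 & em & X1 & X2 & X3 & X4 & X5 & X6) & Hf & F & Hk).
    split; [eapply ex_fr; eauto|]. exists em. split.
    + pose proof X2 as (HI & HR). split; [|exact HR]. rewrite X1, app_assoc.
      destruct l2 as [|c l2]; [rewrite app_nil_r; exact HI|].
      (* The loop stopped with copies of the run left, so the cap is reached and all of them may be
         skipped. *)
      apply (scan_skip_many wm z HC Hlen Hwt) with (rest := Z2) (v := v); auto.
      * rewrite Hz, X1, <- !app_assoc. reflexivity.
      * rewrite X1 in HB. apply repeat_base_app in HB. eapply Forall_impl; [|exact HB]. intros a ->. reflexivity.
      * apply falsity_ev in Hf. apply Nat.nlt_ge. intros Hlt.
        assert (Ht : truth s' scond) by (apply scond_truth; rewrite X3, X5; simpl; split; [lia|auto]).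
        apply truth_ev in Ht. congruence.
    + assert (Hes : esz scond + 1 <= 60) by (cbn; lia). pose proof (SI_len _ _ _ X2).
      pose proof (SI_len _ _ _ HSI). lia.
Qed.

Lemma souter_spec s R : base z = expand R -> runsOf s R -> (forall r, In r R -> fst (fst r) <= wm) ->
  SI [] [] s -> 64 + 16 * length R + 64 < m ->
  tri (LIM * 300 + length R * 200 + 100) souter s (fun s' => exists em, SI z em s').
Proof.
  intros Hz (R0 & RR) Hin HSI Hm5. apply tri_wpx. apply wpx_seq.
  eapply wpx_tri; [apply (tri_wps _ _ 10 _ _ (fun s1 => rg s1 2 = 0))|].
  { wsim. split; [lia|auto]. }
  { cbn; lia. }
  intros s1 t1 Ht1 E2 F1. frx F1 3. frx F1 20. frx F1 26. frx F1 27.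
  fra F1 5. fra F1 6. fra F1 7. fra F1 8. fra F1 9. fra F1 10. fra F1 11. fra F1 13. fra F1 14. fra F1 15.
  assert (HSI1 : SI [] [] s1).
  { destruct HSI as (A & B & C & D & G). unfold SI, rch. rewrite E4, E5, E6, E7, E, E3. split; [exact A|].
    split; [eapply emitted_frame; [| | | |exact B]; auto|auto]. }
  (* The budget is 200 for every run still to be read and 300 for every copy that may still be
     kept. *)
  pose (J := fun k s' => exists j Z0 Z1 em, z = Z0 ++ Z1 /\ base Z1 = expand (skipn j R) /\ rg s' 2 = j /\ j <= length R /\
    SI Z0 em s' /\ k = (length R - j) * 200 + (LIM - length em) * 300).
  destruct (wpx_while m bits J (EV 2 <! EV 20) souter_body s1) with
    (k := length R * 200 + LIM * 300) (s := s1) as (s' & t & Hex & Hpost).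
  - intros k s2 (j & Z0 & Z1 & em & X1 & X2 & X3 & X4 & X5 & X6) F. frx F 20. fra F 13. fra F 14. fra F 15.
    split; [wsim; auto|]. wsim. rewrite X3, E14, E0, R0. intros Hj.
    destruct (RR j Hj) as (Q1 & Q2 & Q3). pose proof (Hin _ (nth_In R dr Hj)) as Hv.
    destruct (nth j R dr) as [[v p] c] eqn:Hn. cbn [fst snd] in *.
    rewrite (skipn_nth R dr j Hj), Hn in X2. change (expand (?a :: ?l)) with (expand ([a] ++ l)) in X2.
    rewrite expand_app, expand_one in X2.
    apply base_app_inv in X2 as (Za & Zb & Y1 & Y2 & Y3).
    assert (HLa : length Za = c) by (apply (f_equal (@length _)) in Y2; unfold base in Y2; rewrite length_map, repeat_length in Y2; auto).
    apply wpx_seq.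
    eapply wpx_tri; [apply (tri_wps _ _ 40 _ _ (fun s3 => rg s3 21 = v /\ rg s3 22 = p /\ rg s3 23 = c))|].
    { unfold load_run. wsim. rewrite X3, E15, E16, E17, E11, E12, E13, Q1, Q2, Q3. repeat split; lia. }
    { cbn; lia. }
    intros s3 t3 Ht3 (A1 & A2 & A3) F3. frx F3 2. frx F3 3. frx F3 26. frx F3 27.
    fra F3 5. fra F3 6. fra F3 7. fra F3 8. fra F3 9. fra F3 10. fra F3 11.
    assert (X5' : SI Z0 em s3).
    { destruct X5 as (A & B & C & D & G). unfold SI, rch. rewrite E19, E21, E22, E23, E24, E25. split; [exact A|].
      split; [eapply emitted_frame; [| | | |exact B]; auto|auto]. }
    apply wpx_seq.
    destruct (sloop_spec s3 Z0 Za Zb em v p) as (s4 & t4 & Hex4 & F4 & em4 & HS4 & Hc4); auto; try congruence.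
    exists s4, t4. split; [exact Hex4|]. frx F4 2.
    eapply wpx_tri; [apply (tri_wps _ _ 20 _ _ (fun s5 => rg s5 2 = S j))|].
    { wsim. split; [lia|]. lia. }
    { cbn; lia. }
    intros s5 t5 Ht5 A5 F5. frx F5 3. frx F5 26. frx F5 27.
    fra F5 5. fra F5 6. fra F5 7. fra F5 8. fra F5 9. fra F5 10. fra F5 11.
    assert (HS5 : SI (Z0 ++ Za) em4 s5).
    { destruct HS4 as (A & B & C & D & G). unfold SI, rch. rewrite E30, E32, E33, E34, E35, E36. split; [exact A|].
      split; [eapply emitted_frame; [| | | |exact B]; auto|auto]. }
    exists ((length R - S j) * 200 + (LIM - length em4) * 300). split.
    + exists (S j), (Z0 ++ Za), Zb, em4. rewrite <- app_assoc, X1, Y1. split; [auto|split; [exact Y3|split; [exact A5|split; [lia|split; [exact HS5|reflexivity]]]]].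
    + change (esz (EV 2 <! EV 20)) with 3. subst k. lia.
  - exists 0, [], z, []. rewrite Nat.sub_0_r. simpl length. rewrite Nat.sub_0_r.
    split; [auto|split; [exact Hz|split; [exact E2|split; [lia|split; [exact HSI1|reflexivity]]]]].
  - apply fr_refl.
  - exists s', t. split; [exact Hex|]. destruct Hpost as (k' & (j & Z0 & Z1 & em & X1 & X2 & X3 & X4 & X5 & X6) & Hf & F & Hk).
    cbn [esz] in Hk. split; [lia|]. exists em. wsimh Hf. frx F 20. rewrite X3, E14, E0, R0 in Hf.
    rewrite skipn_all2 in X2 by lia. apply map_eq_nil in X2. subst Z1. rewrite app_nil_r in X1. now subst Z0.
Qed.

Definition sinit1 : cmd := (2 ::= EC 0);; CWh (EV 2 <! EV 3 +! EC 1)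
  (CSto 5 (EV 2) (EC 0);; CSto 6 (EV 2) (EV 3 +! EV 3);;
   CIf (EV 2 <! EC 2) (CSto 8 (EV 2) (EC 0)) (CSto 8 (EV 2) (EA 8 (EV 2 /! EC 2) +! EC 1));; incr 2).
Definition sinit2 : cmd := (34 ::= (EA 8 (EV 3) +! EC 1) *! (EV 3 +! EV 3 +! EC 1);; 2 ::= EC 0);;
  CWh (EV 2 <! EV 34) (CSto 7 (EV 2) (EC 0);; incr 2).

Lemma log2_half v : 2 <= v -> Nat.log2 v = Nat.log2 (v / 2) + 1.
Proof.
  clear. intros H. rewrite <- Nat.div2_div.
  destruct (Nat.Even_or_Odd v) as [E|E].
  - apply Nat.Even_double in E. unfold Nat.double in E. rewrite E at 1.
    replace (Nat.div2 v + Nat.div2 v) with (2 * Nat.div2 v) by lia. rewrite Nat.log2_double; lia.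
  - apply Nat.Odd_double in E. unfold Nat.double in E. rewrite E at 1.
    replace (S (Nat.div2 v + Nat.div2 v)) with (2 * Nat.div2 v + 1) by lia.
    destruct (Nat.eq_dec (Nat.div2 v) 0); [lia|]. rewrite Nat.log2_succ_double; lia.
Qed.

Lemma sinit1_spec s : rg s 3 = wm -> tri ((wm + 1) * 150 + 100) sinit1 s (fun s' =>
  (forall v, v <= wm -> ar s' 5 v = 0) /\ (forall v, v <= wm -> ar s' 6 v = 2 * wm) /\
  (forall v, 0 < v <= wm -> ar s' 8 v = Nat.log2 v)).
Proof.
  intros E3.
  eapply tri_le; [apply (tri_init_for _ _ (fun k s' => rg s' 2 = k /\
    (forall v, v < k -> ar s' 5 v = 0) /\ (forall v, v < k -> ar s' 6 v = 2 * wm) /\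
    (forall v, v < k -> ar s' 8 v = Nat.log2 v)) (wm + 1) 100)|cbn; nia].
  - wsim. repeat split; lia.
  - intros k s' Hk (X1 & X2 & X3 & X4) F. frx F 3. split; [wsim; lia|]. split; [wsim; lia|].
    apply tri_wps; [|cbn; lia]. wsim. rewrite X1, E, E3.
    assert (Hk2 : 2 <= k -> k / 2 < k) by (intros; apply Nat.div_lt; lia).
    assert (Hkk : k / 2 <= k) by (apply Nat.Div0.div_le_upper_bound; lia).
    repeat split; try lia; intros; try (destruct (Nat.eq_dec v k) as [->|];
      [rewrite updi_same|rewrite updi_diff by auto]; auto; try apply X2; try apply X3; try apply X4; try lia).
    + destruct k as [|[|k]]; try lia; reflexivity.
    + rewrite X4 by auto. pose proof (Nat.log2_le_lin (k / 2)). lia.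
    + rewrite X4 by auto. symmetry. now apply log2_half.
  - intros s' (X1 & X2 & X3 & X4) F. frx F 3. wsim. repeat split; intros; try lia; auto with zarith.
Qed.

Lemma sinit2_spec s : rg s 3 = wm -> ar s 8 wm = Nat.log2 wm ->
  tri ((Nat.log2 wm + 1) * (2 * wm + 1) * 60 + 100) sinit2 s (fun s' =>
   forall i, i < (Nat.log2 wm + 1) * (2 * wm + 1) -> ar s' 7 i = 0).
Proof.
  intros E3 E8. replace (2 * wm) with (wm + wm) in * by lia. set (B := (Nat.log2 wm + 1) * (wm + wm + 1)) in *.
  assert (HL : Nat.log2 wm <= wm) by apply Nat.log2_le_lin, Nat.le_0_l.
  eapply tri_le; [apply (tri_init_for _ _ (fun k s' => rg s' 2 = k /\ rg s' 34 = B /\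
    (forall v, v < k -> ar s' 7 v = 0)) B 40)|cbn; lia].
  - wsim. rewrite E3, E8. repeat split; try lia.
  - intros k s' Hk (X1 & X2 & X3) F. split; [wsim; auto|]. split; [wsim; lia|].
    apply tri_wps; [|cbn; lia]. wsim. rewrite X1. repeat split; try lia.
    intros v Hv. destruct (Nat.eq_dec v k) as [->|]; [now rewrite updi_same|rewrite updi_diff by auto; apply X3; lia].
  - intros s' (X1 & X2 & X3) F. wsim. repeat split; auto; lia.
Qed.

Definition sscan : cmd := sinit1;; sinit2;; souter.
Lemma sscan_spec s R : base z = expand R -> runsOf s R -> (forall r, In r R -> fst (fst r) <= wm) ->
  rg s 3 = wm -> rg s 27 = sg -> emitted [] s -> 64 + 16 * length R + 64 < m ->
  tri (LIM * 600 + length R * 200 + 1000) sscan s (fun s' => exists em, SI z em s').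
Proof.
  intros Hz (R0 & RR) Hin E3 E27 HE Hm5. unfold sscan.
  eapply tri_le; [apply (tri_then _ _ _ ((Nat.log2 wm + 1) * (2 * wm + 1) * 60 + 100 + (LIM * 300 + length R * 200 + 100)) _ _ _ _ _ (sinit1_spec s E3))|].
  - intros s1 (X1 & X2 & X3) F. frx F 3. frx F 20. frx F 26. frx F 27. fra F 9. fra F 10. fra F 11. fra F 13. fra F 14. fra F 15.
    eapply tri_then; [apply (sinit2_spec s1); [congruence|apply X3; lia]|].
    intros s2 X4 F2. frx F2 3. frx F2 20. frx F2 26. frx F2 27. fra F2 5. fra F2 6. fra F2 8.
    fra F2 9. fra F2 10. fra F2 11. fra F2 13. fra F2 14. fra F2 15.
    apply souter_spec; auto.
    + split; [congruence|]. rewrite E20, E21, E22, E7, E8, E9. auto.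
    + split; [|split; [|split; [|split]]]; try congruence.
      * rewrite E14, E15. apply (scan_init wm z Hlen); auto. intros g h Hg Hh. apply X4. nia.
      * eapply emitted_frame; [| | | |exact HE]; congruence.
      * rewrite E16. auto.
  - unfold LIM. pose proof (Nat.log2_pos wm). nia.
Qed.
End Emit.

(** * Drawing the random keys *)

Section Keys.
Context (m : nat) (bits : list bool).
Notation tri := (tri m bits).

Definition kbody : cmd :=
  CRnd 6;; 29 ::= EV 29 +! EV 29 +! EV 6;; 28 ::= EV 28 +! EV 28.
Definition kloop : cmd := (29 ::= EC 0;; 28 ::= EC 1);; CWh (EV 28 <! EV 38) kbody.
Definition keys : cmd := (2 ::= EC 0);; CWh (EV 2 <! EV 26) (kloop;; CSto 12 (EV 2) (EV 29);; incr 2).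

Lemma hv_bitsat_S p k : hv (bitsat bits p (S k)) = 2 * hv (bitsat bits p k) + Nat.b2n (nth (p + k) bits false).
Proof. unfold bitsat. rewrite seq_S, map_app. simpl map. rewrite hv_app. reflexivity. Qed.

Lemma kloop_spec s b : rg s 38 = 2 ^ b -> 2 * 2 ^ b + 64 < m ->
  tri (b * 60 + 30) kloop s (fun s' => rg s' 29 = hv (bitsat bits (rp s) b) /\ rp s' = rp s + b).
Proof.
  intros E38 Hm.
  eapply tri_le; [apply (tri_init_for _ _ (fun k s' => rg s' 28 = 2 ^ k /\ rg s' 29 = hv (bitsat bits (rp s) k) /\
    rp s' = rp s + k) b 40)|cbn; lia].
  - wsim. repeat split; try lia.
  - intros k s' Hk (X1 & X2 & X3) F. frx F 38.
    assert (H1 : 2 ^ S k <= 2 ^ b) by (apply Nat.pow_le_mono_r; lia).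
    assert (H2 : 2 ^ k < 2 ^ S k) by (apply Nat.pow_lt_mono_r; lia).
    pose proof (hv_lt (bitsat bits (rp s) k)) as H3. unfold bitsat in H3 at 2. rewrite length_map, length_seq in H3.
    split; [wsim; auto|]. split; [wsim; lia|].
    apply tri_wps; [|cbn; lia]. unfold kbody. wsim. rewrite hv_bitsat_S, X1, X2, X3. cbn [Nat.pow] in *.
    assert (H4 : (if nth (rp s + k) bits false then 1 else 0) = Nat.b2n (nth (rp s + k) bits false)) by reflexivity.
    rewrite H4. assert (H5 : Nat.b2n (nth (rp s + k) bits false) <= 1) by (destruct (nth _ _ _); simpl; lia).
    repeat split; lia.
  - intros s' (X1 & X2 & X3) F. frx F 38. wsim. repeat split; auto; lia.
Qed.

Lemma keys_spec s b nc : rg s 38 = 2 ^ b -> rg s 26 = nc -> rp s = 0 -> 2 * 2 ^ b + 64 < m -> 64 + 16 * nc + 64 < m ->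
  tri (nc * (b * 60 + 100) + 50) keys s (fun s' => forall i, i < nc -> ar s' 12 i = key b bits i).
Proof.
  intros E38 E26 Erp Hm Hm2.
  eapply tri_le; [apply (tri_init_for _ _ (fun k s' => rg s' 2 = k /\ rp s' = k * b /\
    forall i, i < k -> ar s' 12 i = key b bits i) nc (b * 60 + 70))|cbn; nia].
  - wsim. repeat split; lia.
  - intros k s' Hk (X1 & X2 & X3) F. frx F 38. frx F 26.
    split; [wsim; auto|]. split; [wsim; lia|].
    eapply tri_le; [apply (tri_then _ _ _ 30 _ _ _ _ _ (kloop_spec s' b ltac:(congruence) Hm))|lia].
    intros s2 (Y1 & Y2) F2. frx F2 2. fra F2 12. apply tri_wps; [|cbn; lia]. wsim. rewrite E1, E2, X1, Y1, Y2, X2.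
    repeat split; try lia. intros i Hi. destruct (Nat.eq_dec i k) as [->|].
    + now rewrite updi_same.
    + rewrite updi_diff by auto. apply X3. lia.
  - intros s' (X1 & X2 & X3) F. frx F 26. wsim. repeat split; auto; lia.
Qed.
End Keys.

(** * The dynamic program in the order of the keys *)

Section DPProg.
Context (m : nat) (bits : list bool).
Notation tri := (tri m bits).
Notation wpx := (wpx m bits).
Context (nc R b1 G PB : nat) (cs cw cp K : nat -> nat).
Notation sz := (2 * R + 1).
Context (Hpos : forall Q, (0 < Z.of_nat b1 + qsum nc cs cp Q)%Z)
  (HPB : forall Q, (Z.of_nat b1 + qsum nc cs cp Q <= Z.of_nat PB)%Z)
  (Hcp : forall j, j < nc -> cp j <= PB) (Hcw : forall j, j < nc -> cw j <= PB)
  (HK : forall j, j < nc -> K j < G)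
  (Hm1 : 2 * PB + 64 < m) (Hm2 : 16 * (sz + 1) + PB + 256 < m) (Hm3 : 64 + 16 * nc + 64 < m) (Hm4 : G + 64 < m)
  (HR : 0 < R).

Definition dpinit : cmd := (31 ::= EV 30 +! EV 30 +! EC 1;; 2 ::= EC 0);;
  CWh (EV 2 <! EV 31) (CSto 13 (EV 2) (EC 0);; incr 2).

Definition hcell : cmd :=
  CSto 14 (EV 2) (EA 13 (EV 2));;
  CIf (EV 23)
    (CIf (EV 2 +! EV 21 <! EV 31)
      (CIf (EV 22 <! EA 13 (EV 2 +! EV 21))
        (CIf (EA 13 (EV 2) <! EA 13 (EV 2 +! EV 21) -! EV 22)
          (CSto 14 (EV 2) (EA 13 (EV 2 +! EV 21) -! EV 22)) CSkip) CSkip) CSkip)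
    (CIf (EV 2 <! EV 21) CSkip
      (CIf (EC 0 <! EA 13 (EV 2 -! EV 21))
        (CIf (EA 13 (EV 2) <! EA 13 (EV 2 -! EV 21) +! EV 22)
          (CSto 14 (EV 2) (EA 13 (EV 2 -! EV 21) +! EV 22)) CSkip) CSkip));;
  incr 2.
Definition upd1 : cmd := (2 ::= EC 0);; CWh (EV 2 <! EV 31) hcell.
Definition upd2 : cmd := (2 ::= EC 0);; CWh (EV 2 <! EV 31) (CSto 13 (EV 2) (EA 14 (EV 2));; incr 2).
Definition dpupd : cmd :=
  (21 ::= EA 9 (EV 33);; 22 ::= EA 10 (EV 33);; 23 ::= EA 11 (EV 33));; upd1;; upd2.

Lemma upd1_spec s v p c : rg s 31 = sz -> rg s 21 = v -> rg s 22 = p -> rg s 23 = c ->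
  (forall i, i < sz -> ar s 13 i <= PB) -> v <= PB -> p <= PB ->
  tri (sz * 250 + 50) upd1 s (fun s' => forall i, i < sz -> ar s' 14 i = upf sz (ar s 13) c v p i).
Proof.
  intros E31 E21 E22 E23 HF Hv Hp. set (SZ := sz) in *.
  eapply tri_le; [apply (tri_init_for _ _ (fun k s' => rg s' 2 = k /\
    forall i, i < k -> ar s' 14 i = upf SZ (ar s 13) c v p i) SZ 220)|cbn; lia].
  - wsim. repeat split; lia.
  - intros k s' Hk (X1 & X2) F. frx F 31. frx F 21. frx F 22. frx F 23. fra F 13.
    split; [wsim; auto|]. split; [wsim; lia|]. apply tri_wps; [|cbn; lia].
    pose proof (HF k Hk) as Fk.
    assert (Fm : v <= k -> ar s 13 (k - v) <= PB) by (intros; apply HF; lia).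
    assert (Fp : k + v < SZ -> ar s 13 (k + v) <= PB) by (intros; apply HF; lia).
    assert (Hfin : forall y, y = upf SZ (ar s 13) c v p k ->
      forall f, f k = y -> (forall i, i <> k -> f i = ar s' 14 i) -> forall i, i < S k -> f i = upf SZ (ar s 13) c v p i).
    { intros y Hy f Hf1 Hf2 i Hi. destruct (Nat.eq_dec i k) as [->|]; [congruence|].
      rewrite Hf2 by auto. apply X2. lia. }
    assert (Hsimp : forall y, upf SZ (ar s 13) c v p k = y <-> (
      if c =? 0 then
        if (v <=? k) && (0 <? ar s 13 (k - v)) && (ar s 13 k <? ar s 13 (k - v) + p) then ar s 13 (k - v) + p = y else ar s 13 k = y
      else if (k + v <? SZ) && (p <? ar s 13 (k + v)) && (ar s 13 k <? ar s 13 (k + v) - p) then ar s 13 (k + v) - p = y else ar s 13 k = y)).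
    { intros y. unfold upf. destruct (c =? 0); destruct (_ && _); tauto. }
    unfold hcell. wsim. rewrite X1, E, E0, E1, E2, E3, E31, E21, E22, E23.
    repeat split; try lia; intros;
      repeat match goal with H : ?P -> ?Q, H1 : ?P |- _ => specialize (H H1) end; try lia.
    all: apply (Hfin _ eq_refl); [|intros i0 Hi0; rewrite ?updi_diff by auto; reflexivity|auto];
      rewrite ?updi_same; symmetry; apply Hsimp.
    all: destruct (Nat.eqb_spec c 0); try lia.
    all: repeat match goal with |- context [?a <? ?b] => destruct (Nat.ltb_spec a b); try lia end.
    all: repeat match goal with |- context [?a <=? ?b] => destruct (Nat.leb_spec a b); try lia end.
    all: cbn [andb]; try lia; reflexivity.
  - intros s' (X1 & X2) F. frx F 31. wsim. repeat split; auto; lia.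
Qed.

Definition doneK (x j i : nat) : bool := before x j i (K i).
Definition inrange (D : nat -> bool) : Prop := forall x j, x < G -> j <= nc ->
  (Z.abs (dsum nc cs cw (andf D (doneK x j))) <= Z.of_nat R)%Z.
(** D is quantified inside: soundness holds for all keys, and completeness for whichever target set
    the keys keep in range. *)
Definition dpI (done : nat -> bool) (F : nat -> nat) : Prop :=
  dpsound nc R b1 cs cw cp done F /\ forall D, inrange D -> dpcomp nc R b1 cs cw cp D done F.

Lemma dpI_bound done F : dpI done F -> forall i, i < sz -> F i <= PB.
Proof.
  intros [HS _] i Hi. destruct (Nat.eq_dec (F i) 0); [lia|].
  destruct (HS i Hi ltac:(lia)) as (Q & _ & _ & E). pose proof (HPB Q). lia.
Qed.

Lemma doneK_step x j : j < nc -> K j = x ->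
  doneK x j j = false /\ doneK x (S j) j = true /\ forall i, i <> j -> doneK x (S j) i = doneK x j i.
Proof.
  intros Hj HKj. unfold doneK, before. rewrite HKj, Nat.ltb_irrefl, Nat.eqb_refl, Nat.ltb_irrefl. cbn [orb andb].
  split; [auto|]. split; [apply Nat.ltb_lt; lia|].
  intros i Hi. f_equal. f_equal. destruct (Nat.ltb_spec i (S j)), (Nat.ltb_spec i j); auto; lia.
Qed.
Lemma doneK_same x j i : K j <> x -> doneK x (S j) i = doneK x j i.
Proof.
  intros HKj. unfold doneK, before. destruct (Nat.eqb_spec (K i) x); [|reflexivity]. f_equal. cbn [andb].
  destruct (Nat.eq_dec i j); [congruence|]. destruct (Nat.ltb_spec i (S j)), (Nat.ltb_spec i j); auto; lia.
Qed.
Lemma doneK_next x i : i < nc -> doneK x nc i = doneK (S x) 0 i.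
Proof.
  intros Hi. unfold doneK, before. change (i <? 0) with false. rewrite andb_false_r, orb_false_r.
  destruct (Nat.eqb_spec (K i) x), (Nat.ltb_spec (K i) x), (Nat.ltb_spec (K i) (S x)), (Nat.ltb_spec i nc); auto; lia.
Qed.

Lemma dpI_ext done done' F F' : (forall j, j < nc -> done j = done' j) ->
  (forall i, i < sz -> F i = F' i) -> dpI done F -> dpI done' F'.
Proof.
  intros H1 H2 [HS HC]. split; [eapply sound_ext; eauto|]. intros D HD. eapply comp_ext; eauto.
Qed.

Lemma dpI_step x j F F' : x < G -> j < nc -> K j = x ->
  (forall i, i < sz -> F' i = upf sz F (cs j) (cw j) (cp j) i) ->
  dpI (doneK x j) F -> dpI (doneK x (S j)) F'.
Proof.
  intros Hx Hj HKj HF [HS HC]. destruct (doneK_step x j Hj HKj) as (A & B & C). split.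
  - apply (dpsound_step nc R b1 cs cw cp (doneK x j) _ F F' j); auto.
  - intros D HD. apply (dpcomp_step nc R b1 cs cw cp D Hpos (doneK x j) _ F F' j); auto.
Qed.

Definition cands (s : st) : Prop := rg s 26 = nc /\ rg s 38 = G /\ rg s 31 = sz /\
  forall i, i < nc -> ar s 9 i = cw i /\ ar s 10 i = cp i /\ ar s 11 i = cs i /\ ar s 12 i = K i.

Lemma cands_frame s s' : cands s -> rg s' 26 = rg s 26 -> rg s' 38 = rg s 38 -> rg s' 31 = rg s 31 ->
  ar s' 9 = ar s 9 -> ar s' 10 = ar s 10 -> ar s' 11 = ar s 11 -> ar s' 12 = ar s 12 -> cands s'.
Proof. unfold cands. intros H -> -> -> -> -> -> ->. exact H. Qed.

Definition UC : nat := sz * 350 + 200.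
Lemma dpupd_spec s x j : cands s -> rg s 33 = j -> x < G -> j < nc -> K j = x -> dpI (doneK x j) (ar s 13) ->
  tri UC dpupd s (fun s' => dpI (doneK x (S j)) (ar s' 13)).
Proof.
  intros (C26 & C38 & C31 & CA) E33 Hx Hj HKj HI. destruct (CA j Hj) as (A1 & A2 & A3 & A4).
  pose proof (dpI_bound _ _ HI) as HF. unfold UC, dpupd.
  eapply tri_le; [apply (tri_then _ _ 50 (sz * 250 + 50 + (sz * 50 + 50)) _ _ _ (fun s2 => rg s2 21 = cw j /\ rg s2 22 = cp j /\ rg s2 23 = cs j))|lia].
  { apply tri_wps; [|cbn; lia]. wsim. rewrite E33, A1, A2, A3. repeat split; lia. }
  intros s2 (B1 & B2 & B3) F2. frx F2 31. fra F2 13.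
  eapply tri_then; [apply (upd1_spec s2 _ _ _ ltac:(congruence) B1 B2 B3)|].
  { rewrite E0. exact HF. }
  { auto. } { auto. }
  intros s3 HH F3. frx F3 31. fra F3 13.
  eapply tri_le; [apply (tri_init_for _ _ (fun k s' => rg s' 2 = k /\
    forall i, i < k -> ar s' 13 i = ar s3 14 i) sz 40)|cbn; lia].
  - wsim. repeat split; lia.
  - intros k s' Hk (X1 & X2) F. frx F 31. fra F 14.
    split; [wsim; auto|]. split; [wsim; lia|]. apply tri_wps; [|cbn; lia]. wsim.
    rewrite X1, E4. repeat split; try lia. intros i Hi. destruct (Nat.eq_dec i k) as [->|]; [now rewrite updi_same|].
    rewrite updi_diff by auto. apply X2. lia.
  - intros s' (X1 & X2) F. frx F 31. wsim. split; [auto|]. split; [lia|].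
    apply (dpI_step x j (ar s 13)); auto. intros i Hi. rewrite X2, HH, E0 by auto. reflexivity.
Qed.

(** The candidates still to be processed pay for the table updates. Each is updated once, while the
    G nc visits of the double loop cost only a constant each. *)
Definition rem (x j : nat) : nat := cnt (fun i => negb (doneK x j i)) nc.
Lemma rem_step x j : j < nc -> K j = x -> rem x j = rem x (S j) + 1.
Proof.
  intros Hj HKj. destruct (doneK_step x j Hj HKj) as (A & B & C).
  pose proof (sm_upd (fun i => Nat.b2n (negb (doneK x (S j) i))) (fun i => Nat.b2n (negb (doneK x j i))) nc j Hj) as H.
  cbv beta in H. rewrite A, B in H. simpl in H. unfold rem, cnt. rewrite Nat.add_0_r in H. apply H.
  intros i Hi. now rewrite C.
Qed.
Lemma rem_same x j : K j <> x -> rem x (S j) = rem x j.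
Proof. intros HKj. apply cnt_ext. intros i _. now rewrite doneK_same. Qed.
Lemma rem_next x : rem x nc = rem (S x) 0.
Proof. apply cnt_ext. intros i Hi. now rewrite doneK_next. Qed.

Definition jbody : cmd :=
  CIf (EA 12 (EV 33) <! EV 32) CSkip (CIf (EV 32 <! EA 12 (EV 33)) CSkip dpupd);; incr 33.
Definition jloop : cmd := CWh (EV 33 <! EV 26) jbody.
Definition xloop : cmd := CWh (EV 32 <! EV 38) (33 ::= EC 0;; jloop;; incr 32).
Definition dp : cmd := dpinit;; CSto 13 (EV 30) (EV 16);; 32 ::= EC 0;; xloop.

Lemma jbody_spec s x j : cands s -> rg s 33 = j -> rg s 32 = x -> x < G -> j < nc -> dpI (doneK x j) (ar s 13) ->
  wpx jbody s (fun s' t => rg s' 33 = S j /\ dpI (doneK x (S j)) (ar s' 13) /\ t + rem x (S j) * UC <= rem x j * UC + 80).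
Proof.
  intros HCs E33 E32 Hx Hj HI. pose proof HCs as (C26 & C38 & C31 & CA). destruct (CA j Hj) as (A1 & A2 & A3 & A4).
  apply wpx_seq. destruct (Nat.eq_dec (K j) x) as [HKx|HKx].
  - eapply wpx_tri; [apply (tri_if _ _ (20 + UC))|].
    + wsim. rewrite E33. repeat split; lia.
    + wsim. rewrite E33, E32, A4. intros; lia.
    + intros _. eapply tri_le; [apply (tri_if _ _ UC)|].
      * wsim. rewrite E33. repeat split; lia.
      * wsim. rewrite E33, E32, A4. intros; lia.
      * intros _. apply (dpupd_spec s x j); auto.
      * cbn. lia.
    + intros s1 t1 Ht1 HI1 F1. frx F1 33. eapply wpx_tri; [apply (tri_wps _ _ 20 _ _ (fun s' => rg s' 33 = S j /\ ar s' 13 = ar s1 13))|].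
      { wsim. rewrite E, E33. repeat split; auto; lia. } { cbn; lia. }
      intros s2 t2 Ht2 (X1 & X2) F2. rewrite X1, X2. split; [auto|]. split; [auto|].
      rewrite (rem_step x j Hj HKx). cbn [esz] in Ht1. lia.
  - eapply wpx_tri with (t := 40) (R := fun s' => rg s' 33 = j /\ ar s' 13 = ar s 13).
    + eapply tri_le; [apply (tri_if _ _ 15)|cbn; lia].
      * wsim. rewrite E33. repeat split; lia.
      * intros _. apply tri_wps; [|cbn; lia]. wsim. auto.
      * wsim. rewrite E33, E32, A4. intros Hle.
        eapply tri_le; [apply (tri_if _ _ 0)|cbn; lia].
        -- wsim. rewrite E33. repeat split; lia.
        -- intros _. apply tri_wps; [|cbn; lia]. wsim. auto.
        -- wsim. rewrite E33, E32, A4. intros; lia.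
    + intros s1 t1 Ht1 (Y1 & Y2) F1.
      eapply wpx_tri; [apply (tri_wps _ _ 20 _ _ (fun s' => rg s' 33 = S j /\ ar s' 13 = ar s1 13))|].
      { wsim. rewrite Y1. repeat split; auto; lia. } { cbn; lia. }
      intros s2 t2 Ht2 (X1 & X2) F2. rewrite X1, X2, Y2. split; [auto|].
      rewrite (rem_same x j HKx). split; [|lia].
      eapply dpI_ext; [| |exact HI]; auto. intros i Hi. now rewrite doneK_same.
Qed.

Lemma jloop_spec s x : cands s -> rg s 33 = 0 -> rg s 32 = x -> x < G -> dpI (doneK x 0) (ar s 13) ->
  wpx jloop s (fun s' t => dpI (doneK x nc) (ar s' 13) /\ t + rem x nc * UC <= rem x 0 * UC + nc * 100 + 20 /\ fr jloop s s').
Proof.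
  intros HCs E33 E32 Hx HI.
  destruct (wpx_while m bits (fun k s' => exists j, j <= nc /\ rg s' 33 = j /\ dpI (doneK x j) (ar s' 13) /\
    k = rem x j * UC + (nc - j) * 100) (EV 33 <! EV 26) jbody s) with (k := rem x 0 * UC + nc * 100) (s := s)
    as (s' & t & Hex & Hpost).
  - intros k s1 (j & Hj & X1 & X2 & X3) F. frx F 26. frx F 31. frx F 32. frx F 38. fra F 9. fra F 10. fra F 11. fra F 12.
    assert (HC1 : cands s1) by (eapply cands_frame; eauto). pose proof HC1 as (C26 & _).
    split; [wsim; auto|]. wsim. rewrite X1, C26. intros Hlt.
    destruct (jbody_spec s1 x j HC1 X1 ltac:(congruence) Hx Hlt X2) as (s2 & t2 & Hex2 & Y1 & Y2 & Y3).
    exists s2, t2. split; [exact Hex2|]. exists (rem x (S j) * UC + (nc - S j) * 100). split.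
    + exists (S j). repeat split; auto; apply Y2.
    + cbn [esz]. lia.
  - exists 0. rewrite Nat.sub_0_r. repeat split; auto; try lia; apply HI.
  - apply fr_refl.
  - destruct Hpost as (k' & (j & Hj & X1 & X2 & X3) & Hf & F & Hk). exists s', t. split; [exact Hex|].
    frx F 26. destruct HCs as (C26 & _). wsimh Hf. rewrite X1, E, C26 in Hf. assert (Hjn : j = nc) by lia. rewrite Hjn in *.
    cbn [esz] in Hk. rewrite Nat.sub_diag in X3. repeat split; auto; try apply X2; try lia; apply F.
Qed.

Lemma xloop_spec s : cands s -> rg s 32 = 0 -> dpI (doneK 0 0) (ar s 13) ->
  tri (G * (nc * 100 + 100) + nc * UC + 20) xloop s (fun s' => dpI (fun _ => true) (ar s' 13)).
Proof.
  intros HCs E32 HI. apply tri_wpx.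
  assert (Hr0 : rem 0 0 <= nc) by apply cnt_le.
  destruct (wpx_while m bits (fun k s' => exists x, x <= G /\ rg s' 32 = x /\ dpI (doneK x 0) (ar s' 13) /\
    k = rem x 0 * UC + (G - x) * (nc * 100 + 100)) (EV 32 <! EV 38) (33 ::= EC 0;; jloop;; incr 32) s)
    with (k := rem 0 0 * UC + G * (nc * 100 + 100)) (s := s) as (s' & t & Hex & Hpost).
  - intros k s1 (x & Hx & X1 & X2 & X3) F. frx F 26. frx F 31. frx F 38. fra F 9. fra F 10. fra F 11. fra F 12.
    assert (HC1 : cands s1) by (eapply cands_frame; eauto). pose proof HC1 as (_ & C38 & _).
    split; [wsim; auto|]. wsim. rewrite X1, C38. intros Hlt.
    apply wpx_seq. eapply wpx_tri with (t := 5) (R := fun s' => rg s' 33 = 0).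
    { apply tri_wps; [|cbn; lia]. wsim. split; [lia|auto]. }
    intros s2 t2 Ht2 Y1 F2. frx F2 26. frx F2 31. frx F2 38. frx F2 32. fra F2 9. fra F2 10. fra F2 11. fra F2 12. fra F2 13.
    assert (HC2 : cands s2) by (eapply cands_frame; [exact HC1|..]; auto).
    apply wpx_seq. destruct (jloop_spec s2 x HC2 Y1 ltac:(congruence) Hlt ltac:(rewrite E14; exact X2)) as (s3 & t3 & Hex3 & Z1 & Z2 & F3).
    exists s3, t3. split; [exact Hex3|]. frx F3 32.
    eapply wpx_tri with (t := 20) (R := fun s' => rg s' 32 = S x /\ ar s' 13 = ar s3 13).
    { apply tri_wps; [|cbn; lia]. wsim. repeat split; auto; lia. }
    intros s4 t4 Ht4 (W1 & W2) _. exists (rem (S x) 0 * UC + (G - S x) * (nc * 100 + 100)). split.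
    + exists (S x). rewrite W2. split; [lia|]. split; [auto|]. split; [|auto].
      eapply dpI_ext; [| |exact Z1]; auto. apply doneK_next.
    + cbn [esz]. rewrite rem_next in Z2. replace (G - x) with (S (G - S x)) in X3 by lia. rewrite Nat.mul_succ_l in X3. lia.
  - exists 0. rewrite Nat.sub_0_r. repeat split; auto; try lia; apply HI.
  - apply fr_refl.
  - destruct Hpost as (k' & (x & Hx & X1 & X2 & X3) & Hf & F & Hk). exists s', t. split; [exact Hex|].
    frx F 38. pose proof HCs as (_ & C38 & _). wsimh Hf. rewrite X1, E, C38 in Hf. assert (HxG : x = G) by lia. rewrite HxG in *.
    cbn [esz] in Hk. split.
    + assert (rem 0 0 * UC <= nc * UC) by (apply Nat.mul_le_mono_r; auto). lia.
    + eapply dpI_ext; [| |exact X2]; auto. intros j Hj. unfold doneK, before.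
      specialize (HK j Hj). replace (K j <? G) with true by (symmetry; now apply Nat.ltb_lt). reflexivity.
Qed.

Definition candsR (s : st) : Prop := rg s 26 = nc /\ rg s 38 = G /\ rg s 30 = R /\ rg s 16 = b1 /\
  forall i, i < nc -> ar s 9 i = cw i /\ ar s 10 i = cp i /\ ar s 11 i = cs i /\ ar s 12 i = K i.

Lemma dpI_start F : (forall i, i < sz -> F i = if i =? R then b1 else 0) -> dpI (doneK 0 0) F.
Proof.
  intros HF. assert (HD0 : forall j, doneK 0 0 j = false).
  { intros j. unfold doneK, before. change (K j <? 0) with false. change (j <? 0) with false. now rewrite andb_false_r. }
  assert (Hz : forall f, (forall i, f i = 0%Z) -> sZ f nc = 0%Z).
  { intros f Hf. generalize nc. intros n. induction n as [|k IH]; [apply sZ_0|]. rewrite sZ_S, Hf. lia. }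
  split.
  - intros i Hi Hp. rewrite (HF i Hi) in Hp |- *. destruct (Nat.eqb_spec i R); [|lia]. exists (fun _ => false).
    unfold dsum, qsum. rewrite !Hz by auto. subst. split; [discriminate|lia].
  - intros D _. exists R. unfold dsum, qsum, andf. rewrite !Hz by (intros; now rewrite HD0, andb_false_r).
    rewrite HF, Nat.eqb_refl by lia. lia.
Qed.

Lemma dp_spec s : candsR s ->
  tri (G * (nc * 100 + 100) + nc * UC + sz * 50 + 200) dp s (fun s' => dpI (fun _ => true) (ar s' 13) /\ rg s' 31 = sz).
Proof.
  intros (C26 & C38 & C30 & C16 & CA). unfold dp.
  assert (HI0 : tri (sz * 50 + 50) dpinit s (fun s' => rg s' 31 = sz /\ forall i, i < sz -> ar s' 13 i = 0)).
  { eapply tri_le; [apply (tri_init_for _ _ (fun k s' => rg s' 2 = k /\ rg s' 31 = sz /\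
      forall i, i < k -> ar s' 13 i = 0) sz 40)|cbn; lia].
    - wsim. rewrite C30. repeat split; lia.
    - intros k s' Hk (X1 & X2 & X3) F. split; [wsim; auto|]. split; [wsim; lia|]. apply tri_wps; [|cbn; lia]. wsim.
      rewrite X1. repeat split; try lia. intros i Hi. destruct (Nat.eq_dec i k) as [->|]; [now rewrite updi_same|].
      rewrite updi_diff by auto. apply X3. lia.
    - intros s' (X1 & X2 & X3) F. wsim. repeat split; auto; lia. }
  eapply tri_le; [apply (tri_then _ _ _ (15 + (5 + (G * (nc * 100 + 100) + nc * UC + 20))) _ _ _ _ _ HI0)|lia].
  intros s1 (X1 & X2) F1. frx F1 26. frx F1 38. frx F1 30. frx F1 16. fra F1 9. fra F1 10. fra F1 11. fra F1 12.
  apply (tri_then _ _ _ _ _ _ _ (fun s' => ar s' 13 = updi (ar s1 13) R b1)).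
  { apply tri_wps; [|cbn; lia]. wsim. rewrite E1, C30, E2, C16. repeat split; lia. }
  intros s2 X3 F2. frx F2 26. frx F2 38. frx F2 31. fra F2 9. fra F2 10. fra F2 11. fra F2 12.
  apply (tri_then _ _ _ _ _ _ _ (fun s' => rg s' 32 = 0)).
  { apply tri_wps; [|cbn; lia]. wsim. split; [lia|auto]. }
  intros s3 X4 F3. frx F3 26. frx F3 38. frx F3 31. fra F3 9. fra F3 10. fra F3 11. fra F3 12. fra F3 13.
  eapply tri_mono; [apply le_n| |apply tri_fr, xloop_spec]; auto.
  - intros s4 (H4 & F4). frx F4 31. split; [auto|congruence].
  - unfold cands. rewrite E14, E15, E16, E17, E18, E19, E20, E7, E8, E9, E10, E11, E12, E13, E, E0, E3, E4, E5, E6. auto.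
  - rewrite E21, X3. apply dpI_start. intros i Hi. destruct (Nat.eqb_spec i R) as [->|]; [apply updi_same|].
    rewrite updi_diff by auto. now apply X2.
Qed.

Context (rem0 : nat) (Hm5 : R + rem0 + 64 < m).

Definition final : cmd := (36 ::= EC 0;; 2 ::= EC 0;; 34 ::= EV 30 +! EV 15 +! EC 1);;
  CWh (EV 2 <! EV 31) (CIf (EV 2 <! EV 34) (maxto 36 (EA 13 (EV 2))) CSkip;; incr 2);;
  CIf (EC 0 <! EV 36) (0 ::= EV 36 -! EC 1) (0 ::= EC 0).

(** Index i stands for a net added weight of i - R, so [i <= R + rem0] is the capacity constraint;
    entries are profits plus 1. *)
Definition best (F : nat -> nat) (v : nat) : Prop :=
  (v = 0 \/ exists i, i < sz /\ i <= R + rem0 /\ v + 1 = F i) /\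
  forall i, i < sz -> i <= R + rem0 -> F i <= v + 1.

Lemma final_spec s : rg s 31 = sz -> rg s 30 = R -> rg s 15 = rem0 ->
  tri (sz * 100 + 100) final s (fun s' => best (ar s 13) (rg s' 0)).
Proof.
  intros E31 E30 E15. set (SZ := sz) in *.
  eapply tri_le; [apply (tri_then _ _ 40 (SZ * (80 + 3 + 3) + 3 + 1 + 20) _ _ _
    (fun s' => rg s' 36 = 0 /\ rg s' 2 = 0 /\ rg s' 34 = R + rem0 + 1))|lia].
  - apply tri_wps; [|cbn; lia]. wsim. rewrite E30, E15. repeat split; lia.
  - intros s1 (X1 & X2 & X3) F1. frx F1 31. fra F1 13.
    apply (tri_then _ _ _ _ _ _ _ (fun s' => (rg s' 36 = 0 \/ exists i, i < SZ /\ i <= R + rem0 /\ rg s' 36 = ar s 13 i) /\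
      forall i, i < SZ -> i <= R + rem0 -> ar s 13 i <= rg s' 36)).
    + eapply tri_for_then with (I := fun k s' => rg s' 2 = k /\ (rg s' 36 = 0 \/ exists i, i < SZ /\ i <= R + rem0 /\ rg s' 36 = ar s 13 i) /\
        forall i, i < k -> i <= R + rem0 -> ar s 13 i <= rg s' 36).
      * repeat split; auto. intros; lia.
      * intros k s' Hk (Y1 & Y2 & Y3) F. frx F 31. frx F 34. fra F 13.
        split; [wsim; auto|]. split; [wsim; lia|]. apply tri_wps; [|cbn; lia]. wsim. rewrite Y1, E3, E0, E2, X3.
        repeat split; intros; try lia; eauto.
        -- right. exists k. repeat split; auto; lia.
        -- destruct (Nat.eq_dec i k) as [->|]; auto. specialize (Y3 i ltac:(lia) ltac:(auto)). lia.
        -- destruct (Nat.eq_dec i k) as [->|]; auto. apply Y3; auto; lia.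
        -- apply Y3; auto; lia.
      * intros s' (Y1 & Y2 & Y3) F. frx F 31. wsim. repeat split; auto; lia.
    + intros s2 (Y1 & Y2) F2. apply tri_wps; [|cbn; lia]. wsim. unfold best. fold SZ. repeat split; try lia.
      * destruct Y1 as [Y1|(i & A & B & C)]; [lia|]. right. exists i. repeat split; auto; lia.
      * intros i Hi Hi2. specialize (Y2 i Hi Hi2). lia.
      * intros i Hi Hi2. specialize (Y2 i Hi Hi2). lia.
Qed.
End DPProg.

Lemma list_sum_rev l : list_sum (rev l) = list_sum l.
Proof. induction l; simpl; auto. rewrite list_sum_app, IHl. simpl. lia. Qed.

(** * Moving the input *)

Definition fld (it : item) (f : nat) : nat := match f with 0 => iw it | 1 => ip it | _ => im it end.

Lemma maxval_n W items : length items <= maxval W items /\ W <= maxval W items.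
Proof.
  assert (H : forall l a, a <= fold_right Nat.max a l) by (clear; intros l a; induction l; simpl; lia).
  unfold maxval. specialize (H (map (fun it => Nat.max (iw it) (Nat.max (ip it) (im it))) items) (Nat.max (length items) W)). lia.
Qed.
Lemma maxval_fld W items i f : i < length items -> fld (nth i items dit) f <= maxval W items.
Proof.
  unfold maxval. generalize (Nat.max (length items) W) as a. intros a. revert i.
  induction items as [|it l IH]; simpl; intros i Hi; [lia|].
  destruct i as [|i]; [|specialize (IH i ltac:(lia)); lia].
  unfold fld. destruct f as [|[|]]; lia.
Qed.

Section Boot.
Context (L : nat) (P : program).
Notation m := (2 ^ L).
(* The boot code draws no random bits, so one final memory serves all bit strings. *)
Definition bstep (k pc : nat) (M : nat -> nat) (r pc' : nat) (M' : nat -> nat) (r' : nat) : Prop :=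
  forall bits, step_to L P bits k pc M r pc' M' r'.
Lemma bstep_trans k1 k2 k pc M r pc1 M1 r1 pc2 M2 r2 :
  k = k1 + k2 -> bstep k1 pc M r pc1 M1 r1 -> bstep k2 pc1 M1 r1 pc2 M2 r2 -> bstep k pc M r pc2 M2 r2.
Proof. intros E H1 H2 bits. exact (step_trans L P bits _ _ _ _ _ _ _ _ _ _ _ _ E (H1 bits) (H2 bits)). Qed.
Context (Hm : 128 < m).

Definition iex (i : instr) (M : nat -> nat) : nat -> nat :=
  match i with
  | IConst d k => upd M d (k mod m)
  | IAdd d a b => upd M d ((M a + M b) mod m)
  | ISub d a b => upd M d ((M a + m - M b mod m) mod m)
  | IMul d a b => upd M d ((M a * M b) mod m)
  | IDiv d a b => upd M d ((M a / M b) mod m)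
  | IMod d a b => upd M d ((M a mod M b) mod m)
  | IOr d a b => upd M d ((Nat.lor (M a) (M b)) mod m)
  | ILt d a b => upd M d (if Nat.ltb (M a) (M b) then 1 else 0)
  | ILoad d a => upd M d (M (M a))
  | IStore a s => upd M (M a) (M s)
  | _ => M
  end.
Definition straight (i : instr) : bool :=
  match i with IAnd _ _ _ | IXor _ _ _ | IJz _ _ | IRand _ | IHalt => false | _ => true end.
Definition sl (l : list instr) (M : nat -> nat) : nat -> nat := fold_left (fun M i => iex i M) l M.

Lemma sl_app l1 l2 M : sl (l1 ++ l2) M = sl l2 (sl l1 M).
Proof. apply fold_left_app. Qed.

Lemma sl_ok l : forall pc M r, code_at P pc l -> forallb straight l = true ->
  bstep (length l) pc M r (pc + length l) (sl l M) r.
Proof.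
  induction l as [|i l IH]; intros pc M r HC HS bits f.
  - simpl. now rewrite Nat.add_0_r.
  - apply code_cons in HC as [C HC]. simpl in HS. apply andb_prop in HS as [Hi HS].
    cbn [length Nat.add]. rewrite (run_S _ _ _ _ _ _ _ _ C).
    replace (pc + S (length l)) with (S pc + length l) by lia.
    change (sl (i :: l) M) with (sl l (iex i M)). rewrite <- (IH (S pc) (iex i M) r HC HS bits f).
    destruct i; try discriminate; reflexivity.
Qed.

Lemma iex_lt i M : (forall x, M x < m) -> forall x, iex i M x < m.
Proof.
  intros H x. assert (Hm0 : m <> 0) by lia.
  assert (Hb : forall b : bool, (if b then 1 else 0) < m) by (intros []; lia).
  destruct i; cbn [iex]; auto; unfold upd; destruct (x =? _); auto; apply Nat.mod_upper_bound; auto.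
Qed.
Lemma sl_lt l : forall M, (forall x, M x < m) -> forall x, sl l M x < m.
Proof. induction l; intros M H; simpl; auto. apply IHl, iex_lt, H. Qed.

Definition addall (ks : list nat) : list instr := map (fun k => IAdd 0 0 k) ks.
Lemma addall_spec ks : forall M, ~ In 0 ks -> M 0 + list_sum (map M ks) < m ->
  sl (addall ks) M 0 = M 0 + list_sum (map M ks) /\ forall x, x <> 0 -> sl (addall ks) M x = M x.
Proof.
  induction ks as [|k ks IH]; intros M H0 Hs.
  - simpl. split; auto.
  - simpl in Hs, H0. change (sl (addall (k :: ks)) M) with (sl (addall ks) (upd M 0 ((M 0 + M k) mod m))).
    rewrite Nat.mod_small by lia.
    assert (E : map (upd M 0 (M 0 + M k)) ks = map M ks).
    { apply map_ext_in. intros a Ha. apply upd_diff. intros ->. tauto. }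
    destruct (IH (upd M 0 (M 0 + M k))) as [A B]; [tauto|rewrite E, upd_same; lia|].
    rewrite A, E, upd_same. simpl. split; [lia|]. intros x Hx. rewrite B by auto. now apply upd_diff.
Qed.

Definition suball (ks : list nat) : list instr := map (fun k => ISub 0 0 k) ks.
Lemma suball_spec ks : forall M, ~ In 0 ks -> list_sum (map M ks) <= M 0 -> (forall x, M x < m) ->
  sl (suball ks) M 0 = M 0 - list_sum (map M ks) /\ forall x, x <> 0 -> sl (suball ks) M x = M x.
Proof.
  induction ks as [|k ks IH]; intros M H0 Hs HM.
  - simpl. rewrite Nat.sub_0_r. split; auto.
  - simpl in Hs, H0. change (sl (suball (k :: ks)) M) with (sl (suball ks) (upd M 0 ((M 0 + m - M k mod m) mod m))).
    pose proof (HM k). pose proof (HM 0).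
    rewrite (Nat.mod_small (M k)) by lia.
    replace (M 0 + m - M k) with (M 0 - M k + 1 * m) by lia. rewrite Nat.Div0.mod_add, Nat.mod_small by lia.
    assert (E : map (upd M 0 (M 0 - M k)) ks = map M ks).
    { apply map_ext_in. intros a Ha. apply upd_diff. intros ->. tauto. }
    destruct (IH (upd M 0 (M 0 - M k))) as [A B]; [tauto|rewrite E, upd_same; lia| |].
    { intros x. unfold upd. destruct (x =? 0); [lia|auto]. }
    rewrite A, E, upd_same. simpl. split; [lia|]. intros x Hx. rewrite B by auto. now apply upd_diff.
Qed.

(** Horner's scheme: the number with the given digits in base s, most significant first. *)
Definition enc (s : nat) (ds : list nat) : nat := fold_left (fun a d => a * s + d) ds 0.
Lemma enc_snoc s ds d : enc s (ds ++ [d]) = enc s ds * s + d.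
Proof. unfold enc. now rewrite fold_left_app. Qed.
Lemma enc_lt s ds : 0 < s -> Forall (fun d => d < s) ds -> enc s ds < s ^ length ds.
Proof.
  intros Hs. induction ds as [|d ds IH] using rev_ind; intros H; [cbn; lia|].
  apply Forall_app in H as [H1 H2]. inversion H2; subst. specialize (IH H1).
  rewrite enc_snoc, length_app, Nat.add_1_r. cbn [Nat.pow]. nia.
Qed.

Definition pack (ks : list nat) : list instr := flat_map (fun k => [IMul 1 1 0; IAdd 1 1 k]) ks.
Lemma pack_spec s ks : forall M ds, M 0 = s -> M 1 = enc s ds -> ~ In 1 ks -> 0 < s ->
  Forall (fun d => d < s) (ds ++ map M ks) -> s ^ (length ds + length ks) < m ->
  sl (pack ks) M 1 = enc s (ds ++ map M ks) /\ forall x, x <> 1 -> sl (pack ks) M x = M x.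
Proof.
  induction ks as [|k ks IH]; intros M ds E0 E1 H1 Hs HF Hp.
  - simpl. rewrite app_nil_r. auto.
  - simpl in H1, HF, Hp.
    change (sl (pack (k :: ks)) M) with (sl (pack ks) (upd (upd M 1 ((M 1 * M 0) mod m)) 1
      ((upd M 1 ((M 1 * M 0) mod m) 1 + upd M 1 ((M 1 * M 0) mod m) k) mod m))).
    rewrite upd_same, (upd_diff M 1 _ k) by tauto.
    assert (HF' : Forall (fun d => d < s) (ds ++ [M k])).
    { apply Forall_app in HF as [HF1 HF2]. apply Forall_app. split; auto. inversion HF2; auto. }
    pose proof (enc_lt s _ Hs HF') as HL. rewrite enc_snoc, length_app in HL. simpl in HL.
    assert (Hp2 : s ^ (length ds + 1) <= s ^ (length ds + S (length ks))) by (apply Nat.pow_le_mono_r; lia).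
    rewrite E0, E1. rewrite (Nat.mod_small (enc s ds * s)) by lia. rewrite Nat.mod_small by lia.
    set (M' := upd _ _ _).
    assert (E : map M' ks = map M ks).
    { apply map_ext_in. intros a Ha. unfold M'. rewrite !upd_diff; auto; intros ->; tauto. }
    destruct (IH M' (ds ++ [M k])) as [A B].
    + unfold M'. now rewrite !upd_diff by lia.
    + unfold M'. now rewrite upd_same, enc_snoc.
    + tauto.
    + auto.
    + rewrite E, <- app_assoc. exact HF.
    + rewrite length_app. simpl. rewrite <- Nat.add_assoc. exact Hp.
    + rewrite A, E, <- app_assoc. split; [reflexivity|]. intros x Hx. rewrite B by auto. unfold M'. now rewrite !upd_diff by auto.
Qed.

Lemma enc_mod s ds d : d < s -> enc s (ds ++ [d]) mod s = d.
Proof. intros H. rewrite enc_snoc, Nat.add_comm, Nat.Div0.mod_add, Nat.mod_small; auto. Qed.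
Lemma enc_div s ds d : d < s -> enc s (ds ++ [d]) / s = enc s ds.
Proof. intros H. rewrite enc_snoc, Nat.add_comm, Nat.div_add, Nat.div_small by lia. lia. Qed.

Definition unpack (ks : list nat) : list instr := flat_map (fun a => [IMod a 1 0; IDiv 1 1 0]) ks.
Lemma unpack_spec s ks : forall M ds es, M 0 = s -> M 1 = enc s (ds ++ rev es) -> length es = length ks ->
  Forall (fun d => d < s) es -> (forall k, In k ks -> 1 < k) -> NoDup ks -> (forall x, M x < m) ->
  sl (unpack ks) M 1 = enc s ds /\ map (sl (unpack ks) M) ks = es /\
  forall x, x <> 1 -> ~ In x ks -> sl (unpack ks) M x = M x.
Proof.
  induction ks as [|k ks IH]; intros M ds es E0 E1 Hl HF Hk HN HM.
  - destruct es; [|discriminate]. simpl in *. rewrite app_nil_r in E1. auto.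
  - destruct es as [|e es]; [discriminate|]. inversion HF; inversion HN; subst.
    simpl rev in E1. rewrite app_assoc in E1.
    change (sl (unpack (k :: ks)) M) with (sl (unpack ks) (iex (IDiv 1 1 0) (iex (IMod k 1 0) M))).
    assert (Hk1 : 1 < k) by (apply Hk; simpl; auto).
    assert (HM2 : forall x, iex (IDiv 1 1 0) (iex (IMod k 1 0) M) x < m) by (apply iex_lt, iex_lt, HM).
    set (M' := iex (IDiv 1 1 0) (iex (IMod k 1 0) M)) in *.
    assert (V1 : M' 1 = enc (M 0) (ds ++ rev es)).
    { unfold M'. cbn [iex]. rewrite upd_same, !upd_diff by lia. rewrite E1, enc_div by auto.
      apply Nat.mod_small. pose proof (HM 1) as HX. rewrite E1, enc_snoc in HX. nia. }
    assert (Vk : M' k = e).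
    { unfold M'. cbn [iex]. rewrite upd_diff, upd_same by lia. rewrite E1, enc_mod by auto. apply Nat.mod_small.
      pose proof (HM 0). lia. }
    assert (Vx : forall x, x <> 1 -> x <> k -> M' x = M x).
    { intros x X1 X2. unfold M'. cbn [iex]. now rewrite !upd_diff by auto. }
    destruct (IH M' ds es) as (A & B & C); auto.
    { apply Vx; lia. }
    { intros j Hj. apply Hk. simpl; auto. }
    + split; [exact A|]. split.
      * simpl. rewrite B. f_equal. rewrite C; auto. lia.
      * intros x X1 X2. simpl in X2. rewrite C, Vx; auto.
Qed.

(** Cell 0 no longer holds the number of items but the sum of all eight cells; subtracting the
    digits from a copy of that sum recovers the number of items in cell 2. *)
Definition decode (k : nat) : list instr := flat_map (fun _ => [IMod 4 3 0; ISub 2 2 4; IDiv 3 3 0]) (repeat tt k).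
Lemma decode_spec s : forall es M, M 0 = s -> M 3 = enc s (rev es) ->
  Forall (fun d => d < s) es -> list_sum es <= M 2 -> (forall x, M x < m) ->
  sl (decode (length es)) M 2 = M 2 - list_sum es /\
  forall x, x <> 2 -> x <> 3 -> x <> 4 -> sl (decode (length es)) M x = M x.
Proof.
  unfold decode. intros es. induction es as [|e es IH]; intros M E0 E3 HF Hs HM.
  - simpl. split; auto. lia.
  - inversion HF; subst. simpl in E3, Hs.
    change (sl (flat_map (fun _ => [IMod 4 3 0; ISub 2 2 4; IDiv 3 3 0]) (repeat tt (length (e :: es)))) M)
      with (sl (flat_map (fun _ => [IMod 4 3 0; ISub 2 2 4; IDiv 3 3 0]) (repeat tt (length es)))
        (iex (IDiv 3 3 0) (iex (ISub 2 2 4) (iex (IMod 4 3 0) M)))).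
    assert (HM2 : forall x, iex (IDiv 3 3 0) (iex (ISub 2 2 4) (iex (IMod 4 3 0) M)) x < m) by (apply iex_lt, iex_lt, iex_lt, HM).
    set (M' := iex (IDiv 3 3 0) (iex (ISub 2 2 4) (iex (IMod 4 3 0) M))) in *.
    pose proof (HM 0) as B0. pose proof (HM 2) as B2. pose proof (HM 3) as B3.
    assert (V3 : M' 3 = enc (M 0) (rev es)).
    { unfold M'. cbn [iex]. rewrite upd_same, !upd_diff by lia. rewrite E3, enc_div by auto.
      apply Nat.mod_small. rewrite E3, enc_snoc in B3. nia. }
    assert (V2 : M' 2 = M 2 - e).
    { unfold M'. cbn [iex]. rewrite upd_diff, upd_same by lia. rewrite upd_same. rewrite (upd_diff M 4 _ 2) by lia.
      rewrite E3, enc_mod by auto. rewrite !(Nat.mod_small e) by lia.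
      replace (M 2 + m - e) with (M 2 - e + 1 * m) by lia. rewrite Nat.Div0.mod_add. apply Nat.mod_small. lia. }
    assert (Vx : forall x, x <> 2 -> x <> 3 -> x <> 4 -> M' x = M x).
    { intros x X1 X2 X3. unfold M'. cbn [iex]. now rewrite !upd_diff by auto. }
    destruct (IH M' ltac:(apply Vx; lia) V3 ltac:(auto) ltac:(lia) HM2) as (A & B).
    split; [rewrite A, V2; simpl; lia|]. intros x X1 X2 X3. rewrite B, Vx; auto.
Qed.

(** Cell 0 becomes the base, the sum of cells 0 to 7, and cell 1 the number whose digits are cells 1
    to 7. No other cell is written before this is done; afterwards cells 2 to 7 are free. *)
Definition boot1 : list instr :=
  addall (seq 1 7) ++ pack (seq 2 6) ++ [IOr 2 0 0; IOr 3 1 1] ++ decode 7.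
Definition bcond : list instr := [IConst 5 2; ILt 5 5 2].
Definition bA : list instr := [IConst 6 1; ISub 2 2 6; IConst 5 3; IMul 4 2 5; IConst 5 2; IAdd 4 4 5;
  IConst 5 16; IMul 3 2 5; IConst 5 64; IAdd 3 3 5].
Definition bB : list instr := [ILoad 5 4; IStore 3 5; IAdd 3 3 6; IAdd 4 4 6].
(** Items move upwards in memory, so they are copied from the last one down. Items 0 and 1 filled
    cells 2 to 7 and are restored from the packed number instead. *)
Definition bmove : list instr := bA ++ bB ++ bB ++ bB ++ [IConst 5 0].
(** Digits come off least significant first, hence the cells of item 1 precede those of item 0. The
    digit left in cell 1 is the capacity, and cell 0 becomes the number of items once all digits are
    subtracted from the base. *)
Definition boot3 : list instr :=
  unpack [82; 81; 80; 66; 65; 64] ++ suball [1; 82; 81; 80; 66; 65; 64].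
Definition boot2_pc : nat := length boot1.
Definition boot3_pc : nat := boot2_pc + length bcond + 1 + length bmove + 1.
Definition boot : list instr :=
  boot1 ++ bcond ++ [IJz 5 boot3_pc] ++ bmove ++ [IJz 5 boot2_pc] ++ boot3.

Lemma bB_spec M : 8 <= M 3 -> 8 <= M 4 -> M 6 = 1 -> M 3 + 1 < m -> M 4 + 1 < m ->
  let M' := sl bB M in
  M' 3 = M 3 + 1 /\ M' 4 = M 4 + 1 /\ M' (M 3) = M (M 4) /\
  (forall x, x <> 3 -> x <> 4 -> x <> 5 -> x <> M 3 -> M' x = M x).
Proof.
  intros H3 H4 H6 B3 B4. cbv zeta. set (a := M 3) in *. set (b := M 4) in *.
  assert (E : sl bB M = upd (upd (upd (upd M 5 (M b)) a (M b)) 3 (a + 1)) 4 (b + 1)).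
  { unfold bB, sl. cbn [fold_left iex]. fold b.
    assert (E1 : upd M 5 (M b) 3 = a) by (apply upd_diff; lia). rewrite !E1.
    rewrite (upd_same M 5).
    set (N := upd (upd M 5 (M b)) a (M b)).
    assert (N3 : N 3 = a) by (unfold N; rewrite !upd_diff by lia; reflexivity).
    assert (N4 : N 4 = b) by (unfold N; rewrite !upd_diff by lia; reflexivity).
    assert (N6 : N 6 = 1) by (unfold N; rewrite !upd_diff by lia; exact H6).
    rewrite N3, N6, (Nat.mod_small (a + 1)) by lia.
    rewrite (upd_diff N 3 _ 4), (upd_diff N 3 _ 6), N4, N6, (Nat.mod_small (b + 1)) by lia. reflexivity. }
  rewrite E. repeat split.
  - rewrite !(upd_diff _ _ _ a) by lia. apply upd_same.
  - intros x X1 X2 X3 X4. now rewrite !upd_diff by auto.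
Qed.

Lemma bA_spec M i : M 2 = S i -> 64 + 16 * i + 16 < m ->
  let M' := sl bA M in
  M' 2 = i /\ M' 3 = 64 + 16 * i /\ M' 4 = 2 + 3 * i /\ M' 6 = 1 /\
  (forall x, ~ (2 <= x <= 6) -> M' x = M x).
Proof.
  intros H2 Hi. cbv zeta. unfold bA, sl. cbn [fold_left iex upd Nat.eqb].
  rewrite H2, !(Nat.mod_small 1), !(Nat.mod_small 3), !(Nat.mod_small 2), !(Nat.mod_small 16), !(Nat.mod_small 64) by lia.
  replace (S i + m - 1) with (i + 1 * m) by lia. rewrite Nat.Div0.mod_add, !(Nat.mod_small i) by lia.
  rewrite (Nat.mod_small (i * 16)), (Nat.mod_small (i * 3)) by lia. rewrite !Nat.mod_small by lia.
  repeat split; try lia. intros x Hx.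
  now rewrite !upd_diff by lia.
Qed.

Lemma bmove_spec M i : M 2 = S i -> 2 <= i -> 64 + 16 * i + 16 < m ->
  let M' := sl bmove M in
  M' 2 = i /\ M' 5 = 0 /\ (forall f, f < 3 -> M' (64 + 16 * i + f) = M (2 + 3 * i + f)) /\
  (forall x, ~ (2 <= x <= 6) -> x < 64 + 16 * i \/ 64 + 16 * i + 3 <= x -> M' x = M x).
Proof.
  intros H2 Hi Hb. cbv zeta. unfold bmove. rewrite !sl_app.
  destruct (bA_spec M i H2 Hb) as (A2 & A3 & A4 & A6 & Ax). set (M1 := sl bA M) in *.
  destruct (bB_spec M1) as (B3 & B4 & B5 & Bx); try lia. set (M2 := sl bB M1) in *.
  destruct (bB_spec M2) as (C3 & C4 & C5 & Cx); try lia.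
  { rewrite Bx by lia. auto. }
  set (M3 := sl bB M2) in *.
  destruct (bB_spec M3) as (D3 & D4 & D5 & Dx); try lia.
  { rewrite Cx, Bx by lia. auto. }
  set (M4 := sl bB M3) in *.
  assert (E : sl [IConst 5 0] M4 = upd M4 5 0).
  { unfold sl. cbn [fold_left iex]. now rewrite Nat.mod_small by lia. }
  rewrite E. split; [|split; [|split]].
  - rewrite upd_diff, Dx, Cx, Bx by lia. auto.
  - apply upd_same.
  - intros f Hf. rewrite upd_diff by lia. destruct f as [|[|[|f]]]; [| | |lia].
    + rewrite Dx, Cx by lia. replace (64 + 16 * i + 0) with (M1 3) by lia. rewrite B5, A4, Ax by lia. f_equal; lia.
    + rewrite Dx by lia. replace (64 + 16 * i + 1) with (M2 3) by lia. rewrite C5, B4, A4, Bx, Ax by lia. f_equal; lia.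
    + replace (64 + 16 * i + 2) with (M3 3) by lia. rewrite D5, C4, B4, A4, Cx, Bx, Ax by lia. f_equal; lia.
  - intros x X1 X2. rewrite upd_diff, Dx, Cx, Bx, Ax by lia. auto.
Qed.

Lemma boot_code pc l1 l2 : code_at P 0 boot -> boot = l1 ++ pc ++ l2 -> code_at P (length l1) pc.
Proof. intros HC E. rewrite E in HC. apply code_app in HC as [_ HC]. now apply code_app in HC as [HC _]. Qed.

Context (W : nat) (items : list item) (Hv : valid_instance W items) (Hcode : code_at P 0 boot).
Notation M0 := (init_mem W items).
Notation n := (length items).
Notation A := (maxval W items).
Context (HA : (8 * A) ^ 7 < m) (HnA : 64 + 16 * n + 64 < m).

Lemma init_fld i f : f < 3 -> M0 (2 + 3 * i + f) = if i <? n then fld (nth i items dit) f else 0.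
Proof.
  intros Hf. change (2 + 3 * i + f) with (S (S (3 * i + f))). cbn [init_mem].
  assert (E1 : (3 * i + f) / 3 = i) by (symmetry; apply (Nat.div_unique _ 3 i f); lia).
  assert (E2 : (3 * i + f) mod 3 = f) by (symmetry; apply (Nat.mod_unique _ 3 i f); lia).
  rewrite E1, E2. destruct (Nat.ltb_spec i n) as [h|h].
  - rewrite (nth_error_nth' items dit h). destruct f as [|[|[|]]]; reflexivity || lia.
  - apply nth_error_None in h. now rewrite h.
Qed.

Lemma init_le x : M0 x <= A.
Proof.
  pose proof (maxval_n W items). destruct x as [|[|x]]; cbn [init_mem]; [lia|lia|].
  destruct (nth_error items (x / 3)) as [it|] eqn:E; [|lia].
  apply nth_error_nth with (d := dit) in E as E'. assert (Hl : x / 3 < n) by (apply nth_error_Some; congruence).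
  destruct (x mod 3) as [|[|k]].
  - rewrite <- E'. apply (maxval_fld W items _ 0 Hl).
  - rewrite <- E'. apply (maxval_fld W items _ 1 Hl).
  - rewrite <- E'. apply (maxval_fld W items _ 2 Hl).
Qed.

Definition ssum : nat := list_sum (map M0 (seq 0 8)).
Lemma ssum_le : ssum <= 8 * A.
Proof.
  unfold ssum. pose proof init_le as H. cbn [seq map list_sum fold_right].
  pose proof (H 0); pose proof (H 1); pose proof (H 2); pose proof (H 3); pose proof (H 4); pose proof (H 5); pose proof (H 6); pose proof (H 7). lia.
Qed.
Definition digs : list nat := W :: map M0 (seq 2 6).
Lemma digs_sum : n + list_sum digs = ssum.
Proof. reflexivity. Qed.
(** The sum contains, besides each digit, the positive number of items. *)
Lemma digs_lt : Forall (fun d => d < ssum) digs.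
Proof.
  destruct Hv as (Hw & Hne & Hall). assert (Hn : 0 < n) by (destruct items; simpl; [congruence|lia]).
  pose proof (init_fld 0 0 ltac:(lia)) as H0. replace (0 <? n) with true in H0 by (symmetry; apply Nat.ltb_lt; auto).
  assert (H2 : 0 < M0 2).
  { change 2 with (2 + 3 * 0 + 0). rewrite H0. rewrite Forall_forall in Hall. apply (Hall (nth 0 items dit)). apply nth_In. auto. }
  pose proof digs_sum as E. unfold digs in *. cbn [seq map list_sum fold_right] in *.
  repeat constructor; lia.
Qed.

Lemma boot1_spec : exists M1, bstep (length boot1) 0 M0 0 boot2_pc M1 0 /\
  M1 0 = ssum /\ M1 1 = enc ssum digs /\ M1 2 = n /\ (forall x, 5 <= x -> M1 x = M0 x) /\ (forall x, M1 x < m).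
Proof.
  assert (HM : forall x, M0 x < m).
  { intros x. eapply Nat.le_lt_trans; [apply init_le|]. eapply Nat.le_lt_trans; [|exact HA].
    destruct (Nat.eq_dec A 0) as [->|]; [lia|]. cbn [Nat.pow].
    pose proof (Nat.pow_nonzero (8 * A) 6 ltac:(lia)). cbn [Nat.pow] in *. nia. }
  assert (Hs0 : 0 < ssum) by (pose proof digs_lt as H; inversion H; lia).
  assert (Hs7 : ssum ^ 7 < m).
  { eapply Nat.le_lt_trans; [|exact HA]. apply Nat.pow_le_mono_l, ssum_le. }
  assert (Hsm : ssum < m).
  { eapply Nat.le_lt_trans; [|exact Hs7]. rewrite <- (Nat.pow_1_r ssum) at 1. apply Nat.pow_le_mono_r; lia. }
  assert (HC1 : code_at P 0 boot1) by (apply (boot_code boot1 [] (bcond ++ [IJz 5 boot3_pc] ++ bmove ++ [IJz 5 boot2_pc] ++ boot3)); auto).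
  exists (sl boot1 M0). split; [apply sl_ok; auto|].
  assert (HB : forall x, sl boot1 M0 x < m) by (apply sl_lt; auto).
  unfold boot1 in *. rewrite !sl_app in *.
  destruct (addall_spec (seq 1 7) M0) as [A0 Ax].
  { intros H. apply in_seq in H. lia. }
  { change (M0 0 + list_sum (map M0 (seq 1 7))) with ssum. auto. }
  change (M0 0 + list_sum (map M0 (seq 1 7))) with ssum in A0.
  set (Ma := sl (addall (seq 1 7)) M0) in *.
  assert (Em : map Ma (seq 2 6) = map M0 (seq 2 6)).
  { apply map_ext_in. intros a Ha. apply in_seq in Ha. apply Ax. lia. }
  destruct (pack_spec ssum (seq 2 6) Ma [W]) as [B1 Bx]; auto.
  { intros H. apply in_seq in H. lia. }
  { rewrite Em. apply digs_lt. }
  rewrite Em in B1. change ([W] ++ map M0 (seq 2 6)) with digs in B1.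
  set (Mb := sl (pack (seq 2 6)) Ma) in *.
  assert (HBb : forall x, Mb x < m) by (apply sl_lt, sl_lt, HM).
  set (Mc := sl [IOr 2 0 0; IOr 3 1 1] Mb) in *.
  assert (HBc : forall x, Mc x < m) by (apply sl_lt, HBb).
  assert (Ec : Mc = upd (upd Mb 2 ssum) 3 (enc ssum digs)).
  { unfold Mc, sl. cbn [fold_left iex]. rewrite !Nat.lor_diag. rewrite (Nat.mod_small (Mb 0)) by auto.
    rewrite (Bx 0), A0 by lia. rewrite (upd_diff _ _ _ 1) by lia. rewrite (Nat.mod_small (Mb 1)) by auto. now rewrite B1. }
  destruct (decode_spec ssum (rev digs) Mc) as [C2 Cx].
  { rewrite Ec, !upd_diff by lia. rewrite Bx by lia. auto. }
  { rewrite Ec, upd_same, rev_involutive. auto. }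
  { apply Forall_rev, digs_lt. }
  { rewrite Ec, upd_diff, upd_same by lia. rewrite list_sum_rev, <- digs_sum. lia. }
  { auto. }
  change (length (rev digs)) with 7 in *. set (Md := sl (decode 7) Mc) in *.
  split; [|split; [|split; [|split]]]; auto.
  - rewrite C2, Ec, upd_diff, upd_same by lia. rewrite list_sum_rev, <- digs_sum. lia.
  - intros x Hx. rewrite Cx, Ec, !upd_diff, Bx, Ax by lia. auto.
Qed.

Definition LI (k : nat) (M : nat -> nat) : Prop :=
  M 2 = k /\ M 0 = ssum /\ M 1 = enc ssum digs /\ (forall x, 8 <= x < 2 + 3 * k -> M x = M0 x) /\
  (forall j f, k <= j < n -> 2 <= j -> f < 3 -> M (64 + 16 * j + f) = M0 (2 + 3 * j + f)) /\ (forall x, M x < m).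

Lemma boot2_spec k : forall M, k <= n -> LI k M ->
  exists t M' k', t <= 40 * k + 10 /\ k' <= 2 /\ LI k' M' /\ bstep t boot2_pc M 0 boot3_pc M' 0.
Proof.
  pose proof Hcode as HC. unfold boot in HC. apply code_app in HC as [_ HC]. cbn [Nat.add] in HC. fold boot2_pc in HC.
  apply code_app in HC as [C1 HC]. apply code_app in HC as [C2 HC]. apply code_app in HC as [C3 HC].
  apply code_app in HC as [C4 _]. apply code_cons in C2 as [C2 _]. apply code_cons in C4 as [C4 _].
  change (length [IJz 5 boot3_pc]) with 1 in *.
  induction k as [k IH] using lt_wf_ind. intros M Hk HL.
  pose proof HL as (L2 & L0 & L1 & Lx & Lj & Lm).
  pose proof (sl_ok bcond boot2_pc M 0 C1 eq_refl) as S1. set (M1 := sl bcond M) in *.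
  assert (E5 : M1 = upd (upd M 5 2) 5 (if 2 <? k then 1 else 0)).
  { unfold M1, bcond, sl. cbn [fold_left iex]. rewrite (Nat.mod_small 2) by lia.
    rewrite upd_same, upd_diff, L2 by lia. reflexivity. }
  assert (Hb1 : forall x, M1 x < m) by (apply sl_lt; auto).
  assert (HL1 : LI k M1).
  { unfold LI. rewrite E5. repeat split; intros; rewrite ?upd_diff by lia; auto.
    rewrite <- E5. auto. }
  assert (S2 : bstep 1 (boot2_pc + length bcond) M1 0 (if 2 <? k then S (boot2_pc + length bcond) else boot3_pc) M1 0).
  { intros bits f. cbn [Nat.add]. rewrite (run_S _ _ _ _ _ _ _ _ C2). cbn [stp].
    assert (E15 : M1 5 = if 2 <? k then 1 else 0) by (rewrite E5; apply upd_same).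
    rewrite E15. destruct (2 <? k); reflexivity. }
  destruct (Nat.ltb_spec 2 k) as [H2|H2].
  - destruct k as [|i]; [lia|].
    pose proof (sl_ok bmove (S (boot2_pc + length bcond)) M1 0) as S3.
    replace (S (boot2_pc + length bcond)) with (boot2_pc + length bcond + 1) in * by lia.
    specialize (S3 C3 eq_refl). set (M2 := sl bmove M1) in *.
    destruct HL1 as (K2 & K0 & K1 & Kx & Kj & _).
    destruct (bmove_spec M1 i K2 ltac:(lia) ltac:(lia)) as (B2 & B5 & Bf & Bx).
    fold M2 in B2, B5, Bf, Bx.
    assert (HL2 : LI i M2).
    { split; [auto|]. split; [rewrite Bx; auto; lia|]. split; [rewrite Bx; auto; lia|]. split; [|split].
      - intros x Hx. rewrite Bx by lia. apply Kx. lia.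
      - intros j f Hj Hj2 Hf. destruct (Nat.eq_dec j i) as [->|].
        + rewrite Bf by auto. apply Kx. lia.
        + rewrite Bx by lia. apply Kj; lia.
      - apply sl_lt; auto. }
    assert (S4 : bstep 1 (boot2_pc + length bcond + 1 + length bmove) M2 0 boot2_pc M2 0).
    { intros bits f. cbn [Nat.add]. rewrite (run_S _ _ _ _ _ _ _ _ C4). cbn [stp]. now rewrite B5. }
    destruct (IH i ltac:(lia) M2 ltac:(lia) HL2) as (t & M' & k' & T1 & T2 & T3 & T4).
    exists (length bcond + (1 + (length bmove + (1 + t)))), M', k'. split; [cbn; lia|]. split; [auto|]. split; [auto|].
    eapply bstep_trans; [reflexivity|exact S1|]. eapply bstep_trans; [reflexivity|exact S2|].
    eapply bstep_trans; [reflexivity|exact S3|]. eapply bstep_trans; [reflexivity|exact S4|]. exact T4.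
  - exists (length bcond + 1), M1, k. split; [cbn; lia|]. split; [auto|]. split; [auto|].
    eapply bstep_trans; [reflexivity|exact S1|exact S2].
Qed.

Lemma boot_spec : exists t M' s, t <= 40 * n + 200 /\ rel L M' s /\ inp s W items /\ rp s = 0 /\
  bstep t 0 M0 0 (length boot) M' 0.
Proof.
  destruct boot1_spec as (M1 & S1 & A0 & A1 & A2 & Ax & Am).
  assert (HL : LI n M1).
  { repeat split; auto; intros; try lia. apply Ax. lia. }
  destruct (boot2_spec n M1 ltac:(lia) HL) as (t2 & M2 & k' & T1 & T2 & (K2 & K0 & K1 & Kx & Kj & Km) & S2).
  assert (C3 : code_at P boot3_pc boot3).
  { replace boot3_pc with (length (boot1 ++ bcond ++ [IJz 5 boot3_pc] ++ bmove ++ [IJz 5 boot2_pc])).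
    - apply (boot_code boot3 _ []); auto.
    - reflexivity. }
  pose proof (sl_ok boot3 boot3_pc M2 0 C3 eq_refl) as S3.
  set (M3 := sl boot3 M2) in *. assert (Hm3 : forall x, M3 x < m) by (apply sl_lt; auto).
  assert (F3 : M3 0 = n /\ M3 1 = W /\ (forall f, f < 3 -> M3 (64 + f) = M0 (2 + f)) /\ (forall f, f < 3 -> M3 (80 + f) = M0 (5 + f)) /\
    forall x, 83 <= x -> M3 x = M2 x).
  { unfold M3, boot3. rewrite sl_app.
    pose proof digs_lt as HD. unfold digs in HD. inversion HD as [|? ? HDW HD'].
    destruct (unpack_spec ssum [82; 81; 80; 66; 65; 64] M2 [W] (rev (map M0 (seq 2 6)))) as (U1 & U2 & U3); auto.
    - apply Forall_rev. auto.
    - simpl. intros k Hk. repeat (destruct Hk as [<-|Hk]; [lia|]). contradiction.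
    - repeat (constructor; [simpl; lia|]). constructor.
    - assert (HmU : forall x, sl (unpack [82; 81; 80; 66; 65; 64]) M2 x < m) by (apply sl_lt; auto).
      set (MU := sl (unpack [82; 81; 80; 66; 65; 64]) M2) in *.
      change (rev (map M0 (seq 2 6))) with [M0 7; M0 6; M0 5; M0 4; M0 3; M0 2] in U2.
      assert (V7 : MU 82 = M0 7) by exact (f_equal (fun l => nth 0 l 0) U2).
      assert (V6 : MU 81 = M0 6) by exact (f_equal (fun l => nth 1 l 0) U2).
      assert (V5 : MU 80 = M0 5) by exact (f_equal (fun l => nth 2 l 0) U2).
      assert (V4 : MU 66 = M0 4) by exact (f_equal (fun l => nth 3 l 0) U2).
      assert (V3 : MU 65 = M0 3) by exact (f_equal (fun l => nth 4 l 0) U2).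
      assert (V2 : MU 64 = M0 2) by exact (f_equal (fun l => nth 5 l 0) U2).
      assert (U1' : MU 1 = W) by (rewrite U1; cbn; lia).
      assert (U0 : MU 0 = ssum) by (rewrite U3; [auto|lia|simpl; lia]).
      assert (Hsum : n + list_sum (map MU [1; 82; 81; 80; 66; 65; 64]) = ssum).
      { rewrite <- digs_sum. unfold digs. cbn [map list_sum fold_right seq]. rewrite U1', V2, V3, V4, V5, V6, V7. lia. }
      destruct (suball_spec [1; 82; 81; 80; 66; 65; 64] MU) as [W0 Wx]; auto.
      + simpl. lia.
      + lia.
      + split; [lia|]. split; [rewrite Wx by lia; auto|]. split; [|split].
        * intros f Hf. rewrite Wx by lia. destruct f as [|[|[|]]]; simpl; auto; lia.
        * intros f Hf. rewrite Wx by lia. destruct f as [|[|[|]]]; simpl; auto; lia.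
        * intros y Hy. rewrite Wx, U3 by (simpl; lia). auto. }
  destruct F3 as (F0 & F1 & Fa & Fb & Fx).
  (* The abstract state is read off the final memory through the layout in [rel]. *)
  exists (length boot1 + (t2 + length boot3)), M3, (St M3 (fun a i => M3 (64 + 16 * i + a)) 0).
  split; [change (length boot1) with 42; change (length boot3) with 19; lia|]. split; [repeat split; auto|]. split; [|split; [reflexivity|]].
  - split; [exact F0|]. split; [exact F1|]. cbn [ar]. intros i Hi.
    assert (G : forall f, f < 3 -> M3 (64 + 16 * i + f) = fld (nth i items dit) f).
    { intros f Hf. pose proof (init_fld i f Hf) as E. replace (i <? n) with true in E by (symmetry; apply Nat.ltb_lt; auto).
      rewrite <- E. destruct i as [|[|i]].
      - rewrite <- Fa by auto. f_equal; lia.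
      - replace (2 + 3 * 1 + f) with (5 + f) by lia. rewrite <- Fb by auto. f_equal; lia.
      - rewrite Fx by lia. apply Kj; lia. }
    rewrite !G by lia. auto.
  - eapply bstep_trans; [reflexivity|exact S1|]. eapply bstep_trans; [reflexivity|exact S2|].
    replace (length boot) with (boot3_pc + length boot3) by reflexivity. exact S3.
Qed.
End Boot.

(** * Candidates and the optimum *)

(** Reversed and with the selection complemented, the greedy prefix turns removals into additions.
    [propC] is invariant under this, so one scan serves both sides of the break. *)
Definition flip (z : bl) : bl := rev (map (fun c => (fst c, negb (snd c))) z).

Lemma se_flip z : se (flip z) = rev (un z).
Proof.
  unfold flip. induction z as [|[c []] z IH]; [reflexivity| |]; simpl map; simpl rev; rewrite se_app, IH.
  - unfold se, un. simpl. now rewrite app_nil_r.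
  - unfold se, un. simpl. reflexivity.
Qed.
Lemma un_flip z : un (flip z) = rev (se z).
Proof.
  unfold flip. induction z as [|[c []] z IH]; [reflexivity| |]; simpl map; simpl rev; rewrite un_app, IH.
  - unfold se, un. simpl. reflexivity.
  - unfold se, un. simpl. now rewrite app_nil_r.
Qed.
Lemma base_flip z : base (flip z) = rev (base z).
Proof. unfold base, flip. rewrite map_rev, map_map. reflexivity. Qed.
Lemma flip_flip z : flip (flip z) = z.
Proof.
  unfold flip. rewrite map_rev, rev_involutive, map_map. rewrite <- map_id. apply map_ext.
  intros [c []]; reflexivity.
Qed.
Lemma flip_app l1 l2 : flip (l1 ++ l2) = flip l2 ++ flip l1.
Proof. unfold flip. now rewrite map_app, rev_app_distr. Qed.

Lemma propC_flip z : propC z -> propC (flip z).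
Proof.
  intros HC l1 l2 E a b1 b2 H1 H2.
  assert (Ez : z = flip l2 ++ flip l1) by (rewrite <- flip_app, <- E; symmetry; apply flip_flip).
  apply (HC _ _ Ez a b2 b1).
  - rewrite un_flip. eapply ach_perm; [apply Permutation_rev|exact H2].
  - rewrite se_flip. eapply ach_perm; [apply Permutation_rev|exact H1].
Qed.
Lemma propC_app z1 z2 : propC (z1 ++ z2) -> propC z1 /\ propC z2.
Proof.
  intros HC. split; intros l1 l2 E a b1 b2 H1 H2; subst.
  - apply (HC l1 (l2 ++ z2) ltac:(now rewrite app_assoc) a b1 b2); auto.
    rewrite se_app. now apply ach_weaken.
  - apply (HC (z1 ++ l1) l2 ltac:(now rewrite app_assoc) a b1 b2); auto.
    rewrite un_app. rewrite <- (Nat.add_0_l a), <- (Nat.add_0_l b1). apply ach_app; auto. apply ach_0.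
Qed.

Lemma sumw_rev l : sumw (rev l) = sumw l.
Proof. apply sumw_perm, Permutation_sym, Permutation_rev. Qed.
Lemma sump_rev l : sump (rev l) = sump l.
Proof. induction l; auto. simpl. rewrite sump_app, sump_cons, IHl. unfold sump. simpl. lia. Qed.

Definition optE (W : nat) (E : list (nat * nat)) (v : nat) : Prop :=
  (exists a, a <= W /\ ach E a v) /\ forall a b, a <= W -> ach E a b -> b <= v.

(** Descent on the gap between the total profit and an achieved one. *)
Lemma optE_exists W E : exists v, optE W E v.
Proof.
  assert (H : forall k, (exists a b, a <= W /\ ach E a b /\ sump E <= b + k) -> exists v, optE W E v).
  { induction k as [|k IH]; intros (a & b & A & B & C).
    - exists b. split; [eauto|]. intros a' b' _ H'. apply ach_le in H'. lia.
    - destruct (classic (exists a b, a <= W /\ ach E a b /\ sump E <= b + k)) as [h|h]; [auto|].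
      exists b. split; [eauto|]. intros a' b' A' B'. apply Nat.nlt_ge. intros Hlt. apply h.
      exists a', b'. repeat split; auto. lia. }
  apply (H (sump E)). exists 0, 0. split; [lia|]. split; [apply ach_0|lia].
Qed.

(** The canonical optimum cut at the greedy break: [z1] marks the copies added, [z2], the flipped
    prefix, those removed. The last two clauses express feasibility and the optimal value through
    the two sides. *)
Lemma decomposition w W rl brk xx v :
  let E := expand rl in
  StronglySorted eff E -> Forall (fun c => 0 < fst c <= w /\ 0 < snd c) E -> optE W E v ->
  (match skipn brk rl with [] => True | (x, k) :: _ => xx < k /\ W < sumw (pref brk xx rl) + fst x end) ->
  sumw (pref brk xx rl) <= W ->
  exists z1 z2, base z1 = expand (rightl brk xx rl) /\ base z2 = expand (leftl brk xx rl) /\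
    propC z1 /\ propC z2 /\ length (se z1) <= 2 * w /\ length (se z2) <= 2 * w /\
    sumw (se z1) <= sumw (se z2) + w /\ sumw (se z2) <= sumw (se z1) + w /\
    sumw (pref brk xx rl) + sumw (se z1) <= W + sumw (se z2) /\
    v + sump (se z2) = sump (pref brk xx rl) + sump (se z1).
Proof.
  intros E HS HF [HV HO] Hg HW.
  destruct (exists_canonical E W v HS) as (z & Z1 & Z2 & Z3 & Z4); auto.
  { eapply Forall_impl; [|exact HF]. simpl. intros; lia. }
  assert (HE : E = pref brk xx rl ++ expand (rightl brk xx rl)).
  { apply expand_rightl. destruct (skipn brk rl) as [|[x k] t]; [auto|]. lia. }
  rewrite HE in Z1. destruct (base_app_inv _ _ _ Z1) as (za & zb & -> & Ba & Bb).
  destruct (proximity w W (za ++ zb) za zb) as (P1 & P2 & P3 & P4); auto.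
  - rewrite Z1, <- HE. exact HF.
  - rewrite Z1, <- HE, Z3. exact HO.
  - rewrite Ba. auto.
  (* The first copy to the right of the break belongs to the broken run, because [xx < k]; it is the
     one that exceeds W. *)
  - destruct zb as [|c zb]; auto. rewrite Ba.
    assert (Hin : In (fst c) (expand (rightl brk xx rl))) by (rewrite <- Bb; left; reflexivity).
    unfold rightl in Bb, Hin. destruct (skipn brk rl) as [|[x k] t] eqn:Es; [destruct Hin|].
    destruct Hg as [Hx Hg].
    change ((x, k - xx) :: t) with ([(x, k - xx)] ++ t) in Bb. rewrite expand_app in Bb.
    destruct x as [xw xp]. rewrite expand_one in Bb. destruct (k - xx) as [|r] eqn:Er.
    + lia.
    + simpl in Bb. injection Bb as Ec _. rewrite Ec. simpl in *. lia.
  - exists zb, (flip za). rewrite base_flip, Ba, Bb, expand_leftl. rewrite se_flip, length_rev, sumw_rev, sump_rev.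
    destruct (propC_app _ _ Z4) as [C1 C2]. apply propC_flip in C1.
    rewrite se_app, sumw_app in Z2. rewrite se_app, sump_app in Z3.
    pose proof (sum_base za) as [S1 S2]. rewrite Ba in S1, S2.
    repeat split; auto; lia.
Qed.

Definition irl (items : list item) : list runT := map (fun it => ((iw it, ip it), im it)) items.

Lemma ach_items items : forall a b, ach (expand (irl items)) a b <->
  exists x, Forall2 (fun it xi => xi <= im it) items x /\ sel_weight items x = a /\ sel_profit items x = b.
Proof.
  induction items as [|[[w p] c] items IH]; intros a b.
  - split.
    + intros H. apply ach_nil_inv in H as [-> ->]. exists []. repeat split; constructor.
    + intros (x & H & <- & <-). inversion H. constructor.
  - change (irl ((w, p, c) :: items)) with ([((w, p), c)] ++ irl items). rewrite expand_app, expand_one. split.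
    + intros H. apply ach_app_inv in H as (a1 & b1 & a2 & b2 & H1 & H2 & -> & ->).
      apply ach_repeat in H1 as (j & Hj & -> & ->). apply IH in H2 as (x & X1 & <- & <-).
      exists (j :: x). split; [constructor; auto|]. split; reflexivity.
    + intros (x & X1 & <- & <-). inversion X1 as [|? j ? x' Hj X2]. subst.
      change (sel_weight ((w, p, c) :: items) (j :: x')) with (j * w + sel_weight items x').
      change (sel_profit ((w, p, c) :: items) (j :: x')) with (j * p + sel_profit items x').
      apply ach_app; [apply ach_repeat; eauto|]. apply IH. eauto.
Qed.

Lemma is_opt_optE W items E v : Permutation E (expand (irl items)) -> is_opt W items v -> optE W E v.
Proof.
  intros HP [(x & [X1 X2] & X3) HO]. split.
  - exists (sel_weight items x). split; auto. eapply ach_perm; [apply Permutation_sym, HP|].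
    apply ach_items. eauto.
  - intros a b Ha H. apply (ach_perm _ _ HP), ach_items in H as (y & Y1 & <- & <-). apply HO. split; auto.
Qed.
Lemma optE_unique W E v v' : optE W E v -> optE W E v' -> v = v'.
Proof. intros [(a & A1 & A2) A3] [(b & B1 & B2) B3]. specialize (A3 _ _ B1 B2). specialize (B3 _ _ A1 A2). lia. Qed.

Lemma SSorted_cat {A} (R : A -> A -> Prop) l1 l2 : StronglySorted R l1 -> StronglySorted R l2 ->
  (forall x y, In x l1 -> In y l2 -> R x y) -> StronglySorted R (l1 ++ l2).
Proof.
  induction 1 as [|x l1 H1 IH HF]; simpl; intros H2 H; auto. constructor.
  - apply IH; auto.
  - apply Forall_app. split; auto. apply Forall_forall. auto.
Qed.

Lemma expand_In c rl : In c (expand rl) -> exists r, In r rl /\ fst r = c.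
Proof.
  unfold expand. intros H. apply in_flat_map in H as (r & H1 & H2). exists r. split; auto.
  symmetry. eapply repeat_spec; eauto.
Qed.

Lemma expand_SSorted rl : StronglySorted (fun r r' => eff (fst r) (fst r')) rl -> StronglySorted eff (expand rl).
Proof.
  induction 1 as [|[x k] rl H1 IH HF]; [constructor|].
  change (expand ((x, k) :: rl)) with (repeat x k ++ expand rl). apply SSorted_cat; auto.
  - clear. induction k; simpl; constructor; auto. apply Forall_forall. intros y Hy.
    apply repeat_spec in Hy as ->. unfold eff. lia.
  - intros a b Ha Hb. apply repeat_spec in Ha as ->. apply expand_In in Hb as (r & Hr & <-).
    rewrite Forall_forall in HF. apply (HF r Hr).
Qed.

Lemma rl_SSorted n A w p c : sorted w p A 0 n -> StronglySorted eff (expand (rl n A w p c)).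
Proof.
  intros H. apply expand_SSorted. unfold rl, seg. rewrite Nat.sub_0_r, map_map.
  assert (HS : forall k a, a + k <= n -> StronglySorted (fun r r' : runT => eff (fst r) (fst r'))
    (map (fun x => (w (A x), p (A x), c (A x))) (seq a k))).
  { induction k as [|k IH]; intros a Ha; simpl; constructor.
    - apply IH. lia.
    - apply Forall_forall. intros r Hr. apply in_map_iff in Hr as (x & <- & Hx). apply in_seq in Hx.
      unfold eff. simpl. apply H; lia. }
  apply HS. lia.
Qed.

Lemma rl_perm items A : Permutation (seg A 0 (length items)) (seq 0 (length items)) ->
  let w i := iw (nth i items dit) in let p i := ip (nth i items dit) in let c i := im (nth i items dit) in
  Permutation (rl (length items) A w p c) (irl items).
Proof.
  intros HP w p c. unfold rl. rewrite HP. unfold irl.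
  rewrite <- (map_nth_seq items dit) at 2. rewrite map_map. reflexivity.
Qed.
Lemma expand_perm r1 r2 : Permutation r1 r2 -> Permutation (expand r1) (expand r2).
Proof. apply Permutation_flat_map. Qed.

(** * Sets of candidates as solutions *)

Section Cands.
Context (cl1 cl2 : list (nat * nat)).
Notation n1 := (length cl1).
Notation cl := (cl1 ++ cl2).
Definition candn : nat := length cl1 + length cl2.
Definition candw (i : nat) : nat := fst (nth i cl (0, 0)).
Definition candp (i : nat) : nat := snd (nth i cl (0, 0)).
Definition cands_sg (i : nat) : nat := if i <? n1 then 0 else 1.

Lemma sum_split (f : nat * nat -> nat) (g : list (nat * nat) -> nat) :
  (forall l (Q : nat -> bool), sZ (fun i => if Q i then Z.of_nat (f (nth i l (0, 0))) else 0%Z) (length l) = Z.of_nat (g (se (masked l Q)))) ->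
  forall Q : nat -> bool, sZ (fun j => if Q j then (if cands_sg j =? 0 then Z.of_nat (f (nth j cl (0, 0))) else Z.opp (Z.of_nat (f (nth j cl (0, 0))))) else 0%Z) candn
   = (Z.of_nat (g (se (masked cl1 Q))) - Z.of_nat (g (se (masked cl2 (fun i => Q (n1 + i)%nat)))))%Z.
Proof.
  intros H Q. unfold candn. rewrite sZ_app, <- !H. rewrite <- Z.add_opp_r. f_equal.
  - apply sZ_ext. intros i Hi. unfold cands_sg. replace (i <? n1) with true by (symmetry; now apply Nat.ltb_lt).
    now rewrite app_nth1.
  - assert (HN : forall h k, sZ (fun i => - h i)%Z k = (- sZ h k)%Z).
    { clear. intros h k. induction k; [rewrite !sZ_0; reflexivity|]. rewrite !sZ_S, IHk. lia. }
    rewrite <- HN. apply sZ_ext. intros i Hi. unfold cands_sg. replace (n1 + i <? n1) with false by (symmetry; apply Nat.ltb_ge; lia).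
    rewrite app_nth2 by lia. replace (n1 + i - n1) with i by lia. simpl. destruct (Q (n1 + i)%nat); lia.
Qed.

Lemma dsum_cands Q : dsum candn cands_sg candw Q =
  (Z.of_nat (sumw (se (masked cl1 Q))) - Z.of_nat (sumw (se (masked cl2 (fun i => Q (n1 + i)%nat)))))%Z.
Proof. unfold dsum, sgn, candw. apply (sum_split fst sumw). intros l Q'. apply masked_sums. Qed.
Lemma qsum_cands Q : qsum candn cands_sg candp Q =
  (Z.of_nat (sump (se (masked cl1 Q))) - Z.of_nat (sump (se (masked cl2 (fun i => Q (n1 + i)%nat)))))%Z.
Proof. unfold qsum, sgn, candp. apply (sum_split snd sump). intros l Q'. apply masked_sums. Qed.

Context (E E1 E2 : list (nat * nat)) (W v b1 rem0 R : nat).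
Context (HE : Permutation E (E2 ++ E1)) (Hv : optE W E v)
  (S1 : forall a b, ach cl1 a b -> ach E1 a b) (S2 : forall a b, ach cl2 a b -> ach E2 a b)
  (Hb1 : b1 = 1 + sump E2) (Hrem : rem0 + sumw E2 = W).

(** The greedy copies without the removed ones, an achievable set by [ach_compl], together with the
    added copies form an actual selection. *)
Lemma cands_real Q : exists a b, ach E a b /\
  Z.of_nat a = (Z.of_nat (sumw E2) + dsum candn cands_sg candw Q)%Z /\
  (Z.of_nat b + 1)%Z = (Z.of_nat b1 + qsum candn cands_sg candp Q)%Z.
Proof.
  rewrite dsum_cands, qsum_cands.
  pose proof (mask_ach (masked cl1 Q)) as A1. rewrite base_masked in A1.
  pose proof (mask_ach (masked cl2 (fun i => Q (n1 + i)%nat))) as A2. rewrite base_masked in A2.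
  apply S1 in A1. apply S2, ach_compl in A2 as (a & b & A2 & A3 & A4).
  eexists _, _. split; [eapply ach_perm; [apply Permutation_sym, HE|apply ach_app; [exact A2|exact A1]]|]. lia.
Qed.

Lemma cands_pos Q : (0 < Z.of_nat b1 + qsum candn cands_sg candp Q)%Z.
Proof. destruct (cands_real Q) as (a & b & _ & _ & H). lia. Qed.
Lemma cands_ub Q : (Z.of_nat b1 + qsum candn cands_sg candp Q <= Z.of_nat (1 + sump E))%Z.
Proof. destruct (cands_real Q) as (a & b & H1 & _ & H). apply ach_le in H1. lia. Qed.

Lemma cand_le i : i < candn -> (exists a b, ach (E2 ++ E1) a b /\ candw i <= a /\ candp i <= b).
Proof.
  intros Hi.
  assert (HI : In (nth i cl (0, 0)) cl) by (apply nth_In; rewrite length_app; exact Hi).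
  unfold candw, candp. destruct (nth i cl (0, 0)) as [x y]. simpl.
  assert (Hone : forall l, In (x, y) l -> ach l x y).
  { clear. intros l H. apply in_split in H as (l1 & l2 & ->). pose proof (ach_mid l1 [(x, y)] l2) as H.
    unfold sumw, sump in H. simpl in H. now rewrite !Nat.add_0_r in H. }
  apply in_app_iff in HI as [HI|HI].
  - apply Hone, S1 in HI. exists (sumw E2 + x), (sump E2 + y). split; [apply ach_app; auto; apply ach_all|lia].
  - apply Hone, S2 in HI. exists (x + sumw E1), (y + sump E1). split; [apply ach_app; auto; apply ach_all|lia].
Qed.
Lemma cand_bound i : i < candn -> candw i <= sumw E /\ candp i <= sump E.
Proof.
  intros Hi. destruct (cand_le i Hi) as (a & b & H & A & B).
  apply (ach_perm _ _ (Permutation_sym HE)), ach_le in H. lia.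
Qed.

Context (D : nat -> bool)
  (HD1 : (dsum candn cands_sg candw D <= Z.of_nat rem0)%Z)
  (HD2 : (Z.of_nat b1 + qsum candn cands_sg candp D = Z.of_nat v + 1)%Z).

(** Soundness turns every entry within the capacity into a feasible selection, so v is not exceeded;
    completeness along D supplies an entry of value v + 1. *)
Lemma best_opt F v' :
  dpsound candn R b1 cands_sg candw candp (fun _ => true) F ->
  dpcomp candn R b1 cands_sg candw candp D (fun _ => true) F ->
  best R rem0 F v' -> v' = v.
Proof.
  intros HS (i & Hi & C1 & C2) [B1 B2].
  assert (EA : forall j, andf D (fun _ => true) j = D j) by (intros; apply andb_true_r).
  assert (X1 : dsum candn cands_sg candw (andf D (fun _ => true)) = dsum candn cands_sg candw D) by (apply sZ_ext; intros; now rewrite EA).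
  assert (X2 : qsum candn cands_sg candp (andf D (fun _ => true)) = qsum candn cands_sg candp D) by (apply sZ_ext; intros; now rewrite EA).
  rewrite X1 in C1. rewrite X2 in C2.
  specialize (B2 i Hi ltac:(lia)).
  assert (Hle : v' <= v).
  { destruct B1 as [->|(i' & I1 & I2 & I3)]; [lia|].
    destruct (HS i' I1 ltac:(lia)) as (Q & _ & Q1 & Q2).
    destruct (cands_real Q) as (a & b & R1 & R2 & R3).
    destruct Hv as [_ HO]. specialize (HO a b ltac:(lia) R1). lia. }
  lia.
Qed.
End Cands.

Definition maskD (em : bl) (i : nat) : bool := snd (nth i em ((0, 0), false)).
Definition candD (em1 em2 : bl) : nat -> bool := maskD (em1 ++ em2).

Lemma masked_ext l Q Q' : (forall i, i < length l -> Q i = Q' i) -> masked l Q = masked l Q'.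
Proof. intros H. unfold masked. apply map_ext_in. intros i Hi. apply in_seq in Hi. now rewrite H by lia. Qed.

Lemma masked_em1 em1 em2 : masked (base em1) (candD em1 em2) = em1.
Proof.
  transitivity (masked (base em1) (fun i => snd (nth i em1 ((0, 0), false)))); [|apply masked_self].
  apply masked_ext. intros i Hi. unfold base in Hi. rewrite length_map in Hi.
  unfold candD, maskD. now rewrite app_nth1.
Qed.
Lemma masked_em2 em1 em2 : masked (base em2) (fun i => candD em1 em2 (length (base em1) + i)) = em2.
Proof.
  transitivity (masked (base em2) (fun i => snd (nth i em2 ((0, 0), false)))); [|apply masked_self].
  apply masked_ext. intros i Hi. unfold base in *. rewrite length_map in *.
  unfold candD, maskD. rewrite app_nth2 by lia. do 2 f_equal. lia.
Qed.

Lemma masked_sumw_mono l (Q Q' : nat -> bool) : (forall i, Q i = true -> Q' i = true) ->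
  sumw (se (masked l Q)) <= sumw (se (masked l Q')).
Proof.
  intros H. pose proof (proj1 (masked_sums l Q)) as A. pose proof (proj1 (masked_sums l Q')) as B.
  assert (HZ : forall n, (sZ (fun i => if Q i then Z.of_nat (fst (nth i l (0, 0)%nat)) else 0%Z) n <=
    sZ (fun i => if Q' i then Z.of_nat (fst (nth i l (0, 0)%nat)) else 0%Z) n)%Z).
  { induction n as [|n IH]; [rewrite !sZ_0; lia|]. rewrite !sZ_S. specialize (H n).
    destruct (Q n), (Q' n); try lia. }
  specialize (HZ (length l)). lia.
Qed.

(** * Keeping the target set inside the table *)

Section Range.
Context (em1 em2 : bl).
Notation cl1 := (base em1).
Notation cl2 := (base em2).
Notation nc := (candn cl1 cl2).
Notation cs := (cands_sg cl1).
Notation cw := (candw cl1 cl2).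
Notation cp := (candp cl1 cl2).
Notation D := (candD em1 em2).

Lemma dsum_D : dsum nc cs cw D = (Z.of_nat (sumw (se em1)) - Z.of_nat (sumw (se em2)))%Z.
Proof. rewrite dsum_cands, masked_em1, masked_em2. reflexivity. Qed.
Lemma qsum_D : qsum nc cs cp D = (Z.of_nat (sump (se em1)) - Z.of_nat (sump (se em2)))%Z.
Proof. rewrite qsum_cands, masked_em1, masked_em2. reflexivity. Qed.

(** No order matters here: a partial sum lies between minus the total removed weight and the total
    added weight. *)
Lemma inrange_det R G K : sumw (se em1) <= R -> sumw (se em2) <= R -> inrange nc R G cs cw K D.
Proof.
  intros H1 H2 x j _ _. rewrite dsum_cands.
  pose proof (masked_sumw_mono cl1 (andf D (doneK K x j)) D) as A.
  pose proof (masked_sumw_mono cl2 (fun i => andf D (doneK K x j) (length cl1 + i)) (fun i => D (length cl1 + i))) as B.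
  rewrite masked_em1 in A. rewrite masked_em2 in B.
  assert (HQ : forall i, andf D (doneK K x j) i = true -> D i = true) by (unfold andf; intros i H; now apply andb_prop in H).
  specialize (A HQ). specialize (B (fun i => HQ _)). lia.
Qed.

Context (w sq b t T : nat).
Definition sD (i : nat) : Z := if D i then sgn cs i (cw i) else 0%Z.

Lemma inrange_scan bits : bad w sq nc b t sD bits = false -> inrange nc (Rng w sq t) (2 ^ b) cs cw (key b bits) D.
Proof.
  intros HB x j Hx Hj. apply Z.nlt_ge. intros Hlt. assert (bad w sq nc b t sD bits = true); [|congruence].
  unfold bad. apply existsb_exists. exists x. split; [apply in_seq; lia|].
  apply existsb_exists. exists j. split; [apply in_seq; lia|]. apply Z.ltb_lt.
  eapply Z.lt_le_trans; [exact Hlt|]. apply Z.eq_le_incl. f_equal. unfold dsum, psum. apply sZ_ext.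
  intros i Hi. unfold andf, sD, doneK. destruct (D i), (before x j i (key b bits i)); reflexivity.
Qed.

(** [conc] for the signed weights of the target set: 2w copies on each side give the 4w nonzero
    terms, and the near balance of the two sides bounds their total by w. *)
Lemma conc_scan Q : 0 < w -> w <= sq * sq -> w <= 2 ^ b ->
  Forall (fun c => fst c <= w) (se em1) -> Forall (fun c => fst c <= w) (se em2) ->
  length (se em1) <= 2 * w -> length (se em2) <= 2 * w ->
  sumw (se em1) <= sumw (se em2) + w -> sumw (se em2) <= sumw (se em1) + w -> nc * b <= T ->
  32 * 2 ^ b * (nc + 1) * Q <= 2 ^ t ->
  length (filter (bad w sq nc b t sD) (all_bits T)) * Q <= 2 ^ T.
Proof.
  intros Hw Hsq Hb F1 F2 L1 L2 W1 W2 HT HQ. apply conc; auto.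
  - intros i Hi. unfold sD, sgn.
    assert (Hc : D i = true -> cw i <= w).
    { intros HDi. unfold candw, base. rewrite <- map_app.
      change (0, 0) with (fst ((0, 0), false)). rewrite map_nth.
      assert (HI : In (fst (nth i (em1 ++ em2) ((0, 0), false))) (se (em1 ++ em2))).
      { unfold se. apply in_map, filter_In. split; [|exact HDi]. apply nth_In. rewrite length_app.
        unfold candn, base in Hi. now rewrite !length_map in Hi. }
      rewrite Forall_forall in F1, F2. rewrite se_app in HI. apply in_app_iff in HI as [HI|HI]; auto. }
    destruct (D i); [specialize (Hc eq_refl)|lia]. destruct (cs i =? 0); lia.
  - transitivity (length (filter D (seq 0 nc))).
    + clear. induction (seq 0 nc) as [|i l IH]; simpl; auto. unfold sD at 1. destruct (D i).
      * destruct (negb _); simpl; lia.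
      * simpl. exact IH.
    + assert (E : nc = length (base (em1 ++ em2))) by (rewrite base_app, length_app; reflexivity).
      rewrite E, masked_count. pose proof (masked_self (em1 ++ em2)) as EM. fold (candD em1 em2) in EM.
      change (masked (base (em1 ++ em2)) D = em1 ++ em2) in EM. rewrite EM, se_app, length_app. lia.
  - pose proof dsum_D as E. unfold dsum in E. unfold sD. rewrite E. lia.
Qed.
End Range.

Lemma scan_se em z : filter snd em = filter snd z -> se em = se z.
Proof. unfold se. now intros ->. Qed.

Lemma filter_count_compl {A} (f : A -> bool) l : length (filter f l) + length (filter (fun x => negb (f x)) l) = length l.
Proof. induction l as [|x l IH]; simpl; auto. destruct (f x); simpl; lia. Qed.

Lemma count_bound (good : list bool -> bool) (f : list bool -> bool) T Q :
  (forall bs, In bs (all_bits T) -> f bs = false -> good bs = true) ->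
  length (filter f (all_bits T)) * Q <= 2 ^ T ->
  (Q - 1) * 2 ^ T <= length (filter good (all_bits T)) * Q.
Proof.
  intros H Hb. pose proof (filter_count_compl f (all_bits T)) as E. rewrite all_bits_count in E.
  assert (Hle : length (filter (fun x => negb (f x)) (all_bits T)) <= length (filter good (all_bits T))).
  { revert H. clear. induction (all_bits T) as [|x l IH]; intros H; simpl; auto.
    specialize (IH (fun bs h => H bs (or_intror h))). pose proof (H x (or_introl eq_refl)) as Hx.
    destruct (f x), (good x); simpl; try lia. }
  destruct Q; nia.
Qed.

(** * Assembly *)

(* Bounds e <= B ^ k, where k is found by unification. *)
Section Bounds.
Context (B : nat) (HB : 2 <= B).
Lemma bd_pos k : 1 <= B ^ k.
Proof. induction k; cbn [Nat.pow]; nia. Qed.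
Lemma bd_mono i j : i <= j -> B ^ i <= B ^ j.
Proof. intros. apply Nat.pow_le_mono_r; lia. Qed.
Lemma bd_add a b i j : a <= B ^ i -> b <= B ^ j -> a + b <= B ^ S (Nat.max i j).
Proof.
  intros Ha Hb. pose proof (bd_mono i (Nat.max i j) ltac:(lia)). pose proof (bd_mono j (Nat.max i j) ltac:(lia)).
  cbn [Nat.pow]. nia.
Qed.
Lemma bd_mul a b i j : a <= B ^ i -> b <= B ^ j -> a * b <= B ^ (i + j).
Proof. intros Ha Hb. rewrite Nat.pow_add_r. now apply Nat.mul_le_mono. Qed.
Lemma bd_S a i : a <= B ^ i -> S a <= B ^ S i.
Proof. intros Ha. pose proof (bd_pos i). cbn [Nat.pow]. nia. Qed.
Lemma bd_const n k : n <=? 2 ^ k = true -> n <= B ^ k.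
Proof. intros H. apply Nat.leb_le in H. etransitivity; [exact H|]. apply Nat.pow_le_mono_l. lia. Qed.
Lemma bd_lt m c0 e k : B ^ c0 <= m -> e <= B ^ k -> k < c0 -> e < m.
Proof. intros Hm He Hk. pose proof (Nat.pow_lt_mono_r B k c0 ltac:(lia) Hk). lia. Qed.
Lemma bd_sub a b i : a <= B ^ i -> a - b <= B ^ i.
Proof. lia. Qed.
End Bounds.

Ltac bd :=
  lazymatch goal with
  | |- ?a + ?b <= _ => eapply bd_add; [eassumption|bd|bd]
  | |- ?a * ?b <= _ => eapply bd_mul; [bd|bd]
  | |- ?n <= _ => first [eassumption
      | let k := eval vm_compute in (Nat.log2_up n) in refine (bd_const _ _ n k _); [eassumption|vm_compute; reflexivity]
      | lazymatch n with S ?a => eapply bd_S; [eassumption|bd] | ?a - ?b => eapply bd_sub; bd end]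
  end.
(** The word modulus is at least [B ^ c0], so the absence of overflow reduces to a comparison of
    exponents. *)
Ltac bdlt := eapply bd_lt; [eassumption|eassumption|bd|cbn [Nat.max Nat.add]; lia].

Definition keep (s s' : st) : Prop :=
  (rg s' 0 = rg s 0 /\ rg s' 1 = rg s 1 /\ rg s' 3 = rg s 3 /\ rg s' 5 = rg s 5 /\ rg s' 8 = rg s 8) /\
  (rg s' 15 = rg s 15 /\ rg s' 16 = rg s 16 /\ rg s' 17 = rg s 17 /\ rg s' 18 = rg s 18) /\
  (rg s' 30 = rg s 30 /\ rg s' 38 = rg s 38) /\
  (ar s' 0 = ar s 0 /\ ar s' 1 = ar s 1 /\ ar s' 2 = ar s 2 /\ ar s' 3 = ar s 3) /\ rp s' = rp s.
Lemma keep_trans s1 s2 s3 : keep s1 s2 -> keep s2 s3 -> keep s1 s3.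
Proof. unfold keep. intuition congruence. Qed.
Definition keeps (c : cmd) : bool :=
  forallb (fun x => negb (modv c x)) [0; 1; 3; 5; 8; 15; 16; 17; 18; 30; 38] &&
  forallb (fun a => negb (moda c a)) [0; 1; 2; 3] && negb (modp c).
Lemma keep_fr c s s' : keeps c = true -> fr c s s' -> keep s s'.
Proof.
  intros H F. unfold keeps in H. rewrite !andb_true_iff, !forallb_forall, negb_true_iff in H. destruct H as [[H1 H2] H3].
  assert (G1 : forall x, In x [0; 1; 3; 5; 8; 15; 16; 17; 18; 30; 38] -> rg s' x = rg s x)
    by (intros x Hx; apply F; specialize (H1 x Hx); now apply negb_true_iff in H1).
  assert (G2 : forall x, In x [0; 1; 2; 3] -> ar s' x = ar s x)
    by (intros x Hx; apply F; specialize (H2 x Hx); now apply negb_true_iff in H2).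
  unfold keep. repeat split; try (apply G1; simpl; tauto); try (apply G2; simpl; tauto). apply F, H3.
Qed.

(** * Candidates from both sides of the break *)

Section Sides.
Context (m : nat) (bits : list bool) (n wm : nat) (A w p c : nat -> nat) (brk xx : nat) (X : cmd) (C1 C2 : nat)
  (Pa Pb : list (nat * nat) -> Prop).
Notation tri := (tri m bits).
Notation R1 := (rightl brk xx (rl n A w p c)).
Notation R2 := (leftl brk xx (rl n A w p c)).
Context (Hn : 0 < n) (Hm : 64 + 16 * n + 64 < m) (HA : forall x, x < n -> A x < n) (HkX : keeps X = true)
  (Hb : brk <= n) (Hxx : brk < n -> xx <= c (A brk))
  (HX1 : forall s, runsOf s R1 -> rg s 3 = wm -> rg s 27 = 0 -> rg s 26 = 0 ->
    tri C1 X s (fun s' => exists cl, Pa cl /\ emitted 0 0 s cl s'))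
  (HX2 : forall s cl, Pa cl -> rg s 26 = length cl -> runsOf s R2 -> rg s 3 = wm -> rg s 27 = 1 ->
    tri C2 X s (fun s' => exists cl', Pb cl' /\ emitted (length cl) 1 s cl' s')).

(** [X] stands for either candidate routine, [sscan] or [bouter]; it runs once for the additions and
    once for the removals. *)
Definition sides : cmd :=
  (right_runs;; 27 ::= EC 0;; X);; (left_runs;; 27 ::= EC 1;; X).

Definition emittedAll (cl1 cl2 : list (nat * nat)) (s : st) : Prop :=
  rg s 26 = candn cl1 cl2 /\ forall i, i < candn cl1 cl2 ->
   ar s 9 i = candw cl1 cl2 i /\ ar s 10 i = candp cl1 cl2 i /\ ar s 11 i = cands_sg cl1 i.

Lemma arrs_keep s s' : arrs n A w p c s -> keep s s' -> arrs n A w p c s'.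
Proof.
  intros (H0 & H1 & H2 & H3 & H4) ((K0 & _) & _ & _ & (K1 & K2 & K3 & K4) & _).
  unfold arrs. rewrite K0, K1, K2, K3, K4. auto.
Qed.

Lemma sides_spec s : arrs n A w p c s -> rg s 17 = brk -> rg s 18 = xx -> rg s 3 = wm -> rg s 26 = 0 ->
  tri (n * 400 + C1 + C2 + 400) sides s (fun s' => keep s s' /\ exists cl1 cl2, Pa cl1 /\ Pb cl2 /\ emittedAll cl1 cl2 s').
Proof.
  intros HAr E17 E18 E3 E26. unfold sides.
  eapply tri_le; [apply (tri_then _ _ (n * 200 + 100 + (10 + C1)) (n * 200 + 200 + (10 + C2)) _ _ _
    (fun s' => keep s s' /\ exists cl1, Pa cl1 /\ rg s' 26 = length cl1 /\ forall i, i < length cl1 ->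
       ar s' 9 i = fst (nth i cl1 (0, 0)) /\ ar s' 10 i = snd (nth i cl1 (0, 0)) /\ ar s' 11 i = 0))|lia].
  - eapply tri_then; [apply (right_spec m bits n A w p c Hn Hm HA s brk xx); auto|].
    intros s1 HR1 F1. pose proof (keep_fr right_runs _ _ eq_refl F1) as K1. frx F1 3. frx F1 26.
    apply (tri_then _ _ _ _ _ _ _ (fun s' => rg s' 27 = 0)); [apply tri_wps; [wsim; split; [lia|auto]|cbn; lia]|].
    intros s2 E27 F2. pose proof (keep_fr (27 ::= EC 0) _ _ eq_refl F2) as K2. frx F2 3. frx F2 26. frx F2 20. fra F2 15. fra F2 13. fra F2 14.
    eapply tri_mono; [apply le_n| |apply tri_fr, HX1]; try congruence.
    + intros s3 ((cl1 & HP & (Z1 & _ & Z3)) & F3). apply (keep_fr X _ _ HkX) in F3.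
      split; [eauto using keep_trans|]. exists cl1. split; [auto|]. split; [auto|]. exact Z3.
    + unfold runsOf. rewrite E4, E5, E6, E7. exact HR1.
  - intros s3 (K3 & cl1 & HP1 & Z1 & Z2) _.
    assert (HAr3 : arrs n A w p c s3) by (eapply arrs_keep; eauto).
    assert (E17' : rg s3 17 = brk) by (destruct K3 as (_ & K & _); intuition congruence).
    assert (E18' : rg s3 18 = xx) by (destruct K3 as (_ & K & _); intuition congruence).
    assert (E3' : rg s3 3 = wm) by (destruct K3 as (K & _); intuition congruence).
    eapply tri_then; [apply (left_spec m bits n A w p c Hn Hm HA s3 brk xx); auto|].
    intros s4 HR2 F4. pose proof (keep_fr left_runs _ _ eq_refl F4) as K4. frx F4 3. frx F4 26. fra F4 9. fra F4 10. fra F4 11.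
    apply (tri_then _ _ _ _ _ _ _ (fun s' => rg s' 27 = 1)); [apply tri_wps; [wsim; split; [lia|auto]|cbn; lia]|].
    intros s5 E27 F5. pose proof (keep_fr (27 ::= EC 1) _ _ eq_refl F5) as K5.
    assert (G : rg s5 3 = rg s4 3 /\ rg s5 26 = rg s4 26 /\ rg s5 20 = rg s4 20 /\ ar s5 15 = ar s4 15 /\ ar s5 13 = ar s4 13 /\ ar s5 14 = ar s4 14 /\
      ar s5 9 = ar s4 9 /\ ar s5 10 = ar s4 10 /\ ar s5 11 = ar s4 11) by (repeat split; apply F5; reflexivity).
    destruct G as (G3 & G26 & G20 & G15 & G13 & G14 & G9 & G10 & G11).
    eapply tri_mono; [apply le_n| |apply tri_fr, (HX2 s5 cl1)]; try congruence; auto.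
    + intros s6 ((cl2 & HP2 & (Y1 & Y2 & Y3)) & F6). apply (keep_fr X _ _ HkX) in F6.
      split; [eauto 6 using keep_trans|]. exists cl1, cl2. split; [auto|]. split; [auto|]. split; [exact Y1|].
      intros i Hi. unfold candn in Hi. unfold candw, candp, cands_sg. destruct (Nat.ltb_spec i (length cl1)) as [h|h].
      * rewrite !app_nth1 by auto. destruct (Y2 i h) as (-> & -> & ->). rewrite G9, G10, G11, E1, E2, E4. apply Z2, h.
      * rewrite !app_nth2 by auto. specialize (Y3 (i - length cl1) ltac:(lia)).
        replace (length cl1 + (i - length cl1)) with i in Y3 by lia. exact Y3.
    + unfold runsOf. rewrite G20, G15, G13, G14. exact HR2.
Qed.
End Sides.

Lemma inp_frame W items s s' : inp s W items -> rg s' 0 = rg s 0 -> rg s' 1 = rg s 1 ->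
  ar s' 0 = ar s 0 -> ar s' 1 = ar s 1 -> ar s' 2 = ar s 2 -> inp s' W items.
Proof. unfold inp. intros H -> -> -> -> ->. exact H. Qed.

Lemma lglg_le x : lglg x <= x.
Proof.
  destruct (lglg x) as [|j] eqn:E; [lia|]. pose proof (lglg_lt x j ltac:(lia)) as H.
  pose proof (Nat.pow_gt_lin_r 2 j ltac:(lia)). pose proof (Nat.pow_gt_lin_r 2 (2 ^ j) ltac:(lia)). lia.
Qed.

Lemma wmax_ge items it : In it items -> iw it <= wmax items.
Proof.
  unfold wmax. induction items as [|x l IH]; simpl; [tauto|]. intros [->|H]; [lia|]. specialize (IH H). lia.
Qed.

Section Main.
Context (W : nat) (items : list item) (Hv : valid_instance W items).
Notation n := (length items).
Notation wm := (wmax items).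
Notation mx := (maxval W items).
Definition itw (i : nat) : nat := iw (nth i items dit).
Definition itp (i : nat) : nat := ip (nth i items dit).
Definition itm (i : nat) : nat := im (nth i items dit).
(** Made so that 2^lgN is at least the input size ([N_le_lgN]): the summands pay for the factor n,
    for the bit length of the largest number and for a constant. *)
Definition lgN : nat := 4 + Nat.log2 n + lglg mx.

Lemma n_pos : 0 < n.
Proof. destruct Hv as (_ & H & _). destruct items; simpl; [congruence|lia]. Qed.
Lemma it_pos i : i < n -> 0 < itw i /\ 0 < itp i /\ 0 < itm i.
Proof.
  intros Hi. destruct Hv as (_ & _ & H). rewrite Forall_forall in H. apply (H (nth i items dit)). now apply nth_In.
Qed.
Lemma itw_le i : i < n -> itw i <= wm.
Proof. intros Hi. apply wmax_ge, nth_In, Hi. Qed.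
Lemma it_le i : i < n -> itw i <= mx /\ itp i <= mx /\ itm i <= mx.
Proof.
  intros Hi. split; [apply (maxval_fld W items i 0 Hi)|]. split; [apply (maxval_fld W items i 1 Hi)|apply (maxval_fld W items i 2 Hi)].
Qed.
Lemma wm_pos : 0 < wm.
Proof. pose proof (itw_le 0 n_pos). pose proof (it_pos 0 n_pos). lia. Qed.
Lemma wm_le : wm <= mx.
Proof.
  unfold wmax, maxval. generalize (Nat.max n W). clear. intros a. induction items as [|x l IH]; simpl; lia.
Qed.

Notation RL A := (rl n A itw itp itm).
Lemma RL_perm A : Permutation (seg A 0 n) (seq 0 n) -> Permutation (expand (RL A)) (expand (irl items)).
Proof. intros H. apply expand_perm, (rl_perm items A H). Qed.

Lemma RL_Forall A : (forall x, x < n -> A x < n) -> Forall (fun c => 0 < fst c <= wm /\ 0 < snd c) (expand (RL A)).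
Proof.
  intros HA. apply Forall_forall. intros c Hc. apply expand_In in Hc as (r & Hr & <-).
  unfold rl, seg in Hr. rewrite map_map in Hr. apply in_map_iff in Hr as (x & <- & Hx). apply in_seq in Hx. simpl.
  pose proof (HA x ltac:(lia)) as H. pose proof (it_pos _ H). pose proof (itw_le _ H). lia.
Qed.
Lemma RL_sums A : (forall x, x < n -> A x < n) -> sumw (expand (RL A)) <= n * (mx * mx) /\ sump (expand (RL A)) <= n * (mx * mx).
Proof.
  intros HA. unfold rl, seg. rewrite Nat.sub_0_r, map_map.
  assert (H : forall k, k <= n -> sumw (expand (map (fun x => (itw (A x), itp (A x), itm (A x))) (seq 0 k))) <= k * (mx * mx) /\
    sump (expand (map (fun x => (itw (A x), itp (A x), itm (A x))) (seq 0 k))) <= k * (mx * mx)).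
  { induction k as [|k IH]; intros Hk; [cbn; lia|]. rewrite seq_S, map_app. simpl map. rewrite expand_app, expand_one, sumw_app, sump_app, sumw_repeat, sump_repeat.
    destruct (it_le (A k) (HA k ltac:(lia))) as (H1 & H2 & H3). destruct (IH ltac:(lia)) as [I1 I2].
    pose proof (Nat.mul_le_mono _ _ _ _ H3 H1). pose proof (Nat.mul_le_mono _ _ _ _ H3 H2). lia. }
  apply H. lia.
Qed.

Definition pre0 : cmd :=
  stats;; lg_loop1;; lg_loop2;; sq_loop;; G_loop;; sort_prog;; greedy;; 26 ::= EC 0.
Definition cost0 : nat := n * 100 + 100 + ((Nat.log2 n + 1) * 40 + 40 + (lglg mx * 40 + 40 + (wm * 40 + 80 + (wm * 40 + 80 +
  ((n + 1) * 4000 * (Nat.log2_up n + 1) + (n * 200 + 600 + 10)))))).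

Definition mid (s : st) : Prop :=
  inp s W items /\ rp s = 0 /\ rg s 3 = wm /\ rg s 5 = lgN /\ rg s 8 = Nat.sqrt wm + 1 /\
  rg s 38 = 2 ^ Nat.log2_up wm /\ rg s 26 = 0 /\ sorted itw itp (ar s 3) 0 n /\
  Permutation (seg (ar s 3) 0 n) (seq 0 n) /\ gpost n W (ar s 3) itw itp itm s.

Context (m : nat) (bits : list bool) (B c0 : nat) (HB : 2 <= B) (HBm : B ^ c0 <= m) (Hc0 : 60 <= c0).
Context (Hmx : mx <= B ^ 1).
Notation tri := (tri m bits).

Lemma bn : n <= B ^ 1.
Proof. pose proof (maxval_n W items). lia. Qed.
Lemma bW : W <= B ^ 1.
Proof. pose proof (maxval_n W items). lia. Qed.
Lemma bwm : wm <= B ^ 1.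
Proof. pose proof wm_le. lia. Qed.

Lemma pre0_spec s : inp s W items -> rp s = 0 -> tri cost0 pre0 s mid.
Proof.
  intros HI Hrp. pose proof bn as Bn. pose proof bW as BW. pose proof bwm as Bw. pose proof n_pos as Hn. pose proof wm_pos as Hw.
  pose proof wm_le as Hwm. assert (Bl : lglg mx <= B ^ 1) by (pose proof (lglg_le mx); lia).
  assert (Bl2 : Nat.log2 n <= B ^ 1) by (pose proof (Nat.log2_le_lin n); lia).
  pose proof HI as (HI0 & HI1 & HI2).
  unfold pre0, cost0.
  eapply tri_then; [apply (stats_spec m bits W items s HI); bdlt|].
  intros s1 (X3 & X4) F1. frx F1 0. frx F1 1. fra F1 0. fra F1 1. fra F1 2. pose proof (proj2 (proj2 F1) eq_refl) as P1.
  assert (I1 : inp s1 W items) by (eapply inp_frame; eauto). clear F1 E E0 E1 E2 E3. pose proof I1 as (J0 & _).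
  rewrite <- J0 at 1. eapply tri_then; [apply lg1_spec; rewrite J0; [auto|bdlt]|].
  rewrite J0. intros s2 X5 F1. frx F1 0. frx F1 1. frx F1 3. frx F1 4. fra F1 0. fra F1 1. fra F1 2. pose proof (proj2 (proj2 F1) eq_refl) as P2.
  assert (I2 : inp s2 W items) by (eapply inp_frame; [exact I1|..]; auto). rewrite X3 in E1. rewrite X4 in E2. rename E1 into Y3. rename E2 into Y4.
  clear F1 E E0 E3 E4 E5 X3 X4.
  rewrite <- Y4. eapply tri_then; [apply lg2_spec; rewrite Y4, ?X5; [lia|bdlt]|].
  rewrite Y4. intros s3 X6 F1. frx F1 0. frx F1 1. frx F1 3. fra F1 0. fra F1 1. fra F1 2. pose proof (proj2 (proj2 F1) eq_refl) as P3.
  assert (I3 : inp s3 W items) by (eapply inp_frame; [exact I2|..]; auto). rewrite Y3 in E1. rename E1 into Z3. rewrite X5 in X6.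
  clear F1 E E0 E2 E3 E4 X5 Y3 Y4.
  rewrite <- Z3 at 1. eapply tri_then; [apply sq_spec; rewrite Z3; bdlt|].
  rewrite Z3. intros s4 X8 F1. frx F1 0. frx F1 1. frx F1 3. frx F1 5. fra F1 0. fra F1 1. fra F1 2. pose proof (proj2 (proj2 F1) eq_refl) as P4.
  assert (I4 : inp s4 W items) by (eapply inp_frame; [exact I3|..]; auto). rewrite Z3 in E1. rename E1 into V3. rewrite X6 in E2. rename E2 into V5.
  clear F1 E E0 E3 E4 E5 Z3 X6.
  rewrite <- V3 at 1. eapply tri_then; [apply G_spec; rewrite V3; [auto|bdlt]|].
  rewrite V3. intros s5 X38 F1. frx F1 0. frx F1 1. frx F1 3. frx F1 5. frx F1 8. fra F1 0. fra F1 1. fra F1 2. pose proof (proj2 (proj2 F1) eq_refl) as P5.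
  assert (I5 : inp s5 W items) by (eapply inp_frame; [exact I4|..]; auto). rewrite V3 in E1. rename E1 into U3. rewrite V5 in E2. rename E2 into U5.
  rewrite X8 in E3. rename E3 into U8.
  clear F1 E E0 E4 E5 E6 V3 V5 X8.
  pose proof I5 as (J50 & J51 & J52).
  assert (Bi : forall x, x < n -> itw x <= B ^ 1 /\ itp x <= B ^ 1 /\ itm x <= B ^ 1) by (intros x Hx; pose proof (it_le x Hx); lia).
  eapply tri_then; [apply (sort_spec m bits n itw itp); auto|].
  { bdlt. } { bdlt. }
  { intros x y Hx Hy. destruct (Bi x Hx) as (_ & B1 & _). destruct (Bi y Hy) as (B2 & _). bdlt. }
  { intros x Hx. apply it_pos, Hx. } { intros x Hx. apply J52, Hx. } { intros x Hx. apply J52, Hx. }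
  intros s6 (XS & XP) F1. frx F1 0. frx F1 1. frx F1 3. frx F1 5. frx F1 8. frx F1 38. fra F1 0. fra F1 1. fra F1 2. pose proof (proj2 (proj2 F1) eq_refl) as P6.
  assert (I6 : inp s6 W items) by (eapply inp_frame; [exact I5|..]; auto). rewrite U3 in E1. rewrite U5 in E2. rewrite U8 in E3. rewrite X38 in E4.
  rename E1 into T3. rename E2 into T5. rename E3 into T8. rename E4 into T38. clear F1 E E0 E5 E6 E7 U3 U5 U8 X38.
  assert (HA : forall x, x < n -> ar s6 3 x < n).
  { apply (seg_id_lt m n Hn); auto; bdlt. }
  pose proof I6 as (J60 & J61 & J62).
  pose proof (RL_sums (ar s6 3) HA) as [_ HSp].
  eapply tri_then; [apply (greedy_spec m bits n W (ar s6 3) itw itp itm); auto|].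
  { bdlt. } { intros x Hx. apply it_pos, Hx. }
  { intros x Hx. destruct (Bi x Hx) as (B1 & _ & B2). bdlt. }
  { intros x Hx. destruct (Bi x Hx) as (_ & B1 & B2). bdlt. }
  { bdlt. }
  { eapply Nat.le_lt_trans; [apply Nat.add_le_mono_l, HSp|]. bdlt. }
  { split; [auto|]. split; [intros x Hx; apply J62, Hx|]. split; [intros x Hx; apply J62, Hx|]. split; [intros x Hx; apply J62, Hx|auto]. }
  intros s7 HG F1. frx F1 0. frx F1 1. frx F1 3. frx F1 5. frx F1 8. frx F1 38. fra F1 0. fra F1 1. fra F1 2. fra F1 3. pose proof (proj2 (proj2 F1) eq_refl) as P7.
  assert (I7 : inp s7 W items) by (eapply inp_frame; [exact I6|..]; auto).
  apply tri_wps; [|cbn; lia]. wsim. split; [bdlt|]. unfold mid. wsim.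
  split; [eapply inp_frame; [exact I7|..]; auto|]. rewrite E8.
  split; [congruence|]. repeat split; try congruence; auto.
  unfold lgN. congruence.
Qed.

Context (c : nat) (Hc0c : 2 * c + 120 <= c0).

Definition scanB : cmd :=
  (37 ::= EC (c + 20) *! EV 5;; 30 ::= EC 2 *! EV 3 *! EV 8 *! EV 37 +! EC 5 *! EV 3);; sides sscan.
Definition bundB : cmd := 30 ::= EC 2 *! EV 3 *! EV 3;; sides bouter.
Definition branch : cmd := CIf (EV 3 <! EV 0 *! EV 0 *! (EV 0 *! EV 0)) scanB bundB.

(** [E2] is the greedy prefix and [E1] the rest; the flags of [em1] and [em2] mark the copies, or
    bundles, by which a fixed optimum differs from the prefix. The disjunction records the branch
    taken, with its table radius and its bound on the number of candidates. *)
Definition ready (v : nat) (s : st) : Prop :=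
  exists em1 em2 E1 E2,
  emittedAll (base em1) (base em2) s /\ rg s 38 = 2 ^ Nat.log2_up wm /\ rg s 16 = 1 + sump E2 /\ rg s 15 + sumw E2 = W /\
  rp s = 0 /\ Permutation (expand (irl items)) (E2 ++ E1) /\
  (forall a b, ach (base em1) a b -> ach E1 a b) /\ (forall a b, ach (base em2) a b -> ach E2 a b) /\
  sumw E2 + sumw (se em1) <= W + sumw (se em2) /\ v + sump (se em2) = sump E2 + sump (se em1) /\
  (wm < n ^ 4 /\ rg s 30 = Rng wm (Nat.sqrt wm + 1) ((c + 20) * lgN) /\
     Forall (fun c => fst c <= wm) (se em1) /\ Forall (fun c => fst c <= wm) (se em2) /\
     length (se em1) <= 2 * wm /\ length (se em2) <= 2 * wm /\
     sumw (se em1) <= sumw (se em2) + wm /\ sumw (se em2) <= sumw (se em1) + wm /\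
     candn (base em1) (base em2) <= 2 * LIM wm
   \/ n ^ 4 <= wm /\ rg s 30 = 2 * wm * wm /\ sumw (se em1) <= 2 * wm * wm /\ sumw (se em2) <= 2 * wm * wm /\
     candn (base em1) (base em2) <= (2 * n + 2) * (Nat.log2 wm + 2)).

Definition costS : nat := 100 + (n * 400 + (LIM wm * 600 + (n + 1) * 200 + 1000) + (LIM wm * 600 + (n + 1) * 200 + 1000) + 400).
Definition costB : nat := 100 + (n * 400 + ((n + 1) * ((Nat.log2 wm + 2) * 150 + 300) + 100) + ((n + 1) * ((Nat.log2 wm + 2) * 150 + 300) + 100) + 400).

Lemma rightl_In brk xx rl r : In r (rightl brk xx rl) -> exists r', In r' rl /\ fst r' = fst r.
Proof.
  assert (HS : forall r, In r (skipn brk rl) -> In r rl).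
  { intros r' h. rewrite <- (firstn_skipn brk rl). apply in_app_iff. auto. }
  revert HS. clear. unfold rightl. destruct (skipn brk rl) as [|[x k] t]; [simpl; tauto|]. intros HS [<-|H].
  - exists (x, k). split; auto. apply HS. left. reflexivity.
  - exists r. split; auto. apply HS. right. exact H.
Qed.
Lemma leftl_In brk xx rl r : In r (leftl brk xx rl) -> exists r', In r' rl /\ fst r' = fst r.
Proof.
  assert (HS : forall r, In r (skipn brk rl) \/ In r (firstn brk rl) -> In r rl).
  { intros r' h. rewrite <- (firstn_skipn brk rl). apply in_app_iff. tauto. }
  revert HS. clear. unfold leftl. intros HS H. apply in_app_iff in H as [H|H].
  - destruct (skipn brk rl) as [|[x k] t]; simpl in H; [tauto|]. destruct H as [<-|[]].
    exists (x, k). split; auto. apply HS. left. left. reflexivity.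
  - exists r. split; auto. apply HS. right. now apply in_rev.
Qed.
Lemma RL_In A r : (forall x, x < n -> A x < n) -> In r (RL A) -> fst (fst r) <= wm /\ snd (fst r) <= mx.
Proof.
  intros HA Hr. unfold rl, seg in Hr. rewrite map_map in Hr. apply in_map_iff in Hr as (x & <- & Hx). apply in_seq in Hx. simpl.
  pose proof (HA x ltac:(lia)) as H. pose proof (it_le _ H). pose proof (itw_le _ H). lia.
Qed.

Lemma Forall_se_le z : Forall (fun c : nat * nat => 0 < fst c <= wm) (base z) -> Forall (fun c => fst c <= wm) (se z).
Proof.
  intros H. eapply Forall_impl; [|apply (Forall_se (fun c => 0 < fst c <= wm)), H]. simpl. intros; lia.
Qed.

Lemma sumw_le_length l k : Forall (fun c : nat * nat => fst c <= k) l -> sumw l <= length l * k.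
Proof. induction 1; [cbn; lia|]. rewrite sumw_cons. simpl. lia. Qed.

Lemma branch_spec s v : mid s -> optE W (expand (irl items)) v ->
  tri (40 + if wm <? n ^ 4 then costS else costB) branch s (ready v).
Proof.
  intros (HI & Hrp & E3 & E5 & E8 & E38 & E26 & HS & HP & HG) Hopt.
  pose proof bn as Bn. pose proof bW as BW. pose proof bwm as Bw. pose proof n_pos as Hn. pose proof wm_pos as Hw.
  pose proof wm_le as Hwm. assert (Bl : lglg mx <= B ^ 1) by (pose proof (lglg_le mx); lia).
  assert (Bl2 : Nat.log2 n <= B ^ 1) by (pose proof (Nat.log2_le_lin n); lia).
  assert (Bl3 : Nat.log2 wm <= B ^ 1) by (pose proof (Nat.log2_le_lin wm); lia).
  assert (Bs : Nat.sqrt wm <= B ^ 1) by (pose proof (Nat.sqrt_le_lin wm); lia).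
  assert (Bc : c <= B ^ (c + 20)).
  { pose proof (Nat.pow_gt_lin_r B (c + 20) ltac:(lia)). lia. }
  assert (HA : forall x, x < n -> ar s 3 x < n) by (apply (seg_id_lt m n Hn); auto; bdlt).
  pose proof HI as (I0 & I1 & I2).
  assert (HAr : arrs n (ar s 3) itw itp itm s).
  { split; [auto|]. split; [intros x Hx; apply I2, Hx|]. split; [intros x Hx; apply I2, Hx|]. split; [intros x Hx; apply I2, Hx|auto]. }
  set (A := ar s 3) in *.
  destruct HG as (brk & xx & E17 & E18 & Hb & Hgr & E15 & E16).
  pose proof (RL_Forall A HA) as HF. pose proof (RL_perm A HP) as HPE.
  assert (HoptE : optE W (expand (RL A)) v).
  { destruct Hopt as [(a & O1 & O2) O3]. split.
    - exists a. split; auto. eapply ach_perm; [apply Permutation_sym, HPE|auto].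
    - intros a' b' Ha' H'. eapply O3; [exact Ha'|]. eapply ach_perm; [apply HPE|auto]. }
  destruct (decomposition wm W (RL A) brk xx v) as (z1 & z2 & Bz1 & Bz2 & C1 & C2 & L1 & L2 & D1 & D2 & D3 & D4); auto.
  { apply rl_SSorted, HS. } { lia. }
  set (R1 := rightl brk xx (RL A)) in *. set (R2 := leftl brk xx (RL A)) in *. set (E2 := pref brk xx (RL A)) in *.
  assert (HE12 : Permutation (expand (irl items)) (E2 ++ expand R1)).
  { rewrite <- HPE. unfold E2, R1. rewrite <- expand_rightl; [reflexivity|]. destruct (skipn brk (RL A)) as [|[x k] t]; [auto|lia]. }
  assert (HR2 : expand R2 = rev E2) by apply expand_leftl.
  assert (HEsum : expand (RL A) = E2 ++ expand R1).
  { unfold E2, R1. rewrite <- expand_rightl; [reflexivity|]. destruct (skipn brk (RL A)) as [|[x k] t]; [auto|lia]. }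
  rewrite HEsum in HF. apply Forall_app in HF as [HF2 HF1].
  assert (HFz1 : Forall (fun c => 0 < fst c <= wm) (base z1)).
  { rewrite Bz1. eapply Forall_impl; [|exact HF1]. simpl. intros; lia. }
  assert (HFz2 : Forall (fun c => 0 < fst c <= wm) (base z2)).
  { rewrite Bz2, HR2. apply Forall_rev. eapply Forall_impl; [|exact HF2]. simpl. intros; lia. }
  assert (HLR1 : length R1 <= n) by (unfold R1; rewrite rightl_length by auto; lia).
  assert (HLR2 : length R2 <= n + 1).
  { unfold R2. rewrite (leftl_length m) by (auto; bdlt). unfold off. destruct (_ <? _); lia. }
  assert (HIn1 : forall r, In r R1 -> fst (fst r) <= wm /\ snd (fst r) <= mx).
  { intros r Hr. apply rightl_In in Hr as (r' & Hr & <-). now apply RL_In with A. }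
  assert (HIn2 : forall r, In r R2 -> fst (fst r) <= wm /\ snd (fst r) <= mx).
  { intros r Hr. apply leftl_In in Hr as (r' & Hr & <-). now apply RL_In with A. }
  assert (BR1 : length R1 <= B ^ 1) by lia. assert (BR2 : length R2 <= B ^ 2).
  { eapply Nat.le_trans; [exact HLR2|]. cbn [Nat.pow] in *. nia. }
  assert (HxxA : brk < n -> xx <= itm (A brk)).
  { intros h. rewrite (skipn_nth (RL A) dr brk), rl_nth in Hgr by (rewrite ?rl_length; lia). lia. }
  assert (Hm1 : 64 + 16 * n + 64 < m) by bdlt.
  assert (En4 : n * n * (n * n) = n ^ 4) by (cbn [Nat.pow]; lia).
  destruct (Nat.ltb_spec wm (n ^ 4)) as [Hcase|Hcase].
  - eapply tri_le; [apply (tri_if _ _ costS)|cbn; lia].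
    { wsim. rewrite I0. repeat split; auto; bdlt. }
    2:{ wsim. rewrite E3, I0, En4. intros; lia. }
    intros _. unfold scanB, costS.
    eapply tri_then with (R := fun s1 => rg s1 30 = Rng wm (Nat.sqrt wm + 1) ((c + 20) * lgN) /\ rp s1 = 0 /\ rg s1 17 = brk /\ rg s1 18 = xx /\ rg s1 3 = wm /\
       rg s1 26 = 0 /\ rg s1 38 = 2 ^ Nat.log2_up wm /\ rg s1 15 = rg s 15 /\ rg s1 16 = rg s 16 /\ arrs n A itw itp itm s1).
    + apply tri_wps; [|cbn; lia]. unfold arrs. wsim. rewrite E3, E5, E8. unfold lgN, Rng.
      repeat split; auto; try bdlt; try apply HAr.
    + intros s1 (F30 & Frp & F17 & F18 & F3 & F26 & F38 & F15 & F16 & FA) _.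
      pose (PZ := fun z cl => exists em, base em = cl /\ filter snd em = filter snd z /\
        (forall a b, ach (base em) a b -> ach (base z) a b) /\ length em <= LIM wm).
      assert (BL : LIM wm <= B ^ 20).
      { unfold LIM. eapply Nat.le_trans; [bd|]. apply Nat.pow_le_mono_r; cbn; lia. }
      eapply tri_mono; [apply le_n| |apply (sides_spec m bits n wm A itw itp itm brk xx sscan
        (LIM wm * 600 + (n + 1) * 200 + 1000) (LIM wm * 600 + (n + 1) * 200 + 1000) (PZ z1) (PZ z2)); auto].
      * intros s2 (HK & cl1 & cl2 & (em1 & Y1 & Y2 & Y3 & Y4) & (em2 & X1 & X2 & X3 & X4) & HE). subst cl1 cl2.
        destruct HK as ((K0 & K1 & K3 & K5 & K8) & (K15 & K16 & K17 & K18) & (K30 & K38) & _ & Krp).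
        apply scan_se in Y2. apply scan_se in X2.
        exists em1, em2, (expand R1), E2. rewrite Y2, X2. split; [exact HE|].
        split; [congruence|]. split; [congruence|]. split; [congruence|]. split; [congruence|]. split; [exact HE12|].
        split; [rewrite <- Bz1; exact Y3|].
        split. { intros a b h. apply X3 in h. rewrite Bz2, HR2 in h. eapply ach_perm; [apply Permutation_sym, Permutation_rev|exact h]. }
        split; [exact D3|]. split; [exact D4|]. left. repeat split; auto; try congruence; try (now apply Forall_se_le).
        unfold candn, base. rewrite !length_map. lia.
      * intros s2 HR Z3 Z27 Z26.
        eapply tri_mono; [| |apply (sscan_spec m bits wm 0 0 s2 z1 C1 L1 Hw HFz1) with (R := R1)]; auto; try bdlt.
        -- nia.
        -- intros s3 (em & (HSI & HEm & _)). exists (base em). split; [|exact HEm]. exists em.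
           destruct HSI. split; [auto|]. split; [auto|]. split; [auto|]. unfold LIM. eapply scan_count; eauto. constructor; eauto.
        -- apply HIn1.
        -- apply emitted_init; auto.
      * intros s2 cl (em1 & Y1 & Y2 & Y3 & Y4) Z26 HR Z3 Z27.
        assert (Bcl : length cl <= B ^ 20) by (rewrite <- Y1; unfold base; rewrite length_map; lia).
        eapply tri_mono; [| |apply (sscan_spec m bits wm (length cl) 1 s2 z2 C2 L2 Hw HFz2) with (R := R2)]; auto; try bdlt.
        -- nia.
        -- intros s3 (em & (HSI & HEm & _)). exists (base em). split; [|exact HEm]. exists em.
           destruct HSI. split; [auto|]. split; [auto|]. split; [auto|]. unfold LIM. eapply scan_count; eauto. constructor; eauto.
        -- apply HIn2.
        -- apply emitted_init; auto.
  - eapply tri_le; [apply (tri_if _ _ costB)|cbn; lia].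
    { wsim. rewrite I0. repeat split; auto; bdlt. }
    { wsim. rewrite E3, I0, En4. intros; lia. }
    intros _. unfold bundB, costB.
    eapply tri_then with (R := fun s1 => rg s1 30 = 2 * wm * wm /\ rp s1 = 0 /\ rg s1 17 = brk /\ rg s1 18 = xx /\ rg s1 3 = wm /\
       rg s1 26 = 0 /\ rg s1 38 = 2 ^ Nat.log2_up wm /\ rg s1 15 = rg s 15 /\ rg s1 16 = rg s 16 /\ arrs n A itw itp itm s1).
    + apply tri_wps; [|cbn; lia]. unfold arrs. wsim. rewrite E3.
      repeat split; auto; try bdlt; try apply HAr.
    + intros s1 (F30 & Frp & F17 & F18 & F3 & F26 & F38 & F15 & F16 & FA) _.
      eapply tri_mono; [apply le_n| |apply (sides_spec m bits n wm A itw itp itm brk xx bouter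
        ((n + 1) * ((Nat.log2 wm + 2) * 150 + 300) + 100) ((n + 1) * ((Nat.log2 wm + 2) * 150 + 300) + 100)
        (fun cl => cl = bundles wm R1) (fun cl => cl = bundles wm R2)); auto].
      * intros s2 (HK & cl1 & cl2 & -> & -> & HE).
        destruct HK as ((K0 & K1 & K3 & K5 & K8) & (K15 & K16 & K17 & K18) & (K30 & K38) & _ & Krp).
        (* The selection of copies is replaced by a selection of bundles with the same weight and
           profit. *)
        destruct (ach_mask _ _ _ (bundles_complete wm R1 z1 Bz1 L1)) as (em1 & Y1 & Y2 & Y3).
        destruct (ach_mask _ _ _ (bundles_complete wm R2 z2 Bz2 L2)) as (em2 & X1 & X2 & X3).
        exists em1, em2, (expand R1), E2. rewrite Y1, Y2, Y3, X1, X2, X3. split; [exact HE|].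
        split; [congruence|]. split; [congruence|]. split; [congruence|]. split; [congruence|]. split; [exact HE12|].
        split; [apply bundles_sound|].
        split. { intros a b h. apply bundles_sound in h. rewrite HR2 in h. eapply ach_perm; [apply Permutation_sym, Permutation_rev|exact h]. }
        split; [exact D3|]. split; [exact D4|]. right. split; [auto|]. split; [congruence|].
        pose proof (sumw_le_length _ _ (Forall_se_le _ HFz1)). pose proof (sumw_le_length _ _ (Forall_se_le _ HFz2)).
        pose proof (Nat.mul_le_mono_r _ _ wm L1). pose proof (Nat.mul_le_mono_r _ _ wm L2).
        split; [lia|]. split; [lia|]. unfold candn. pose proof (bundles_length wm R1 Hw). pose proof (bundles_length wm R2 Hw).
        assert (HRn1 : length R1 <= n + 1) by lia.
        pose proof (Nat.mul_le_mono_r _ _ (Nat.log2 wm + 2) HRn1). pose proof (Nat.mul_le_mono_r _ _ (Nat.log2 wm + 2) HLR2). lia.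
      * intros s2 HR Z3 Z27 Z26.
        eapply tri_mono; [| |apply (bouter_spec m bits wm 0 0 s2 s2 R1 mx Hw HR)]; auto; try bdlt.
        -- apply Nat.add_le_mono_r, Nat.mul_le_mono_r. lia.
        -- intros s3 h. exists (bundles wm R1). auto.
        -- apply emitted_init; auto.
      * intros s2 cl -> Z26 HR Z3 Z27.
        assert (Bcl : length (bundles wm R1) <= B ^ 10).
        { eapply Nat.le_trans; [apply bundles_length; auto|]. eapply Nat.le_trans; [bd|]. apply Nat.pow_le_mono_r; cbn; lia. }
        eapply tri_mono; [| |apply (bouter_spec m bits wm (length (bundles wm R1)) 1 s2 s2 R2 mx Hw HR)]; auto; try bdlt.
        -- apply Nat.add_le_mono_r, Nat.mul_le_mono_r. lia.
        -- intros s3 h. exists (bundles wm R2). auto.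
        -- apply emitted_init; auto.
Qed.
End Main.

Lemma log2_up_bounds w : 0 < w -> w <= 2 ^ Nat.log2_up w /\ 2 ^ Nat.log2_up w <= 2 * w /\ Nat.log2_up w <= Nat.log2 w + 1 /\ Nat.log2_up w <= w.
Proof.
  intros Hw. pose proof (Nat.le_log2_up_succ_log2 w) as H1. pose proof (Nat.log2_up_le_lin w ltac:(lia)).
  pose proof (Nat.log2_spec w Hw) as [H2 _].
  split; [|split; [|lia]].
  - destruct (Nat.eq_dec w 1) as [->|]; [cbn; lia|]. apply Nat.log2_up_spec. lia.
  - transitivity (2 ^ S (Nat.log2 w)); [apply Nat.pow_le_mono_r; lia|]. cbn [Nat.pow]. lia.
Qed.

(** * Input size and failure probability *)

Section Size.
Context (c W : nat) (items : list item) (Hv : valid_instance W items).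
Notation n := (length items).
Notation wm := (wmax items).
Notation mx := (maxval W items).
Notation N := (input_size W items).

Lemma input_size_le : N <= 5 * n * bitlen mx.
Proof.
  assert (H0 : forall x y, x <= y -> bitlen x <= bitlen y).
  { intros x y H. unfold bitlen. pose proof (Nat.log2_le_mono x y H). lia. }
  assert (H1 : fold_right Nat.add 0 (map (fun it => bitlen (iw it) + bitlen (ip it) + bitlen (im it)) items) <= n * (3 * bitlen mx)).
  { assert (HF : Forall (fun it => iw it <= mx /\ ip it <= mx /\ im it <= mx) items).
    { apply Forall_forall. intros it Hit. apply (In_nth _ _ dit) in Hit as (i & Hi & <-).
      apply (it_le W items i Hi). }
    revert HF. generalize mx as M. intros M. clear - H0. induction 1 as [|it l (A1 & A2 & A3) HF IH]; simpl; [lia|].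
    apply H0 in A1, A2, A3. lia. }
  pose proof (maxval_n W items) as [_ HW]. apply H0 in HW. pose proof (n_pos W items Hv) as Hn.
  assert (1 <= bitlen mx) by (unfold bitlen; lia).
  assert (n <= n * bitlen mx) by nia. assert (bitlen mx <= n * bitlen mx) by nia.
  unfold input_size. lia.
Qed.

Lemma bitlen_le_pow : bitlen mx <= 2 ^ lglg mx.
Proof.
  pose proof (maxval_n W items) as [H _]. pose proof (n_pos W items Hv) as Hn.
  assert (Hx : 0 < mx) by lia. pose proof (lglg_ge mx Hx) as H1. pose proof (Nat.log2_spec mx Hx) as [H2 _].
  unfold bitlen. rewrite Nat.add_1_r. apply Nat.le_succ_l. apply (Nat.pow_lt_mono_r_iff 2); lia.
Qed.

Lemma N_le_lgN : N <= 2 ^ lgN W items.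
Proof.
  etransitivity; [apply input_size_le|]. unfold lgN. rewrite !Nat.pow_add_r.
  pose proof bitlen_le_pow. pose proof (n_pos W items Hv) as Hn. pose proof (Nat.log2_spec n Hn) as [_ H2].
  cbn [Nat.pow] in H2. apply Nat.mul_le_mono; auto. change (2 ^ 4) with 16. lia.
Qed.

Lemma n_le_N : n <= N.
Proof. unfold input_size. lia. Qed.

(** With g = lgN >= 4 and w <= 2^(4g), the left side is at most 2^(14 + 16g + cg), and 14 <= 4g.
    This is the origin of the 20. *)
Lemma prob_cond nc : wm < n ^ 4 -> nc <= 2 * LIM wm ->
  32 * 2 ^ Nat.log2_up wm * (nc + 1) * N ^ c <= 2 ^ ((c + 20) * lgN W items).
Proof.
  intros Hw4 Hnc. set (g := lgN W items). pose proof (wm_pos W items Hv) as Hw.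
  destruct (log2_up_bounds wm Hw) as (_ & HG & _).
  assert (Hg : 4 <= g) by (unfold g, lgN; lia).
  assert (HN : N <= 2 ^ g) by apply N_le_lgN.
  assert (Hwg : wm <= 2 ^ (4 * g)).
  { rewrite Nat.mul_comm, Nat.pow_mul_r. pose proof n_le_N.
    pose proof (Nat.pow_le_mono_l n (2 ^ g) 4 ltac:(lia)). lia. }
  assert (HNc : N ^ c <= 2 ^ (g * c)) by (rewrite Nat.pow_mul_r; now apply Nat.pow_le_mono_l).
  assert (HL : nc + 1 <= 2 ^ 8 * (2 ^ (4 * g) * (2 ^ (4 * g) * 2 ^ (4 * g)))).
  { unfold LIM in Hnc. pose proof (Nat.log2_lt_lin wm Hw) as Hl.
    assert (H1 : (Nat.log2 wm + 1) * (Nat.log2 wm + 1) <= wm * wm) by (apply Nat.mul_le_mono; lia).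
    assert (H2 : wm * ((Nat.log2 wm + 1) * (Nat.log2 wm + 1)) <= wm * (wm * wm)) by (apply Nat.mul_le_mono_l; auto).
    assert (H3 : wm * (wm * wm) <= 2 ^ (4 * g) * (2 ^ (4 * g) * 2 ^ (4 * g))) by (repeat apply Nat.mul_le_mono; auto).
    assert (H4 : wm <= wm * (wm * wm)) by (assert (1 <= wm * wm) by nia; nia).
    change (2 ^ 8) with 256. lia. }
  transitivity (2 ^ 5 * 2 ^ (1 + 4 * g) * (2 ^ 8 * (2 ^ (4 * g) * (2 ^ (4 * g) * 2 ^ (4 * g)))) * 2 ^ (g * c)).
  - repeat apply Nat.mul_le_mono; auto. rewrite Nat.pow_add_r. change (2 ^ 1) with 2. lia.
  - rewrite <- !Nat.pow_add_r. apply Nat.pow_le_mono_r; lia.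
Qed.
End Size.

(** * The last phase: keys, dynamic program, output *)

Section Post.
Context (c W : nat) (items : list item) (Hv : valid_instance W items).
Notation n := (length items).
Notation wm := (wmax items).
Notation mx := (maxval W items).
Context (m : nat) (bits : list bool) (B c0 : nat) (HB : 2 <= B) (HBm : B ^ c0 <= m).
Context (Hmx : mx <= B ^ 1) (Hc0c : 2 * c + 120 <= c0).
Notation tri := (tri m bits).

Definition post : cmd := keys;; dp;; final.
Definition costP (nc R : nat) : nat :=
  nc * (Nat.log2_up wm * 60 + 100) + 50 +
  (2 ^ Nat.log2_up wm * (nc * 100 + 100) + nc * UC R + (2 * R + 1) * 50 + 200 + ((2 * R + 1) * 100 + 100)).
Definition RS : nat := Rng wm (Nat.sqrt wm + 1) ((c + 20) * lgN W items).
Definition costPost : nat :=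
  if wm <? n ^ 4 then costP (2 * LIM wm) RS else costP ((2 * n + 2) * (Nat.log2 wm + 2)) (2 * wm * wm).

Lemma costP_mono nc nc' R : nc <= nc' -> costP nc R <= costP nc' R.
Proof.
  intros H. unfold costP. pose proof (Nat.mul_le_mono_r _ _ (Nat.log2_up wm * 60 + 100) H).
  pose proof (Nat.mul_le_mono_r _ _ (UC R) H).
  assert (2 ^ Nat.log2_up wm * (nc * 100 + 100) <= 2 ^ Nat.log2_up wm * (nc' * 100 + 100)) by (apply Nat.mul_le_mono_l; lia).
  lia.
Qed.

(** Halting within the bound is unconditional; only the correctness of the output depends on the
    keys. *)
Lemma post_one v s em1 em2 E1 E2 R :
  emittedAll (base em1) (base em2) s -> rg s 38 = 2 ^ Nat.log2_up wm -> rg s 16 = 1 + sump E2 -> rg s 15 + sumw E2 = W ->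
  rp s = 0 -> Permutation (expand (irl items)) (E2 ++ E1) ->
  (forall a b, ach (base em1) a b -> ach E1 a b) -> (forall a b, ach (base em2) a b -> ach E2 a b) ->
  sumw E2 + sumw (se em1) <= W + sumw (se em2) -> v + sump (se em2) = sump E2 + sump (se em1) ->
  optE W (expand (irl items)) v -> rg s 30 = R -> 0 < R -> R <= B ^ (c + 60) -> candn (base em1) (base em2) <= B ^ 40 ->
  tri (costP (candn (base em1) (base em2)) R) post s (fun s' =>
    inrange (candn (base em1) (base em2)) R (2 ^ Nat.log2_up wm) (cands_sg (base em1)) (candw (base em1) (base em2))
      (key (Nat.log2_up wm) bits) (candD em1 em2) -> rg s' 0 = v).
Proof.
  intros [E26 HE] E38 E16 E15 Erp HP S1 S2 D3 D4 Hopt E30 HR BR Bnc.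
  assert (Bw : wm <= B ^ 1) by (pose proof (wm_le W items); lia). pose proof (wm_pos W items Hv) as Hw.
  assert (Bn : n <= B ^ 1) by (pose proof (maxval_n W items); lia). assert (BW : W <= B ^ 1) by (pose proof (maxval_n W items); lia).
  set (nc := candn (base em1) (base em2)) in *.
  set (K := key (Nat.log2_up wm) bits).
  assert (BG : 2 ^ Nat.log2_up wm <= B ^ 3).
  { destruct (log2_up_bounds wm Hw) as (_ & H & _). etransitivity; [exact H|]. eapply Nat.le_trans; [bd|].
    apply Nat.pow_le_mono_r; cbn; lia. }
  set (G := 2 ^ Nat.log2_up wm) in *.
  assert (BE : sumw (expand (irl items)) <= B ^ 3 /\ sump (expand (irl items)) <= B ^ 3).
  { pose proof (rl_perm items (fun x => x)) as HPid. cbv zeta in HPid.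
    assert (Hid : Permutation (seg (fun x => x) 0 n) (seq 0 n)) by (unfold seg; rewrite map_id, Nat.sub_0_r; reflexivity).
    specialize (HPid Hid). apply expand_perm in HPid.
    destruct (RL_sums W items (fun x => x) ltac:(auto)) as [R1 R2].
    assert (Hb : n * (mx * mx) <= B ^ 3).
    { change 3 with (1 + (1 + 1)). rewrite !Nat.pow_add_r. repeat apply Nat.mul_le_mono; auto. }
    split.
    - rewrite <- (sumw_perm _ _ HPid). unfold itw, itp, itm in R1. lia.
    - pose proof (ach_all (expand (irl items))) as HA. apply (ach_perm _ _ (Permutation_sym HPid)), ach_le in HA.
      unfold itw, itp, itm in R2. lia. }
  set (E := expand (irl items)) in *. destruct BE as [BE1 BE2].
  set (PB := 1 + sumw E + sump E).
  assert (BPB : PB <= B ^ 6) by (unfold PB; eapply Nat.le_trans; [bd|apply Nat.pow_le_mono_r; cbn; lia]).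
  unfold post, costP. fold nc G.
  eapply tri_then; [apply (keys_spec m bits s (Nat.log2_up wm) nc); auto; try bdlt|].
  intros s1 HK F1. frx F1 26. frx F1 38. frx F1 30. frx F1 16. frx F1 15. fra F1 9. fra F1 10. fra F1 11.
  assert (Hpos : forall Q, (0 < Z.of_nat (rg s 16) + qsum nc (cands_sg (base em1)) (candp (base em1) (base em2)) Q)%Z)
    by (apply (cands_pos (base em1) (base em2) E E1 E2 W (rg s 16) (rg s 15)); auto).
  assert (HPB : forall Q, (Z.of_nat (rg s 16) + qsum nc (cands_sg (base em1)) (candp (base em1) (base em2)) Q <= Z.of_nat PB)%Z).
  { intros Q. etransitivity; [apply (cands_ub (base em1) (base em2) E E1 E2 W (rg s 16) (rg s 15)); auto|]. unfold PB. lia. }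
  assert (Hcb : forall j, j < nc -> candw (base em1) (base em2) j <= PB /\ candp (base em1) (base em2) j <= PB).
  { intros j Hj. destruct (cand_bound (base em1) (base em2) E E1 E2 W (rg s 16) (rg s 15) HP S1 S2 E16 E15 j Hj). unfold PB. lia. }
  assert (HKG : forall j, j < nc -> K j < G) by (intros; apply key_lt).
  assert (M1 : 2 * PB + 64 < m) by bdlt. assert (M2 : 16 * (2 * R + 1 + 1) + PB + 256 < m) by bdlt.
  assert (M3 : 64 + 16 * nc + 64 < m) by bdlt. assert (M4 : G + 64 < m) by bdlt.
  eapply tri_then; [apply (dp_spec m bits nc R (rg s 16) G PB _ _ _ K Hpos HPB
    (fun j Hj => proj2 (Hcb j Hj)) (fun j Hj => proj1 (Hcb j Hj)) HKG M1 M2 M3 M4 HR s1)|].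
  { unfold candsR. rewrite E0, E3, E4, E5, E7, E8, E9. repeat split; auto; try apply HE; auto. }
  intros s2 (HI & E31) F2. frx F2 30. frx F2 15.
  assert (Hrem : rg s 15 <= B ^ 1) by lia.
  assert (M5 : R + rg s 15 + 64 < m) by bdlt.
  eapply tri_mono; [apply le_n| |apply (final_spec m bits nc R G PB M1 M2 M3 M4 HR (rg s 15) M5 s2); auto; congruence].
  intros s3 Hbest HIR. destruct HI as [HIs HIc].
  apply (best_opt (base em1) (base em2) E E1 E2 W v (rg s 16) (rg s 15) R HP Hopt S1 S2 E16 E15 (candD em1 em2))
    with (F := ar s2 13); auto.
  - rewrite dsum_D. lia.
  - rewrite qsum_D. lia.
Qed.

Lemma LIM_bd : LIM wm <= B ^ 20.
Proof.
  assert (Bw : wm <= B ^ 1) by (pose proof (wm_le W items); lia).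
  assert (Bl : Nat.log2 wm <= B ^ 1) by (pose proof (Nat.log2_le_lin wm); lia).
  unfold LIM. eapply Nat.le_trans; [bd|]. apply Nat.pow_le_mono_r; cbn; lia.
Qed.

Lemma RS_bd : RS <= B ^ (c + 60).
Proof.
  assert (Bw : wm <= B ^ 1) by (pose proof (wm_le W items); lia).
  assert (Bn : n <= B ^ 1) by (pose proof (maxval_n W items); lia).
  assert (Bs : Nat.sqrt wm <= B ^ 1) by (pose proof (Nat.sqrt_le_lin wm); lia).
  assert (Bl : lglg mx <= B ^ 1) by (pose proof (lglg_le mx); lia).
  assert (Bl2 : Nat.log2 n <= B ^ 1) by (pose proof (Nat.log2_le_lin n); lia).
  assert (Bc : c <= B ^ c).
  { pose proof (Nat.pow_gt_lin_r B c ltac:(lia)). lia. }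
  unfold RS, Rng, lgN. eapply Nat.le_trans; [bd|]. apply Nat.pow_le_mono_r; [lia|]. cbn [Nat.max Nat.add]. lia.
Qed.
End Post.

Section PostReady.
Context (c W : nat) (items : list item) (Hv : valid_instance W items).
Notation n := (length items).
Notation wm := (wmax items).
Notation mx := (maxval W items).
Notation N := (input_size W items).
Context (m B c0 : nat) (HB : 2 <= B) (HBm : B ^ c0 <= m) (Hmx : mx <= B ^ 1) (Hc0c : 2 * c + 120 <= c0).

(** [f] marks the strings of random bits on which correctness is not guaranteed; it is constantly
    false in the bundle branch, where every order works. T only has to be long enough to contain all
    key bits. *)
Lemma post_ready v s : ready W items c v s -> optE W (expand (irl items)) v ->
  exists f : list bool -> bool,
    (forall bits, exists s' t, exec m bits post s s' t /\ t <= costPost c W items /\ (f bits = false -> rg s' 0 = v)) /\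
    forall T, costPost c W items <= T -> length (filter f (all_bits T)) * N ^ c <= 2 ^ T.
Proof.
  intros (em1 & em2 & E1 & E2 & HE & E38 & E16 & E15 & Erp & HP & S1 & S2 & D3 & D4 & Hcase) Hopt.
  pose proof (wm_pos W items Hv) as Hw. unfold costPost.
  assert (Bw : wm <= B ^ 1) by (pose proof (wm_le W items); lia).
  assert (Bn : n <= B ^ 1) by (pose proof (maxval_n W items); lia).
  assert (Bl : Nat.log2 wm <= B ^ 1) by (pose proof (Nat.log2_le_lin wm); lia).
  destruct (log2_up_bounds wm Hw) as (G1 & G2 & G3 & G4).
  assert (Hsq : wm <= (Nat.sqrt wm + 1) * (Nat.sqrt wm + 1)).
  { pose proof (Nat.sqrt_spec wm ltac:(lia)). lia. }
  destruct Hcase as [(Hc1 & E30 & F1 & F2 & L1 & L2 & W1 & W2 & Hnc)|(Hc1 & E30 & W1 & W2 & Hnc)].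
  - replace (wm <? n ^ 4) with true by (symmetry; now apply Nat.ltb_lt).
    exists (bad wm (Nat.sqrt wm + 1) (candn (base em1) (base em2)) (Nat.log2_up wm) ((c + 20) * lgN W items) (sD em1 em2)). split.
    + intros bits. pose proof (LIM_bd c W items m B c0 HB HBm Hmx Hc0c) as HLB.
      destruct (post_one c W items Hv m bits B c0 HB HBm Hmx Hc0c v s em1 em2 E1 E2 (RS c W items)) as (s' & t & X1 & X2 & X3); auto.
      * unfold RS, Rng. lia.
      * apply (RS_bd c W items m B c0 HB HBm Hmx Hc0c).
      * eapply Nat.le_trans; [exact Hnc|]. eapply Nat.le_trans; [bd|]. apply Nat.pow_le_mono_r; cbn; lia.
      * exists s', t. split; [exact X1|]. split.
        { etransitivity; [exact X2|]. eapply costP_mono; eauto. }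
        { intros Hb. apply X3. now apply inrange_scan. }
    + intros T HT. apply conc_scan; auto.
      * assert (Hmul : candn (base em1) (base em2) * Nat.log2_up wm <= 2 * LIM wm * Nat.log2_up wm) by (apply Nat.mul_le_mono_r; auto).
        unfold costP in HT. lia.
      * eapply prob_cond; eauto.
  - replace (wm <? n ^ 4) with false by (symmetry; now apply Nat.ltb_ge).
    exists (fun _ => false). split.
    + intros bits.
      destruct (post_one c W items Hv m bits B c0 HB HBm Hmx Hc0c v s em1 em2 E1 E2 (2 * wm * wm)) as (s' & t & X1 & X2 & X3); auto.
      * lia.
      * eapply Nat.le_trans; [bd|]. apply Nat.pow_le_mono_r; cbn; lia.
      * eapply Nat.le_trans; [exact Hnc|]. eapply Nat.le_trans; [bd|]. apply Nat.pow_le_mono_r; cbn; lia.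
      * exists s', t. split; [exact X1|]. split.
        { etransitivity; [exact X2|]. eapply costP_mono; eauto. }
        { intros _. apply X3. now apply inrange_det. }
    + intros T _. assert (E : forall l : list (list bool), filter (fun _ => false) l = []) by (induction l; auto).
      rewrite E. simpl. lia.
Qed.
End PostReady.

(** * Running time *)

Section Cost.
Context (c W : nat) (items : list item) (Hv : valid_instance W items).
Notation n := (length items).
Notation wm := (wmax items).
Notation mx := (maxval W items).
Notation N := (input_size W items).
Notation r := (Nat.sqrt wm).
Notation l := (bitlen N).
Notation S := (wm * wm * r).

Lemma l_pos : 1 <= l.
Proof. unfold bitlen. lia. Qed.
Lemma r_bounds : 1 <= r /\ r * r <= wm /\ wm < (r + 1) * (r + 1).
Proof.
  pose proof (wm_pos W items Hv). pose proof (Nat.sqrt_spec wm ltac:(lia)).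
  assert (0 < r) by (destruct r; lia). lia.
Qed.
Lemma log2_n_l : Nat.log2 n + 1 <= l.
Proof. unfold bitlen. pose proof (Nat.log2_le_mono _ _ (n_le_N W items)). lia. Qed.

Lemma bitlen_mx_N : bitlen mx <= N.
Proof.
  assert (H : forall a s l, (bitlen a <= s) -> bitlen (fold_right Nat.max a (map (fun it => Nat.max (iw it) (Nat.max (ip it) (im it))) l)) <=
     s + fold_right Nat.add 0 (map (fun it => bitlen (iw it) + bitlen (ip it) + bitlen (im it)) l)).
  { assert (HM : forall x y, bitlen (Nat.max x y) <= Nat.max (bitlen x) (bitlen y)).
    { intros x y. destruct (Nat.max_spec x y) as [[_ ->]|[_ ->]]; lia. }
    intros a s l'. intros Ha. induction l' as [|it l' IH]; simpl; [lia|].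
    set (y := fold_right Nat.max a _) in *. set (z := fold_right Nat.add 0 _) in *.
    pose proof (HM (Nat.max (iw it) (Nat.max (ip it) (im it))) y). pose proof (HM (iw it) (Nat.max (ip it) (im it))).
    pose proof (HM (ip it) (im it)). lia. }
  unfold maxval, input_size. apply H. destruct (Nat.max_spec n W) as [[_ ->]|[_ ->]]; [lia|].
  pose proof (n_pos W items Hv). pose proof (Nat.log2_lt_lin n ltac:(lia)). unfold bitlen at 1. lia.
Qed.

Lemma lglg_l : lglg mx <= l.
Proof.
  unfold lglg. destruct (Nat.eqb_spec (Nat.log2 mx) 0); [lia|]. pose proof bitlen_mx_N as H. unfold bitlen at 1 in H. unfold bitlen.
  pose proof (Nat.log2_le_mono (Nat.log2 mx) N ltac:(lia)). lia.
Qed.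
Lemma lgN_l : lgN W items <= 6 * l.
Proof. unfold lgN. pose proof log2_n_l. pose proof lglg_l. pose proof l_pos. lia. Qed.

Lemma wS : wm <= S /\ wm * wm <= S /\ wm * r <= S /\ r <= S /\ 1 <= S.
Proof.
  pose proof (wm_pos W items Hv) as Hw. destruct r_bounds as (R1 & _).
  assert (H1 : wm * wm * 1 <= S) by (apply Nat.mul_le_mono_l; auto).
  assert (H2 : 1 * wm * r <= S) by (apply Nat.mul_le_mono_r, Nat.mul_le_mono_r; auto).
  assert (H3 : 1 * wm <= wm * wm) by (apply Nat.mul_le_mono_r; auto).
  assert (H4 : 1 * r <= wm * r) by (apply Nat.mul_le_mono_r; auto). lia.
Qed.

Definition Y : nat := (n + S) * (l * l * l).

Lemma scale x : x <= n + S -> x * (l * l * l) <= Y /\ x * (l * l) <= Y /\ x * l <= Y /\ x <= Y.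
Proof.
  intros H. pose proof l_pos as Hl. unfold Y.
  assert (H1 : l * 1 <= l * l) by (apply Nat.mul_le_mono_l; auto).
  assert (H2 : l * l * 1 <= l * l * l) by (apply Nat.mul_le_mono_l; auto).
  assert (H3 : 1 <= l * l * l) by lia.
  split; [now apply Nat.mul_le_mono|]. split; [apply Nat.mul_le_mono; lia|]. split; [apply Nat.mul_le_mono; lia|].
  rewrite <- (Nat.mul_1_r x). apply Nat.mul_le_mono; lia.
Qed.

Lemma cost_common : 40 * n + 200 + cost0 W items + 40 + 1 <= 40 * 1000 * Y.
Proof.
  pose proof (n_pos W items Hv) as Hn. pose proof wS as (H1 & H2 & H3 & H4 & H5). pose proof l_pos as Hl.
  destruct (scale n ltac:(lia)) as (_ & _ & A1 & A2). destruct (scale wm ltac:(lia)) as (_ & _ & B1 & B2).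
  pose proof log2_n_l. pose proof lglg_l. pose proof (Nat.le_log2_up_succ_log2 n).
  assert (C1 : 1 * l <= n * l) by (apply Nat.mul_le_mono_r; auto).
  assert (C2 : (n + 1) * 4000 * (Nat.log2_up n + 1) <= (n + n) * 4000 * (l + l)) by (apply Nat.mul_le_mono; lia).
  unfold cost0. lia.
Qed.

(** The leading term is the number of candidates, O(w l^2), times the table size, O(w r l), where l
    is the bit length of N; hence three logarithmic factors. The condition w < n^4 is what gives
    log2 w + 1 <= 4l. *)
Lemma cost_scan : wm < n ^ 4 -> costS items + costP items (2 * LIM wm) (RS c W items) <= 1000 * 1000 * 500 * (c + 20) * Y.
Proof.
  intros Hc. pose proof (n_pos W items Hv) as Hn. pose proof (wm_pos W items Hv) as Hw.
  pose proof wS as (H1 & H2 & H3 & H4 & H5). pose proof l_pos as Hl. destruct r_bounds as (R1 & _).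
  destruct (log2_up_bounds wm Hw) as (_ & G2 & G3 & _).
  assert (Hlog : Nat.log2 wm + 1 <= 4 * l).
  { pose proof (n_le_N W items) as HnN. assert (HN0 : 0 < N) by lia. pose proof (Nat.log2_spec N HN0) as [_ HN].
    assert (Hw2 : wm < 2 ^ (4 * l)).
    { rewrite Nat.mul_comm, Nat.pow_mul_r. unfold bitlen. rewrite Nat.add_1_r.
      pose proof (Nat.pow_le_mono_l n (2 ^ Datatypes.S (Nat.log2 N)) 4 ltac:(lia)). lia. }
    pose proof (Nat.log2_spec wm Hw) as [Hw3 _]. rewrite Nat.add_1_r. apply Nat.le_succ_l, (Nat.pow_lt_mono_r_iff 2); lia. }
  set (a := wm * (l * l)).
  assert (HLIM : LIM wm <= 514 * a).
  { assert (X1 : wm * ((Nat.log2 wm + 1) * (Nat.log2 wm + 1)) <= wm * (4 * l * (4 * l))) by (apply Nat.mul_le_mono_l, Nat.mul_le_mono; auto).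
    assert (X2 : wm * 1 <= wm * (l * l)) by (apply Nat.mul_le_mono_l; nia).
    unfold LIM, a. lia. }
  set (b := wm * r * l). set (cc := c + 20).
  assert (HR : RS c W items <= (24 * cc + 5) * b).
  { unfold RS, Rng. fold cc.
    assert (X1 : wm * (r + 1) * (cc * lgN W items) <= wm * (2 * r) * (cc * (6 * l))).
    { apply Nat.mul_le_mono; [apply Nat.mul_le_mono_l; lia|]. apply Nat.mul_le_mono_l, lgN_l. }
    assert (X2 : wm * 1 * 1 <= wm * r * l) by (apply Nat.mul_le_mono; auto; apply Nat.mul_le_mono_l; auto).
    unfold b. lia. }
  assert (Hb1 : 1 <= b) by (unfold b; assert (1 * 1 <= wm * r) by (apply Nat.mul_le_mono; auto); nia).
  assert (Ha1 : 1 <= a) by (unfold a; nia).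
  set (R := RS c W items) in *. set (nc := 2 * LIM wm) in *.
  assert (Hnc : nc <= 1028 * a) by (unfold nc; lia).
  assert (HUC : UC R <= (168 * 100 * cc + 4600) * b).
  { unfold UC. lia. }
  assert (Hab : a * b <= Y).
  { unfold a, b. destruct (scale S ltac:(lia)) as (X & _). lia. }
  assert (HaY : a <= Y) by (unfold a; destruct (scale wm ltac:(lia)) as (_ & X & _); lia).
  assert (HbY : b <= Y) by (unfold b; destruct (scale (wm * r) ltac:(lia)) as (_ & _ & X & _); lia).
  assert (HwaY : wm * a <= Y) by (unfold a; destruct (scale (wm * wm) ltac:(lia)) as (_ & X & _); lia).
  assert (HalY : a * l <= Y) by (unfold a; destruct (scale wm ltac:(lia)) as (X & _); lia).
  assert (HnY : n <= Y) by (destruct (scale n ltac:(lia)) as (_ & _ & _ & X); lia).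
  assert (HwY : wm <= Y) by (destruct (scale wm ltac:(lia)) as (_ & _ & _ & X); lia).
  assert (P1 : nc * (Nat.log2_up wm * 60 + 100) <= 1028 * a * (4 * l * 60 + 100 * l)) by (apply Nat.mul_le_mono; lia).
  assert (P2 : 2 ^ Nat.log2_up wm * (nc * 100 + 100) <= 2 * wm * (1028 * a * 100 + 100)) by (apply Nat.mul_le_mono; lia).
  assert (P3 : nc * UC R <= 1028 * a * ((168 * 100 * cc + 4600) * b)) by (apply Nat.mul_le_mono; auto).
  assert (P4 : cc * (a * b) <= cc * Y) by (apply Nat.mul_le_mono_l; auto).
  assert (P5 : cc * b <= cc * Y) by (apply Nat.mul_le_mono_l; auto).
  assert (P6 : 20 * Y <= cc * Y) by (apply Nat.mul_le_mono_r; unfold cc; lia).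
  assert (P7 : 1028 * a * ((168 * 100 * cc + 4600) * b) = 1028 * 168 * 100 * (cc * (a * b)) + 1028 * 4600 * (a * b)) by lia.
  assert (P8 : (24 * cc + 5) * b = 24 * (cc * b) + 5 * b) by lia.
  rewrite P7 in P3. rewrite P8 in HR.
  unfold costS, costP. fold nc R.
  replace (1000 * 1000 * 500 * cc * Y) with (1000 * 1000 * 500 * (cc * Y)) by lia.
  lia.
Qed.

(** From k = 8 on the left side at most doubles when k grows by 1; the smaller cases are
    computed. *)
Lemma log2_quarter k : (k + 2) ^ 4 <= 100 * 2 ^ k.
Proof.
  destruct (Nat.le_gt_cases 8 k) as [H|H].
  - induction H as [|k H IH]; [apply Nat.leb_le; vm_compute; reflexivity|].
    assert (H2 : (Datatypes.S k + 2) ^ 4 <= 2 * (k + 2) ^ 4) by (cbn [Nat.pow]; nia).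
    rewrite (Nat.pow_succ_r' 2). lia.
  - do 8 (destruct k as [|k]; [apply Nat.leb_le; vm_compute; reflexivity|]). lia.
Qed.

(** Fourth powers: n^4 <= w and (log2 w + 2)^4 <= 100 w bound the left side by 100 w^2 <= 1600 r^4,
    as w <= 4 r^2, which is below (8r)^4. *)
Lemma n_log_le : n ^ 4 <= wm -> n * (Nat.log2 wm + 2) <= 8 * r.
Proof.
  intros H. pose proof (wm_pos W items Hv) as Hw. pose proof (log2_quarter (Nat.log2 wm)) as HQ.
  pose proof (Nat.log2_spec wm Hw) as [H2 _]. destruct r_bounds as (R1 & R2 & R3).
  set (x := n * (Nat.log2 wm + 2)).
  assert (Hx : x ^ 4 <= 100 * (wm * wm)).
  { unfold x. rewrite Nat.pow_mul_l.
    transitivity (wm * (100 * wm)); [apply Nat.mul_le_mono; lia|lia]. }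
  apply Nat.nlt_ge. intros Hlt.
  assert (H4 : wm <= 4 * (r * r)) by nia.
  assert (H5 : (8 * r) ^ 4 < x ^ 4) by (apply Nat.pow_lt_mono_l; lia).
  assert (H6 : wm * wm <= 4 * (r * r) * (4 * (r * r))) by (apply Nat.mul_le_mono; auto).
  assert (H7 : (8 * r) ^ 4 = 8 * 8 * 8 * 8 * (r * r * (r * r))) by (cbn [Nat.pow]; ring).
  assert (H8 : 4 * (r * r) * (4 * (r * r)) = 16 * (r * r * (r * r))) by ring.
  lia.
Qed.

(** By [n_log_le] there are O(r) bundles, and the table has O(w^2) entries, so no logarithm of w is
    left in the product. *)
Lemma cost_bund : n ^ 4 <= wm -> costB items + costP items ((2 * n + 2) * (Nat.log2 wm + 2)) (2 * wm * wm) <= 1000 * 1000 * Y.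
Proof.
  intros Hc. pose proof (n_pos W items Hv) as Hn. pose proof (wm_pos W items Hv) as Hw.
  pose proof wS as (H1 & H2 & H3 & H4 & H5). pose proof l_pos as Hl. destruct r_bounds as (R1 & _).
  destruct (log2_up_bounds wm Hw) as (_ & G2 & _ & G4). pose proof (n_log_le Hc) as Hnl.
  set (d := Nat.log2 wm + 2) in *. set (nc := (2 * n + 2) * d).
  assert (Hd : 1 * d <= n * d) by (apply Nat.mul_le_mono_r; lia).
  assert (Hnc : nc <= 32 * r) by (unfold nc; lia).
  assert (Hn1 : n * 1 <= n * d) by (apply Nat.mul_le_mono_l; unfold d; lia).
  assert (HUC : UC (2 * wm * wm) <= 1950 * (wm * wm)).
  { unfold UC. assert (1 * 1 <= wm * wm) by (apply Nat.mul_le_mono; lia). lia. }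
  assert (P1 : nc * (Nat.log2_up wm * 60 + 100) <= 32 * r * (wm * 160)) by (apply Nat.mul_le_mono; lia).
  assert (P2 : 2 ^ Nat.log2_up wm * (nc * 100 + 100) <= 2 * wm * (3300 * r)) by (apply Nat.mul_le_mono; lia).
  assert (P3 : nc * UC (2 * wm * wm) <= 32 * r * (1950 * (wm * wm))) by (apply Nat.mul_le_mono; auto).
  destruct (scale S ltac:(lia)) as (_ & _ & _ & HSY).
  unfold costB, costP. fold d nc. lia.
Qed.

Lemma cost_total : 40 * n + 200 + (cost0 W items + (40 + if wm <? n ^ 4 then costS items else costB items)) +
  costPost c W items + 1 <= 1000 * (1000 * (1000 * (c + 20))) * Y.
Proof.
  pose proof cost_common as H. unfold costPost.
  assert (P6 : 20 * Y <= (c + 20) * Y) by (apply Nat.mul_le_mono_r; lia).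
  replace (1000 * (1000 * (1000 * (c + 20))) * Y) with (1000 * 1000 * 1000 * ((c + 20) * Y)) by lia.
  destruct (Nat.ltb_spec wm (n ^ 4)) as [Hc|Hc].
  - pose proof (cost_scan Hc) as H2.
    replace (1000 * 1000 * 500 * (c + 20) * Y) with (1000 * 1000 * 500 * ((c + 20) * Y)) in H2 by lia. lia.
  - pose proof (cost_bund Hc) as H2. lia.
Qed.
End Cost.

(** The preparation draws no bits, so it reaches the same state on every random string, and the
    failure event [f] can be fixed after it. *)
Lemma ex_bits m bits bits' c s s' t : modp c = false -> exec m bits c s s' t -> exec m bits' c s s' t.
Proof.
  intros Hp H. induction H; simpl in Hp; try apply orb_false_iff in Hp; try discriminate.
  - constructor.
  - now constructor.
  - now constructor.
  - econstructor; [apply IHexec1|apply IHexec2]; tauto.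
  - apply ex_ift; auto. apply IHexec. tauto.
  - apply ex_iff; auto. apply IHexec. tauto.
  - now constructor.
  - eapply ex_wht; eauto.
Qed.

(* For every constant c there is a randomized word-RAM program (word size
   c0 * (bit length of the largest input number)) that on every valid
   instance halts within K * (n + wmax^2 * floor(sqrt wmax)) * (log N)^k
   steps for every outcome of its random bits (N = input size), and
   outputs the optimum with probability >= 1 - 1/N^c. *)
Theorem theorem4 :
  forall c : nat,
  exists (P : program) (c0 K k : nat),
    1 <= c0 /\
    forall (W : nat) (items : list item),
      valid_instance W items ->
      let L := c0 * bitlen (maxval W items) in
      let N := input_size W items in
      let T := K * (length items + wmax items ^ 2 * Nat.sqrt (wmax items))
                 * (bitlen N) ^ k in
      (forall bits, output L P T bits W items <> None) /\
      (forall v, is_opt W items v ->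
         (N ^ c - 1) * 2 ^ T <= count_out L P T W items v * N ^ c).
Proof.
  intros c. pose (main := (pre0;; branch c);; post).
  (* The word is long enough for every power of [B] that occurs as a bound; the time constant is
     that of [cost_total], and 3 counts the logarithmic factors of [cost_scan]. *)
  exists (boot ++ ccmd (length boot) main), (2 * c + 200), (1000 * (1000 * (1000 * (c + 20)))), 3.
  split; [lia|]. intros W items Hv L N T.
  set (P := boot ++ ccmd (length boot) main) in *.
  set (B := 2 ^ bitlen (maxval W items)).
  assert (HmB : 2 ^ L = B ^ (2 * c + 200)) by (unfold L, B; rewrite Nat.mul_comm, Nat.pow_mul_r; reflexivity).
  pose proof (maxval_n W items) as [HnA HWA]. pose proof (n_pos W items Hv) as Hn.
  assert (HA : maxval W items < B).
  { unfold B, bitlen. rewrite Nat.add_1_r. apply Nat.log2_spec. lia. }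
  assert (HB : 2 <= B) by lia.
  assert (HBm : B ^ (2 * c + 200) <= 2 ^ L) by lia.
  assert (Hmx : maxval W items <= B ^ 1) by (rewrite Nat.pow_1_r; lia).
  assert (Bn : length items <= B ^ 1) by lia.
  assert (M1 : 128 < 2 ^ L) by bdlt.
  assert (M2 : (8 * maxval W items) ^ 7 < 2 ^ L) by (cbn [Nat.pow]; bdlt).
  assert (M3 : 64 + 16 * length items + 64 < 2 ^ L) by bdlt.
  assert (HC : code_at P 0 (boot ++ ccmd (length boot) main)) by (intros i Hi; reflexivity).
  apply code_app in HC as [HC1 HC2].
  destruct (boot_spec L P M1 W items Hv HC1 M2 M3) as (t0 & M & s & Ht0 & HR & HI & Hrp & HS0).
  (* Even halting needs an optimum, since the state before the last phase is described relative to
     one. *)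
  destruct (optE_exists W (expand (irl items))) as [v Hopt].
  destruct (tri_seq (2 ^ L) [] (cost0 W items) (40 + if wmax items <? length items ^ 4 then costS items else costB items)
    pre0 (branch c) s (ready W items c v)) as (s1 & t1 & Hex1 & Ht1 & Hready).
  { eapply tri_mono; [apply le_n| |apply (pre0_spec W items Hv (2 ^ L) [] B (2 * c + 200) HB HBm ltac:(lia) Hmx s HI Hrp)].
    intros s' Hmid. apply (branch_spec W items Hv (2 ^ L) [] B (2 * c + 200) HB HBm ltac:(lia) Hmx c ltac:(lia) s' v Hmid Hopt). }
  destruct (post_ready c W items Hv (2 ^ L) B (2 * c + 200) HB HBm Hmx ltac:(lia) v s1 Hready Hopt) as (f & Hpost & Hprob).
  assert (HT : 40 * length items + 200 + (cost0 W items + (40 + if wmax items <? length items ^ 4 then costS items else costB items)) +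
    costPost c W items + 1 <= T).
  { etransitivity; [apply (cost_total c W items Hv)|]. unfold T, Y, N. cbn [Nat.pow].
    set (K := 1000 * (1000 * (1000 * (c + 20)))). generalize K. intros K'. rewrite !Nat.mul_1_r, !Nat.mul_assoc. apply le_n. }
  assert (Hout : forall bits, exists s2, output L P T bits W items = Some (rg s2 0) /\ (f bits = false -> rg s2 0 = v)).
  { intros bits. destruct (Hpost bits) as (s2 & t2 & Hex2 & Ht2 & Hgood). exists s2. split; [|exact Hgood].
    assert (Hex : exec (2 ^ L) bits main s s2 (t1 + t2)).
    { econstructor; [|exact Hex2]. eapply ex_bits; [reflexivity|exact Hex1]. }
    destruct (compile_ok L P bits ltac:(lia) main s s2 (t1 + t2) Hex (length boot) M eq_refl HR HC2) as (M' & (HR' & _) & HS1).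
    (* The successor is the step that halts by running off the end of the code; the rest of T is
       surplus fuel. *)
    unfold output. replace T with (t0 + ((t1 + t2) + Datatypes.S (T - t0 - t1 - t2 - 1))) by lia.
    rewrite Hrp in HS1. rewrite (HS0 bits), HS1.
    rewrite (run_S L P bits IHalt).
    - cbn [stp]. now rewrite HR' by lia.
    - apply nth_overflow. unfold P. rewrite length_app, ccmd_length. lia. }
  split.
  - intros bits. destruct (Hout bits) as (s2 & -> & _). discriminate.
  - intros v' Hv'. assert (v' = v).
    { apply (optE_unique W (expand (irl items))); auto. apply (is_opt_optE W items); auto. }
    subst v'. unfold count_out. apply count_bound with (f := f).
    + intros bs _ Hf. destruct (Hout bs) as (s2 & -> & Hg). rewrite (Hg Hf). apply Nat.eqb_refl.
    + apply Hprob. lia.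
Qed.
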